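(* Suppose the compact set $E\subset\mathbb R$ (of positive Lebesgue measure) satisfies the Craig-type condition, and let $(a,b)(t)$ be the solution of the Toda lattice with initial data $(a,b)(0)=(\tilde a,\tilde b)\in\mathcal J(E)$. Then the corresponding function $\varphi(t)=\mathcal B((a,b)(t))\in\mathcal D(E)$ is differentiable in $t$ and obeys $$\partial_t\varphi_j(t)=\Psi_j(\varphi(t))\qquad\text{for all } j\in I,\ t\in\mathbb R.$$
   Context: For bounded real sequences $a,b$ on $\mathbb Z$ with $a_n>0$, $J(a,b)$ is the Jacobi operator on $\ell^2(\mathbb Z)$, $(Ju)_n=a_nu_{n+1}+b_nu_n+a_{n-1}u_{n-1}$. The Toda lattice is $\frac{d}{dt}a_n=a_n(b_{n+1}-b_n)$, $\frac{d}{dt}b_n=2(a_n^2-a_{n-1}^2)$, $n\in\mathbb Z$, which has a unique solution for bounded initial data. Write $\underline E=\inf E$, $\overline E=\sup E$ and $E=[\underline E,\overline E]\setminus\bigcup_{j\in I}(E_j^-,E_j^+)$, where $I$ is at most countable and the $(E_j^-,E_j^+)$ are the (distinct) bounded maximal open intervals of $\mathbb R\setminus E$ (gaps). Put $\gamma_j=E_j^+-E_j^-$, $\eta_{j,l}=\min\{|E_j^+-E_l^-|,|E_j^--E_l^+|\}$, $\eta_j=\min\{|E_j^+-\overline E|,|E_j^--\underline E|\}$, and $$C_j=\big((\overline E-\underline E)-\eta_j\big)^{1/2}\exp\Big(\tfrac12\sum_{k\ne j}\frac{\gamma_k}{\eta_{j,k}}\Big).$$ The Craig-type condition on $E$ is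 $$\sup_{j\in I}\gamma_jC_j<\infty,\qquad \sup_{j\in I}\frac{\gamma_j}{\eta_j}C_j<\infty,\qquad \sup_{j\in I}\sum_{k\ne j}\frac{(\gamma_j\gamma_k)^{1/2}}{\eta_{j,k}}C_j<\infty .$$ $J$ is reflectionless on $E$ if for every $n\in\mathbb Z$, $\operatorname{Re}\langle\delta_n,(J-(x+i0))^{-1}\delta_n\rangle=0$ for Lebesgue-a.e. $x\in E$. $\mathcal J(E)$ is the set of pairs $(a,b)$ (identified with $J(a,b)$) with $\sigma(J(a,b))\subset E$ and $J(a,b)$ reflectionless on $E$; the Toda flow preserves $\mathcal J(E)$. Dirichlet data at the origin: for $J\in\mathcal J(E)$ let $r(z)=\langle\delta_0,(J-z)^{-1}\delta_0\rangle$, strictly increasing on each gap. Let $\mu_j$ be the zero of $r$ in $(E_j^-,E_j^+)$ if it exists; $\mu_j=E_j^+$ if $r<0$ on the gap; $\mu_j=E_j^-$ if $r>0$ on the gap. For $z\notin\sigma(J)$ let $u_\pm$ be nontrivial solutions of $Ju=zu$ square-summable at $\pm\infty$ and $m_\pm(z)=\mp\frac{u_\pm(1)}{a_0u_\pm(0)}$. If $\mu_j\in(E_j^-,E_j^+)$, exactly one of $m_\pm$ has a pole at $\mu_j$, and $\sigma_j\in\{+1,-1\}$ is chosen so that $m_{\sigma_j}$ has the pole. With $\mathbb T=\mathbb R/2\pi\mathbb Z$, $\mathcal D(E)=\mathbb T^I$ and $\mathcal B(J)=\varphi=(\varphi_j)_{j\in I}\in\mathcal D(E)$ is determined by $\mu_j=E_j^-+(E_j^+-E_j^-)\cos^2(\varphi_j/2)$,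 with $\varphi_j\in(0,\pi)+2\pi\mathbb Z$ if $\sigma_j=+1$ and $\varphi_j\in(-\pi,0)+2\pi\mathbb Z$ if $\sigma_j=-1$ (when $\mu_j=E_j^\pm$, $\varphi_j$ is determined by $\mu_j$ alone). The derivative of $\varphi$ is taken componentwise. The vector field $\Psi$ on $\mathcal D(E)$ is $$\Psi_j(\varphi)=2\Big((\mu_j-\underline E)(\overline E-\mu_j)\prod_{k\ne j}\frac{(E_k^--\mu_j)(E_k^+-\mu_j)}{(\mu_k-\mu_j)^2}\Big)^{1/2}.$$ *)

(* Defs.v *)
From HB Require Import structures.
From mathcomp Require Import all_boot all_order all_algebra generic_quotient.
From mathcomp Require Import finmap complex.
From mathcomp Require Import all_classical all_reals all_analysis.
From mathcomp.analysis.showcase Require Import summability.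

Set Implicit Arguments.
Unset Strict Implicit.
Unset Printing Implicit Defensive.

Import Order.TTheory GRing.Theory Num.Theory.
Import numFieldNormedType.Exports.

Local Open Scope classical_set_scope.
Local Open Scope ring_scope.

Section Circle.
Variable R : realType.

Definition eqmod2pi (x y : R) : bool :=
  `[< exists k : int, x - y = k%:~R * (2 * pi) >].

Lemma eqmod2pi_refl : reflexive eqmod2pi.
Proof. by move=> x; apply/asboolP; exists 0; rewrite subrr mul0r. Qed.

Lemma eqmod2pi_sym : symmetric eqmod2pi.
Proof.
by move=> x y; apply/asboolP/asboolP => -[k kE]; exists (- k);
  rewrite -opprB kE mulrNz mulNr.
Qed.

Lemma eqmod2pi_trans : transitive eqmod2pi.
Proof.
move=> y x z /asboolP[k kE] /asboolP[l lE]; apply/asboolP; exists (k + l).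
by rewrite mulrzDr mulrDl -kE -lE addrA subrK.
Qed.

Canonical eqmod2pi_equiv :=
  EquivRel eqmod2pi eqmod2pi_refl eqmod2pi_sym eqmod2pi_trans.

(* T = R / 2 pi Z *)
Definition circle : Type := {eq_quot eqmod2pi}%qT.
HB.instance Definition _ := Choice.on circle.
HB.instance Definition _ := EqQuotient.on circle.

Definition circle_of (x : R) : circle := \pi_circle%qT x.

Lemma circle_ofP (x y : R) :
  circle_of x = circle_of y <-> exists k : int, x - y = k%:~R * (2 * pi).
Proof.
rewrite /circle_of; split=> [/eqmodP/asboolP //|xy].
by apply/eqmodP/asboolP.
Qed.

(* Derivative of a curve in T, read in the charts of T given by the local
   inverses of the covering R -> T. *)
Definition circle_derive (f : R -> circle) (t d : R) : Prop :=
  exists g : R -> R,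
    (\forall s \near t, circle_of (g s) = f s) /\ is_derive t 1 g d.

(* The point l + (r - l) cos^2 (phi / 2); by [gap_pointE] it does not depend
   on the representative of phi. *)
Definition gap_point (l r : R) (phi : circle) : R :=
  l + (r - l) * cos (repr phi / 2) ^+ 2.

Lemma gap_pointE (l r x : R) :
  gap_point l r (circle_of x) = l + (r - l) * cos (x / 2) ^+ 2.
Proof.
rewrite /gap_point; congr (_ + _ * _).
have /circle_ofP[k kE] : circle_of (repr (circle_of x)) = circle_of x.
  by rewrite /circle_of reprK.
have -> : repr (circle_of x) / 2 = x / 2 + k%:~R * pi.
  apply: (mulIf (x := 2)) => //.
  rewrite mulrDl !divfK // -mulrA [pi * 2]mulrC -kE addrC subrK //.
have sE (y : R) : cos (y + pi) ^+ 2 = cos y ^+ 2 by rewrite cosDpi sqrrN.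
have sN (n : nat) (y : R) : cos (y + n%:R * pi) ^+ 2 = cos y ^+ 2.
  elim: n => [|n IH]; first by rewrite mul0r addr0.
  by rewrite -natr1 mulrDl mul1r addrA sE IH.
case: k {kE} => n; first exact: sN.
by rewrite -(sN n.+1) NegzE mulrNz mulNr subrK.
Qed.

End Circle.

Section Gaps.
Variable R : realType.
Variable E : set R.

(* ]l, r[ is a nonempty bounded maximal open interval of the complement of E *)
Definition is_gap (l r : R) : Prop :=
  [/\ l < r, `]l, r[ `<=` ~` E &
      forall l' r' : R, `]l, r[ `<=` `]l', r'[ -> `]l', r'[ `<=` ~` E ->
        l' = l /\ r' = r].

Definition gap_family (I : countType) (Em Ep : I -> R) : Prop :=
  [/\ forall j, is_gap (Em j) (Ep j),
      injective (fun j => (Em j, Ep j)) &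
      E = `[inf E, sup E]%classic `\` \bigcup_j `]Em j, Ep j[%classic].

Variables (I : countType) (Em Ep : I -> R).

Definition gap_length (j : I) : R := Ep j - Em j.

Definition gap_dist (j l : I) : R :=
  Num.min `|Ep j - Em l| `|Em j - Ep l|.

Definition gap_edge_dist (j : I) : R :=
  Num.min `|Ep j - sup E| `|Em j - inf E|.

(* All quotients are taken in \bar R, where x / 0 = +oo for x > 0. *)
Definition craig_const (j : I) : \bar R :=
  ((Num.sqrt (sup E - inf E - gap_edge_dist j))%:E *
   expeR (2^-1%:E *
     \esum_(k in [set k | k != j]) ((gap_length k)%:E / (gap_dist j k)%:E)))%E.

Definition craig_condition : Prop :=
  [/\ (ereal_sup (range (fun j =>
         (gap_length j)%:E * craig_const j)) < +oo)%E,
      (ereal_sup (range (fun j =>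
         (gap_length j)%:E / (gap_edge_dist j)%:E * craig_const j)) < +oo)%E &
      (ereal_sup (range (fun j =>
         \esum_(k in [set k | k != j])
           ((Num.sqrt (gap_length j * gap_length k))%:E / (gap_dist j k)%:E
              * craig_const j))) < +oo)%E].

(* Infinite product, as the limit of the net of finite subproducts. *)
Definition infinite_prod (P : pred I) (F : I -> R) : R :=
  lim ((fun A : {fset I} => \prod_(k <- A | P k) F k) @ totally).

Definition toda_field (phi : I -> circle R) (j : I) : R :=
  let mu k := gap_point (Em k) (Ep k) (phi k) in
  2 * Num.sqrt ((mu j - inf E) * (sup E - mu j) *
    infinite_prod (fun k => k != j)
      (fun k => (Em k - mu j) * (Ep k - mu j) / (mu k - mu j) ^+ 2)).

End Gaps.

Section Jacobi.
Variable R : realType.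

Definition sqnorm (u : int -> R[i]) : \bar R :=
  \esum_(n in [set: int]) (ComplexField.Normc.normc (u n) ^+ 2)%:E.

Definition l2 (u : int -> R[i]) : Prop := (sqnorm u < +oo)%E.

Definition delta (n : int) : int -> R[i] := fun k => (k == n)%:R.

Definition bounded_seq (a : int -> R) : Prop :=
  exists M : R, forall n, `|a n| <= M.

Variables (a b : int -> R).

Definition jacobi (u : int -> R[i]) : int -> R[i] := fun n =>
  (a n)%:C%C * u (n + 1) + (b n)%:C%C * u n + (a (n - 1))%:C%C * u (n - 1).

Definition jacobi_shift (z : R[i]) (u : int -> R[i]) : int -> R[i] :=
  fun n => jacobi u n - z * u n.

(* z such that J - z is a bijection of l2 with bounded inverse *)
Definition resolvent_set : set R[i] := [set z |
  (forall f, l2 f -> exists! u, l2 u /\ jacobi_shift z u = f) /\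
  (exists M : R, forall u, l2 u ->
     (sqnorm u <= M%:E * sqnorm (jacobi_shift z u))%E)].

Definition spectrum : set R[i] := ~` resolvent_set.

Definition resolvent (z : R[i]) (f : int -> R[i]) : int -> R[i] :=
  xget (fun=> 0) [set u | l2 u /\ jacobi_shift z u = f].

(* <delta_n, (J - z)^-1 delta_n>; pairing with delta_n is evaluation at n *)
Definition green (n : int) (z : R[i]) : R[i] := resolvent z (delta n) n.

Definition reflectionless (E : set R) : Prop :=
  forall n : int, {ae lebesgue_measure, forall x : R, E x ->
    exists G : R[i],
      (green n (x +i* e)%C : R[i]^o) @[e --> (0 : R)^'+] --> (G : R[i]^o) /\
      complex.Re G = 0}.

(* u is a Weyl solution at +oo if s = 1, at -oo if s = -1. *)
Definition weyl_solution (s : int) (z : R[i]) : set (int -> R[i]) := [set u |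
  [/\ u <> (fun=> 0),
      jacobi u = (fun n => z * u n) &
      (\esum_(n in [set n : int | (0 <= n)%R])
         (ComplexField.Normc.normc (u (s * n)%R) ^+ 2)%:E < +oo)%E]].

Definition weyl_m (s : int) (z : R[i]) : R[i] :=
  let u := xget (fun=> 0) (weyl_solution s z) in
  - s%:~R * (u 1 / ((a 0)%:C%C * u 0)).

Definition has_pole (f : R[i] -> R[i]) (x : R) : Prop :=
  `|f z| @[z --> (x%:C%C : R[i]^o)^'] --> +oo.

Definition dirichlet_mu (l r : R) : R := xget l [set m |
  [\/ l < m < r /\ green 0 m%:C%C = 0,
      m = r /\ (forall x, l < x < r -> green 0 x%:C%C < 0) |
      m = l /\ (forall x, l < x < r -> 0 < green 0 x%:C%C)]].

Definition dirichlet_sign (m : R) : int := xget 1 [set s |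
  (s = 1 \/ s = -1) /\ has_pole (weyl_m s) m].

Definition dirichlet_map (I : countType) (Em Ep : I -> R) (j : I) : circle R :=
  let m := dirichlet_mu (Em j) (Ep j) in
  let s := dirichlet_sign m in
  xget (circle_of 0) [set phi |
    m = gap_point (Em j) (Ep j) phi /\
    (Em j < m < Ep j ->
      exists2 x, phi = circle_of x &
        (s = 1 -> 0 < x < pi) /\ (s = -1 -> - pi < x < 0))].

End Jacobi.

Definition jacobi_class (R : realType) (E : set R) (a b : int -> R) : Prop :=
  [/\ bounded_seq a /\ bounded_seq b, forall n, 0 < a n,
      spectrum a b `<=` [set x%:C%C | x in E] & reflectionless a b E].

(* The bound, locally uniform in t, selects the solution with values in
   l^oo (Z) x l^oo (Z), the class in which the initial value problem is
   uniquely solvable. *)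
Definition toda_solution (R : realType) (a b : R -> int -> R) : Prop :=
  [/\ forall T : R, exists M : R, forall t n, `|t| <= T ->
        `|a t n| <= M /\ `|b t n| <= M,
      forall (t : R) (n : int),
        is_derive t 1 (a ^~ n) (a t n * (b t (n + 1) - b t n)) &
      forall (t : R) (n : int),
        is_derive t 1 (b ^~ n) (2 * (a t n ^+ 2 - a t (n - 1) ^+ 2))].

(* Main.v *)
Require Import Defs.
From mathcomp Require Import all_boot all_order all_algebra.
From mathcomp Require Import finmap complex ring lra zify.
From mathcomp Require Import all_classical all_reals all_analysis.
From mathcomp.analysis.showcase Require Import summability.
From mathcomp Require Import measurable_realfun.
Set Implicit Arguments.
Unset Strict Implicit.
Unset Printing Implicit Defensive.
Import Order.TTheory GRing.Theory Num.Theory.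
Import numFieldNormedType.Exports.
Local Open Scope classical_set_scope.
Local Open Scope ring_scope.
Import ComplexField.Normc.

(** Write g, h, q, q_- for the combinations of entries of the Green matrix G = (J - z)^-1 near
    the origin given by g = G_00, h = a_0 G_10 - a_{-1} G_{-1,0}, q = a_0^2 G_11 and
    q_- = a_{-1}^2 G_{-1,-1}.  Along the Toda flow, for z fixed off the spectrum, they solve a
    linear system of which the first equation is g' = 2 h (gf_cder, hf_cder, qf_cder, qmf_cder),
    and they satisfy 4 g q = (h - (b_0 - z) g)^2 - 1 together with its mirror image (gq_id,
    gqm_id).  So h^2 = 1 at a Dirichlet datum, where g = 0, and h is then the sign which tells
    which of the two Weyl functions has the pole (dirichlet_signE).

    The other ingredient is the product formula (green_product): in the gap j,
      g(x)^2 (x - inf E) (sup E - x) (x - E_j^-) (E_j^+ - x) W_j(x) = (x - mu_j)^2,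
    where W_j is the infinite product over the other gaps.  Reading it at the fixed point
    x0 = mu_j(t0) gives mu_j(t) = x0 - g(x0, t) c(t), with a continuous factor c, and thus
    mu_j' = -2 h c at t0 (dm_derive).  The change of variable mu_j = E_j^- + gamma_j cos^2(phi_j / 2)
    absorbs the sign -h and the two factors that vanish at the edges; what is left is the
    stated vector field (ang_derive).

    The product formula requires J(t) to be reflectionless.  The spectrum is preserved because
    1 + d P nearly intertwines J(t) and J(t + d), where P is the antisymmetric part of the Lax pair
    (toda_isospectral).  For the reflectionless property, Gronwall's inequality shows
    that the real parts of g, h, q, q_- stay small as z tends to a point of E, and the quadratic identity
    then keeps g away from 0 (reflectionless_time).  Consequently arg g has the boundary value
    pi/2 almost everywhere on E; as it is 0 or pi elsewhere, it agrees with the argument of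
      - prod_k (z - mu_k) / sqrt((z - E_k^-) (z - E_k^+)) / sqrt((z - inf E) (z - sup E))
    on the real line, except on the gaps left out of a finite product.  A contour integral turns this
    into the estimate product_estimate of log |g| in a gap by the total length of those gaps.
    The Craig-type condition enters through the convergence of the sum of gamma_k / eta_{j,k},
    which makes W_j converge uniformly and continuously (wprod_tail, wprod_cvg).

    At a gap edge the angle has no sign, and it must be shown that mu_j leaves the edge.
    As long as mu_j rests at an edge, v = -h/g satisfies a Riccati equation (riccati)
    whose forcing 1/g^2 is as large as desired at points x close to the edge; this makes
    v blow up in an arbitrarily short time, which is absurd (no_stuck).  So the times spent at an edge
    are isolated (edge_isolated), the angle lifts continuously across them,
    and its derivative extends by continuity (is_derive_removable). *)
(** * Square-summable sequences on the integers *)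
Section SquareSummable.
Variable R : realType.
Implicit Types (u v : int -> R[i]) (B C : R).

Lemma normc_sqE (z : R[i]) : normc z ^+ 2 = complex.Re z ^+ 2 + complex.Im z ^+ 2.
Proof. by case: z => a b /=; rewrite sqr_sqrtr // addr_ge0 // sqr_ge0. Qed.

Lemma normc_ge0 (z : R[i]) : 0 <= normc z.
Proof. by case: z => a b /=; rewrite sqrtr_ge0. Qed.

Lemma Re_le_normc (z : R[i]) : `|complex.Re z| <= normc z.
Proof. by case: z => a b /=; rewrite -sqrtr_sqr ler_wsqrtr // lerDl sqr_ge0. Qed.

Lemma Im_le_normc (z : R[i]) : `|complex.Im z| <= normc z.
Proof. by case: z => a b /=; rewrite -sqrtr_sqr ler_wsqrtr // lerDr sqr_ge0. Qed.

Lemma normc_real (x : R) : normc x%:C%C = `|x|.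
Proof. by rewrite /= expr0n /= addr0 sqrtr_sqr. Qed.

Lemma normcD (z w : R[i]) : normc (z + w) <= normc z + normc w.
Proof. exact: le_normcD. Qed.

Lemma normcB (z w : R[i]) : normc (z - w) <= normc z + normc w.
Proof. by rewrite -(normcN w) normcD. Qed.

Lemma normc_le_ReIm (z : R[i]) : normc z <= `|complex.Re z| + `|complex.Im z|.
Proof.
rewrite -(@ler_pXn2r _ 2) ?nnegrE ?normc_ge0 ?addr_ge0 //.
rewrite normc_sqE -(real_normK (num_real (complex.Re z))).
rewrite -(real_normK (num_real (complex.Im z))).
have := normr_ge0 (complex.Re z); have := normr_ge0 (complex.Im z).
by move: `|_| `|_| => x y; nra.
Qed.

(** The l^2 norm is handled through its finite partial sums, so that an
    inequality between norms becomes a family of inequalities between finite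
    sums and needs no summability side condition. *)
Definition l2_le u B := 0 <= B /\
  forall s : seq int, uniq s -> \sum_(n <- s) normc (u n) ^+ 2 <= B ^+ 2.

Lemma l2_le_ge0 u B : l2_le u B -> 0 <= B. Proof. by case. Qed.

Lemma l2_le_ext u v B : u =1 v -> l2_le u B -> l2_le v B.
Proof. by move=> /funext ->. Qed.

Lemma l2_le_pt u B n : l2_le u B -> normc (u n) <= B.
Proof.
move=> [B0 /(_ [:: n] isT)]; rewrite big_seq1.
by rewrite ler_pXn2r // nnegrE ?normc_ge0.
Qed.

Lemma l2_le_weak u B C : B <= C -> l2_le u B -> l2_le u C.
Proof.
move=> BC [B0 H]; have C0 := le_trans B0 BC; split=> // s us.
by apply: le_trans (H s us) _; rewrite ler_pXn2r.
Qed.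

Lemma l2_le_mul (c : int -> R[i]) u B C : (forall n, normc (c n) <= C) ->
  l2_le u B -> l2_le (fun n => c n * u n) (C * B).
Proof.
move=> cC [B0 H]; have C0 : 0 <= C by apply: le_trans (cC 0); exact: normc_ge0.
split=> [|s us]; first exact: mulr_ge0.
rewrite exprMn; apply: le_trans (ler_wpM2l (sqr_ge0 C) (H s us)).
rewrite mulr_sumr; apply: ler_sum => n _.
rewrite normcM exprMn ler_wpM2r ?sqr_ge0 // ler_pXn2r ?nnegrE ?normc_ge0 //.
Qed.

Lemma l2_leZ (c : R[i]) u B : l2_le u B -> l2_le (fun n => c * u n) (normc c * B).
Proof. exact: l2_le_mul. Qed.

Lemma l2_le0 B : 0 <= B -> l2_le (fun=> 0) B.
Proof.
move=> B0; split=> // s _; rewrite big1 ?sqr_ge0 // => n _.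
by rewrite normc0 expr0n.
Qed.

Lemma l2_le_eq0 u : l2_le u 0 -> u = fun=> 0.
Proof.
move=> H; apply/funext => n; apply: eq0_normc; apply/eqP.
by rewrite eq_le (l2_le_pt n H) normc_ge0.
Qed.

Lemma l2_leD u v B C : l2_le u B -> l2_le v C -> l2_le (fun n => u n + v n) (B + C).
Proof.
have main B' C' : 0 < B' -> 0 < C' -> l2_le u B' -> l2_le v C' ->
    l2_le (fun n => u n + v n) (B' + C').
  move=> B0 C0 [_ hu] [_ hv]; split=> [|s us]; first by rewrite addr_ge0 ?ltW.
  have -> : (B' + C') ^+ 2 = (1 + C' / B') * B' ^+ 2 + (1 + B' / C') * C' ^+ 2.
    by field; rewrite !gt_eqF.
  have p1 : 0 <= 1 + C' / B' by rewrite addr_ge0 ?divr_ge0 ?ltW.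
  have p2 : 0 <= 1 + B' / C' by rewrite addr_ge0 ?divr_ge0 ?ltW.
  apply: le_trans (lerD (ler_wpM2l p1 (hu s us)) (ler_wpM2l p2 (hv s us))).
  rewrite !mulr_sumr -big_split /=; apply: ler_sum => n _.
  apply: (@le_trans _ _ ((normc (u n) + normc (v n)) ^+ 2)).
    by rewrite ler_pXn2r ?nnegrE ?addr_ge0 ?normc_ge0 // normcD.
  move: (normc (u n)) (normc (v n)) => x y.
  rewrite -subr_ge0.
  have -> : (1 + C' / B') * x ^+ 2 + (1 + B' / C') * y ^+ 2 - (x + y) ^+ 2
     = (C' * x - B' * y) ^+ 2 / (B' * C') by field; rewrite !gt_eqF.
  by rewrite divr_ge0 ?sqr_ge0 // mulr_ge0 ?ltW.
move=> hu hv; have B0 := l2_le_ge0 hu; have C0 := l2_le_ge0 hv.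
split=> [|s us]; first exact: addr_ge0.
set S := (X in X <= _).
have H e : 0 < e -> S <= (B + C + e) ^+ 2.
  move=> e0.
  have e2 : 0 < e / 2 by rewrite divr_gt0.
  have [] := main (B + e / 2) (C + e / 2).
  - by apply: ltr_wpDl.
  - by apply: ltr_wpDl.
  - by apply: l2_le_weak hu; rewrite lerDl ltW.
  - by apply: l2_le_weak hv; rewrite lerDl ltW.
  by move=> _ /(_ s us); rewrite -/S; congr (_ <= _ ^+ 2); field.
have S0 : 0 <= S by apply: sumr_ge0 => n _; exact: sqr_ge0.
rewrite -(sqr_sqrtr S0) ler_pXn2r ?nnegrE ?sqrtr_ge0 ?addr_ge0 //.
apply/ler_addgt0Pr => e e0.
rewrite -(@ler_pXn2r _ 2) ?nnegrE ?sqrtr_ge0 ?addr_ge0 ?(ltW e0) //.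
by rewrite sqr_sqrtr // H.
Qed.

Lemma l2_leN u B : l2_le u B -> l2_le (fun n => - u n) B.
Proof. by move=> [B0 H]; split=> // s us; under eq_bigr do rewrite normcN; exact: H. Qed.

Lemma l2_leB u v B C : l2_le u B -> l2_le v C -> l2_le (fun n => u n - v n) (B + C).
Proof. by move=> hu hv; exact: l2_leD hu (l2_leN hv). Qed.

Lemma l2_le_inj (f : int -> int) u B : injective f -> l2_le u B -> l2_le (fun n => u (f n)) B.
Proof.
move=> finj [B0 H]; split=> // s us.
by have := H [seq f x | x <- s]; rewrite big_map; apply; rewrite map_inj_uniq.
Qed.

Lemma l2_le_cvg (w : nat -> int -> R[i]) u B :
  (forall k, l2_le (w k) B) ->
  (forall n, (fun k => normc (w k n) ^+ 2) @ \oo --> normc (u n) ^+ 2) ->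
  l2_le u B.
Proof.
move=> wB wu; have B0 := l2_le_ge0 (wB 0%N); split=> // s us.
have cs : (fun k => \sum_(n <- s) normc (w k n) ^+ 2) @ \oo -->
    \sum_(n <- s) normc (u n) ^+ 2.
  elim: s {us} => [|n s IH].
    by rewrite big_nil; under eq_cvg do rewrite big_nil; exact: cvg_cst.
  rewrite big_cons; under eq_cvg do rewrite big_cons.
  by apply: cvgD.
rewrite -(cvg_lim _ cs) //; apply: limr_le; first by apply/cvg_ex; eexists; exact: cs.
by near=> k; have [_] := wB k; apply.
Unshelve. all: by end_near. Qed.

Lemma l2_le_delta n : l2_le (@delta R n) 1.
Proof.
split=> // s us; rewrite expr1n.
have E k : normc (@delta R n k) ^+ 2 = (k == n)%:R :> R.
  by rewrite /delta; case: (k == n); rewrite ?normc1 ?normc0 ?expr1n ?expr0n.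
under eq_bigr do rewrite E.
rewrite -natr_sum (ler_nat _ _ 1) -big_mkcond /= sum1_count count_uniq_mem //.
by case: (_ \in _).
Qed.

Lemma sqnorm_leP u B : 0 <= B -> l2_le u B <-> (sqnorm u <= (B ^+ 2)%:E)%E.
Proof.
move=> B0; split=> [[_ H]|H].
  apply: ub_ereal_sup => _ [A [fA _] <-].
  rewrite fsbig_finite //= sumEFin lee_fin; apply: H; exact: fset_uniq.
split=> // s us; rewrite -lee_fin; apply: le_trans H.
rewrite /sqnorm /esum; apply: ereal_sup_ubound => /=.
exists [set` s]; first by split => //; exact: finite_seq.
by rewrite -fsbig_seq //= sumEFin.
Qed.

Lemma sqnorm_ge0 u : (0 <= sqnorm u)%E.
Proof. by apply: esum_ge0 => n _; rewrite lee_fin sqr_ge0. Qed.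

Definition nrm u : R := Num.sqrt (fine (sqnorm u)).

Lemma nrm_ge0 u : 0 <= nrm u. Proof. exact: sqrtr_ge0. Qed.

Lemma sqnorm_nrm u : l2 u -> sqnorm u = (nrm u ^+ 2)%:E.
Proof.
move=> ul; rewrite /nrm sqr_sqrtr; last by rewrite fine_ge0 ?sqnorm_ge0.
by rewrite fineK // ge0_fin_numE ?sqnorm_ge0.
Qed.

Lemma l2_le_nrm u : l2 u -> l2_le u (nrm u).
Proof. by move=> ul; apply/sqnorm_leP; rewrite ?nrm_ge0 // sqnorm_nrm. Qed.

Lemma l2_le_l2 u B : l2_le u B -> l2 u.
Proof. by move=> H; move/(sqnorm_leP u (l2_le_ge0 H)) : H => /le_lt_trans; apply; rewrite ltry. Qed.

Lemma nrm_le u B : l2_le u B -> nrm u <= B.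
Proof.
move=> H; have B0 := l2_le_ge0 H; have ul := l2_le_l2 H.
move/(sqnorm_leP u B0) : H; rewrite sqnorm_nrm // lee_fin.
by rewrite ler_pXn2r // nnegrE nrm_ge0.
Qed.

Lemma l2_leE u B : l2 u -> nrm u <= B -> l2_le u B.
Proof. by move=> ul h; exact: l2_le_weak h (l2_le_nrm ul). Qed.

End SquareSummable.

(** * Bounded operators and their perturbations *)
Section Operators.
Variable R : realType.
Implicit Types (u v w f : int -> R[i]) (A D P : (int -> R[i]) -> int -> R[i]).
Implicit Types (B C K M : R).

Definition linop A := forall (c : R[i]) u v,
  A (fun k => c * u k + v k) = (fun n => c * A u n + A v n).

Definition opb A K := 0 <= K /\ forall u B, l2_le u B -> l2_le (A u) (K * B).

(** Bounded invertibility of a linear A on l^2; injectivity is the lower bound with B = 0. *)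
Definition inv_by A M := [/\ 0 <= M,
  forall u B, l2 u -> l2_le (A u) B -> l2_le u (M * B) &
  forall f, l2 f -> exists u, l2 u /\ A u = f].

Lemma linopD A u v : linop A -> A (fun k => u k + v k) = (fun n => A u n + A v n).
Proof.
move=> lA; have /= := lA 1 u v.
have -> : (fun k => 1 * u k + v k) = (fun k => u k + v k) by apply/funext => k; rewrite mul1r.
by move=> ->; apply/funext => k; rewrite mul1r.
Qed.

Lemma linopB A u v : linop A -> A (fun k => u k - v k) = (fun n => A u n - A v n).
Proof.
move=> lA; have /= := lA (-1) v u.
have -> : (fun k => -1 * v k + u k) = (fun k => u k - v k).
  by apply/funext => k; rewrite mulN1r addrC.
by move=> ->; apply/funext => k; rewrite mulN1r addrC.
Qed.

Lemma linop0 A : linop A -> A (fun=> 0) = fun=> 0.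
Proof.
move=> lA; have := linopB (fun=> 0) (fun=> 0) lA.
have -> : (fun k : int => 0 - 0 : R[i]) = fun=> 0 by apply/funext => k; rewrite subr0.
by move=> ->; apply/funext => k; rewrite subrr.
Qed.

Lemma linopZ A c u : linop A -> A (fun k => c * u k) = (fun n => c * A u n).
Proof.
move=> lA; have := lA c u (fun=> 0); rewrite linop0 //.
have -> : (fun k => c * u k + 0) = (fun k => c * u k) by apply/funext => k; rewrite addr0.
by move=> ->; apply/funext => k; rewrite addr0.
Qed.

Lemma l2D u v : l2 u -> l2 v -> l2 (fun n => u n + v n).
Proof. by move=> /l2_le_nrm hu /l2_le_nrm hv; exact: l2_le_l2 (l2_leD hu hv). Qed.

Lemma l2B u v : l2 u -> l2 v -> l2 (fun n => u n - v n).
Proof. by move=> /l2_le_nrm hu /l2_le_nrm hv; exact: l2_le_l2 (l2_leB hu hv). Qed.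

Lemma l2Z c u : l2 u -> l2 (fun n => c * u n).
Proof. by move=> /l2_le_nrm hu; exact: l2_le_l2 (l2_leZ c hu). Qed.

Lemma opb_l2 A K u : opb A K -> l2 u -> l2 (A u).
Proof. by move=> [_ h] /l2_le_nrm /h /l2_le_l2. Qed.

Lemma geometric_steps_cvg (x : nat -> R) r q : 0 <= q < 1 ->
  (forall n, `|x n.+1 - x n| <= r * q ^+ n) -> cvg (x @ \oo).
Proof.
move=> /andP[q0 q1] H.
have r0 : 0 <= r by have := H 0%N; rewrite expr0 mulr1; apply: le_trans.
have cs : cvgn (series (fun n => x n.+1 - x n)).
  apply: normed_cvg; apply: (@series_le_cvg _ _ (geometric r q)).
  - by move=> n; exact: normr_ge0.
  - by move=> n; rewrite /geometric /= mulr_ge0 // exprn_ge0.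
  - by move=> n; exact: H.
  - by apply: is_cvg_geometric_series; rewrite ger0_norm.
have E n : x n = x 0%N + series (fun n => x n.+1 - x n) n.
  elim: n => [|n IH]; first by rewrite /series /= big_geq // addr0.
  by rewrite seriesSr /= addrA -IH addrC subrK.
have -> : x = (fun n => x 0%N + series (fun n => x n.+1 - x n) n) by exact/funext.
by apply: is_cvgD cs; exact: is_cvg_cst.
Qed.

(** Completeness of l^2, in the form needed for Neumann series. *)
Lemma l2_geometric_limit (s : nat -> int -> R[i]) r q : 0 <= q < 1 ->
  (forall n, l2_le (fun k => s n.+1 k - s n k) (r * q ^+ n)) ->
  exists u, forall n, l2_le (fun k => u k - s n k) (r / (1 - q) * q ^+ n).
Proof.
move=> q01 H; have /andP[q0 q1] := q01.
have p : 0 < 1 - q by rewrite subr_gt0.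
have r0 : 0 <= r by have := l2_le_ge0 (H 0%N); rewrite expr0 mulr1.
have cR k : cvgn (fun n => complex.Re (s n k)).
  apply: (geometric_steps_cvg (r := r) q01) => n.
  rewrite -(raddfB (@complex.Re R : Rcomplex R -> R)).
  by apply: le_trans (Re_le_normc _) _; exact: (l2_le_pt k (H n)).
have cI k : cvgn (fun n => complex.Im (s n k)).
  apply: (geometric_steps_cvg (r := r) q01) => n.
  rewrite -(raddfB (@complex.Im R : Rcomplex R -> R)).
  by apply: le_trans (Im_le_normc _) _; exact: (l2_le_pt k (H n)).
exists (fun k => limn (fun n => complex.Re (s n k)) +i* limn (fun n => complex.Im (s n k)))%C.
move=> n.
have G m : l2_le (fun k => s (m + n)%N k - s n k) (r / (1 - q) * q ^+ n * (1 - q ^+ m)).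
  elim: m => [|m IH].
    rewrite add0n expr0 subrr mulr0; apply: (@l2_le_ext _ (fun=> 0)) (l2_le0 (lexx 0)).
    by move=> k; rewrite subrr.
  have := l2_leD IH (H (m + n)%N).
  have -> : r / (1 - q) * q ^+ n * (1 - q ^+ m) + r * q ^+ (m + n) =
     r / (1 - q) * q ^+ n * (1 - q ^+ m.+1).
    by rewrite exprD exprS; field; rewrite gt_eqF.
  by apply: l2_le_ext => k; rewrite addSn; ring.
apply: (@l2_le_cvg _ (fun m k => s (m + n)%N k - s n k)).
  move=> m; apply: l2_le_weak (G m); rewrite -[leRHS]mulr1 ler_wpM2l //.
    by rewrite mulr_ge0 ?exprn_ge0 // divr_ge0 // ltW.
  by rewrite gerBl exprn_ge0.
move=> k; under eq_cvg do rewrite normc_sqE.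
rewrite normc_sqE; apply: cvgD; rewrite expr2; under eq_cvg do rewrite expr2.
- have c1 : (fun m => complex.Re (s (m + n)%N k - s n k)) @ \oo -->
     limn (fun n => complex.Re (s n k)) - complex.Re (s n k).
    under eq_cvg do rewrite (raddfB (@complex.Re R : Rcomplex R -> R)).
    apply: cvgB; last exact: cvg_cst.
    by rewrite (cvg_shiftn n (fun m => complex.Re (s m k))); exact: cR.
  rewrite (raddfB (@complex.Re R : Rcomplex R -> R)) /=.
  exact: cvgM.
- have c1 : (fun m => complex.Im (s (m + n)%N k - s n k)) @ \oo -->
     limn (fun n => complex.Im (s n k)) - complex.Im (s n k).
    under eq_cvg do rewrite (raddfB (@complex.Im R : Rcomplex R -> R)).
    apply: cvgB; last exact: cvg_cst.
    by rewrite (cvg_shiftn n (fun m => complex.Im (s m k))); exact: cI.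
  rewrite (raddfB (@complex.Im R : Rcomplex R -> R)) /=.
  exact: cvgM.
Qed.

Lemma l2_le_geometric_eq0 u C q : 0 <= q < 1 ->
  (forall n, l2_le u (C * q ^+ n)) -> u = fun=> 0.
Proof.
move=> /andP[q0 q1] H; apply: l2_le_eq0; split=> // s us.
have C0 : 0 <= C by have := l2_le_ge0 (H 0%N); rewrite mulr1.
have cq : (fun n => (C * q ^+ n) ^+ 2) @ \oo --> (0 : R) ^+ 2.
  have c0 : (fun n => C * q ^+ n) @ \oo --> (0 : R).
    by have := @cvg_geometric R C q; apply; rewrite ger0_norm.
  by rewrite expr2; under eq_cvg do rewrite expr2; exact: cvgM.
rewrite -(cvg_lim _ cq) //; apply: limr_ge; first by apply/cvg_ex; eexists; exact: cq.
by apply: nearW => n; have [_] := H n; apply.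
Qed.

Lemma inv_by_inj A M u v : linop A -> inv_by A M -> l2 u -> l2 v -> A u = A v -> u = v.
Proof.
move=> lA [_ lo _] ul vl E.
have /lo : l2 (fun k => u k - v k) by exact: l2B.
move=> /(_ 0); rewrite linopB // E mulr0 => h.
have /l2_le_eq0 /funeqP d0 : l2_le (fun k => u k - v k) 0.
  apply: h; apply: (@l2_le_ext _ (fun=> 0)) (l2_le0 (lexx 0)) => k.
  by rewrite subrr.
by apply/funext => k; apply/eqP; rewrite -subr_eq0 d0.
Qed.

(** Neumann series: an operator within e of one with inverse bound M is again
    invertible as soon as e M < 1. *)
Lemma inv_by_pert A D K M e : linop A -> linop D -> opb A K -> opb D e ->
  inv_by A M -> e * M < 1 ->
  inv_by (fun u n => A u n + D u n) (M / (1 - e * M)).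
Proof.
move=> lA lD [K0 bA] [e0 bD] [M0 lo su] eM.
have p : 0 < 1 - e * M by rewrite subr_gt0.
have q0 : 0 <= e * M by exact: mulr_ge0.
split=> [|u B ul h|f fl]; first by rewrite divr_ge0 // ltW.
- have hu := l2_le_nrm ul; have B0 := l2_le_ge0 h.
  have h2 : l2_le (A u) (B + e * nrm u).
    by apply: l2_le_ext (l2_leB h (bD _ _ hu)) => k; rewrite addrK.
  have /nrm_le h3 := lo _ _ ul h2.
  apply: l2_leE => //; rewrite mulrAC ler_pdivlMr //; nra.
- have [S HS] : exists S : (int -> R[i]) -> int -> R[i],
      forall g, l2 g -> l2 (S g) /\ A (S g) = g.
    have /choice [S HS] : forall g, exists u, l2 g -> l2 u /\ A u = g.
      by move=> g; have [/su [u hu]|] := pselect (l2 g); [exists u|exists g].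
    by exists S.
  pose w := fix w n := if n is m.+1 then S (fun k => - D (w m) k) else S f.
  pose F := nrm f; have F0 : 0 <= F := nrm_ge0 f.
  have l2N (u : int -> R[i]) : l2 u -> l2 (fun k => - D u k).
    by move=> /l2_le_nrm /bD /l2_leN /l2_le_l2.
  have wl n : l2 (w n) by elim: n => [|n IH]; [case: (HS f fl)|case: (HS _ (l2N _ IH))].
  have Aw0 : A (w 0%N) = f by case: (HS f fl).
  have AwS n : A (w n.+1) = fun k => - D (w n) k by case: (HS _ (l2N _ (wl n))).
  have wB n : l2_le (w n) (M * F * (e * M) ^+ n).
    elim: n => [|n IH].
      by rewrite mulr1; apply: lo => //; rewrite Aw0; exact: l2_le_nrm.
    have -> : M * F * (e * M) ^+ n.+1 = M * (e * (M * F * (e * M) ^+ n)).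
      by rewrite exprS; ring.
    by apply: lo => //; rewrite AwS; apply/l2_leN/bD.
  pose s := fix s n := if n is m.+1 then (fun k : int => s m k + w m k) else fun=> 0.
  have q01 : 0 <= e * M < 1 by rewrite q0.
  have [u hu] : exists u, forall n, l2_le (fun k => u k - s n k)
      (M * F / (1 - e * M) * (e * M) ^+ n).
    apply: l2_geometric_limit => // n.
    by apply: l2_le_ext (wB n) => k /=; rewrite addrC addKr.
  have sl n : l2 (s n).
    by elim: n => [|n IH] /=; [exact: l2_le_l2 (l2_le0 (lexx 0))|exact: l2D].
  have ul : l2 u.
    by apply: l2_le_l2 (l2_le_ext _ (hu 0%N)) => k /=; rewrite subr0.
  exists u; split=> //.
  have sE n : (fun k => A (s n.+1) k + D (s n) k) = f.
    elim: n => [|n IH].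
      rewrite /= linopD // !linop0 // Aw0.
      by apply/funext => k; rewrite add0r addr0.
    apply/funext => k.
    have -> : s n.+2 = (fun k : int => s n.+1 k + w n.+1 k) by [].
    rewrite linopD // AwS.
    have -> : D (s n.+1) = fun k => D (s n) k + D (w n) k by rewrite /= linopD.
    by move/funeqP: IH => /(_ k) <-; ring.
  set C := M * F / (1 - e * M) in hu.
  have z0 : (fun k => A u k + D u k - f k) = fun=> 0.
    apply: (@l2_le_geometric_eq0 _ (K * C + e * C) (e * M)) => // n.
    have C0 : 0 <= C by apply: divr_ge0; [exact: mulr_ge0|exact: ltW].
    have := l2_leD (bA _ _ (hu n.+1)) (bD _ _ (hu n)); rewrite !linopB // => H.
    apply: l2_le_weak (l2_le_ext _ H).
      have x : (e * M) ^+ n.+1 <= (e * M) ^+ n.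
        by rewrite exprS ler_piMl ?exprn_ge0 // ltW.
      rewrite mulrDl -2!(mulrA _ C); apply: lerD => //.
      by apply: ler_wpM2l => //; exact: ler_wpM2l.
    by move=> k; move/funeqP: (sE n) => /(_ k) <-; ring.
  by apply/funext => k; move/funeqP: z0 => /(_ k) /eqP; rewrite subr_eq0 => /eqP.
Qed.

Lemma inv_by_comp A D M N : inv_by A M -> inv_by D N ->
  (forall u, l2 u -> l2 (D u)) ->
  inv_by (fun u => A (D u)) (N * M).
Proof.
move=> [M0 lA sA] [N0 lB sB] bB; split=> [|u C ul h|f fl]; first exact: mulr_ge0.
  by rewrite -mulrA; apply: lB => //; apply: lA => //; exact: bB.
have [v [vl vE]] := sA _ fl; have [u [ul uE]] := sB _ vl.
by exists u; rewrite uE.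
Qed.

Lemma inv_by_factor A D K M N : opb D K -> inv_by D N -> inv_by (fun u => A (D u)) M ->
  inv_by A (K * M).
Proof.
move=> [K0 bB] [N0 lB sB] [M0 lX sX]; split=> [|u C ul h|f fl]; first exact: mulr_ge0.
  have [w [wl wE]] := sB _ ul; rewrite -wE in h *.
  by rewrite -mulrA; apply: bB; apply: lX.
have [u [ul uE]] := sX _ fl; exists (D u); split=> //.
exact: (opb_l2 (conj K0 bB)).
Qed.

Lemma inv_by_id : inv_by (fun u => u) 1.
Proof. by split=> // [u B _|f fl]; [rewrite mul1r|exists f]. Qed.

Lemma linop_id : linop (fun u => u). Proof. by []. Qed.

Lemma opb_id : opb (fun u => u) 1.
Proof. by split=> // u B; rewrite mul1r. Qed.

Lemma opbZ A K (c : R[i]) : opb A K -> opb (fun u n => c * A u n) (normc c * K).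
Proof.
move=> [K0 h]; split=> [|u B /h /(l2_leZ c)]; first by rewrite mulr_ge0 // normc_ge0.
by rewrite mulrA.
Qed.

Lemma linopZs A (c : R[i]) : linop A -> linop (fun u n => c * A u n).
Proof. by move=> lA d u v; rewrite lA; apply/funext => k; ring. Qed.

Lemma opbD A D K e : opb A K -> opb D e -> opb (fun u n => A u n + D u n) (K + e).
Proof.
move=> [K0 h] [e0 h']; split=> [|u B ul]; first exact: addr_ge0.
by rewrite mulrDl; apply: l2_leD; [exact: h|exact: h'].
Qed.

Lemma opb_comp A D K e : opb A K -> opb D e -> opb (fun u => A (D u)) (K * e).
Proof.
move=> [K0 h] [e0 h']; split=> [|u B ul]; first exact: mulr_ge0.
by rewrite -mulrA; apply: h; exact: h'.
Qed.

Lemma opb_weak A K K' : K <= K' -> opb A K -> opb A K'.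
Proof.
move=> KK [K0 h]; split=> [|u B ul]; first exact: le_trans KK.
by apply: l2_le_weak (h _ _ ul); rewrite ler_wpM2r // (l2_le_ge0 ul).
Qed.

Lemma inv_by_weak A M M' : M <= M' -> inv_by A M -> inv_by A M'.
Proof.
move=> MM [M0 h s]; split=> //; first exact: le_trans MM.
move=> u B ul hu; apply: l2_le_weak (h _ _ ul hu).
by rewrite ler_wpM2r // (l2_le_ge0 hu).
Qed.

Lemma opb_shift_mul (c : int -> R[i]) (f : int -> int) C : injective f ->
  (forall n, normc (c n) <= C) -> opb (fun u n => c n * u (f n)) C.
Proof.
move=> fi cC; split; first by apply: le_trans (cC 0); exact: normc_ge0.
by move=> u B ul; apply: l2_le_mul => //; apply: l2_le_inj ul.
Qed.

End Operators.

(** * Jacobi operators and their resolvents *)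
Section JacobiBounds.
Variable R : realType.
Implicit Types (a b : int -> R) (u v f g : int -> R[i]) (z w : R[i]) (M C : R).

Lemma linop_jacobi a b : linop (jacobi a b).
Proof. by move=> c u v; apply/funext => n; rewrite /jacobi; ring. Qed.

Lemma linop_jacobi_shift a b z : linop (jacobi_shift a b z).
Proof. by move=> c u v; apply/funext => n; rewrite /jacobi_shift linop_jacobi; ring. Qed.

Lemma addi1_inj (k : int) : injective (fun n : int => n + k).
Proof. by move=> x y /addIr. Qed.

Lemma opb_jacobi a b C : (forall n, `|a n| <= C) -> (forall n, `|b n| <= C) ->
  opb (jacobi a b) (C + C + C).
Proof.
move=> aC bC.
apply: opbD; first apply: opbD.
- by apply: (opb_shift_mul (@addi1_inj 1)) => n; rewrite normc_real.
- by apply: (@opb_shift_mul _ (fun n => (b n)%:C%C) id) => // n; rewrite normc_real.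
- by apply: (opb_shift_mul (@addi1_inj (-1))) => n; rewrite normc_real.
Qed.

Lemma opb_jacobi_shift a b z C : (forall n, `|a n| <= C) -> (forall n, `|b n| <= C) ->
  opb (jacobi_shift a b z) (C + C + C + normc z).
Proof.
move=> aC bC; have -> : jacobi_shift a b z = fun u n => jacobi a b u n + (- z) * u n.
  by apply/funext => u; apply/funext => n; rewrite /jacobi_shift mulNr.
apply: opbD; first exact: opb_jacobi.
by rewrite -(normcN z); apply: (@opb_shift_mul _ (fun=> - z) id).
Qed.

Lemma resolvent_set_inv_by a b z : resolvent_set a b z ->
  exists M, inv_by (jacobi_shift a b z) M.
Proof.
move=> [ex [M hM]]; exists (Num.sqrt `|M|); split; first exact: sqrtr_ge0.
- move=> u B ul hB; have B0 := l2_le_ge0 hB.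
  apply/sqnorm_leP; first by rewrite mulr_ge0 // sqrtr_ge0.
  rewrite exprMn sqr_sqrtr // EFinM.
  apply: le_trans (hM u ul) _.
  apply: (@le_trans _ _ (`|M|%:E * sqnorm (jacobi_shift a b z u))%E).
    by apply: lee_wpmul2r; [exact: sqnorm_ge0|rewrite lee_fin ler_norm].
  by apply: lee_wpmul2l; [rewrite lee_fin|apply/sqnorm_leP].
- by move=> f /ex [u [[ul uE] _]]; exists u.
Qed.

Section Resolvent.
Variables (a b : int -> R) (z : R[i]) (M : R).
Hypothesis iM : inv_by (jacobi_shift a b z) M.

Lemma resolventP f : l2 f -> l2 (resolvent a b z f) /\ jacobi_shift a b z (resolvent a b z f) = f.
Proof.
case: iM => _ _ su /su [u hu]; rewrite /resolvent.
exact: (xgetPex (fun=> 0) (ex_intro [set u | l2 u /\ jacobi_shift a b z u = f] u hu)).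
Qed.

Lemma resolvent_l2 f : l2 f -> l2 (resolvent a b z f).
Proof. by case/resolventP. Qed.

Lemma resolventK f : l2 f -> jacobi_shift a b z (resolvent a b z f) = f.
Proof. by case/resolventP. Qed.

Lemma resolvent_uniq u f : l2 f -> l2 u -> jacobi_shift a b z u = f ->
  resolvent a b z f = u.
Proof.
move=> fl ul uE; apply: (inv_by_inj (linop_jacobi_shift a b z) iM) => //.
  exact: resolvent_l2.
by rewrite resolventK.
Qed.

Lemma l2_le_resolvent f B : l2_le f B -> l2_le (resolvent a b z f) (M * B).
Proof.
move=> hf; have fl := l2_le_l2 hf; case: iM => _ lo _.
by apply: lo; [exact: resolvent_l2|rewrite resolventK].
Qed.

Lemma resolvent_lin (c : R[i]) f g : l2 f -> l2 g ->
  resolvent a b z (fun k => c * f k + g k) =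
  (fun n => c * resolvent a b z f n + resolvent a b z g n).
Proof.
move=> fl gl; have zl := l2Z c fl.
apply: resolvent_uniq; first exact: l2D.
  by apply: l2D; [exact/l2Z/resolvent_l2|exact: resolvent_l2].
by rewrite linop_jacobi_shift !resolventK.
Qed.

Lemma resolventZ (c : R[i]) f : l2 f ->
  resolvent a b z (fun k => c * f k) = (fun n => c * resolvent a b z f n).
Proof.
move=> fl; apply: resolvent_uniq; [exact: l2Z|exact/l2Z/resolvent_l2|].
by rewrite linopZ ?resolventK //; exact: linop_jacobi_shift.
Qed.

Lemma resolventB f g : l2 f -> l2 g ->
  resolvent a b z (fun k => f k - g k) =
  (fun n => resolvent a b z f n - resolvent a b z g n).
Proof.
move=> fl gl; apply: resolvent_uniq; first exact: l2B.
  by apply: l2B; exact: resolvent_l2.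
by rewrite linopB ?resolventK //; exact: linop_jacobi_shift.
Qed.

End Resolvent.

Lemma resolvent_id a b z w M N f : inv_by (jacobi_shift a b z) M ->
  inv_by (jacobi_shift a b w) N -> l2 f ->
  forall n, resolvent a b z f n - resolvent a b w f n =
    (z - w) * resolvent a b z (resolvent a b w f) n.
Proof.
move=> iz iw fl n.
have wl := resolvent_l2 iw fl; have zl := resolvent_l2 iz fl.
have zwl := resolvent_l2 iz wl.
suff -> : resolvent a b z f = fun k => (z - w) * resolvent a b z (resolvent a b w f) k
   + resolvent a b w f k by rewrite addrK.
apply: (resolvent_uniq iz) => //; first by apply: l2D => //; exact: l2Z.
rewrite linop_jacobi_shift (resolventK iz) //.
apply/funext => k; move/funeqP: (resolventK iw fl) => /(_ k) <-.
by rewrite /jacobi_shift; ring.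
Qed.

Lemma inv_by_shift a b z w M C : (forall n, `|a n| <= C) -> (forall n, `|b n| <= C) ->
  inv_by (jacobi_shift a b z) M ->
  normc (w - z) * M <= 2^-1 -> inv_by (jacobi_shift a b w) (2 * M).
Proof.
move=> aC bC iM h.
have q1 : normc (- (w - z)) * M < 1 by rewrite normcN (le_lt_trans h) //; lra.
have oD : opb (fun u n => - (w - z) * u n) (normc (- (w - z))).
  by apply: (@opb_shift_mul _ (fun=> - (w - z)) id).
have lD : linop (fun u n => - (w - z) * u n).
  by move=> c u v; apply/funext => k; ring.
have := inv_by_pert (linop_jacobi_shift a b z) lD (opb_jacobi_shift z aC bC) oD iM q1.
have -> : (fun (u : int -> R[i]) n => jacobi_shift a b z u n + - (w - z) * u n) =
    jacobi_shift a b w.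
  by apply/funext => u; apply/funext => n; rewrite /jacobi_shift; ring.
apply: inv_by_weak; rewrite normcN.
have M0 : 0 <= M by case: iM.
have p : 0 < 1 - normc (w - z) * M by lra.
by rewrite ler_pdivrMr //; nra.
Qed.

End JacobiBounds.

Section MeanValue.
Variable R : realType.

Lemma is_derive_continuous (f df : R -> R) : (forall x : R, is_derive x 1 f (df x)) ->
  continuous f.
Proof.
move=> fd x; apply: differentiable_continuous; apply/derivable1_diffP.
by have := fd x; case.
Qed.

Lemma mvt_le (f df : R -> R) x y L : (forall x : R, is_derive x 1 f (df x)) ->
  (forall s, Num.min x y <= s <= Num.max x y -> `|df s| <= L) ->
  `|f y - f x| <= L * `|y - x|.
Proof.
move=> fd; wlog xy : x y / x <= y.
  move=> W H; have [xy|/ltW yx] := leP x y; first exact: W.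
  by rewrite distrC (distrC y); apply: W => // s; rewrite minC maxC; exact: H.
move=> H.
have cf : {within `[x, y], continuous f}.
  by apply: continuous_subspaceT; exact: (is_derive_continuous fd).
have [c] := @MVT_segment R f df _ _ xy (fun s _ => fd s) cf.
rewrite in_itv /= => cxy ->; rewrite normrM ler_wpM2r //; apply: H.
by rewrite (min_idPl xy) (max_idPr xy).
Qed.

Lemma mvt_quad (f df : R -> R) x y L : (forall x : R, is_derive x 1 f (df x)) ->
  0 <= L ->
  (forall s, Num.min x y <= s <= Num.max x y -> `|df s - df x| <= L * `|s - x|) ->
  `|f y - f x - (y - x) * df x| <= L * `|y - x| ^+ 2.
Proof.
move=> fd L0 H.
have gd (s : R) : is_derive s 1 (fun s => f s - s * df x) (df s - df x).
  have ? := fd s; apply: is_derive_eq.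
  by rewrite /GRing.scale /=; ring.
have -> : f y - f x - (y - x) * df x = (fun s => f s - s * df x) y - (fun s => f s - s * df x) x.
  by rewrite /=; ring.
rewrite expr2 mulrA; apply: (mvt_le gd) => s hs.
apply: le_trans (H s hs) _; rewrite ler_wpM2l //.
move: hs; rewrite ge_min le_max => /andP[/orP[] h1 /orP[] h2].
- by rewrite (le_anti (introT andP (conj h2 h1))) subrr normr0.
- by rewrite !ger0_norm; lra.
- by rewrite !ler0_norm; lra.
- by rewrite (le_anti (introT andP (conj h2 h1))).
Qed.

End MeanValue.

(** * The Lax pair and isospectrality *)
Section Lax.
Variable R : realType.
Implicit Types (a b : int -> R) (u v f g : int -> R[i]) (z w : R[i]) (M C : R).

(** The skew-symmetric member of the Lax pair of the Toda lattice. *)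
Definition lax_P a u : int -> R[i] := fun n =>
  (a n)%:C%C * u (n + 1) - (a (n - 1))%:C%C * u (n - 1).

Definition toda_da a b : int -> R := fun n => a n * (b (n + 1) - b n).
Definition toda_db a : int -> R := fun n => 2 * (a n ^+ 2 - a (n - 1) ^+ 2).

Lemma linop_lax_P a : linop (lax_P a).
Proof. by move=> c u v; apply/funext => n; rewrite /lax_P; ring. Qed.

Lemma opb_lax_P a C : (forall n, `|a n| <= C) -> opb (lax_P a) (C + C).
Proof.
move=> aC; have -> : lax_P a = fun u n =>
    (a n)%:C%C * u (n + 1) + (- a (n - 1))%:C%C * u (n + (-1)).
  by apply/funext => u; apply/funext => n; rewrite /lax_P rmorphN /= mulNr.
apply: opbD.
- by apply: (opb_shift_mul (@addi1_inj 1)) => n; rewrite normc_real.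
- by apply: (opb_shift_mul (@addi1_inj (-1))) => n; rewrite normc_real normrN.
Qed.

Lemma lax_commutator a b u :
  jacobi (toda_da a b) (toda_db a) u =
  (fun n => lax_P a (jacobi a b u) n - jacobi a b (lax_P a u) n).
Proof.
apply/funext => n; rewrite /jacobi /lax_P /toda_da /toda_db.
rewrite !addrK ?subrK !(rmorphM, rmorphB, rmorphXn) /=.
have -> : (2 : R)%:C%C = 2 :> R[i] by rewrite (rmorph_nat (real_complex R)).
ring.
Qed.

Lemma jacobi_sub a b a' b' u n :
  jacobi (fun k => a' k - a k) (fun k => b' k - b k) u n = jacobi a' b' u n - jacobi a b u n.
Proof. by rewrite /jacobi !rmorphB; ring. Qed.

Variables (a b a' b' : int -> R) (C c1 d : R).
Hypothesis aC : forall n, `|a n| <= C.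
Hypothesis bC : forall n, `|b n| <= C.
Hypothesis C1 : 1 <= C.
Hypothesis c10 : 0 <= c1.
Hypothesis a1 : forall n, `|a' n - a n| <= c1 * `|d|.
Hypothesis b1 : forall n, `|b' n - b n| <= c1 * `|d|.
Hypothesis a2 : forall n, `|a' n - a n - d * toda_da a b n| <= c1 * `|d| ^+ 2.
Hypothesis b2 : forall n, `|b' n - b n - d * toda_db a n| <= c1 * `|d| ^+ 2.

(** One Euler step: up to O(d^2), (J' - z)(1 + d P) = (1 + d P)(J - z), so the
    inverse bound grows by a factor 1 + O(d) only. *)
Lemma lax_step z M : inv_by (jacobi_shift a b z) M ->
  C * `|d| <= 8^-1 -> 9 * c1 * `|d| * M <= 1 ->
  inv_by (jacobi_shift a' b' z) (M * (1 + 16 * (C * `|d|))).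
Proof.
move=> iM hd hM.
pose E u n := jacobi (fun n => a' n - a n - d * toda_da a b n)
    (fun n => b' n - b n - d * toda_db a n) u n +
  d%:C%C * jacobi (fun n => a' n - a n) (fun n => b' n - b n) (lax_P a u) n.
pose V u n := u n + d%:C%C * lax_P a u n.
have M0 : 0 <= M by case: iM.
have d0 := normr_ge0 d.
set p := 2 * (C * `|d|).
have p0 : 0 <= p by rewrite !mulr_ge0 // (le_trans ler01).
have p4 : p <= 4^-1 by rewrite /p; lra.
have lE : linop E.
  by move=> c u v; apply/funext => n; rewrite /E linop_lax_P !linop_jacobi; ring.
have oE : opb E (9 * C * c1 * `|d| ^+ 2).
  have := opbD (opb_jacobi a2 b2) (opbZ d%:C%C (opb_comp (opb_jacobi a1 b1) (opb_lax_P aC))).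
  apply: opb_weak; rewrite normc_real.
  have h : 0 <= (C - 1) * (c1 * `|d| ^+ 2).
    by rewrite mulr_ge0 ?subr_ge0 // mulr_ge0 // sqr_ge0.
  rewrite -subr_ge0; apply: le_trans (mulr_ge0 (ler0n R 3) h) _.
  by rewrite le_eqVlt; apply/orP; left; apply/eqP; ring.
have lV : linop (fun u n => d%:C%C * lax_P a u n) by exact/linopZs/linop_lax_P.
have oV : opb (fun u n => d%:C%C * lax_P a u n) p.
  have := opbZ d%:C%C (opb_lax_P aC); apply: opb_weak.
  by rewrite normc_real /p; lra.
have iV : inv_by V (1 / (1 - p * 1)).
  by apply: (inv_by_pert (@linop_id R) lV (@opb_id R) oV (@inv_by_id R)); lra.
have oV1 : opb V (1 + p) by apply: opbD oV; exact: opb_id.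
have lVV : linop V by move=> c u v; apply/funext => n; rewrite /V linop_lax_P; ring.
have lX : linop (fun u => V (jacobi_shift a b z u)).
  by move=> c u v; rewrite linop_jacobi_shift lVV.
have oX := opb_comp oV1 (opb_jacobi_shift z aC bC).
have iX : inv_by (fun u => V (jacobi_shift a b z u)) (M * (1 / (1 - p * 1))).
  apply: inv_by_comp iV iM _ => u ul; exact: opb_l2 (opb_jacobi_shift z aC bC) ul.
have q1 : 9 * C * c1 * `|d| ^+ 2 * (M * (1 / (1 - p * 1))) <= p.
  rewrite mulr1 mulrA div1r ler_pdivrMr; last by lra.
  have -> : 9 * C * c1 * `|d| ^+ 2 * M = (C * `|d|) * (9 * c1 * `|d| * M) by ring.
  have : 0 <= C * `|d| by rewrite mulr_ge0 // (le_trans ler01).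
  move: hM p4; rewrite /p; move: (9 * c1 * `|d| * M) (C * `|d|) => x y; nra.
have q2 : 9 * C * c1 * `|d| ^+ 2 * (M * (1 / (1 - p * 1))) < 1.
  by apply: le_lt_trans q1 _; lra.
have iXE := inv_by_pert lX lE oX oE iX q2.
have eq1 : (fun u n => V (jacobi_shift a b z u) n + E u n) =
    fun u => jacobi_shift a' b' z (V u).
  apply/funext => u; apply/funext => n.
  have lc : lax_P a (jacobi_shift a b z u) n = jacobi a b (lax_P a u) n +
      jacobi (toda_da a b) (toda_db a) u n - z * lax_P a u n.
    rewrite lax_commutator /jacobi_shift.
    rewrite (@linopB _ _ _ (fun k => z * u k) (linop_lax_P a)) (linopZ _ _ (linop_lax_P a)).
    ring.
  rewrite /V lc /E !jacobi_sub /jacobi_shift.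
  have -> : (fun n => u n + d%:C%C * lax_P a u n) = (fun n => d%:C%C * lax_P a u n + u n).
    by apply/funext => k; rewrite addrC.
  rewrite linop_jacobi.
  have -> : jacobi (fun k => d * toda_da a b k) (fun k => d * toda_db a k) u n =
      d%:C%C * jacobi (toda_da a b) (toda_db a) u n.
    by rewrite /jacobi !rmorphM /=; ring.
  ring.
rewrite eq1 in iXE.
have := inv_by_factor oV1 iV iXE; apply: inv_by_weak.
set q := 9 * C * c1 * `|d| ^+ 2 * (M * (1 / (1 - p * 1))) in q1 q2 *.
have -> : M * (1 + 16 * (C * `|d|)) = M * (1 + 8 * p) by rewrite /p; ring.
have p1 : 0 < 1 - p by lra.
have q3 : 0 < 1 - q by lra.
have -> : (1 + p) * (M * (1 / (1 - p * 1)) / (1 - q)) = M * ((1 + p) / ((1 - p) * (1 - q))).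
  by rewrite mulr1; field; rewrite !gt_eqF.
apply: ler_wpM2l => //; rewrite ler_pdivrMr ?mulr_gt0 //.
apply: (@le_trans _ _ ((1 + 8 * p) * ((1 - p) * (1 - p)))); first nra.
by apply: ler_wpM2l; [lra|apply: ler_wpM2l; lra].
Qed.

End Lax.

Section Isospectral.
Variable R : realType.
Variables (a b : R -> int -> R).
Hypothesis sol : toda_solution a b.

Lemma toda_bound (T : R) : exists C, 1 <= C /\ forall t n, `|t| <= T ->
  `|a t n| <= C /\ `|b t n| <= C.
Proof.
case: sol => /(_ T) [M hM] _ _; exists (Num.max M 1); split.
  by rewrite le_max lexx orbT.
by move=> t n /(hM t n) [h1 h2]; rewrite !le_max h1 h2.
Qed.

Lemma toda_da_derive (t : R) n : is_derive t 1 (a ^~ n) (toda_da (a t) (b t) n).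
Proof. by case: sol => _ h _; exact: h. Qed.

Lemma toda_db_derive (t : R) n : is_derive t 1 (b ^~ n) (toda_db (a t) n).
Proof. by case: sol => _ _ h; exact: h. Qed.

Lemma between_norm_le (s t x T : R) : `|s| <= T -> `|t| <= T ->
  Num.min s t <= x <= Num.max s t -> `|x| <= T.
Proof.
rewrite !ler_norml ge_min le_max => /andP[h1 h2] /andP[h3 h4] /andP[].
by move=> /orP[] h5 /orP[] h6; apply/andP; split; lra.
Qed.

(** Because the constant does not depend on the site, these Taylor bounds for the
    coefficients are bounds in operator norm for the Jacobi operators. *)
Lemma toda_quad (T : R) : exists c1, 0 <= c1 /\
  forall s t, `|s| <= T -> `|t| <= T -> forall n,
  [/\ `|a t n - a s n| <= c1 * `|t - s|, `|b t n - b s n| <= c1 * `|t - s|,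
   `|a t n - a s n - (t - s) * toda_da (a s) (b s) n| <= c1 * `|t - s| ^+ 2 &
   `|b t n - b s n - (t - s) * toda_db (a s) n| <= c1 * `|t - s| ^+ 2].
Proof.
have [C [C1 hC]] := toda_bound T.
have C0 : 0 <= C by apply: le_trans C1.
have CC : 1 <= C ^+ 2 by rewrite expr_ge1.
have CC3 : C ^+ 2 <= C ^+ 3 by rewrite [leRHS]exprSr ler_peMr // sqr_ge0.
have bd1 s n : `|s| <= T -> `|toda_da (a s) (b s) n| <= 4 * C ^+ 2.
  move=> sT; rewrite /toda_da normrM.
  apply: (@le_trans _ _ (C * (C + C))); last by rewrite expr2; nra.
  apply: ler_pM => //; first by case: (hC s n sT).
  apply: le_trans (ler_normB _ _) _; apply: lerD; by [case: (hC s (n + 1) sT)|case: (hC s n sT)].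
have bd2 s n : `|s| <= T -> `|toda_db (a s) n| <= 4 * C ^+ 2.
  move=> sT; rewrite /toda_db normrM normr_nat.
  have h k : `|a s k ^+ 2| <= C ^+ 2.
    by rewrite normrX ler_pXn2r ?nnegrE //; case: (hC s k sT).
  have := ler_normB (a s n ^+ 2) (a s (n - 1) ^+ 2).
  have := h n; have := h (n - 1); lra.
have lipa s t n : `|s| <= T -> `|t| <= T -> `|a t n - a s n| <= 4 * C ^+ 2 * `|t - s|.
  move=> sT tT; apply: (mvt_le (fun x => toda_da_derive x n)) => x hx.
  by apply: bd1; exact: between_norm_le hx.
have lipb s t n : `|s| <= T -> `|t| <= T -> `|b t n - b s n| <= 4 * C ^+ 2 * `|t - s|.
  move=> sT tT; apply: (mvt_le (fun x => toda_db_derive x n)) => x hx.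
  by apply: bd2; exact: between_norm_le hx.
have lip2 s t n : `|s| <= T -> `|t| <= T ->
    `|toda_da (a t) (b t) n - toda_da (a s) (b s) n| <= 32 * C ^+ 3 * `|t - s|.
  move=> sT tT; rewrite /toda_da.
  have -> : a t n * (b t (n + 1) - b t n) - a s n * (b s (n + 1) - b s n) =
    (a t n - a s n) * (b t (n + 1) - b t n) +
    a s n * ((b t (n + 1) - b s (n + 1)) - (b t n - b s n)) by ring.
  have h1 : `|(a t n - a s n) * (b t (n + 1) - b t n)| <= (4 * C ^+ 2 * `|t - s|) * (C + C).
    rewrite normrM; apply: ler_pM => //; first exact: lipa.
    by apply: le_trans (ler_normB _ _) _; apply: lerD; [case: (hC t (n + 1) tT)|case: (hC t n tT)].
  have h2 : `|a s n * ((b t (n + 1) - b s (n + 1)) - (b t n - b s n))| <=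
     C * (4 * C ^+ 2 * `|t - s| + 4 * C ^+ 2 * `|t - s|).
    rewrite normrM; apply: ler_pM => //; first by case: (hC s n sT).
    by apply: le_trans (ler_normB _ _) _; apply: lerD; exact: lipb.
  apply: le_trans (ler_normD _ _) _; apply: le_trans (lerD h1 h2) _.
  have : 0 <= `|t - s| by [].
  have : 0 <= C ^+ 3 * `|t - s| by rewrite mulr_ge0 // exprn_ge0.
  rewrite !exprS expr0; nra.
have lip3 s t n : `|s| <= T -> `|t| <= T ->
    `|toda_db (a t) n - toda_db (a s) n| <= 32 * C ^+ 3 * `|t - s|.
  move=> sT tT; rewrite /toda_db.
  have h k : `|a t k ^+ 2 - a s k ^+ 2| <= (4 * C ^+ 2 * `|t - s|) * (C + C).
    rewrite subr_sqr normrM; apply: ler_pM => //; first exact: lipa.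
    by apply: le_trans (ler_normD _ _) _; apply: lerD; [case: (hC t k tT)|case: (hC s k sT)].
  have -> : 2 * (a t n ^+ 2 - a t (n - 1) ^+ 2) - 2 * (a s n ^+ 2 - a s (n - 1) ^+ 2)
    = 2 * ((a t n ^+ 2 - a s n ^+ 2) - (a t (n - 1) ^+ 2 - a s (n - 1) ^+ 2)) by ring.
  rewrite normrM normr_nat.
  have := ler_normB (a t n ^+ 2 - a s n ^+ 2) (a t (n - 1) ^+ 2 - a s (n - 1) ^+ 2).
  have := h n; have := h (n - 1).
  rewrite !exprS expr0; lra.
exists (32 * C ^+ 3); split; first by rewrite mulr_ge0 // exprn_ge0.
move=> s t sT tT n.
have le1 : 4 * C ^+ 2 * `|t - s| <= 32 * C ^+ 3 * `|t - s|.
  by rewrite ler_wpM2r //; lra.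
split; try by apply: le_trans le1; by [exact: lipa|exact: lipb].
- apply: (mvt_quad (fun x => toda_da_derive x n)); first by rewrite mulr_ge0 // exprn_ge0.
  by move=> x hx; apply: lip2 => //; exact: between_norm_le hx.
- apply: (mvt_quad (fun x => toda_db_derive x n)); first by rewrite mulr_ge0 // exprn_ge0.
  by move=> x hx; apply: lip3 => //; exact: between_norm_le hx.
Qed.

(** The resolvent set is carried along by the flow: iterating the Euler step
    N times multiplies the inverse bound by at most (1 + 16 C T / N)^N. *)
Lemma toda_isospectral z M0 (T : R) : 0 <= T ->
  inv_by (jacobi_shift (a 0) (b 0) z) M0 ->
  exists M, forall t, `|t| <= T -> inv_by (jacobi_shift (a t) (b t) z) M.
Proof.
move=> T0 i0.
have [C [C1 hC]] := toda_bound T.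
have [c1 [c10 hc]] := toda_quad T.
have M00 : 0 <= M0 by case: i0.
pose M := M0 * expR (16 * C * T).
have MM : 0 <= M by rewrite mulr_ge0 // expR_ge0.
exists M => t tT.
pose N := (Num.truncn (8 * C * T + 9 * c1 * T * M)).+1.
have hN : 8 * C * T + 9 * c1 * T * M < N%:R.
  have := truncnS_gt (8 * C * T + 9 * c1 * T * M); exact.
have N0 : 0 < N%:R :> R by rewrite ltr0n.
pose d := t / N%:R.
have dE : `|d| = `|t| / N%:R by rewrite /d normrM normfV normr_nat.
have dT : `|d| <= T / N%:R by rewrite dE ler_pM2r ?invr_gt0.
have C0 : 0 <= C by apply: le_trans C1.
have cT0 : 0 <= 9 * c1 * T * M by rewrite !mulr_ge0.
have CT0 : 0 <= 8 * C * T by rewrite !mulr_ge0.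
have s1 : C * `|d| <= 8^-1.
  apply: le_trans (ler_wpM2l C0 dT) _; rewrite mulrA ler_pdivrMr //; lra.
have s2 : 9 * c1 * `|d| * M <= 1.
  apply: (@le_trans _ _ (9 * c1 * (T / N%:R) * M)).
    by rewrite ler_wpM2r // ler_wpM2l // mulr_ge0.
  have -> : 9 * c1 * (T / N%:R) * M = 9 * c1 * T * M / N%:R by ring.
  by rewrite ler_pdivrMr //; lra.
pose q := 1 + 16 * (C * `|d|).
have q1 : 1 <= q by rewrite /q lerDl !mulr_ge0.
have qN i : (i <= N)%N -> M0 * q ^+ i <= M.
  move=> iN; rewrite /M ler_wpM2l //.
  apply: (@le_trans _ _ (q ^+ N)); first exact: ler_weXn2l.
  have -> : 16 * C * T = 16 * C * T / N%:R * N%:R by rewrite divfK // gt_eqF.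
  rewrite expRM_natr; apply: lerXn2r; rewrite ?nnegrE ?expR_ge0 //.
    by apply: le_trans q1.
  apply: le_trans (expR_ge1Dx _); rewrite /q lerD2l -!mulrA ler_wpM2l //.
  exact: ler_wpM2l.
have key i : (i <= N)%N ->
    inv_by (jacobi_shift (a (i%:R * d)) (b (i%:R * d)) z) (M0 * q ^+ i).
  elim: i => [|i IH] iN; first by rewrite mul0r mulr1.
  have bdi k : (k <= N)%N -> `|k%:R * d| <= T.
    move=> kN; rewrite normrM normr_nat dE mulrA ler_pdivrMr // mulrC.
    by apply: ler_pM => //; rewrite ler_nat.
  have Ti := bdi _ (ltnW iN); have TSi := bdi _ iN.
  have sub : i.+1%:R * d - i%:R * d = d by rewrite -mulrBl -natr1 addrAC subrr add0r mul1r.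
  have hq n := hc _ _ Ti TSi n; rewrite sub in hq.
  have -> : M0 * q ^+ i.+1 = M0 * q ^+ i * q by rewrite exprSr mulrA.
  apply: (@lax_step R (a (i%:R * d)) (b (i%:R * d)) _ _ C c1 d) => //.
  - by move=> n; case: (hC _ n Ti).
  - by move=> n; case: (hC _ n Ti).
  - by move=> n; case: (hq n).
  - by move=> n; case: (hq n).
  - by move=> n; case: (hq n).
  - by move=> n; case: (hq n).
  - exact: IH (ltnW iN).
  - apply: le_trans s2; rewrite ler_wpM2l ?mulr_ge0 //; exact: qN (ltnW iN).
have := key N (leqnn N).
have -> : N%:R * d = t by rewrite /d mulrC divfK // gt_eqF.
by apply: inv_by_weak; exact: qN.
Qed.

End Isospectral.

(** * Green's function at a fixed time *)
Section Pairing.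
Variable R : realType.
Implicit Types (u v : int -> R[i]) (s : seq int).

Definition win (N : nat) : seq int := [seq i%:Z - N%:Z | i <- iota 0 N.*2.+1].

Lemma win_uniq N : uniq (win N).
Proof. by rewrite map_inj_uniq ?iota_uniq // => i j /addIr [->]. Qed.

Lemma mem_win N (n : int) : (n \in win N) = (`|n| <= N%:Z).
Proof.
apply/mapP/idP => [H|h].
  by case: H => i; rewrite mem_iota => h ->; lia.
by exists (absz (n + N%:Z)); rewrite ?mem_iota; lia.
Qed.

Lemma sum_win_telescope (V : zmodType) (F : int -> V) N :
  \sum_(n <- win N) (F n - F (n - 1)) = F N%:Z - F (- N%:Z - 1).
Proof.
rewrite /win big_map -[iota 0 _]/(iota 0 (N.*2.+1 - 0)%N).
rewrite -[LHS]/(\sum_(0 <= i < N.*2.+1) _).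
have := @telescope_sumr V 0 N.*2.+1 (fun i => F (i%:Z - N%:Z - 1)) isT.
rewrite (_ : N.*2.+1%:Z - N%:Z - 1 = N%:Z); last by lia.
rewrite sub0r => <-; apply: eq_bigr => i _.
by congr (F _ - _); lia.
Qed.

Lemma sum_win_delta (V : zmodType) (F : int -> V) m N : `|m| <= N%:Z ->
  \sum_(n <- win N) (if n == m then F n else 0) = F m.
Proof.
move=> mN; rewrite (bigD1_seq m) ?win_uniq ?mem_win //= eqxx big1 ?addr0 //.
by move=> i /negbTE ->.
Qed.

Lemma sum_uniq_le_win (F : int -> R) s N : (forall n, 0 <= F n) -> uniq s ->
  {in s, forall n, `|n| <= N%:Z} -> \sum_(n <- s) F n <= \sum_(n <- win N) F n.
Proof.
move=> F0 us sN.
have ps : perm_eq s [seq n <- win N | n \in s].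
  apply: uniq_perm => //; first by rewrite filter_uniq ?win_uniq.
  move=> n; rewrite mem_filter mem_win; case: (boolP (n \in s)) => //= /sN -> //.
rewrite (perm_big _ ps) big_filter big_mkcond /=; apply: ler_sum => n _.
by case: ifP.
Qed.

Lemma l2_le_small u B e : l2_le u B -> 0 < e ->
  exists N0 : nat, forall n : int, N0%:Z <= `|n| -> normc (u n) <= e.
Proof.
move=> [B0 H] e0.
apply: contrapT => NH.
have {}NH N0 : exists n : int, N0%:Z <= `|n| /\ e < normc (u n).
  apply: contrapT => h; apply: NH; exists N0 => n hn.
  by rewrite leNgt; apply/negP => h2; apply: h; exists n.
have build k : exists s : seq int, uniq s /\ e ^+ 2 * k%:R <= \sum_(n <- s) normc (u n) ^+ 2.
  elim: k => [|k [s [us hs]]]; first by exists [::]; rewrite mulr0 big_nil.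
  pose N := (\sum_(n <- s) (absz n).+1)%N.
  have [n [nN en]] := NH N.
  exists (n :: s); split.
    rewrite /= us andbT; apply/negP => ns.
    have : (absz n < N)%N by rewrite /N (bigD1_seq n) //= ltn_addr.
    by move: nN; lia.
  rewrite big_cons -natr1 mulrDr mulr1 addrC lerD //.
  by rewrite ler_pXn2r ?nnegrE ?normc_ge0 ?ltW.
pose k := (Num.truncn (B ^+ 2 / e ^+ 2)).+1.
have [s [us hs]] := build k.
have := le_trans hs (H s us); rewrite leNgt => /negP; apply.
by rewrite mulrC -ltr_pdivrMr ?exprn_gt0 // truncnS_gt.
Qed.

Variables (a b : int -> R) (C : R).
Hypothesis aC : forall n, `|a n| <= C.

Definition wronskian u v (n : int) : R[i] := (a n)%:C%C * (u (n + 1) * v n - u n * v (n + 1)).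

Lemma wronskian_step u v n :
  jacobi a b u n * v n - u n * jacobi a b v n = wronskian u v n - wronskian u v (n - 1).
Proof. by rewrite /jacobi /wronskian !subrK; ring. Qed.

Lemma wronskian_small u v B B' e : l2_le u B -> l2_le v B' -> 0 < e ->
  exists N0 : nat, forall n : int, N0%:Z <= `|n| -> normc (wronskian u v n) <= e.
Proof.
move=> hu hv e0.
have C0 : 0 <= C by apply: le_trans (aC 0).
have B0 := l2_le_ge0 hv.
have d0 : 0 < e / (2 * (C * (B' + 1)) + 1).
  by rewrite divr_gt0 // ltr_wpDl // !mulr_ge0 // addr_ge0.
have [N0 h] := l2_le_small hu d0; exists N0.+1 => n hn.
have h1 := h n; have h2 := h (n + 1).
rewrite /wronskian normcM normc_real.
have k1 : normc (u (n + 1) * v n - u n * v (n + 1)) <=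
    2 * (e / (2 * (C * (B' + 1)) + 1) * (B' + 1)).
  apply: le_trans (normcB _ _) _; rewrite !normcM mulr_natl mulr2n.
  apply: lerD; apply: ler_pM; rewrite ?normc_ge0 //.
  - by apply: h2; lia.
  - by apply: le_trans (l2_le_pt _ hv) _; rewrite lerDl.
  - by apply: h1; lia.
  - by apply: le_trans (l2_le_pt _ hv) _; rewrite lerDl.
apply: le_trans (ler_pM _ _ (aC n) k1) _; rewrite ?normc_ge0 //.
set D := 2 * (C * (B' + 1)) + 1 in d0 *.
have D0 : 0 < D by rewrite /D ltr_wpDl // !mulr_ge0 // addr_ge0.
have -> : C * (2 * (e / D * (B' + 1))) = e / D * (D - 1) by rewrite /D; ring.
by rewrite -mulrA ler_piMr ?(ltW e0) // mulrC ler_pdivrMr // mul1r gerBl.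
Qed.

(** Symmetry of J, as the vanishing of the boundary terms of Green's formula. *)
Lemma green_formula u v B B' e : l2_le u B -> l2_le v B' -> 0 < e ->
  exists N0 : nat, forall N : nat, (N0 <= N)%N ->
  normc (\sum_(n <- win N) (jacobi a b u n * v n - u n * jacobi a b v n)) <= e.
Proof.
move=> hu hv e0; have e2 : 0 < e / 2 by rewrite divr_gt0.
have [N0 h] := wronskian_small hu hv e2; exists N0 => N hN.
under eq_bigr do rewrite wronskian_step.
rewrite sum_win_telescope; apply: le_trans (normcB _ _) _.
by rewrite [leRHS](splitr e) lerD //; apply: h; lia.
Qed.

End Pairing.

Section Green.
Variable R : realType.
Variables (a b : int -> R) (C : R).
Hypothesis aC : forall n, `|a n| <= C.
Hypothesis bC : forall n, `|b n| <= C.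
Implicit Types (z w : R[i]) (M : R).

Definition gmat z (m n : int) : R[i] := resolvent a b z (@delta R n) m.

Lemma l2_delta n : l2 (@delta R n). Proof. exact: l2_le_l2 (l2_le_delta _ n). Qed.

Lemma gmat_bound z M m n : inv_by (jacobi_shift a b z) M -> normc (gmat z m n) <= M.
Proof.
by move=> iM; have := l2_le_pt m (l2_le_resolvent iM (l2_le_delta R n)); rewrite mulr1.
Qed.

Lemma gmat_eq z M m n : inv_by (jacobi_shift a b z) M ->
  (a m)%:C%C * gmat z (m + 1) n + (b m)%:C%C * gmat z m n + (a (m - 1))%:C%C * gmat z (m - 1) n
    - z * gmat z m n = (m == n)%:R.
Proof. by move=> iM; have /funeqP /(_ m) := resolventK iM (l2_delta n). Qed.

Lemma gmat_jacobi z M m n : inv_by (jacobi_shift a b z) M ->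
  jacobi a b (gmat z ^~ n) m = z * gmat z m n + (m == n)%:R.
Proof. by move=> iM; rewrite -(gmat_eq _ _ iM) /jacobi; ring. Qed.

Lemma l2_le_gmat z M n : inv_by (jacobi_shift a b z) M -> l2_le (gmat z ^~ n) M.
Proof. by move=> iM; have := l2_le_resolvent iM (l2_le_delta R n); rewrite mulr1. Qed.

Lemma normc_small (x : R[i]) : (forall e, 0 < e -> normc x <= e) -> x = 0.
Proof.
move=> h; apply: eq0_normc; apply/eqP; rewrite eq_le normc_ge0 andbT.
by apply/ler_addgt0Pr => e /h; rewrite add0r.
Qed.

Lemma gmat_sym z M m n : inv_by (jacobi_shift a b z) M -> gmat z m n = gmat z n m.
Proof.
move=> iM; apply/eqP; rewrite -subr_eq0; apply/eqP/normc_small => e e0.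
have [N0 h] := green_formula b aC (l2_le_gmat n iM) (l2_le_gmat m iM) e0.
pose N := (maxn N0 (maxn (absz m) (absz n))).
have := h N; rewrite leq_maxl => /(_ isT).
under eq_bigr => k _.
  rewrite !(gmat_jacobi _ _ iM).
  rewrite (_ : _ - _ = (if k == n then gmat z k m else 0) - (if k == m then gmat z k n else 0)).
    over.
  by case: (k == n); case: (k == m) => /=; ring.
rewrite big_split /= sumrN !sum_win_delta; [|lia|lia].
by rewrite -normcN opprB.
Qed.

Lemma gmat_wronskian z M m : inv_by (jacobi_shift a b z) M ->
  (a m)%:C%C * (gmat z (m + 1) m ^+ 2 - gmat z m m * gmat z (m + 1) (m + 1)) = gmat z (m + 1) m.
Proof.
move=> iM.
pose u := gmat z ^~ m; pose v := gmat z ^~ (m + 1).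
have stp n : wronskian a u v n - wronskian a u v (n - 1) =
    (if n == m then v n else 0) - (if n == m + 1 then u n else 0).
  rewrite -(wronskian_step a b) /u /v !(gmat_jacobi _ _ iM).
  by case: (n == m); case: (n == m + 1) => /=; ring.
have below k : wronskian a u v (m - 1 - k%:Z) = wronskian a u v (m - 1).
  elim: k => [|k IH]; first by rewrite subr0.
  have := stp (m - 1 - k%:Z).
  have -> : m - 1 - k%:Z - 1 = m - 1 - k.+1%:Z by lia.
  have -> : (m - 1 - k%:Z == m) = false by lia.
  have -> : (m - 1 - k%:Z == m + 1) = false by lia.
  by rewrite subrr => /eqP; rewrite subr_eq0 => /eqP <-.
have w0 : wronskian a u v (m - 1) = 0.
  apply: normc_small => e e0.
  have [N0 h] := wronskian_small aC (l2_le_gmat m iM) (l2_le_gmat (m + 1) iM) e0.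
  by rewrite -(below (N0 + absz m)%N); apply: h; lia.
have := stp m; rewrite w0 subr0 eqxx.
have -> : (m == m + 1) = false by lia.
rewrite subr0 /wronskian /u /v (gmat_sym m (m + 1) iM) => E; rewrite -[RHS]E; ring.
Qed.

(** With v the column, Green's formula gives Im <(J - z) v, v> = - Im z |v|^2, and the
    left-hand side is - Im G(n,n); only a finite part of the norm is kept. *)
Lemma gmat_im z M n s : inv_by (jacobi_shift a b z) M -> uniq s -> 0 < complex.Im z ->
  complex.Im z * \sum_(k <- s) normc (gmat z k n) ^+ 2 <= complex.Im (gmat z n n).
Proof.
move=> iM us y0.
apply/ler_addgt0Pr => e e0.
pose v := fun k => (gmat z k n)^*%C.
have vl : l2_le v M.
  have [B0 H] := l2_le_gmat n iM; split=> // t ut.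
  apply: le_trans (H t ut); apply: ler_sum => k _.
  by rewrite /v !normc_sqE; case: (gmat z k n) => p q /=; rewrite sqrrN.
have [N0 h] := green_formula b aC (l2_le_gmat n iM) vl (mulr_gt0 (ltr0n R 2) e0).
pose N := (maxn N0 (maxn (absz n) (\sum_(k <- s) absz k)))%N.
have hs : {in s, forall k, `|k| <= N%:Z}.
  move=> k ks; have : (absz k <= \sum_(k <- s) absz k)%N by rewrite (bigD1_seq k) //= leq_addr.
  by rewrite /N; lia.
have S0 k : 0 <= normc (gmat z k n) ^+ 2 by exact: sqr_ge0.
apply: le_trans (ler_wpM2l (ltW y0) (sum_uniq_le_win S0 us hs)) _.
have := h N; rewrite leq_maxl => /(_ isT).
have jv k : jacobi a b v k = (z * gmat z k n + (k == n)%:R)^*%C.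
  rewrite -(gmat_jacobi _ _ iM) /jacobi /v !rmorphD !rmorphM /=.
  by rewrite !oppr0.
move=> /(le_trans (Im_le_normc _)).
rewrite raddf_sum /=.
under eq_bigr => k _.
  rewrite (gmat_jacobi _ _ iM) jv /v.
  rewrite (_ : complex.Im _ = (2 * complex.Im z) * normc (gmat z k n) ^+ 2 -
     (if k == n then 2 * complex.Im (gmat z k n) else 0)).
    over.
  rewrite normc_sqE; case: (k == n) => /=; case: (gmat z k n) => p q; case: (z) => x y /=; ring.
rewrite big_split /= sumrN -mulr_sumr sum_win_delta; last by lia.
rewrite ler_norml => /andP[_]; lra.
Unshelve. all: exact: R. Qed.

Lemma gmat_real (x : R) M m n : inv_by (jacobi_shift a b x%:C%C) M ->
  complex.Im (gmat x%:C%C m n) = 0.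
Proof.
move=> iM; pose v := fun k => (gmat x%:C%C k n)^*%C.
have vl : l2 v.
  apply: (@l2_le_l2 _ _ M); have [B0 H] := l2_le_gmat n iM; split=> // t ut.
  apply: le_trans (H t ut); apply: ler_sum => k _.
  by rewrite /v !normc_sqE; case: (gmat _ k n) => p q /=; rewrite sqrrN.
have /funeqP /(_ m) : resolvent a b x%:C%C (@delta R n) = v.
  apply: (resolvent_uniq iM) => //; first exact: l2_delta.
  apply/funext => k.
  have -> : @delta R n k = (@delta R n k)^*%C by rewrite /delta rmorph_nat.
  move/funeqP: (resolventK iM (l2_delta n)) => /(_ k) <-.
  rewrite /jacobi_shift /jacobi /v /gmat !(rmorphB, rmorphD, rmorphM) /=.
  by rewrite !oppr0.
rewrite -/(gmat _ m n) /v; case: (gmat _ m n) => p q /= [] h.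
by lra.
Qed.

Lemma green_im_lower z M : inv_by (jacobi_shift a b z) M -> 0 < complex.Im z ->
  complex.Im z <= 3 * (C + normc z) ^+ 2 * complex.Im (gmat z 0 0).
Proof.
move=> iM y0; have := gmat_im (s := [:: -1; 0; 1]) 0 iM isT y0.
rewrite !big_cons big_nil addr0.
have := gmat_eq 0 0 iM; rewrite eqxx add0r sub0r.
set u1 := gmat z 1 0; set u0 := gmat z 0 0; set v1 := gmat z (-1) 0 => E.
have h1 : 1 <= (C + normc z) * (normc u1 + normc u0 + normc v1).
  rewrite -(normc1 R) -[X in normc X]/(1%:R) -E.
  have C0 : 0 <= C by apply: le_trans (aC 0).
  have nz := normc_ge0 z.
  have -> : (a 0)%:C%C * u1 + (b 0)%:C%C * u0 + (a (-1))%:C%C * v1 - z * u0 =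
    (a 0)%:C%C * u1 + ((b 0)%:C%C - z) * u0 + (a (-1))%:C%C * v1 by ring.
  apply: le_trans (normcD _ _) _; rewrite mulrDr lerD //.
    apply: le_trans (normcD _ _) _; rewrite mulrDr lerD //.
      rewrite normcM normc_real ler_wpM2r ?normc_ge0 // (le_trans (aC 0)) // lerDl.
      exact: nz.
    rewrite normcM ler_wpM2r ?normc_ge0 // (le_trans (normcB _ _)) // normc_real lerD2r.
    exact: bC.
  rewrite normcM normc_real ler_wpM2r ?normc_ge0 // (le_trans (aC _)) // lerDl; exact: nz.
have h2 : (normc u1 + normc u0 + normc v1) ^+ 2 <=
   3 * (normc v1 ^+ 2 + (normc u0 ^+ 2 + normc u1 ^+ 2)).
  move: (normc u1) (normc u0) (normc v1) => p q r.
  by have := sqr_ge0 (p - q); have := sqr_ge0 (p - r); have := sqr_ge0 (q - r); rewrite !expr2; lra.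
have h3 : 1 <= (C + normc z) ^+ 2 * (normc u1 + normc u0 + normc v1) ^+ 2.
  by rewrite -exprMn expr_ge1 // (le_trans ler01).
have h4 : 1 <= (C + normc z) ^+ 2 * (3 * (normc v1 ^+ 2 + (normc u0 ^+ 2 + normc u1 ^+ 2))).
  by apply: le_trans h3 _; rewrite ler_wpM2l // sqr_ge0.
move=> h5; have k0 := sqr_ge0 (C + normc z).
have := ler_wpM2l k0 h5; have := ler_wpM2l (ltW y0) h4.
rewrite mulr1; move: ((C + normc z) ^+ 2) (complex.Im z) (complex.Im u0) => k y i.
move: (normc v1 ^+ 2 + _) => S; lra.
Qed.

Lemma green_upper z M : inv_by (jacobi_shift a b z) M -> 0 < complex.Im z ->
  complex.Im z * normc (gmat z 0 0) <= 1.
Proof.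
move=> iM y0; have := gmat_im (s := [:: 0]) 0 iM isT y0.
rewrite big_seq1 => h.
have := le_trans h (le_trans (ler_norm _) (Im_le_normc _)).
have := normc_ge0 (gmat z 0 0); set n := normc _; rewrite le_eqVlt => /orP[/eqP <-|n0].
  by rewrite mulr0.
by rewrite -[leRHS]mul1r expr2 mulrA ler_pM2r.
Qed.

Lemma green_infinity z M : inv_by (jacobi_shift a b z) M -> 3 * C < normc z ->
  normc (z * gmat z 0 0 + 1) <= 3 * C / (normc z - 3 * C).
Proof.
move=> iM hz; have ul := l2_le_l2 (l2_le_gmat 0 iM).
have hu := l2_le_nrm ul; set N := nrm _ in hu.
have p : 0 < normc z - 3 * C by rewrite subr_gt0.
have hJ := (opb_jacobi aC bC).2 _ _ hu.
have Jd : (fun k => jacobi a b (gmat z ^~ 0) k - @delta R 0 k) = (fun k => z * gmat z k 0).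
  by apply/funext => k; rewrite (gmat_jacobi _ _ iM) /delta addrK.
have h1 : l2_le (fun k => z * gmat z k 0) ((C + C + C) * N + 1).
  by rewrite -Jd; apply: l2_leB => //; exact: l2_le_delta.
have C0 : 0 <= C by apply: le_trans (aC 0).
have z0 : 0 < normc z by apply: le_lt_trans hz; rewrite mulr_ge0.
have zn0 : z != 0 by apply/eqP => z00; move: z0; rewrite z00 normc0 ltxx.
have h2 : l2_le (gmat z ^~ 0) ((normc z)^-1 * ((C + C + C) * N + 1)).
  have := l2_leZ z^-1 h1; rewrite normcV; apply: l2_le_ext => k.
  by rewrite mulrA mulVf // mul1r.
have h3 : N <= (normc z)^-1 * ((C + C + C) * N + 1) := nrm_le h2.
have h4 : N * (normc z - 3 * C) <= 1.
  move: h3; rewrite mulrC ler_pdivlMr //; lra.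
have -> : z * gmat z 0 0 + 1 = jacobi a b (gmat z ^~ 0) 0.
  by rewrite (gmat_jacobi _ _ iM) eqxx.
apply: le_trans (l2_le_pt 0 hJ) _.
have -> : (C + C + C) * N = 3 * C * N by ring.
by rewrite ler_wpM2l ?mulr_ge0 // -[leRHS]mul1r ler_pdivlMr.
Qed.

End Green.

(** * Derivatives of Green's function in the spectral parameter and in time *)
Section SpectralDerivative.
Variable R : realType.
Variables (a b : int -> R) (C : R).
Hypothesis aC : forall n, `|a n| <= C.
Hypothesis bC : forall n, `|b n| <= C.
Implicit Types (z w : R[i]) (M : R).

Definition dgreen z : R[i] := resolvent a b z (resolvent a b z (@delta R 0)) 0.

Lemma green_zquad z w M : inv_by (jacobi_shift a b z) M -> normc (w - z) * M <= 2^-1 ->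
  [/\ normc (gmat a b w 0 0 - gmat a b z 0 0) <= 2 * M ^+ 2 * normc (w - z),
   normc (gmat a b w 0 0 - gmat a b z 0 0 - (w - z) * dgreen z)
     <= 2 * M ^+ 3 * normc (w - z) ^+ 2 &
   normc (dgreen w - dgreen z) <= 6 * M ^+ 3 * normc (w - z)].
Proof.
move=> iM hw; have iw := inv_by_shift aC bC iM hw.
have M0 : 0 <= M by case: iM.
have d0 := l2_delta R 0.
pose Rz := resolvent a b z; pose Rw := resolvent a b w.
have bz := l2_le_resolvent iM; have bw := l2_le_resolvent iw.
have id1 f : l2 f -> forall n, Rw f n - Rz f n = (w - z) * Rw (Rz f) n.
  by move=> fl n; exact: resolvent_id iw iM fl n.
have uB := bz _ _ (l2_le_delta R 0); rewrite mulr1 in uB.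
have ul := l2_le_l2 uB.
have diffB f B n : l2_le f B -> normc (Rw f n - Rz f n) <= normc (w - z) * (2 * M * (M * B)).
  move=> fB; rewrite id1 ?normcM; last exact: l2_le_l2 fB.
  by rewrite ler_wpM2l ?normc_ge0 //; apply: l2_le_pt; exact/bw/bz.
have e1 := id1 _ d0 0.
split.
- rewrite /gmat; apply: le_trans (diffB _ _ 0 (l2_le_delta R 0)) _.
  by rewrite expr2; lra.
- rewrite /gmat -/Rz -/Rw e1 /dgreen -/Rz -mulrBr normcM.
  apply: le_trans (ler_wpM2l (normc_ge0 _) (diffB _ _ 0 uB)) _.
  by rewrite !exprS expr0; lra.
- have -> : dgreen w - dgreen z = (w - z) * Rw (Rw (Rz (@delta R 0))) 0 +
     (Rw (Rz (@delta R 0)) 0 - Rz (Rz (@delta R 0)) 0).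
    rewrite /dgreen -/Rw -/Rz.
    have -> : Rw (@delta R 0) = fun k => (w - z) * Rw (Rz (@delta R 0)) k + Rz (@delta R 0) k.
      by apply/funext => k; rewrite -id1 // subrK.
    rewrite /Rw (resolvent_lin iw) //; last exact: resolvent_l2 iw _ ul.
    by ring.
  apply: le_trans (normcD _ _) _.
  have h1 : normc ((w - z) * Rw (Rw (Rz (@delta R 0))) 0) <=
      normc (w - z) * (2 * M * (2 * M * M)).
    by rewrite normcM ler_wpM2l ?normc_ge0 //; apply: l2_le_pt; exact/bw/bw.
  apply: le_trans (lerD h1 (diffB _ _ 0 uB)) _.
  by rewrite !exprS expr0; lra.
Qed.

(** On the real axis the derivative is the squared norm of the column. *)
Lemma dgreen_gt0 (x : R) M : inv_by (jacobi_shift a b x%:C%C) M ->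
  0 < complex.Re (dgreen x%:C%C).
Proof.
move=> iM.
pose u := gmat a b x%:C%C ^~ 0; pose v := resolvent a b x%:C%C u.
have uB : l2_le u M := l2_le_gmat 0 iM.
have vB := l2_le_resolvent iM uB.
have [n un] : exists n, u n != 0.
  apply: contrapT => h; have := gmat_eq 0 0 iM.
  have z k : gmat a b x%:C%C k 0 = 0.
    by apply: contrapT => /eqP hk; apply: h; exists k.
  by rewrite eqxx !z !mulr0 subr0 !addr0 => /esym/eqP; rewrite oner_eq0.
have n0 : 0 < normc (u n) ^+ 2.
  rewrite exprn_gt0 // lt_neqAle normc_ge0 andbT eq_sym.
  by apply: contraNneq un => /eq0_normc ->.
suff : normc (u n) ^+ 2 <= complex.Re (dgreen x%:C%C) by exact: lt_le_trans.
apply/ler_addgt0Pr => e e0.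
have [N0 h] := green_formula b aC uB vB e0.
pose N := maxn N0 (absz n).
have S0 k : 0 <= normc (u k) ^+ 2 by exact: sqr_ge0.
have sn : {in [:: n], forall k : int, `|k| <= N%:Z}.
  by move=> k; rewrite inE => /eqP ->; rewrite /N; lia.
have := sum_uniq_le_win (s := [:: n]) S0 isT sn; rewrite big_seq1 => h1.
apply: le_trans h1 _.
have := h N; rewrite leq_maxl => /(_ isT) /(le_trans (Re_le_normc _)).
rewrite raddf_sum /=.
under eq_bigr => k _.
  rewrite (gmat_jacobi _ _ iM).
  have -> : jacobi a b v k = x%:C%C * v k + u k.
    by move/funeqP: (resolventK iM (l2_le_l2 uB)) => /(_ k) <-; rewrite /jacobi_shift -/v; ring.
  rewrite (_ : complex.Re _ = (if k == 0 then complex.Re (v k) else 0) - normc (u k) ^+ 2).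
    over.
  rewrite normc_sqE /u.
  rewrite (_ : resolvent a b x%:C%C (gmat a b x%:C%C ^~ 0) k = v k) //.
  have := gmat_real k 0 iM; move: (v k) (gmat _ _ _ k 0) => [p' q'] [p q] /= ->.
  by case: (k == 0) => /=; ring.
rewrite big_split /= sumrN sum_win_delta; last by lia.
rewrite ler_norml => /andP[h2 _]; rewrite -/(dgreen _) in h2.
have -> : dgreen x%:C%C = v 0 by [].
lra.
Unshelve. all: exact: R. Qed.

End SpectralDerivative.

Section QuadraticDerivative.
Variable R : realType.

Lemma is_derive_quad (f : R -> R) x d K e : 0 < e ->
  (forall h, `|h| <= e -> `|f (x + h) - f x - h * d| <= K * h ^+ 2) -> is_derive x 1 f d.
Proof.
move=> e0 H.
have K0 : 0 <= K.
  have := H e; rewrite ger0_norm ?(ltW e0) // lexx => /(_ isT) /(le_trans (normr_ge0 _)).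
  by rewrite pmulr_lge0 // exprn_gt0.
have c : h^-1 *: (f (h *: (1 : R^o) + x) - f x) @[h --> (0:R)^'] --> d.
  apply/cvgrPdist_le => eps eps0; near=> h.
  have h0 : h != 0 by near: h; exact: nbhs_dnbhs_neq.
  have he : `|h| <= e.
    near: h; apply: dnbhs0_le; exact: e0.
  have hK : `|h| <= eps / (K + 1).
    near: h; apply: dnbhs0_le; by rewrite divr_gt0 // ltr_wpDl.
  rewrite /GRing.scale /= mulr1 (addrC h).
  have -> : d - h^-1 * (f (x + h) - f x) = - (h^-1 * (f (x + h) - f x - h * d)).
    by field.
  rewrite normrN normrM normfV ler_pdivrMl ?normr_gt0 //.
  apply: le_trans (H h he) _; rewrite -(real_normK (num_real h)) expr2 mulrA mulrC.
  rewrite ler_wpM2l //.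
  apply: le_trans (ler_wpM2l K0 hK) _.
  by rewrite mulrCA ler_piMr ?(ltW eps0) // ler_pdivrMr ?mul1r ?lerDl // ltr_wpDl.
split; first by apply/cvg_ex; exists d.
by apply/cvg_lim.
Unshelve. all: by end_near. Qed.

Definition cder (f : R -> R[i]) (t : R) (d : R[i]) :=
  is_derive t 1 (fun s => complex.Re (f s)) (complex.Re d) /\
  is_derive t 1 (fun s => complex.Im (f s)) (complex.Im d).

Lemma cder_quad (f : R -> R[i]) t d K e : 0 < e ->
  (forall h, `|h| <= e -> normc (f (t + h) - f t - h%:C%C * d) <= K * h ^+ 2) -> cder f t d.
Proof.
move=> e0 H; split; apply: (is_derive_quad (K := K) e0) => h /H.
- move/(le_trans (Re_le_normc _)).
  move: d (f _) (f _) {H} => [r s] [p q] [p' q'] /=; by rewrite mul0r subr0.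
- move/(le_trans (Im_le_normc _)).
  move: d (f _) (f _) {H} => [r s] [p q] [p' q'] /=; by rewrite mul0r addr0.
Qed.

Lemma cder_eq f t d d' : cder f t d -> d = d' -> cder f t d'.
Proof. by move=> h <-. Qed.

Lemma cderD f g t d e : cder f t d -> cder g t e -> cder (fun s => f s + g s) t (d + e).
Proof.
move=> [f1 f2] [g1 g2]; split.
- have -> : (fun s => complex.Re (f s + g s)) =
    (fun s => complex.Re (f s)) \+ (fun s => complex.Re (g s)).
    by apply/funext => s /=; case: (f s) (g s) => ? ? [].
  by apply: is_derive_eq; case: d f1 f2 => ? ? ? ?; case: e g1 g2.
- have -> : (fun s => complex.Im (f s + g s)) =
    (fun s => complex.Im (f s)) \+ (fun s => complex.Im (g s)).
    by apply/funext => s /=; case: (f s) (g s) => ? ? [].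
  by apply: is_derive_eq; case: d f1 f2 => ? ? ? ?; case: e g1 g2.
Qed.

Lemma cderMr (r : R -> R) (r' : R) (f : R -> R[i]) (t : R) d : is_derive t 1 r r' -> cder f t d ->
  cder (fun s => (r s)%:C%C * f s) t (r'%:C%C * f t + (r t)%:C%C * d).
Proof.
move=> hr [f1 f2]; split.
- have -> : (fun s => complex.Re ((r s)%:C%C * f s)) = r * (fun s => complex.Re (f s)).
    by apply/funext => s; rewrite fctE /=; case: (f s) => ? ? /=; rewrite mul0r subr0.
  apply: is_derive_eq; rewrite /GRing.scale /=.
  by case: d f1 f2 => ? ? _ _; case: (f t) => ? ? /=; ring.
- have -> : (fun s => complex.Im ((r s)%:C%C * f s)) = r * (fun s => complex.Im (f s)).
    by apply/funext => s; rewrite fctE /=; case: (f s) => ? ? /=; rewrite mul0r addr0.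
  apply: is_derive_eq; rewrite /GRing.scale /=.
  by case: d f1 f2 => ? ? _ _; case: (f t) => ? ? /=; ring.
Qed.

Lemma cderN f t d : cder f t d -> cder (fun s => - f s) t (- d).
Proof.
move=> [f1 f2]; split.
- have -> : (fun s => complex.Re (- f s)) = - (fun s => complex.Re (f s)).
    by apply/funext => s; rewrite fctE /=; case: (f s).
  by apply: is_derive_eq; case: d f1 f2.
- have -> : (fun s => complex.Im (- f s)) = - (fun s => complex.Im (f s)).
    by apply/funext => s; rewrite fctE /=; case: (f s).
  by apply: is_derive_eq; case: d f1 f2.
Qed.

End QuadraticDerivative.

Section TimeDerivative.
Variable R : realType.
Variables (a b : R -> int -> R).
Hypothesis sol : toda_solution a b.
Implicit Types (z : R[i]).

Definition res_all z := forall T : R, exists M,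
  forall t, `|t| <= T -> inv_by (jacobi_shift (a t) (b t) z) M.

Definition gt z t m n : R[i] := gmat (a t) (b t) z m n.

Definition gdot z t m n : R[i] :=
  (a t m)%:C%C * gt z t (m + 1) n - (a t (m - 1))%:C%C * gt z t (m - 1) n
  - (a t (n - 1))%:C%C * gt z t m (n - 1) + (a t n)%:C%C * gt z t m (n + 1).

Lemma lax_P_delta (c : int -> R) n :
  lax_P c (@delta R n) = fun k => (c (n - 1))%:C%C * @delta R (n - 1) k
    - (c n)%:C%C * @delta R (n + 1) k.
Proof.
apply/funext => k; rewrite /lax_P /delta.
have -> : (k + 1 == n) = (k == n - 1) by apply/idP/idP; lia.
have -> : (k - 1 == n) = (k == n + 1) by apply/idP/idP; lia.
have [->|h1] := eqVneq k (n - 1); first last.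
  by have [->|h2] := eqVneq k (n + 1); rewrite ?mulr0 // addrK.
have -> : (n - 1 == n + 1) = false by apply/negP => h; lia.
by rewrite !mulr0.
Qed.

(** From G(t + d) - G(t) = - G(t + d) (J(t + d) - J(t)) G(t) and the Lax equation J' = [P, J]:
    since (J - z) G = 1, the derivative - G [P, J] G is P G - G P. *)
Lemma gt_cder z t m n : res_all z -> cder (fun s => gt z s m n) t (gdot z t m n).
Proof.
move=> hz; pose T := `|t| + 1.
have [M hM] := hz T; have [c1 [c10 hc]] := toda_quad sol T.
have [C [C1 hC]] := toda_bound sol T.
have tT : `|t| <= T by rewrite /T lerDl.
have iM := hM t tT; have M0 : 0 <= M by case: iM.
pose K := M * (3 * c1) * M * (3 * c1) * M + M * (3 * c1) * M.
apply: (cder_quad (K := K) (ltr01)) => h h1.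
have sT : `|t + h| <= T by apply: le_trans (ler_normD _ _) _; rewrite /T lerD2l.
have iS := hM _ sT.
have {}hc := hc _ _ tT sT.
have hh : t + h - t = h by rewrite addrAC subrr add0r.
rewrite hh in hc.
pose Rt := resolvent (a t) (b t) z; pose Rs := resolvent (a (t + h)) (b (t + h)) z.
pose da k := a (t + h) k - a t k; pose db k := b (t + h) k - b t k.
pose D := jacobi da db.
have oD : opb D (3 * c1 * `|h|).
  have := @opb_jacobi R da db (c1 * `|h|); rewrite (_ : _ + _ + _ = 3 * c1 * `|h|); last by ring.
  by apply => k; case: (hc k).
have id1 f : l2 f -> forall k, Rs f k - Rt f k = - Rs (D (Rt f)) k.
  move=> fl k.
  have tl := resolvent_l2 iM fl.
  have Dl := opb_l2 oD tl.
  suff -> : Rs f = fun k => (-1) * Rs (D (Rt f)) k + Rt f k by rewrite mulN1r addrK.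
  apply: (resolvent_uniq iS) => //.
    by apply: l2D => //; apply/l2Z/(resolvent_l2 iS).
  rewrite linop_jacobi_shift (resolventK iS) //.
  apply/funext => j; move/funeqP: (resolventK iM fl) => /(_ j) <-.
  rewrite /jacobi_shift -/Rt /D /da /db jacobi_sub; ring.
pose v := Rt (@delta R n).
have vB : l2_le v M by have := l2_le_resolvent iM (l2_le_delta R n); rewrite mulr1.
have vl := l2_le_l2 vB.
pose J1 := jacobi (toda_da (a t) (b t)) (toda_db (a t)).
pose D2 := jacobi (fun k => da k - h * toda_da (a t) (b t) k) (fun k => db k - h * toda_db (a t) k).
have oD2 : opb D2 (3 * c1 * `|h| ^+ 2).
  have := @opb_jacobi R (fun k => da k - h * toda_da (a t) (b t) k)
    (fun k => db k - h * toda_db (a t) k) (c1 * `|h| ^+ 2).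
  rewrite (_ : _ + _ + _ = 3 * c1 * `|h| ^+ 2); last by ring.
  by apply => k; case: (hc k).
have DE f k : D f k = h%:C%C * J1 f k + D2 f k.
  rewrite /D /J1 /D2 /jacobi !(rmorphB, rmorphM) /=; ring.
have J1v k : J1 v k = lax_P (a t) (@delta R n) k - jacobi_shift (a t) (b t) z (lax_P (a t) v) k.
  rewrite /J1 lax_commutator /jacobi_shift.
  have -> : jacobi (a t) (b t) v = fun k => z * v k + @delta R n k.
    have vE : jacobi_shift (a t) (b t) z v = @delta R n := resolventK iM (l2_delta R n).
    by rewrite -vE; apply/funext => j; rewrite /jacobi_shift; ring.
  by rewrite linop_lax_P; ring.
have aC k : `|a t k| <= C by case: (hC t k tT).
have Pl := opb_l2 (opb_lax_P aC) vl.
have Pdl := opb_l2 (opb_lax_P aC) (l2_delta R n).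
have J1vl : l2 (J1 v).
  have -> : J1 v = fun k => lax_P (a t) (@delta R n) k - jacobi_shift (a t) (b t) z (lax_P (a t) v) k.
    exact/funext.
  apply: l2B => //.
  have bC k : `|b t k| <= C by case: (hC t k tT).
  exact: opb_l2 (opb_jacobi_shift z aC bC) Pl.
have RJ1 : Rt (J1 v) m = - gdot z t m n.
  have -> : J1 v = fun k => lax_P (a t) (@delta R n) k - jacobi_shift (a t) (b t) z (lax_P (a t) v) k.
    exact/funext.
  rewrite /Rt (resolventB iM) //; last first.
    have bC k : `|b t k| <= C by case: (hC t k tT).
    exact: opb_l2 (opb_jacobi_shift z aC bC) Pl.
  have -> : resolvent (a t) (b t) z (jacobi_shift (a t) (b t) z (lax_P (a t) v)) = lax_P (a t) v.
    apply: (resolvent_uniq iM) => //.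
    have bC k : `|b t k| <= C by case: (hC t k tT).
    exact: opb_l2 (opb_jacobi_shift z aC bC) Pl.
  rewrite lax_P_delta (resolventB iM); [|exact/l2Z/l2_delta|exact/l2Z/l2_delta].
  rewrite !(resolventZ iM); [|exact/l2_delta|exact/l2_delta].
  rewrite /gdot /gt /gmat /lax_P /v /Rt; ring.
have DvB := oD.2 _ _ vB.
have Dvl := l2_le_l2 DvB.
have -> : gt z (t + h) m n - gt z t m n - h%:C%C * gdot z t m n =
    - (Rs (D v) m - Rt (D v) m) - Rt (D2 v) m.
  have -> : gt z (t + h) m n - gt z t m n = - Rs (D v) m.
    by rewrite /gt /gmat; exact: id1 (l2_delta R n) m.
  have -> : Rt (D v) m = h%:C%C * Rt (J1 v) m + Rt (D2 v) m.
    have -> : D v = fun k => h%:C%C * J1 v k + D2 v k by apply/funext => k; rewrite DE.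
    by rewrite /Rt (resolvent_lin iM) //; exact: l2_le_l2 (oD2.2 _ _ vB).
  by rewrite RJ1; ring.
apply: le_trans (normcB _ _) _; rewrite normcN /K mulrDl; apply: lerD.
- rewrite id1 // normcN.
  have := l2_le_pt m (l2_le_resolvent iS (oD.2 _ _ (l2_le_resolvent iM DvB))).
  move/le_trans; apply; rewrite -(real_normK (num_real h)) expr2.
  by rewrite le_eqVlt; apply/orP; left; apply/eqP; ring.
- have := l2_le_pt m (l2_le_resolvent iM (oD2.2 _ _ vB)).
  move/le_trans; apply; rewrite -(real_normK (num_real h)).
  by rewrite le_eqVlt; apply/orP; left; apply/eqP; ring.
Qed.

(** The quantities g, h, q, q_- built from the Green matrix next to the origin.  They obey a
    closed linear system whose coefficients are regular in z, so that the system survives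
    the limit in which z tends to the spectrum. *)
Definition gf z t := gt z t 0 0.
Definition hf z t := (a t 0)%:C%C * gt z t 1 0 - (a t (-1))%:C%C * gt z t (-1) 0.
Definition qf z t := ((a t 0) ^+ 2)%:C%C * gt z t 1 1.
Definition qmf z t := ((a t (-1)) ^+ 2)%:C%C * gt z t (-1) (-1).
Definition cf z t : R[i] := (b t 0)%:C%C - z.
Definition kf t : R := 2 * (a t 0 ^+ 2 + a t (-1) ^+ 2).

Section AtZ.
Variable (z : R[i]).
Hypothesis hz : res_all z.

Lemma res_all_at t : exists M, inv_by (jacobi_shift (a t) (b t) z) M.
Proof. by have [M hM] := hz `|t|; exists M; exact: hM. Qed.

Lemma coef_bound t : exists C, forall n, `|a t n| <= C.
Proof.
by have [C [_ hC]] := toda_bound sol `|t|; exists C => n; case: (hC t n (lexx _)).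
Qed.

Lemma gt_sym t m n : gt z t m n = gt z t n m.
Proof.
by have [M iM] := res_all_at t; have [C aC] := coef_bound t; rewrite /gt; exact: (gmat_sym aC m n iM).
Qed.

Lemma gt_eq t m n : (a t m)%:C%C * gt z t (m + 1) n + (b t m)%:C%C * gt z t m n
  + (a t (m - 1))%:C%C * gt z t (m - 1) n - z * gt z t m n = (m == n)%:R.
Proof. by have [M iM] := res_all_at t; exact: gmat_eq iM. Qed.

Lemma gt_wronskian t m : (a t m)%:C%C * (gt z t (m + 1) m ^+ 2 - gt z t m m * gt z t (m + 1) (m + 1))
  = gt z t (m + 1) m.
Proof.
by have [M iM] := res_all_at t; have [C aC] := coef_bound t; rewrite /gt; exact: (gmat_wronskian aC m iM).
Qed.

Lemma sum_AB t : (a t 0)%:C%C * gt z t 1 0 + (a t (-1))%:C%C * gt z t (-1) 0 = 1 - cf z t * gf z t.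
Proof.
have E : (a t 0)%:C%C * gt z t 1 0 + (b t 0)%:C%C * gt z t 0 0
  + (a t (-1))%:C%C * gt z t (-1) 0 - z * gt z t 0 0 = 1 := gt_eq t 0 0.
by rewrite -E /cf /gf; ring.
Qed.

(** Since A + B = 1 - c g and A - B = h, the square is (2 A - 1)^2, where A = a_0 G_10;
    the Wronskian identity reads A^2 - A = g q. *)
Lemma gq_id t : 4 * gf z t * qf z t = (hf z t - cf z t * gf z t) ^+ 2 - 1.
Proof.
have -> : hf z t - cf z t * gf z t = 2 * (a t 0)%:C%C * gt z t 1 0 - 1.
  have := sum_AB t; rewrite /hf => E.
  rewrite -[cf z t * _](subKr 1) -E; ring.
have := gt_wronskian t 0; rewrite add0r => E.
rewrite /gf /qf rmorphXn /= .
have -> : (2 * (a t 0)%:C%C * gt z t 1 0 - 1) ^+ 2 - 1 =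
  4 * (a t 0)%:C%C * ((a t 0)%:C%C * gt z t 1 0 ^+ 2 - gt z t 1 0) by ring.
rewrite -[X in _ - X]E; ring.
Qed.

Lemma gqm_id t : 4 * gf z t * qmf z t = (hf z t + cf z t * gf z t) ^+ 2 - 1.
Proof.
have -> : hf z t + cf z t * gf z t = 1 - 2 * (a t (-1))%:C%C * gt z t (-1) 0.
  have := sum_AB t; rewrite /hf => E.
  rewrite -[cf z t * _](subKr 1) -E; ring.
have := gt_wronskian t (-1); rewrite addNr (gt_sym _ 0 (-1)) => E.
rewrite /gf /qmf rmorphXn /= .
have -> : (1 - 2 * (a t (-1))%:C%C * gt z t (-1) 0) ^+ 2 - 1 =
  4 * (a t (-1))%:C%C * ((a t (-1))%:C%C * gt z t (-1) 0 ^+ 2 - gt z t (-1) 0) by ring.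
rewrite -[X in _ - X]E; ring.
Qed.

Lemma two_X t : (a t 0)%:C%C * ((a t (-1))%:C%C * gt z t 1 (-1)) =
   - (cf z t * ((a t 0)%:C%C * gt z t 1 0)) - qf z t.
Proof.
have := gt_eq t 0 1; rewrite add0r sub0r /= => E.
have {}E : (a t (-1))%:C%C * gt z t (-1) 1 = - (cf z t * gt z t 0 1) - (a t 0)%:C%C * gt z t 1 1.
  apply/eqP; rewrite -subr_eq0; apply/eqP; rewrite -[RHS]E /cf; ring.
by rewrite (gt_sym _ 1 (-1)) E (gt_sym _ 0 1) /qf rmorphXn /=; ring.
Qed.

Lemma two_Xm t : (a t 0)%:C%C * ((a t (-1))%:C%C * gt z t 1 (-1)) =
   - (cf z t * ((a t (-1))%:C%C * gt z t (-1) 0)) - qmf z t.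
Proof.
have := gt_eq t 0 (-1); rewrite add0r sub0r /= => E.
have {}E : (a t 0)%:C%C * gt z t 1 (-1) = - (cf z t * gt z t 0 (-1)) - (a t (-1))%:C%C * gt z t (-1) (-1).
  apply/eqP; rewrite -subr_eq0; apply/eqP; rewrite -[RHS]E /cf; ring.
by rewrite mulrCA E (gt_sym _ 0 (-1)) /qmf rmorphXn /=; ring.
Qed.

Lemma hc_id t : hf z t * cf z t = qmf z t - qf z t.
Proof.
have := two_X t; rewrite two_Xm => /eqP; rewrite subr_eq => /eqP E.
have -> : qmf z t = - (cf z t * ((a t (-1))%:C%C * gt z t (-1) 0)) -
   (- (cf z t * ((a t 0)%:C%C * gt z t 1 0)) - qf z t).
  have := E; move=> /eqP; rewrite -subr_eq0 => /eqP E2.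
  apply/eqP; rewrite -subr_eq0; apply/eqP; rewrite -[RHS]oppr0 -E2; ring.
rewrite /hf; ring.
Qed.

Lemma gf_cder t : cder (gf z) t (2 * hf z t).
Proof.
apply: cder_eq (gt_cder t 0 0 hz) _.
rewrite /gdot /hf add0r sub0r (gt_sym t 0 (-1)) (gt_sym t 0 1); ring.
Qed.

Lemma qf_cder t : cder (qf z) t (- (2 * cf z t * qf z t) +
  2 * ((a t 0) ^+ 2)%:C%C * (- hf z t + cf z t * gf z t)).
Proof.
have d1 := toda_da_derive sol t 0.
have d2 : is_derive t 1 (fun s => a s 0 ^+ 2) (2 * a t 0 * toda_da (a t) (b t) 0).
  by apply: is_derive_eq; rewrite /GRing.scale /=; ring.
apply: cder_eq (cderMr d2 (gt_cder t 1 1 hz)) _.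
have E := sum_AB t.
have E1 : (a t 1)%:C%C * gt z t 2 1 + (b t 1)%:C%C * gt z t 1 1
  + (a t 0)%:C%C * gt z t 0 1 - z * gt z t 1 1 = 1 := gt_eq t 1 1.
have -> : gdot z t 1 1 = (a t 1)%:C%C * gt z t 2 1 - (a t 0)%:C%C * gt z t 0 1
  - (a t 0)%:C%C * gt z t 1 0 + (a t 1)%:C%C * gt z t 1 2 by [].
rewrite (gt_sym t 1 2) (gt_sym t 0 1) in E1 *.
have F : (a t 1)%:C%C * gt z t 2 1 = 1 - ((b t 1)%:C%C - z) * gt z t 1 1
    - (a t 0)%:C%C * gt z t 1 0.
  by rewrite -[1 in RHS]E1; ring.
have -> : - hf z t + cf z t * gf z t = 1 - 2 * ((a t 0)%:C%C * gt z t 1 0).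
  rewrite /hf -[cf z t * _](subKr 1) -E; ring.
have -> : (toda_da (a t) (b t) 0) = a t 0 * (b t 1 - b t 0) by [].
rewrite F /qf /cf !(rmorphM, rmorphB, rmorphXn) (rmorph_nat (real_complex R)) /=; ring.
Qed.

Lemma qmf_cder t : cder (qmf z) t (2 * cf z t * qmf z t -
  2 * ((a t (-1)) ^+ 2)%:C%C * (hf z t + cf z t * gf z t)).
Proof.
have d1 := toda_da_derive sol t (-1).
have d2 : is_derive t 1 (fun s => a s (-1) ^+ 2) (2 * a t (-1) * toda_da (a t) (b t) (-1)).
  by apply: is_derive_eq; rewrite /GRing.scale /=; ring.
apply: cder_eq (cderMr d2 (gt_cder t (-1) (-1) hz)) _.
have E := sum_AB t.
have E1 : (a t (-1))%:C%C * gt z t 0 (-1) + (b t (-1))%:C%C * gt z t (-1) (-1)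
  + (a t (-2))%:C%C * gt z t (-2) (-1) - z * gt z t (-1) (-1) = 1 := gt_eq t (-1) (-1).
have -> : gdot z t (-1) (-1) = (a t (-1))%:C%C * gt z t 0 (-1) - (a t (-2))%:C%C * gt z t (-2) (-1)
  - (a t (-2))%:C%C * gt z t (-1) (-2) + (a t (-1))%:C%C * gt z t (-1) 0 by [].
rewrite (gt_sym t (-1) (-2)) (gt_sym t 0 (-1)) in E1 *.
have F : (a t (-2))%:C%C * gt z t (-2) (-1) = 1 - ((b t (-1))%:C%C - z) * gt z t (-1) (-1)
    - (a t (-1))%:C%C * gt z t (-1) 0.
  by rewrite -[1 in RHS]E1; ring.
have -> : hf z t + cf z t * gf z t = 1 - 2 * ((a t (-1))%:C%C * gt z t (-1) 0).
  rewrite /hf -[cf z t * _](subKr 1) -E; ring.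
have -> : (toda_da (a t) (b t) (-1)) = a t (-1) * (b t 0 - b t (-1)) by [].
rewrite F /qmf /cf !(rmorphM, rmorphB, rmorphXn) (rmorph_nat (real_complex R)) /=; ring.
Qed.

Lemma hf_cder t : cder (hf z) t (2 * qf z t + 2 * qmf z t - (kf t)%:C%C * gf z t).
Proof.
have c1 := cderMr (toda_da_derive sol t 0) (gt_cder t 1 0 hz).
have c2 := cderMr (toda_da_derive sol t (-1)) (gt_cder t (-1) 0 hz).
apply: cder_eq (cderD c1 (cderN c2)) _.
have E1 : (a t 1)%:C%C * gt z t 2 0 + (b t 1)%:C%C * gt z t 1 0
  + (a t 0)%:C%C * gt z t 0 0 - z * gt z t 1 0 = 0 := gt_eq t 1 0.
have E2 : (a t (-1))%:C%C * gt z t 0 0 + (b t (-1))%:C%C * gt z t (-1) 0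
  + (a t (-2))%:C%C * gt z t (-2) 0 - z * gt z t (-1) 0 = 0 := gt_eq t (-1) 0.
have X1 := two_X t; have X2 := two_Xm t.
have F1 : (a t 1)%:C%C * gt z t 2 0 = - ((b t 1)%:C%C - z) * gt z t 1 0 - (a t 0)%:C%C * gf z t.
  apply/eqP; rewrite -subr_eq0; apply/eqP; rewrite -[RHS]E1 /gf; ring.
have F2 : (a t (-2))%:C%C * gt z t (-2) 0 = - ((b t (-1))%:C%C - z) * gt z t (-1) 0 - (a t (-1))%:C%C * gf z t.
  apply/eqP; rewrite -subr_eq0; apply/eqP; rewrite -[RHS]E2 /gf; ring.
have -> : gdot z t 1 0 = (a t 1)%:C%C * gt z t 2 0 - (a t 0)%:C%C * gt z t 0 0
  - (a t (-1))%:C%C * gt z t 1 (-1) + (a t 0)%:C%C * gt z t 1 1 by [].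
have -> : gdot z t (-1) 0 = (a t (-1))%:C%C * gt z t 0 0 - (a t (-2))%:C%C * gt z t (-2) 0
  - (a t (-1))%:C%C * gt z t (-1) (-1) + (a t 0)%:C%C * gt z t (-1) 1 by [].
have -> : toda_da (a t) (b t) 0 = a t 0 * (b t 1 - b t 0) by [].
have -> : toda_da (a t) (b t) (-1) = a t (-1) * (b t 0 - b t (-1)) by [].
rewrite F1 F2 (gt_sym t (-1) 1).
have G1 : 2 * qf z t + 2 * qmf z t = qf z t + qmf z t - cf z t * ((a t 0)%:C%C * gt z t 1 0)
   - cf z t * ((a t (-1))%:C%C * gt z t (-1) 0)
   - 2 * ((a t 0)%:C%C * ((a t (-1))%:C%C * gt z t 1 (-1))).
  have -> : 2 * ((a t 0)%:C%C * ((a t (-1))%:C%C * gt z t 1 (-1))) =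
      (- (cf z t * ((a t 0)%:C%C * gt z t 1 0)) - qf z t) +
      (- (cf z t * ((a t (-1))%:C%C * gt z t (-1) 0)) - qmf z t).
    by rewrite -X1 -X2; ring.
  ring.
rewrite G1 /kf /cf /qf /qmf /gf.
have t2 : (2 : R)%:C%C = 2 :> R[i] by rewrite (rmorph_nat (real_complex R)).
have k2 (x y : R) : (2 * (x + y))%:C%C = 2 * (x%:C%C + y%:C%C) by rewrite -t2 -rmorphD -rmorphM.
rewrite k2 !(rmorphM, rmorphB, rmorphXn) /=; ring.
Qed.

End AtZ.
End TimeDerivative.

(** * Persistence of the reflectionless condition *)
Section Gronwall.
Variable R : realType.

Lemma gronwall (f df : R -> R) K T t : (forall s : R, is_derive s 1 f (df s)) ->
  (forall s, `|s| <= T -> `|df s| <= K * f s) -> `|t| <= T ->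
  f t <= f 0 * expR (K * `|t|).
Proof.
have main (g dg : R -> R) u : 0 <= u -> u <= T -> (forall s : R, is_derive s 1 g (dg s)) ->
    (forall s, `|s| <= T -> `|dg s| <= K * g s) -> g u <= g 0 * expR (K * u).
  move=> u0 uT gd H.
  pose k s := g s * expR (- K * s).
  have kd (s : R) : is_derive s 1 k ((dg s - K * g s) * expR (- K * s)).
    have d1 := gd s.
    have d2 : is_derive s 1 (fun s : R => - K * s) (- K).
      by apply: is_derive_eq; rewrite /GRing.scale /= mulr1.
    have d3 : is_derive s 1 (fun s : R => expR (- K * s)) (- K * expR (- K * s)).
      have := @is_derive1_comp R expR (fun s : R => - K * s) s _ _ (is_derive_expR _) d2.
      by rewrite mulrC.
    by apply: is_derive_eq; rewrite /GRing.scale /=; ring.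
  have cf : {within `[0, u], continuous k}.
    by apply: continuous_subspaceT; exact: (is_derive_continuous kd).
  have [c] := @MVT_segment R k _ _ _ u0 (fun s _ => kd s) cf.
  rewrite in_itv /= => /andP[c0 cu] E.
  have : k u - k 0 <= 0.
    rewrite E mulr_le0_ge0 ?subr0 // mulr_le0_ge0 ?expR_ge0 // subr_le0.
    by apply: le_trans (ler_norm _) (H c _); rewrite ger0_norm // (le_trans cu).
  rewrite /k mulr0 expR0 mulr1 subr_le0 mulNr expRN => h.
  by rewrite -ler_pdivrMr ?expR_gt0.
move=> fd H tT; have [t0|t0] := leP 0 t.
  by rewrite ger0_norm // in tT *; exact: main t0 tT fd H.
rewrite ltr0_norm // in tT *.
have gd (s : R) : is_derive s 1 (fun s : R => f (- s)) (- df (- s)).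
  have d2 : is_derive s 1 (fun s : R => - s) (-1) by apply: is_derive_eq.
  have := @is_derive1_comp R f (fun s : R => - s) s _ _ (fd _) d2.
  by rewrite mulrN1.
have := main (fun s => f (- s)) (fun s => - df (- s)) (- t) _ tT gd.
rewrite opprK oppr0; apply; first by rewrite oppr_ge0 ltW.
by move=> s sT; rewrite normrN; apply: H; rewrite normrN.
Qed.

End Gronwall.

Section Persistence.
Variable R : realType.
Variables (a b : R -> int -> R).
Hypothesis sol : toda_solution a b.

Lemma Re_mul (z w : R[i]) : complex.Re (z * w) =
  complex.Re z * complex.Re w - complex.Im z * complex.Im w.
Proof. by case: z w => ? ? []. Qed.

Lemma Im_mul (z w : R[i]) : complex.Im (z * w) =
  complex.Re z * complex.Im w + complex.Im z * complex.Re w.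
Proof. by case: z w => ? ? []. Qed.

Lemma Re_add (z w : R[i]) : complex.Re (z + w) = complex.Re z + complex.Re w.
Proof. by case: z w => ? ? []. Qed.

Lemma Im_add (z w : R[i]) : complex.Im (z + w) = complex.Im z + complex.Im w.
Proof. by case: z w => ? ? []. Qed.

Lemma Re_opp (z : R[i]) : complex.Re (- z) = - complex.Re z. Proof. by case: z. Qed.

Lemma Im_opp (z : R[i]) : complex.Im (- z) = - complex.Im z. Proof. by case: z. Qed.

Lemma is_derive_sq (f : R -> R) (t d : R) : is_derive t 1 f d ->
  is_derive t 1 (fun s => f s ^+ 2) (2 * (f t * d)).
Proof. by move=> h; apply: is_derive_eq; rewrite /GRing.scale /=; ring. Qed.

Lemma is_derive_normc2 (f : R -> R[i]) (t : R) d : cder f t d ->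
  is_derive t 1 (fun s => normc (f s) ^+ 2)
    (2 * (complex.Re (f t) * complex.Re d + complex.Im (f t) * complex.Im d)).
Proof.
move=> [f1 f2].
have -> : (fun s => normc (f s) ^+ 2) =
    (fun s => complex.Re (f s) ^+ 2) \+ (fun s => complex.Im (f s) ^+ 2).
  by apply/funext => s; rewrite normc_sqE.
by rewrite mulrDr; apply: is_deriveD; exact: is_derive_sq.
Qed.

Lemma re_conj_le (z w : R[i]) :
  `|2 * (complex.Re z * complex.Re w + complex.Im z * complex.Im w)| <= 2 * (normc z * normc w).
Proof.
rewrite normrM ger0_norm // ler_pM2l //.
have -> : complex.Re z * complex.Re w + complex.Im z * complex.Im w = complex.Re (z * w^*%C).
  by case: z w => ? ? [] ? ? /=; ring.
apply: le_trans (Re_le_normc _) _; rewrite normcM.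
by rewrite ler_wpM2l ?normc_ge0 //; case: w => p q /=; rewrite sqrrN.
Qed.

Definition energy z t := normc (gf a b z t) ^+ 2 + normc (hf a b z t) ^+ 2 +
  normc (qf a b z t) ^+ 2 + normc (qmf a b z t) ^+ 2.

Definition re_energy z t := complex.Re (gf a b z t) ^+ 2 + complex.Re (hf a b z t) ^+ 2 +
  complex.Re (qf a b z t) ^+ 2 + complex.Re (qmf a b z t) ^+ 2.

Lemma energy_ge0 z t : 0 <= energy z t.
Proof. by rewrite /energy !addr_ge0 // sqr_ge0. Qed.

Lemma re_energy_ge0 z t : 0 <= re_energy z t.
Proof. by rewrite /re_energy !addr_ge0 // sqr_ge0. Qed.

Lemma sq_sum4 (x y u v : R) : (x + y + u + v) ^+ 2 <= 4 * (x ^+ 2 + y ^+ 2 + u ^+ 2 + v ^+ 2).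
Proof.
rewrite -subr_ge0.
have -> : 4 * (x ^+ 2 + y ^+ 2 + u ^+ 2 + v ^+ 2) - (x + y + u + v) ^+ 2 =
  (x - y) ^+ 2 + (x - u) ^+ 2 + (x - v) ^+ 2 + (y - u) ^+ 2 + (y - v) ^+ 2 + (u - v) ^+ 2 by ring.
by rewrite !addr_ge0 // sqr_ge0.
Qed.

Lemma normc_nat (n : nat) : normc (n%:R : R[i]) = n%:R.
Proof. by rewrite -(rmorph_nat (real_complex R)) normc_real normr_nat. Qed.

Lemma system_coef_bound (x y g E D F : R) : 0 <= D -> 0 <= F -> 0 <= x -> 0 <= y ->
  0 <= g -> 0 <= E ->
  2 * (F * x + E) + 2 * (D * (y + (F * g + E))) <=
  (4 * D + 2 * F + 2 * D * (1 + F) + 2) * (g + y + x + E).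
Proof.
move=> D0 F0 x0 y0 g0 E0; rewrite -subr_ge0.
have -> : (4 * D + 2 * F + 2 * D * (1 + F) + 2) * (g + y + x + E) -
  (2 * (F * x + E) + 2 * (D * (y + (F * g + E)))) =
  (6 * D + 2 * F + 2) * g + (4 * D + 2 * F + 2 * (D * F) + 2) * y +
  (6 * D + 2 * (D * F) + 2) * x + (4 * D + 2 * F + 2 * (D * F)) * E by ring.
by rewrite !addr_ge0 // mulr_ge0 // ?addr_ge0 // ?mulr_ge0.
Qed.

Lemma energy_bound (T Z : R) : 0 <= Z -> exists K, 0 <= K /\
  forall z, res_all a b z -> normc z <= Z -> forall t, `|t| <= T ->
  energy z t <= energy z 0 * K.
Proof.
move=> Z0; have [C [C1 hC]] := toda_bound sol T.
have C0 : 0 <= C by apply: le_trans C1.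
pose L := 4 * C ^+ 2 + 2 * (C + Z) + 2 * C ^+ 2 * (1 + (C + Z)) + 2.
have C2 : 0 <= C ^+ 2 by exact: sqr_ge0.
have L0 : 0 <= L by rewrite /L !addr_ge0 // ?mulr_ge0 // ?addr_ge0 // ?mulr_ge0 ?addr_ge0.
exists (expR (8 * L * T)); split; first exact: expR_ge0.
move=> z hz zZ t tT; have T0 : 0 <= T by apply: le_trans tT.
pose dg s := 2 * hf a b z s.
pose dh s := 2 * qf a b z s + 2 * qmf a b z s - (kf a s)%:C%C * gf a b z s.
pose dq s := - (2 * cf b z s * qf a b z s) +
  2 * ((a s 0) ^+ 2)%:C%C * (- hf a b z s + cf b z s * gf a b z s).
pose dm s := 2 * cf b z s * qmf a b z s -
  2 * ((a s (-1)) ^+ 2)%:C%C * (hf a b z s + cf b z s * gf a b z s).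
have gd s : cder (gf a b z) s (dg s) by exact: gf_cder.
have hd s : cder (hf a b z) s (dh s) by exact: hf_cder.
have qd s : cder (qf a b z) s (dq s) by exact: qf_cder.
have md s : cder (qmf a b z) s (dm s) by exact: qmf_cder.
pose P (f d : R -> R[i]) s := 2 * (complex.Re (f s) * complex.Re (d s) + complex.Im (f s) * complex.Im (d s)).
have Ed (s : R) : is_derive s 1 (energy z) (P (gf a b z) dg s + P (hf a b z) dh s +
    P (qf a b z) dq s + P (qmf a b z) dm s).
  have d1 := is_derive_normc2 (gd s); have d2 := is_derive_normc2 (hd s).
  have d3 := is_derive_normc2 (qd s); have d4 := is_derive_normc2 (md s).
  by apply: is_deriveD.
have H s : `|s| <= T -> `|P (gf a b z) dg s + P (hf a b z) dh s +
    P (qf a b z) dq s + P (qmf a b z) dm s| <= 8 * L * energy z s.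
  move=> sT.
  have hb : normc (cf b z s) <= C + Z.
    apply: le_trans (normcB _ _) _; rewrite normc_real lerD //.
    by case: (hC s 0 sT).
  have ha' k : `|a s k ^+ 2| <= C ^+ 2.
    by rewrite normrX ler_pXn2r ?nnegrE //; case: (hC s k sT).
  have ha k : normc ((a s k ^+ 2)%:C%C) <= C ^+ 2 by rewrite normc_real.
  have hk : normc ((kf a s)%:C%C) <= 4 * C ^+ 2.
    rewrite normc_real /kf normrM normr_nat.
    have := ha' 0; have := ha' (-1).
    have := ler_normD (a s 0 ^+ 2) (a s (-1) ^+ 2); lra.
  pose ng := normc (gf a b z s); pose nh := normc (hf a b z s).
  pose nq := normc (qf a b z s); pose nm := normc (qmf a b z s).
  have g0 : 0 <= ng := normc_ge0 _; have h0 : 0 <= nh := normc_ge0 _.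
  have q0 : 0 <= nq := normc_ge0 _; have m0 : 0 <= nm := normc_ge0 _.
  pose N := ng + nh + nq + nm.
  have CZ : 0 <= C + Z by rewrite addr_ge0.
  have N2 (x : R[i]) : normc (2 * x) = 2 * normc x by rewrite normcM normc_nat.
  have cg : normc (cf b z s * gf a b z s) <= (C + Z) * ng by rewrite normcM ler_wpM2r.
  have P3 : 0 <= 2 * C ^+ 2 * (1 + (C + Z)) by rewrite !mulr_ge0 ?addr_ge0.
  have L2 : 2 <= L by rewrite /L; lra.
  have L4 : 4 * C ^+ 2 <= L by rewrite /L; lra.
  have b1 : normc (dg s) <= L * N.
    by rewrite N2 -/nh; apply: ler_pM => //; rewrite /N; lra.
  have b2 : normc (dh s) <= L * N.
    apply: le_trans (normcB _ _) _.
    apply: le_trans (lerD (normcD _ _) (lexx _)) _; rewrite !N2 -/nq -/nm (normcM (kf a s)%:C%C) -/ng.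
    have : normc (kf a s)%:C%C * ng <= L * ng by rewrite ler_wpM2r // (le_trans hk).
    have : 2 * nq <= L * nq by rewrite ler_wpM2r.
    have : 2 * nm <= L * nm by rewrite ler_wpM2r.
    have : 0 <= L * nh by rewrite mulr_ge0.
    by rewrite /N !mulrDr; lra.
  have b3 : normc (dq s) <= L * N.
    apply: le_trans (normcD _ _) _; rewrite normcN -2!mulrA !N2 (normcM (cf b z s)) (normcM (a s 0 ^+ 2)%:C%C (- _ + _)) -/nq.
    have e1 : normc (cf b z s) * nq <= (C + Z) * nq by rewrite ler_wpM2r.
    have e2 : normc (a s 0 ^+ 2)%:C%C * normc (- hf a b z s + cf b z s * gf a b z s) <=
       C ^+ 2 * (nh + (C + Z) * ng).
      apply: ler_pM; rewrite ?normc_ge0 //; apply: le_trans (normcD _ _) _.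
      by rewrite normcN lerD.
    have := system_coef_bound C2 CZ q0 h0 g0 (lexx 0); rewrite -/L !addr0.
    have : 0 <= L * nm by rewrite mulr_ge0.
    by rewrite /N !mulrDr; lra.
  have b4 : normc (dm s) <= L * N.
    apply: le_trans (normcB _ _) _; rewrite -2!mulrA !N2 (normcM (cf b z s)) (normcM (a s (-1) ^+ 2)%:C%C (_ + _)) -/nm.
    have e1 : normc (cf b z s) * nm <= (C + Z) * nm by rewrite ler_wpM2r.
    have e2 : normc (a s (-1) ^+ 2)%:C%C * normc (hf a b z s + cf b z s * gf a b z s) <=
       C ^+ 2 * (nh + (C + Z) * ng).
      apply: ler_pM; rewrite ?normc_ge0 //; apply: le_trans (normcD _ _) _.
      by rewrite lerD.
    have := system_coef_bound C2 CZ m0 h0 g0 (lexx 0); rewrite -/L !addr0.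
    have : 0 <= L * nq by rewrite mulr_ge0.
    by rewrite /N !mulrDr; lra.
  have Pb f d : normc (d s) <= L * N -> `|P f d s| <= 2 * (normc (f s) * (L * N)).
    move=> h; apply: le_trans (re_conj_le _ _) _.
    by rewrite ler_wpM2l // ler_wpM2l ?normc_ge0.
  apply: le_trans (ler_normD _ _) _.
  apply: le_trans (lerD (ler_normD _ _) (lexx _)) _.
  apply: le_trans (lerD (lerD (ler_normD _ _) (lexx _)) (lexx _)) _.
  apply: le_trans (lerD (lerD (lerD (Pb _ _ b1) (Pb _ _ b2)) (Pb _ _ b3)) (Pb _ _ b4)) _.
  rewrite -/ng -/nh -/nq -/nm.
  have -> : 2 * (ng * (L * N)) + 2 * (nh * (L * N)) + 2 * (nq * (L * N)) + 2 * (nm * (L * N)) =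
    2 * L * N ^+ 2 by rewrite /N; ring.
  have -> : 8 * L * energy z s = 2 * L * (4 * energy z s) by ring.
  by rewrite ler_wpM2l ?mulr_ge0 //; exact: sq_sum4.
apply: le_trans (gronwall Ed H tT) _.
by rewrite ler_wpM2l ?energy_ge0 // ler_expR ler_wpM2l // mulr_ge0.
Qed.

(** Along the vertical line above x the real parts obey the system of the
    real point x up to an error of order Im z. *)
Lemma re_energy_bound (T Z : R) : 0 <= Z -> exists K, 0 <= K /\
  forall z, res_all a b z -> normc z <= Z -> forall t, `|t| <= T ->
  re_energy z t <= (re_energy z 0 + complex.Im z ^+ 2 * energy z 0) * K.
Proof.
move=> Z0; have [C [C1 hC]] := toda_bound sol T.
have [K1 [K10 hK1]] := energy_bound T Z0.
have C0 : 0 <= C by apply: le_trans C1.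
pose L := 4 * C ^+ 2 + 2 * (C + Z) + 2 * C ^+ 2 * (1 + (C + Z)) + 2.
have C2 : 0 <= C ^+ 2 by exact: sqr_ge0.
have L0 : 0 <= L by rewrite /L !addr_ge0 // ?mulr_ge0 // ?addr_ge0 // ?mulr_ge0 ?addr_ge0.
exists ((1 + K1) * expR (12 * L * T)); split; first by rewrite mulr_ge0 ?expR_ge0 ?addr_ge0.
move=> z hz zZ t tT; have T0 : 0 <= T by apply: le_trans tT.
pose e := complex.Im z.
pose dg s := 2 * hf a b z s.
pose dh s := 2 * qf a b z s + 2 * qmf a b z s - (kf a s)%:C%C * gf a b z s.
pose dq s := - (2 * cf b z s * qf a b z s) +
  2 * ((a s 0) ^+ 2)%:C%C * (- hf a b z s + cf b z s * gf a b z s).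
pose dm s := 2 * cf b z s * qmf a b z s -
  2 * ((a s (-1)) ^+ 2)%:C%C * (hf a b z s + cf b z s * gf a b z s).
have gd' (s : R) : is_derive s 1 (fun s => complex.Re (gf a b z s)) (complex.Re (dg s)).
  by have [] : cder (gf a b z) s (dg s) by exact: gf_cder.
have hd' (s : R) : is_derive s 1 (fun s => complex.Re (hf a b z s)) (complex.Re (dh s)).
  by have [] : cder (hf a b z) s (dh s) by exact: hf_cder.
have qd' (s : R) : is_derive s 1 (fun s => complex.Re (qf a b z s)) (complex.Re (dq s)).
  by have [] : cder (qf a b z) s (dq s) by exact: qf_cder.
have md' (s : R) : is_derive s 1 (fun s => complex.Re (qmf a b z s)) (complex.Re (dm s)).
  by have [] : cder (qmf a b z) s (dm s) by exact: qmf_cder.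
pose c0 := e ^+ 2 * (energy z 0 * K1).
have c00 : 0 <= c0 by rewrite mulr_ge0 ?sqr_ge0 // mulr_ge0 ?energy_ge0.
pose dE s := 2 * (complex.Re (gf a b z s) * complex.Re (dg s) +
  complex.Re (hf a b z s) * complex.Re (dh s) +
  complex.Re (qf a b z s) * complex.Re (dq s) +
  complex.Re (qmf a b z s) * complex.Re (dm s)).
have Ed (s : R) : is_derive s 1 (fun s => re_energy z s + c0) (dE s).
  have d1 := gd' s; have d2 := hd' s; have d3 := qd' s; have d4 := md' s.
  have -> : (fun s => re_energy z s + c0) =
    (fun s => complex.Re (gf a b z s) ^+ 2) \+ (fun s => complex.Re (hf a b z s) ^+ 2) \+
    (fun s => complex.Re (qf a b z s) ^+ 2) \+ (fun s => complex.Re (qmf a b z s) ^+ 2) \+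
    cst c0 by apply/funext.
  rewrite /dE !mulrDr -[X in is_derive _ _ _ X]addr0.
  apply: is_deriveD; apply: is_deriveD; last exact: is_derive_sq.
  by apply: is_deriveD; [apply: is_deriveD|]; exact: is_derive_sq.
have H s : `|s| <= T -> `|dE s| <= 12 * L * (re_energy z s + c0).
  move=> sT.
  have hb : `|complex.Re (cf b z s)| <= C + Z.
    apply: le_trans (Re_le_normc _) _.
    apply: le_trans (normcB _ _) _; rewrite normc_real lerD //.
    by case: (hC s 0 sT).
  have hI : complex.Im (cf b z s) = - e by rewrite /cf /e; case: (z) => ? ? /=; rewrite sub0r.
  have ha k : `|a s k ^+ 2| <= C ^+ 2.
    by rewrite normrX ler_pXn2r ?nnegrE //; case: (hC s k sT).
  have hk : `|kf a s| <= 4 * C ^+ 2.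
    rewrite /kf normrM normr_nat; have := ha 0; have := ha (-1).
    have := ler_normD (a s 0 ^+ 2) (a s (-1) ^+ 2); lra.
  pose rg := complex.Re (gf a b z s); pose rh := complex.Re (hf a b z s).
  pose rq := complex.Re (qf a b z s); pose rm := complex.Re (qmf a b z s).
  pose ig := complex.Im (gf a b z s); pose iq := complex.Im (qf a b z s).
  pose im := complex.Im (qmf a b z s).
  pose N := `|rg| + `|rh| + `|rq| + `|rm|.
  pose B := Num.sqrt (energy z s).
  have B0 : 0 <= B := sqrtr_ge0 _.
  have BB : B ^+ 2 = energy z s by rewrite sqr_sqrtr // energy_ge0.
  have Bc (x : R[i]) : normc x ^+ 2 <= energy z s -> `|complex.Im x| <= B.
    move=> h; apply: le_trans (Im_le_normc _) _.
    by rewrite -(@ler_pXn2r _ 2) ?nnegrE ?normc_ge0 // BB.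
  have sg x : 0 <= normc (x : R[i]) ^+ 2 by exact: sqr_ge0.
  have Ig : `|ig| <= B.
    apply: Bc; rewrite /energy.
    by have := sg (hf a b z s); have := sg (qf a b z s); have := sg (qmf a b z s); lra.
  have Iq : `|iq| <= B.
    apply: Bc; rewrite /energy.
    by have := sg (hf a b z s); have := sg (gf a b z s); have := sg (qmf a b z s); lra.
  have Im : `|im| <= B.
    apply: Bc; rewrite /energy.
    by have := sg (hf a b z s); have := sg (gf a b z s); have := sg (qf a b z s); lra.
  have N0 : 0 <= N by rewrite /N !addr_ge0.
  have g0 := normr_ge0 rg; have h0 := normr_ge0 rh.
  have q0 := normr_ge0 rq; have m0 := normr_ge0 rm.
  have CZ : 0 <= C + Z by rewrite addr_ge0.
  have e0 := normr_ge0 e.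
  have eB : 0 <= `|e| * B by rewrite mulr_ge0.
  have re2 (x : R[i]) : complex.Re (2 * x) = 2 * complex.Re x.
    by rewrite -(rmorph_nat (real_complex R)) Re_mul /= mul0r subr0.
  have rer (r : R) (x : R[i]) : complex.Re (r%:C%C * x) = r * complex.Re x.
    by rewrite Re_mul /= mul0r subr0.
  have cx (x : R[i]) : `|complex.Im x| <= B -> `|complex.Re (cf b z s * x)| <=
      (C + Z) * `|complex.Re x| + `|e| * B.
    move=> hx; rewrite Re_mul hI mulNr opprK.
    apply: le_trans (ler_normD _ _) _; rewrite !normrM lerD ?ler_wpM2r //.
    by rewrite ler_wpM2l.
  have P3 : 0 <= 2 * C ^+ 2 * (1 + (C + Z)) by rewrite !mulr_ge0 ?addr_ge0.
  have L2 : 2 <= L by rewrite /L; lra.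
  have L4 : 4 * C ^+ 2 <= L by rewrite /L; lra.
  have b1 : `|complex.Re (dg s)| <= L * (N + `|e| * B).
    rewrite re2 -/rh normrM normr_nat; apply: ler_pM => //.
    by rewrite /N; lra.
  have b2 : `|complex.Re (dh s)| <= L * (N + `|e| * B).
    rewrite /dh Re_add Re_opp Re_add !re2 (rer (kf a s)) -/rq -/rm -/rg.
    apply: le_trans (ler_normB _ _) _.
    apply: le_trans (lerD (ler_normD _ _) (lexx _)) _.
    rewrite !(normrM 2) (normrM (kf a s)) !normr_nat.
    have : `|kf a s| * `|rg| <= L * `|rg| by rewrite ler_wpM2r // (le_trans hk).
    have : 2 * `|rq| <= L * `|rq| by rewrite ler_wpM2r.
    have : 2 * `|rm| <= L * `|rm| by rewrite ler_wpM2r.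
    have : 0 <= L * `|rh| by rewrite mulr_ge0.
    have : 0 <= L * (`|e| * B) by rewrite mulr_ge0.
    by rewrite /N !mulrDr; lra.
  have b3 : `|complex.Re (dq s)| <= L * (N + `|e| * B).
    rewrite /dq Re_add Re_opp -2!mulrA !re2 (rer (a s 0 ^+ 2)) Re_add Re_opp -/rh.
    apply: le_trans (ler_normD _ _) _; rewrite normrN !(normrM 2) (normrM (a s 0 ^+ 2)) !normr_nat.
    have e1 := cx (qf a b z s) Iq; have e2 := cx (gf a b z s) Ig.
    have e3 : `|a s 0 ^+ 2| * `|- rh + complex.Re (cf b z s * gf a b z s)| <=
       C ^+ 2 * (`|rh| + ((C + Z) * `|rg| + `|e| * B)).
      apply: ler_pM => //; apply: le_trans (ler_normD _ _) _.
      by rewrite normrN lerD.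
    have := system_coef_bound C2 CZ q0 h0 g0 eB; rewrite -/L.
    have : 0 <= L * `|rm| by rewrite mulr_ge0.
    rewrite -/rq -/rg in e1 e2 e3 *.
    by rewrite /N; lra.
  have b4 : `|complex.Re (dm s)| <= L * (N + `|e| * B).
    rewrite /dm Re_add Re_opp -2!mulrA !re2 (rer (a s (-1) ^+ 2)) Re_add -/rh.
    apply: le_trans (ler_normB _ _) _; rewrite !(normrM 2) (normrM (a s (-1) ^+ 2)) !normr_nat.
    have e1 := cx (qmf a b z s) Im; have e2 := cx (gf a b z s) Ig.
    have e3 : `|a s (-1) ^+ 2| * `|rh + complex.Re (cf b z s * gf a b z s)| <=
       C ^+ 2 * (`|rh| + ((C + Z) * `|rg| + `|e| * B)).
      apply: ler_pM => //; apply: le_trans (ler_normD _ _) _.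
      by rewrite lerD.
    have := system_coef_bound C2 CZ m0 h0 g0 eB; rewrite -/L.
    have : 0 <= L * `|rq| by rewrite mulr_ge0.
    rewrite -/rm -/rg in e1 e2 e3 *.
    by rewrite /N; lra.
  have t1 : `|dE s| <= 2 * (N * (L * (N + `|e| * B))).
    rewrite /dE normrM normr_nat ler_wpM2l // -/rg -/rh -/rq -/rm /N.
    rewrite 3![in leRHS]mulrDl.
    apply: le_trans (ler_normD _ _) _; apply: lerD.
      apply: le_trans (ler_normD _ _) _; apply: lerD.
        apply: le_trans (ler_normD _ _) _; apply: lerD.
          by rewrite normrM ler_wpM2l.
        by rewrite normrM ler_wpM2l.
      by rewrite normrM ler_wpM2l.
    by rewrite normrM ler_wpM2l.
  have t2 : N ^+ 2 <= 4 * re_energy z s.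
    apply: le_trans (sq_sum4 _ _ _ _) _.
    by rewrite !(real_normK (num_real _)).
  have t3 : (`|e| * B) ^+ 2 <= c0.
    rewrite exprMn BB (real_normK (num_real _)) /c0 ler_wpM2l ?sqr_ge0 //.
    exact: hK1.
  apply: le_trans t1 _.
  have t4 : 2 * (N * (N + `|e| * B)) <= 3 * N ^+ 2 + (`|e| * B) ^+ 2.
    have := sqr_ge0 (N - `|e| * B); rewrite sqrrB; rewrite !expr2; lra.
  have -> : 2 * (N * (L * (N + `|e| * B))) = L * (2 * (N * (N + `|e| * B))) by ring.
  apply: le_trans (ler_wpM2l L0 t4) _.
  have -> : 12 * L * (re_energy z s + c0) = L * (12 * (re_energy z s + c0)) by ring.
  rewrite ler_wpM2l //; lra.
have := gronwall Ed H tT => h.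
have {h} : re_energy z t <= (re_energy z 0 + c0) * expR (12 * L * T).
  apply: le_trans (_ : re_energy z t + c0 <= _); first by rewrite lerDl.
  apply: le_trans h _; apply: ler_wpM2l.
    by apply: addr_ge0 => //; exact: re_energy_ge0.
  by rewrite ler_expR ler_wpM2l // mulr_ge0.
move/le_trans; apply; rewrite mulrA ler_wpM2r ?expR_ge0 //.
have r0 := re_energy_ge0 z 0; have E0 := energy_ge0 z 0.
have : 0 <= e ^+ 2 * energy z 0 by rewrite mulr_ge0 // sqr_ge0.
have : 0 <= re_energy z 0 * K1 by rewrite mulr_ge0.
rewrite /c0 -/e; lra.
Qed.

End Persistence.

(** * The logarithm on the upper half plane *)
Section ComplexPaths.
Variable R : realType.

Lemma complexP (z w : R[i]) : complex.Re z = complex.Re w -> complex.Im z = complex.Im w -> z = w.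
Proof. by case: z w => ? ? [] ? ? /= -> ->. Qed.

Lemma cderM (f g : R -> R[i]) (t : R) d e : cder f t d -> cder g t e ->
  cder (fun s => f s * g s) t (d * g t + f t * e).
Proof.
move=> [f1 f2] [g1 g2]; split.
- have -> : (fun s => complex.Re (f s * g s)) =
    (fun s => complex.Re (f s)) * (fun s => complex.Re (g s)) -
    (fun s => complex.Im (f s)) * (fun s => complex.Im (g s)).
    by apply/funext => s; rewrite Re_mul.
  apply: is_derive_eq; rewrite Re_add !Re_mul /GRing.scale /=.
  by move: (complex.Re (f t)) (complex.Im (f t)) (complex.Re (g t)) (complex.Im (g t))
      (complex.Re d) (complex.Im d) (complex.Re e) (complex.Im e) => *; ring.
- have -> : (fun s => complex.Im (f s * g s)) =
    (fun s => complex.Re (f s)) * (fun s => complex.Im (g s)) +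
    (fun s => complex.Im (f s)) * (fun s => complex.Re (g s)).
    by apply/funext => s; rewrite Im_mul.
  apply: is_derive_eq; rewrite Im_add !Im_mul /GRing.scale /=.
  by move: (complex.Re (f t)) (complex.Im (f t)) (complex.Re (g t)) (complex.Im (g t))
      (complex.Re d) (complex.Im d) (complex.Re e) (complex.Im e) => *; ring.
Qed.

Lemma Re_inv (z : R[i]) : complex.Re z^-1 = complex.Re z / normc z ^+ 2.
Proof. by rewrite normc_sqE; case: z. Qed.

Lemma Im_inv (z : R[i]) : complex.Im z^-1 = - complex.Im z / normc z ^+ 2.
Proof. by rewrite normc_sqE mulNr; case: z. Qed.

Lemma normc_gt0 (z : R[i]) : 0 < complex.Im z -> 0 < normc z.
Proof. by move=> h; apply: lt_le_trans (Im_le_normc z); rewrite normr_gt0 gt_eqF. Qed.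

Lemma normc_neq0 (z : R[i]) : 0 < normc z -> z != 0.
Proof. by move=> h; apply/eqP => z0; rewrite z0 normc0 ltxx in h. Qed.

Lemma cderV (f : R -> R[i]) (t : R) d : cder f t d -> 0 < complex.Im (f t) ->
  cder (fun s => (f s)^-1) t (- d / f t ^+ 2).
Proof.
move=> fd p; have [f1 f2] := fd; have dn := is_derive_normc2 fd.
have n0 : normc (f t) ^+ 2 != 0 by rewrite gt_eqF // exprn_gt0 // normc_gt0.
have dV : is_derive t 1 (fun s => (normc (f s) ^+ 2)^-1)
   (- (normc (f t) ^+ 2) ^- 2 * (2 * (complex.Re (f t) * complex.Re d + complex.Im (f t) * complex.Im d))).
  exact: is_deriveV.
have E : (complex.Re (f t) ^+ 2 + complex.Im (f t) ^+ 2) != 0 by rewrite -normc_sqE.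
have E2 : f t ^+ 2 != 0 by rewrite expf_eq0 /= normc_neq0 // normc_gt0.
have dE : - d / f t ^+ 2 = ((- complex.Re d) +i* (- complex.Im d))%C *
   ((complex.Re (f t) ^+ 2 - complex.Im (f t) ^+ 2) / (complex.Re (f t) ^+ 2 + complex.Im (f t) ^+ 2) ^+ 2
    +i* (- (2 * complex.Re (f t) * complex.Im (f t)) / (complex.Re (f t) ^+ 2 + complex.Im (f t) ^+ 2) ^+ 2))%C.
  have -> : ((- complex.Re d) +i* (- complex.Im d))%C = - d by case: (d).
  congr (_ * _); apply: (mulfI E2); rewrite divff //.
  move: E {E2 n0 dV dn p f1 f2 fd}; case: (f t) => x y /= E.
  by rewrite expr2; apply: complexP => /=; field.
split.
- have -> : (fun s => complex.Re (f s)^-1) =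
    (fun s => complex.Re (f s)) * (fun s => (normc (f s) ^+ 2)^-1).
    by apply/funext => s; rewrite Re_inv.
  apply: is_derive_eq; rewrite dE Re_mul /GRing.scale /= normc_sqE; field.
  exact: E.
- have -> : (fun s => complex.Im (f s)^-1) =
    - ((fun s => complex.Im (f s)) * (fun s => (normc (f s) ^+ 2)^-1)).
    by apply/funext => s; rewrite Im_inv mulNr.
  apply: is_derive_eq; rewrite dE Im_mul /GRing.scale /= normc_sqE; field.
  exact: E.
Qed.

(** A branch of log w - i pi / 2 on the upper half plane; its imaginary part
    tends to 0 where w approaches the imaginary axis. *)
Definition logc (w : R[i]) : R[i] :=
  (2^-1 * ln (normc w ^+ 2) +i* (- atan (complex.Re w / complex.Im w)))%C.

Lemma cder_log (f : R -> R[i]) (t : R) d : cder f t d -> 0 < complex.Im (f t) ->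
  cder (fun s => logc (f s)) t (d / f t).
Proof.
move=> fd p; have [f1 f2] := fd; have dn := is_derive_normc2 fd.
have n0 : 0 < normc (f t) ^+ 2 by rewrite exprn_gt0 // normc_gt0.
have q0 : complex.Im (f t) != 0 by rewrite gt_eqF.
have E : complex.Re (f t) ^+ 2 + complex.Im (f t) ^+ 2 != 0 by rewrite -normc_sqE gt_eqF.
split; rewrite /logc /=.
- have d1 := is_derive1_ln n0.
  have d2 : is_derive t 1 (fun s => ln (normc (f s) ^+ 2)) ((normc (f t) ^+ 2)^-1 *
     (2 * (complex.Re (f t) * complex.Re d + complex.Im (f t) * complex.Im d))).
    exact: (@is_derive1_comp R (@ln R) (fun s => normc (f s) ^+ 2) t _ _ d1 dn).
  apply: is_derive_eq; rewrite Re_mul Re_inv Im_inv /GRing.scale /= normc_sqE; field.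
  exact: E.
- have d0 : is_derive t 1 (fun s => (complex.Im (f s))^-1) (- (complex.Im (f t)) ^- 2 * complex.Im d).
    exact: is_deriveV.
  have d1 : is_derive t 1 ((fun s => complex.Re (f s)) * (fun s => (complex.Im (f s))^-1))
     ((complex.Re d * complex.Im (f t) - complex.Re (f t) * complex.Im d) / complex.Im (f t) ^+ 2).
    by apply: is_derive_eq; rewrite /GRing.scale /=; field.
  have d2 : is_derive t 1 (fun s => atan (complex.Re (f s) / complex.Im (f s))) ((1 + (complex.Re (f t) / complex.Im (f t)) ^+ 2)^-1 *
     ((complex.Re d * complex.Im (f t) - complex.Re (f t) * complex.Im d) / complex.Im (f t) ^+ 2)).
    exact: (@is_derive1_comp R (@atan R) _ t _ _ (is_derive1_atan _) d1).
  apply: is_derive_eq; rewrite Im_mul Re_inv Im_inv /GRing.scale /= normc_sqE; field.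
  rewrite q0 /= andbT.
  have E' : complex.Im (f t) ^+ 2 + complex.Re (f t) ^+ 2 != 0 by rewrite addrC.
  by rewrite ?E ?E'.
Qed.

Lemma mvt_le_on (f df : R -> R) x y L : x <= y ->
  (forall s : R, x <= s <= y -> is_derive s 1 f (df s)) ->
  (forall s, x <= s <= y -> `|df s| <= L) ->
  `|f y - f x| <= L * (y - x).
Proof.
move=> xy fd H.
have cf : {within `[x, y], continuous f}.
  by apply: derivable_within_continuous => s; rewrite in_itv /= => hs; have [] := fd s hs.
have fd' s : s \in `]x, y[ -> is_derive s 1 f (df s).
  by rewrite in_itv /= => /andP[h1 h2]; apply: fd; rewrite !ltW.
have [c] := @MVT_segment R f df _ _ xy fd' cf.
rewrite in_itv /= => cxy ->; rewrite normrM [X in _ * X]ger0_norm ?subr_ge0 //.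
by rewrite ler_wpM2r ?subr_ge0 // H.
Qed.

(** The logarithm does not oscillate on a scale small compared to |w|. *)
Lemma logc_lip (z w : R[i]) : 0 < complex.Im z -> 0 < complex.Im w ->
  normc (z - w) <= 2^-1 * normc w ->
  normc (logc z - logc w) <= 4 * (normc (z - w) / normc w).
Proof.
move=> z0 w0 h; have wp := normc_gt0 w0.
pose p s := w + s%:C%C * (z - w).
have pd (s : R) : cder p s (z - w).
  apply: (@cder_quad _ _ _ _ 0 1) => // e _.
  rewrite (_ : _ - _ = 0) ?normc0 ?mul0r // /p rmorphD; ring.
have pI s : 0 <= s <= 1 -> 0 < complex.Im (p s).
  move=> /andP[s0 s1]; rewrite /p Im_add Im_mul /= mul0r addr0 Im_add Im_opp.
  have -> : complex.Im w + s * (complex.Im z - complex.Im w) =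
    s * complex.Im z + (1 - s) * complex.Im w by ring.
  have [->|s00] := eqVneq s 0; first by rewrite mul0r add0r subr0 mul1r.
  apply: ltr_pwDl; first by rewrite mulr_gt0 // lt_neqAle eq_sym s00.
  by rewrite mulr_ge0 ?subr_ge0 // ltW.
have pn s : 0 <= s <= 1 -> 2^-1 * normc w <= normc (p s).
  move=> /andP[s0 s1].
  have h1 : normc w <= normc (p s) + normc (s%:C%C * (z - w)).
    by rewrite -{1}(addrK (s%:C%C * (z - w)) w); exact: normcB.
  have : normc (s%:C%C * (z - w)) <= normc (z - w).
    by rewrite normcM normc_real ger0_norm // ler_piMl // normc_ge0.
  lra.
have ld s : 0 <= s <= 1 -> cder (fun s => logc (p s)) s ((z - w) / p s).
  by move=> hs; apply: cder_log; [exact: pd|exact: pI].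
have lb s : 0 <= s <= 1 -> normc ((z - w) / p s) <= 2 * (normc (z - w) / normc w).
  move=> hs; have hp := pn s hs.
  have pp : 0 < normc (p s) by apply: lt_le_trans hp; rewrite mulr_gt0.
  rewrite normcM normcV ler_pdivrMr //.
  apply: (@le_trans _ _ (2 * (normc (z - w) / normc w) * (2^-1 * normc w))).
    by rewrite le_eqVlt; apply/orP; left; apply/eqP; field; rewrite gt_eqF.
  by rewrite ler_wpM2l // mulr_ge0 // divr_ge0 ?normc_ge0.
have p1 : p 1 = z by rewrite /p mul1r addrC subrK.
have p0 : p 0 = w by rewrite /p mul0r addr0.
have l1 : `|complex.Re (logc z) - complex.Re (logc w)| <= 2 * (normc (z - w) / normc w).
  have := @mvt_le_on (fun s => complex.Re (logc (p s))) (fun s => complex.Re ((z - w) / p s)) 0 1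
    (2 * (normc (z - w) / normc w)) ler01.
  rewrite p1 p0 subr0 mulr1; apply => s hs.
    by case: (ld s hs).
  by apply: le_trans (Re_le_normc _) (lb s hs).
have l2 : `|complex.Im (logc z) - complex.Im (logc w)| <= 2 * (normc (z - w) / normc w).
  have := @mvt_le_on (fun s => complex.Im (logc (p s))) (fun s => complex.Im ((z - w) / p s)) 0 1
    (2 * (normc (z - w) / normc w)) ler01.
  rewrite p1 p0 subr0 mulr1; apply => s hs.
    by case: (ld s hs).
  by apply: le_trans (Im_le_normc _) (lb s hs).
apply: le_trans (normc_le_ReIm _) _; rewrite Re_add Im_add Re_opp Im_opp; lra.
Qed.

Lemma logc_oppV (z : R[i]) : 0 < complex.Im z -> logc (- z^-1) = - logc z.
Proof.
move=> z0; have n0 : 0 < normc z ^+ 2 by rewrite exprn_gt0 // normc_gt0.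
apply: complexP; rewrite /logc /=.
- by rewrite normcN normcV exprVn lnV // mulrN.
- rewrite opprK -atanN; congr atan.
  rewrite Re_opp Im_opp Re_inv Im_inv; field.
  by rewrite !gt_eqF // normc_gt0.
Qed.

Lemma ln_near1 (x : R) : `|x - 1| <= 2^-1 -> `|ln x| <= 2 * `|x - 1|.
Proof.
rewrite ler_norml => /andP[h1 h2]; have x0 : 0 < x by lra.
have u1 : ln x <= x - 1.
  by have := @le_ln1Dx R (x - 1); rewrite addrCA subrr addr0; apply; lra.
have u2 : - ln x <= x^-1 - 1.
  have := @le_ln1Dx R (x^-1 - 1); rewrite addrCA subrr addr0 lnV //; apply.
  by rewrite ltrBrDr addNr invr_gt0.
have u3 : x^-1 - 1 <= 2 * `|x - 1|.
  have -> : x^-1 - 1 = (1 - x) / x by field; rewrite gt_eqF.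
  rewrite ler_pdivrMr //; have := ler_norm (1 - x); rewrite distrC => h.
  have := normr_ge0 (x - 1); nra.
have := ler_norm (x - 1); have := normr_ge0 (x - 1).
by rewrite ler_norml; lra.
Qed.

Lemma atanV_gt0 (y : R) : 0 < y -> atan y^-1 = pi / 2 - atan y.
Proof.
move=> y0; have h0 : 0 < atan y by rewrite -(atan0 R) lt_atan.
have h1 := atan_ltpi2 y.
have t : tan (pi / 2 - atan y) = y^-1.
  rewrite -opprB tanN /tan sinBpihalf cosBpihalf mulNr opprK -(invf_div (sin _)).
  by rewrite -/(tan (atan y)) atanK.
by rewrite -t tanK // in_itv /=; lra.
Qed.

Lemma atan_inv_bound (p q : R) : 0 < q -> p != 0 ->
  `|atan (p / q) - Num.sg p * (pi / 2)| <= q / `|p|.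
Proof.
have atan_le (x : R) : 0 <= x -> atan x <= x.
  move=> x0; have := @mvt_le R atan (fun s => (1 + s ^+ 2)^-1) 0 x 1 (fun s => is_derive1_atan s).
  rewrite atan0 !subr0 mul1r (ger0_norm x0) => h.
  apply: le_trans (ler_norm _) (h _) => s _.
  have p1 : 0 < 1 + s ^+ 2 by rewrite ltr_pwDl // sqr_ge0.
  by rewrite ger0_norm ?invr_ge0 ?(ltW p1) // invf_le1 // lerDl sqr_ge0.
have main (p' : R) : 0 < q -> 0 < p' -> `|atan (p' / q) - pi / 2| <= q / p'.
  move=> q0 p0.
  have -> : atan (p' / q) = pi / 2 - atan (q / p').
    rewrite -[in RHS](invf_div p' q).
    rewrite atanV_gt0 ?divr_gt0 //; ring.
  rewrite addrAC subrr sub0r normrN ger0_norm.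
    by apply: atan_le; rewrite divr_ge0 // ltW.
  by rewrite -(atan0 R) ltW // lt_atan // divr_gt0.
move=> q0 pn; have [p0|p0|p0] := ltgtP p 0.
- rewrite ltr0_sg // (ltr0_norm p0) mulN1r opprK.
  have := main (- p) q0; rewrite oppr_gt0 => /(_ p0).
  by rewrite mulNr atanN -opprD normrN.
- by rewrite gtr0_sg // (gtr0_norm p0) mul1r; exact: main.
- by rewrite p0 eqxx in pn.
Qed.

(** Boundary behaviour of log at a real non-zero value. *)
Lemma logc_near_real (h0 K : R) (w : R[i]) (r : R) : h0 != 0 -> 0 < complex.Im w ->
  normc (w - h0%:C%C) <= K * r -> K * r <= `|h0| / 8 ->
  normc (logc w - (ln `|h0| +i* (- (Num.sg h0 * (pi / 2))))%C) <= (8 * K / `|h0|) * r.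
Proof.
move=> h00 w0 hw hr.
have a0 : 0 < `|h0| by rewrite normr_gt0.
have Kr : 0 <= K * r by apply: le_trans hw; exact: normc_ge0.
pose n := normc w.
have n1 : `|n - `|h0| | <= K * r.
  rewrite ler_norml; apply/andP; split.
    have : `|h0| <= normc (w - h0%:C%C) + n.
      rewrite -normc_real -(normcN (w - _)) opprB.
      by rewrite -{1}(subrK w h0%:C%C) normcD.
    by lra.
  have : n <= normc (w - h0%:C%C) + `|h0|.
    by rewrite /n -normc_real -{1}(subrK h0%:C%C w) normcD.
  by lra.
have n0 : 0 < n by exact: normc_gt0.
have l1 : `|2^-1 * ln (n ^+ 2) - ln `|h0| | <= 2 * (K * r / `|h0|).
  have -> : 2^-1 * ln (n ^+ 2) = ln n by rewrite lnXn // -mulr_natr; field.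
  rewrite -ln_div //.
  have E : `|n / `|h0| - 1| <= K * r / `|h0|.
    have -> : n / `|h0| - 1 = (n - `|h0|) / `|h0| by field; rewrite gt_eqF.
    by rewrite normrM normfV normr_id ler_pM2r ?invr_gt0.
  apply: le_trans (ln_near1 _) _; last by rewrite ler_pM2l.
  apply: le_trans E _; rewrite ler_pdivrMr //; lra.
pose p := complex.Re w; pose q := complex.Im w.
have ph : `|p - h0| <= K * r.
  apply: le_trans hw; apply: le_trans (Re_le_normc _).
  by rewrite Re_add Re_opp.
have qh : q <= K * r.
  apply: le_trans hw; apply: le_trans (Im_le_normc _).
  by rewrite Im_add Im_opp /= subr0 ler_norm.
have p0 : `|h0| / 2 <= `|p|.
  have := ler_normB p (p - h0); rewrite opprB addrC subrK => h; lra.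
have pn : p != 0 by rewrite -normr_gt0; lra.
have sp : Num.sg p = Num.sg h0.
  move: ph; rewrite ler_norml => /andP[h1 h2].
  have [h|h|h] := ltgtP h0 0.
  - rewrite !ltr0_sg //; move: hr; rewrite ltr0_norm //; lra.
  - rewrite !gtr0_sg //; move: hr; rewrite gtr0_norm //; lra.
  - by rewrite h eqxx in h00.
have l2 : `|atan (p / q) - Num.sg h0 * (pi / 2)| <= 2 * (K * r / `|h0|).
  rewrite -sp; apply: le_trans (atan_inv_bound w0 pn) _.
  rewrite ler_pdivrMr; last by rewrite normr_gt0.
  apply: le_trans qh _.
  apply: (@le_trans _ _ (2 * (K * r / `|h0|) * (`|h0| / 2))).
    by rewrite le_eqVlt; apply/orP; left; apply/eqP; field; rewrite gt_eqF.
  by rewrite ler_wpM2l // mulr_ge0 // divr_ge0 // ltW.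
apply: le_trans (normc_le_ReIm _) _; rewrite Re_add Im_add Re_opp Im_opp.
have -> : (8 * K / `|h0|) * r = 4 * (2 * (K * r / `|h0|)) by ring.
have k0 : 0 <= K * r / `|h0| by rewrite divr_ge0 // ltW.
apply: le_trans (lerD l1 (_ : _ <= 2 * (K * r / `|h0|))) _; last by lra.
by rewrite /logc /= opprK addrC distrC.
Qed.

End ComplexPaths.

(** * Contour integration along horizontal segments *)
Section HorizontalIntegrals.
Variable R : realType.
Local Notation mu := (@lebesgue_measure R).

Definition ccont (f : R -> R[i]) :=
  continuous (fun s => complex.Re (f s)) /\ continuous (fun s => complex.Im (f s)).

Lemma cder_ccont (f d : R -> R[i]) : (forall t, cder f t (d t)) -> ccont f.
Proof.
move=> h; split.
- by apply: (@is_derive_continuous R _ (fun t => complex.Re (d t))) => t; case: (h t).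
- by apply: (@is_derive_continuous R _ (fun t => complex.Im (d t))) => t; case: (h t).
Qed.

Lemma ccontM (f g : R -> R[i]) : ccont f -> ccont g -> ccont (fun s => f s * g s).
Proof.
move=> [f1 f2] [g1 g2]; split=> s.
- under eq_fun do rewrite Re_mul.
  apply: (@cvgB _ R^o); apply: (@cvgM R); [exact: f1|exact: g1|exact: f2|exact: g2].
- under eq_fun do rewrite Im_mul.
  apply: (@cvgD _ R^o); apply: (@cvgM R); [exact: f1|exact: g2|exact: f2|exact: g1].
Qed.

Lemma ccontB (f g : R -> R[i]) : ccont f -> ccont g -> ccont (fun s => f s - g s).
Proof.
move=> [f1 f2] [g1 g2]; split=> s.
- by under eq_fun do rewrite Re_add Re_opp; apply: (@cvgB _ R^o); [exact: f1|exact: g1].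
- by under eq_fun do rewrite Im_add Im_opp; apply: (@cvgB _ R^o); [exact: f2|exact: g2].
Qed.

Lemma continuous_itv_integrable (f : R -> R) (A B : R) : continuous f ->
  mu.-integrable `[A, B] (EFin \o f).
Proof.
move=> cf; apply: continuous_compact_integrable; first exact: segment_compact.
exact: continuous_subspaceT.
Qed.

Lemma Rintegral_FTC2 (f F : R -> R) (A B : R) : A < B -> continuous f ->
  (forall x : R, is_derive x 1 F (f x)) -> \int[mu]_(x in `[A, B]) f x = F B - F A.
Proof.
move=> AB cf Fd; have cF := is_derive_continuous Fd.
rewrite /Rintegral (@continuous_FTC2 R f F A B AB) //.
- exact: continuous_subspaceT.
- split=> [x _||]; first by case: (Fd x).
  + by apply: cvg_at_right_filter; exact: cF.
  + by apply: cvg_at_left_filter; exact: cF.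
- by move=> x _; rewrite derive1E; case: (Fd x).
Qed.

Lemma Rintegral_cst_itv (c A B : R) : A < B ->
  \int[mu]_(x in `[A, B]) c = c * (B - A).
Proof.
move=> AB; rewrite Rintegral_cst //; congr (_ * _).
have := @lebesgue_measure_itv R `[A, B]; rewrite /= lte_fin AB => E.
by rewrite -[mu _]/(lebesgue_measure _) E.
Qed.

Variables (f F : R -> R -> R[i]) (x0 : R).
Hypothesis fx : forall x y : R, 0 < y -> cder (f ^~ y) x (F x y).
Hypothesis fy : forall x y : R, 0 < y -> cder (f x) y ('i%C * F x y).
Hypothesis Fc : forall y : R, 0 < y -> ccont (F ^~ y).
Hypothesis Fb : exists K, forall x y : R, 0 < y -> normc (F x y) <= K / y.
Hypothesis fU : forall X, exists2 K, 0 <= K & forall x y : R, `|x| <= X -> 0 < y <= X ->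
  `|complex.Re (f x y)| <= K * (1 + (Num.sqrt y)^-1).
Hypothesis fV : exists2 K, 0 <= K & forall x y : R, 0 < y -> `|complex.Im (f x y)| <= K.
Hypothesis fD : exists K R0, [/\ 0 <= K, 0 < R0 & forall x y : R, 0 < y ->
  R0 <= normc (x +i* y)%C -> normc (f x y) <= K / normc (x +i* y)%C].

Let zz (x y : R) : R[i] := ((x - x0) +i* y)%C.
Definition ckern (x y : R) : R[i] := f x y * (zz x y)^-1.
Let dk (x y : R) : R[i] := F x y * (zz x y)^-1 + f x y * (- 1 / zz x y ^+ 2).

Lemma zz_ge_y (x y : R) : 0 < y -> y <= normc (zz x y).
Proof. by move=> y0; apply: le_trans (Im_le_normc _); rewrite ger0_norm //= ltW. Qed.

Lemma cderV_zz_x (x y : R) : 0 < y -> cder (fun x => (zz x y)^-1) x (- 1 / zz x y ^+ 2).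
Proof.
move=> y0; apply: (@cderV R (fun x => zz x y) x 1) => //.
apply: (@cder_quad _ _ _ _ 0 1) => // e _.
rewrite (_ : _ - _ = 0) ?normc0 ?mul0r // /zz; apply: complexP => /=; ring.
Qed.

Lemma cderV_zz_y (x y : R) : 0 < y -> cder (fun y => (zz x y)^-1) y (- 'i%C / zz x y ^+ 2).
Proof.
move=> y0; apply: (@cderV R (fun y => zz x y) y 'i%C) => //.
apply: (@cder_quad _ _ _ _ 0 1) => // e _.
rewrite (_ : _ - _ = 0) ?normc0 ?mul0r // /zz; apply: complexP => /=; ring.
Qed.

Lemma ckern_x (x y : R) : 0 < y -> cder (ckern ^~ y) x (dk x y).
Proof. by move=> y0; exact: cderM (fx x y0) (cderV_zz_x x y0). Qed.

Lemma ckern_y (x y : R) : 0 < y -> cder (ckern x) y ('i%C * dk x y).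
Proof.
move=> y0; apply: cder_eq (cderM (fy x y0) (cderV_zz_y x y0)) _.
by rewrite /dk; ring.
Qed.

Lemma normc_zz_inv (x y : R) : 0 < y -> normc (zz x y)^-1 <= y^-1.
Proof.
move=> y0; have zy := zz_ge_y x y0.
by rewrite normcV lef_pV2 // posrE // (lt_le_trans y0).
Qed.

Lemma ckern_dk_bound (A B y0 y1 : R) : 0 < y0 -> exists K, forall x y : R,
  A <= x <= B -> y0 <= y <= y1 -> normc (dk x y) <= K.
Proof.
move=> y00; have [K1 h1] := Fb; have [K3 K30 h3] := fV.
have [K2 K20 h2] := fU (`|A| + `|B| + `|y1|).
pose K := `|K1| / y0 / y0 + (K2 * (1 + (Num.sqrt y0)^-1) + K3) / y0 ^+ 2.
exists K => x y /andP[Ax xB] /andP[yy0 yy1].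
have yp : 0 < y by apply: lt_le_trans yy0.
have xb : `|x| <= `|A| + `|B| + `|y1|.
  have := ler_norm B; have := ler_norm (- A); rewrite normrN => i1 i2.
  have := normr_ge0 A; have := normr_ge0 B; have := normr_ge0 y1.
  by rewrite ler_norml; lra.
have yb : 0 < y <= `|A| + `|B| + `|y1|.
  have := normr_ge0 A; have := normr_ge0 B; have := ler_norm y1; lra.
have i0 : y^-1 <= y0^-1 by rewrite lef_pV2.
have fb : normc (f x y) <= K2 * (1 + (Num.sqrt y0)^-1) + K3.
  apply: le_trans (normc_le_ReIm _) _; apply: lerD; last exact: h3.
  apply: le_trans (h2 _ _ xb yb) _; rewrite ler_wpM2l // lerD2l.
  by rewrite lef_pV2 ?posrE ?sqrtr_gt0 // ler_sqrt // ltW.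
have iz := normc_zz_inv x yp.
apply: le_trans (normcD _ _) _; rewrite !normcM /K; apply: lerD.
- apply: ler_pM; rewrite ?normc_ge0 //; last exact: le_trans iz i0.
  apply: le_trans (h1 _ _ yp) _; apply: (@le_trans _ _ (`|K1| / y)).
    by rewrite ler_pM2r ?invr_gt0 // ler_norm.
  by rewrite ler_wpM2l.
- apply: ler_pM; rewrite ?normc_ge0 //.
    by rewrite mulr_ge0 ?normc_ge0.
  rewrite normcN normc1 mul1r expr2 invfM normcM -exprVn expr2.
  by apply: ler_pM; rewrite ?normc_ge0 //; exact: le_trans iz i0.
Qed.

Lemma ckern_cont y : 0 < y -> continuous (fun x => complex.Im (ckern x y)).
Proof. by move=> y0; case: (cder_ccont (fun x => ckern_x x y0)). Qed.

Lemma dk_cont y : 0 < y -> continuous (fun x => complex.Re (dk x y)).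
Proof.
move=> y0; have ci := cder_ccont (fun x => cderV_zz_x x y0).
have cf := cder_ccont (fun x => fx x y0).
have [] // : ccont (dk ^~ y).
have -> : dk ^~ y = fun x => F x y * (zz x y)^-1 - f x y * ((zz x y)^-1 * (zz x y)^-1).
  by apply/funext => x; rewrite /dk expr2 invfM mulN1r mulrN.
apply: ccontB; first exact: ccontM (Fc y0) ci.
by apply: ccontM => //; exact: ccontM.
Qed.

Definition hint L y := \int[mu]_(x in `[x0 - L, x0 + L]) complex.Im (ckern x y).

(** The Cauchy-Riemann equations turn the vertical derivative of a horizontal
    integral into a boundary term. *)
Lemma hint_derive (L y : R) : 0 < L -> 0 < y ->
  is_derive y 1 (hint L) (complex.Re (ckern (x0 + L) y) - complex.Re (ckern (x0 - L) y)).
Proof.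
move=> L0 y0; pose A := x0 - L; pose B := x0 + L.
have AB : A < B by rewrite /A /B; lra.
have y20 : 0 < y / 2 by rewrite divr_gt0.
have [K hK] := @ckern_dk_bound A B (y / 2) (2 * y) y20.
pose g s x := complex.Im (ckern x s).
have Ia : `](y / 2), (2 * y)[%classic y by rewrite /= in_itv /=; lra.
have Ipos s : `](y / 2), (2 * y)[%classic s -> 0 < s.
  by rewrite /= in_itv /= => /andP[h _]; apply: lt_trans h.
have gd (s x : R) : 0 < s -> is_derive s 1 (g ^~ x) (complex.Re (dk x s)).
  move=> s0; have [_] := ckern_y x s0.
  by rewrite Im_mul /= mul0r add0r mul1r.
have intg s : `](y / 2), (2 * y)[%classic s -> mu.-integrable `[A, B] (EFin \o g s).
  by move=> /Ipos s0; apply: continuous_itv_integrable; exact: ckern_cont.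
have derg s x : `](y / 2), (2 * y)[%classic s -> `[A, B]%classic x -> derivable (g ^~ x) s 1.
  by move=> /Ipos s0 _; have [] := gd s x s0.
have p1 s x : 0 < s -> partial1of2 g s x = complex.Re (dk x s).
  by move=> s0; rewrite partial1of2E; have [] := gd s x s0.
have K0 : 0 <= K.
  apply: le_trans (normc_ge0 (dk A y)) (hK _ _ _ _); first by rewrite lexx ltW.
  by lra.
have intK : mu.-integrable `[A, B] (EFin \o (cst K : R -> R)).
  by apply: continuous_itv_integrable => x; exact: cvg_cst.
have ub s x : `](y / 2), (2 * y)[%classic s -> `[A, B]%classic x -> `|partial1of2 g s x| <= cst K x.
  move=> sI; have s0 := Ipos _ sI; rewrite /= in_itv /= => hx; rewrite p1 //.
  apply: le_trans (Re_le_normc _) (hK _ _ hx _).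
  by move: sI; rewrite /= in_itv /= => /andP[/ltW -> /ltW ->].
have K0' (x : R) : 0 <= cst K x by [].
have dd := @derivable_under_integral R _ _ mu g `[A, B]%classic (measurable_itv _)
  y _ _ Ia intg derg (cst K) K0' intK ub.
have dv := @differentiation_under_integral R _ _ mu g `[A, B]%classic (measurable_itv _)
  y _ _ Ia intg derg (cst K) K0' intK ub.
have E : \int[mu]_(x in `[A, B]) partial1of2 g y x =
    complex.Re (ckern B y) - complex.Re (ckern A y).
  under eq_Rintegral do rewrite p1 //.
  apply: (Rintegral_FTC2 (F := fun x => complex.Re (ckern x y)) AB).
    exact: dk_cont.
  by move=> x; case: (ckern_x x y0).
split; first exact: dd.
by rewrite -E -dv derive1E.
Qed.

Lemma hint_bound : exists C L1, [/\ 0 <= C, 0 < L1 &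
  forall L s, L1 <= L -> 0 < s <= 1 -> `|hint L s| <= C / L].
Proof.
have [K [R0 [K0 R00 hK]]] := fD.
exists (8 * K), (1 + 2 * R0 + 2 * `|x0|); split; first by rewrite mulr_ge0.
  by have := normr_ge0 x0; lra.
move=> L s hL /andP[s0 s1].
have ax := normr_ge0 x0.
have L1 : 1 <= L by lra.
have L0 : 0 < L by lra.
have LR : 2 * R0 <= L by lra.
have Lx : 2 * `|x0| <= L by lra.
have kb x y : 0 < y -> L / 2 <= normc (x +i* y)%C -> L <= normc (zz x y) ->
    normc (ckern x y) <= 2 * K / L ^+ 2.
  move=> y0 h1 h2; rewrite normcM normcV.
  have h3 : normc (f x y) <= K / (L / 2).
    apply: le_trans (hK _ _ y0 (le_trans _ h1)) _; first by lra.
    by rewrite ler_wpM2l // lef_pV2 // posrE ?divr_gt0 // (lt_le_trans _ h1) // divr_gt0.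
  have -> : 2 * K / L ^+ 2 = K / (L / 2) * L^-1 by field; rewrite gt_eqF.
  apply: ler_pM; rewrite ?normc_ge0 ?invr_ge0 ?normc_ge0 //.
  by rewrite lef_pV2 // posrE // (lt_le_trans L0).
have top : `|hint L L| <= 4 * K / L.
  have AB : x0 - L < x0 + L by lra.
  have ci : mu.-integrable `[x0 - L, x0 + L] (EFin \o (fun x => complex.Im (ckern x L))).
    by apply: continuous_itv_integrable; exact: ckern_cont.
  apply: le_trans (le_normr_Rintegral _ ci) _ => //.
  have cn : mu.-integrable `[x0 - L, x0 + L] (EFin \o (fun x => `|complex.Im (ckern x L)|)).
    apply: continuous_itv_integrable => x.
    by apply: cvg_norm; exact: ckern_cont.
  apply: (@le_trans _ _ (\int[mu]_(x in `[x0 - L, x0 + L]) (2 * K / L ^+ 2))).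
    apply: le_Rintegral => //.
      by apply: continuous_itv_integrable => x; exact: cvg_cst.
    move=> x _; apply: le_trans (Im_le_normc _) _; apply: kb => //.
      apply: le_trans (Im_le_normc _); rewrite /= ger0_norm; lra.
    exact: zz_ge_y.
  rewrite Rintegral_cst_itv //.
  by rewrite le_eqVlt; apply/orP; left; apply/eqP; field; rewrite gt_eqF.
have sL : s <= L by lra.
have side : `|hint L L - hint L s| <= 4 * K / L ^+ 2 * (L - s).
  apply: (mvt_le_on (df := fun y => complex.Re (ckern (x0 + L) y) - complex.Re (ckern (x0 - L) y))) => //.
    by move=> y /andP[sy _]; apply: hint_derive => //; apply: lt_le_trans sy.
  move=> y /andP[sy _]; have y0 : 0 < y by apply: lt_le_trans sy.
  have -> : 4 * K / L ^+ 2 = 2 * K / L ^+ 2 + 2 * K / L ^+ 2 by ring.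
  apply: le_trans (ler_normB _ _) _; apply: lerD; apply: le_trans (Re_le_normc _) _; apply: kb => //.
  - apply: le_trans (Re_le_normc _) => /=.
    have := ler_norm (x0 + L); have := ler_norm (- x0); rewrite normrN; lra.
  - by apply: le_trans (Re_le_normc _); rewrite /= addrC addKr ler_norm.
  - apply: le_trans (Re_le_normc _) => /=; rewrite -normrN.
    have := ler_norm (- (x0 - L)); have := ler_norm x0; lra.
  - by apply: le_trans (Re_le_normc _); rewrite /= addrC addKr normrN ler_norm.
have -> : hint L s = hint L L - (hint L L - hint L s) by ring.
apply: le_trans (ler_normB _ _) _.
have : 4 * K / L ^+ 2 * (L - s) <= 4 * K / L.
  have -> : 4 * K / L = 4 * K / L ^+ 2 * L by field; rewrite gt_eqF.
  apply: ler_wpM2l; last by rewrite gerBl ltW.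
  by apply: divr_ge0; [exact: mulr_ge0|exact: sqr_ge0].
have -> : 8 * K / L = 4 * K / L + 4 * K / L by ring.
by move=> side2; apply: lerD => //; apply: le_trans side side2.
Qed.


End HorizontalIntegrals.

(** * Recovering a real boundary value from the boundary argument *)
Section BoundaryValue.
Variable R : realType.
Local Notation mu := (@lebesgue_measure R).

Variables (f F : R -> R -> R[i]) (x0 U0 d0 tau : R) (T : set R).
Hypothesis fx : forall x y : R, 0 < y -> cder (f ^~ y) x (F x y).
Hypothesis fU : forall X, exists2 K, 0 <= K & forall x y : R, `|x| <= X -> 0 < y <= X ->
  `|complex.Re (f x y)| <= K * (1 + (Num.sqrt y)^-1).
Hypothesis fV : exists2 K, 0 <= K & forall x y : R, 0 < y -> `|complex.Im (f x y)| <= K.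
Hypothesis hb : exists C L1, [/\ 0 <= C, 0 < L1 &
  forall L s, L1 <= L -> 0 < s <= 1 -> `|hint f x0 L s| <= C / L].
Hypothesis near0 : exists K d : R, [/\ 0 <= K, 0 < d & forall x y : R, `|x - x0| <= d -> 0 < y <= d ->
  normc (f x y - U0%:C%C) <= K * normc ((x - x0) +i* y)%C].
Hypothesis mT : measurable T.
Hypothesis T_tau : (mu T <= tau%:E)%E.
Hypothesis d00 : 0 < d0.
Hypothesis T_d0 : forall x, T x -> d0 <= `|x - x0|.
Hypothesis flim : {ae mu, forall x : R, forall e : R, 0 < e -> exists2 s0 : R, 0 < s0 & forall s, 0 < s < s0 ->
  `|complex.Im (f x s)| <= (pi / 2) * \1_T x + e}.

Let zz (x y : R) : R[i] := ((x - x0) +i* y)%C.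
Let W (x s : R) : R := complex.Im (ckern f x0 x s) + U0 * (s / ((x - x0) ^+ 2 + s ^+ 2)).

Lemma ckern_im (x s : R) : 0 < s -> complex.Im (ckern f x0 x s) =
  (complex.Im (f x s) * (x - x0) - complex.Re (f x s) * s) / ((x - x0) ^+ 2 + s ^+ 2).
Proof.
move=> s0; rewrite /ckern Im_mul Re_inv Im_inv normc_sqE /=; ring.
Qed.

Lemma W_im (x s : R) : 0 < s -> W x s = complex.Im ((f x s - U0%:C%C) / zz x s).
Proof.
move=> s0; rewrite /W ckern_im // Im_mul Re_inv Im_inv normc_sqE /= Re_add Im_add Re_opp Im_opp /=.
ring.
Qed.

Lemma poisson_cont s : 0 < s -> continuous (fun x : R => s / ((x - x0) ^+ 2 + s ^+ 2)).
Proof.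
move=> s0 x; apply: (@cvgM R); first exact: cvg_cst.
apply: cvgV; first by rewrite gt_eqF // ltr_wpDl ?sqr_ge0 // exprn_gt0.
apply: (@cvgD _ R^o); last exact: cvg_cst.
rewrite expr2; under eq_fun do rewrite expr2.
by apply: (@cvgM R); apply: (@cvgB _ R^o) => //; exact: cvg_cst.
Qed.

Lemma ckern_im_cont s : 0 < s -> continuous (fun x => complex.Im (ckern f x0 x s)).
Proof.
move=> s0.
have c : ccont (ckern f x0 ^~ s).
  apply: ccontM; first exact: (cder_ccont (fun x => fx x s0)).
  exact: (cder_ccont (fun x => @cderV_zz_x R x0 x s s0)).
by case: c.
Qed.

Lemma W_cont s : 0 < s -> continuous (W ^~ s).
Proof.
move=> s0 x.
have -> : W ^~ s = (fun x => complex.Im (ckern f x0 x s)) \+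
    (cst U0 \* (fun x : R => s / ((x - x0) ^+ 2 + s ^+ 2))) by apply/funext.
apply: continuousD; first exact: ckern_im_cont.
by apply: continuousM; [exact: cvg_cst|exact: poisson_cont].
Qed.

(** The mass of the kernel s / ((x - x0)^2 + s^2) concentrates at x0 as s tends to 0 and
    produces the half-residue pi * U0. *)
Lemma poisson_int L s : 0 < L -> 0 < s ->
  \int[mu]_(x in `[x0 - L, x0 + L]) (s / ((x - x0) ^+ 2 + s ^+ 2)) = 2 * atan (L / s).
Proof.
move=> L0 s0.
have p (x : R) : 0 < (x - x0) ^+ 2 + s ^+ 2 by rewrite ltr_wpDl ?sqr_ge0 // exprn_gt0.
have AB : x0 - L < x0 + L by lra.
have Fd (x : R) : is_derive x 1 (fun x => atan ((x - x0) / s)) (s / ((x - x0) ^+ 2 + s ^+ 2)).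
  have d1 : is_derive x 1 (fun x : R => (x - x0) / s) (1 / s).
    by apply: is_derive_eq; rewrite /GRing.scale /=; ring.
  have d2 := @is_derive1_comp R (@atan R) _ x _ _ (is_derive1_atan _) d1.
  apply: is_derive_eq; rewrite /=; field.
  by rewrite !gt_eqF //= addrC p.
rewrite (@Rintegral_FTC2 R _ _ _ _ AB (poisson_cont s0) Fd).
have -> : (x0 + L - x0) / s = L / s by congr (_ / _); ring.
have -> : (x0 - L - x0) / s = - (L / s) by rewrite -mulNr; congr (_ / _); ring.
by rewrite atanN; ring.
Qed.

(** Letting the contour descend to the real axis, the half-residue at x0 is
    pi * U0 and the rest is the boundary argument, carried by T. *)
Theorem boundary_value_bound : 2 * d0 * `|U0| <= tau.
Proof.
have [C [L1 [C0 L10 hC]]] := hb.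
have [KV KV0 hV] := fV.
have [Kn [d [Kn0 dpos hn]]] := near0.
have pi0 := pi_gt0 R.
have tau0 : 0 <= tau by rewrite -lee_fin; apply: le_trans T_tau.
suff main L : L1 <= L -> pi * `|U0| <= C / L + pi / 2 / d0 * tau.
  have : pi * `|U0| <= pi / 2 / d0 * tau.
    apply/ler_addgt0Pr => e e0.
    pose L := L1 + C / e.
    have CL : 0 <= C / e by rewrite divr_ge0 // ltW.
    have L0 : 0 < L by rewrite /L ltr_pwDl.
    have LL : L1 <= L by rewrite lerDl.
    apply: le_trans (main L LL) _; rewrite addrC lerD2l.
    rewrite ler_pdivrMr // /L mulrDr (mulrC e (C / e)) divfK ?gt_eqF // lerDr.
    by rewrite mulr_ge0 // ltW.
  have -> : pi / 2 / d0 * tau = pi * (tau / (2 * d0)) by field; rewrite gt_eqF.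
  by rewrite ler_pM2l // ler_pdivlMr ?mulr_gt0 // mulrC.
move=> LL; have L0 : 0 < L by apply: lt_le_trans LL.
have AB : x0 - L < x0 + L by lra.
pose A := x0 - L; pose B := x0 + L.
pose dd := Num.min d 1.
have dd0 : 0 < dd by rewrite lt_min dpos ltr01.
pose s_ n : R := dd / n.+1%:R.
have s0 n : 0 < s_ n by rewrite divr_gt0.
have sdd n : s_ n <= dd by rewrite ler_pdivrMr // ler_peMr ?(ltW dd0) // ler1n.
have s1 n : s_ n <= 1 by apply: le_trans (sdd n) _; rewrite ge_min lexx orbT.
have sd n : s_ n <= d by apply: le_trans (sdd n) _; rewrite ge_min lexx.
have s_cvg : s_ n @[n --> \oo] --> (0 : R).
  rewrite -(mulr0 dd); apply: (@cvgM R); first exact: cvg_cst.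
  exact: cvg_harmonic.
have [KU KU0 hU] := fU (`|x0| + L + 1).
have xb x : `[A, B]%classic x -> `|x| <= `|x0| + L + 1.
  rewrite /= in_itv /= /A /B => /andP[h1 h2].
  have := ler_norm x0; have := ler_norm (- x0); rewrite normrN => h3 h4.
  by rewrite ler_norml; lra.
have sX n : 0 < s_ n <= `|x0| + L + 1.
  by rewrite s0 /=; apply: le_trans (s1 n) _; have := normr_ge0 x0; lra.
have sU n x : `[A, B]%classic x -> s_ n * `|complex.Re (f x (s_ n))| <= KU * (s_ n + Num.sqrt (s_ n)).
  move=> xAB; apply: le_trans (ler_wpM2l (ltW (s0 n)) (hU _ _ (xb _ xAB) (sX n))) _.
  rewrite mulrCA ler_wpM2l // mulrDr mulr1 lerD2l.
  by rewrite -{1}(sqr_sqrtr (ltW (s0 n))) expr2 mulfK // gt_eqF // sqrtr_gt0.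
have zn (x s : R) : normc (zz x s) ^+ 2 = (x - x0) ^+ 2 + s ^+ 2 by rewrite normc_sqE.
have Wle x s r : 0 < s -> 0 < r -> r <= `|x - x0| ->
    `|W x s| <= `|complex.Im (f x s)| / r + (s * `|complex.Re (f x s)| + `|U0| * s) / r ^+ 2.
  move=> sp rp rx.
  have r2 : r ^+ 2 <= (x - x0) ^+ 2 + s ^+ 2.
    apply: (@le_trans _ _ (`|x - x0| ^+ 2)); first by rewrite ler_pXn2r // nnegrE ltW // (lt_le_trans rp).
    by rewrite real_normK ?num_real // lerDl sqr_ge0.
  have xp : 0 < `|x - x0| by apply: lt_le_trans rx.
  have z0 : 0 < (x - x0) ^+ 2 + s ^+ 2 by rewrite ltr_wpDl ?sqr_ge0 // exprn_gt0.
  have -> : W x s = complex.Im (f x s) * (x - x0) / ((x - x0) ^+ 2 + s ^+ 2) +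
     (U0 * s - s * complex.Re (f x s)) / ((x - x0) ^+ 2 + s ^+ 2).
    by rewrite /W ckern_im //; ring.
  apply: le_trans (ler_normD _ _) _; apply: lerD.
    rewrite normrM normrM normfV (gtr0_norm z0) -mulrA ler_wpM2l //.
    rewrite ler_pdivrMr // mulrC ler_pdivlMr //.
    apply: (@le_trans _ _ (`|x - x0| * `|x - x0|)); first by rewrite ler_wpM2l // ltW.
    by rewrite -expr2 real_normK ?num_real // lerDl sqr_ge0.
  rewrite normrM normfV (gtr0_norm z0); apply: ler_pM => //.
  - by rewrite invr_ge0 ltW.
  - apply: le_trans (ler_normB _ _) _.
    by rewrite !normrM (gtr0_norm sp) addrC.
  - by rewrite lef_pV2 // posrE exprn_gt0.
pose M := Kn + (KV / d + (KU * 2 + `|U0|) / d ^+ 2).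
have M0 : 0 <= M.
  by rewrite /M !addr_ge0 // divr_ge0 ?addr_ge0 ?mulr_ge0 ?exprn_ge0 // ltW.
have WM n x : `[A, B]%classic x -> `|W x (s_ n)| <= M.
  move=> xAB; have [xd|xd] := leP `|x - x0| d.
    have hz : 0 < normc (zz x (s_ n)) by apply: normc_gt0; exact: s0.
    have := hn x (s_ n) xd; rewrite s0 sd => /(_ isT) h.
    rewrite W_im //; apply: le_trans (Im_le_normc _) _; rewrite normcM normcV.
    rewrite ler_pdivrMr //; apply: le_trans h _; rewrite ler_wpM2r ?normc_ge0 // /M lerDl.
    by rewrite addr_ge0 // divr_ge0 ?addr_ge0 ?mulr_ge0 ?exprn_ge0 // ltW.
  apply: le_trans (Wle _ _ _ (s0 n) dpos (ltW xd)) _.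
  rewrite /M -[leLHS]add0r; apply: lerD => //; apply: lerD.
    by rewrite ler_pM2r ?invr_gt0 //; exact: hV.
  rewrite ler_pM2r ?invr_gt0 ?exprn_gt0 //; apply: lerD.
    apply: le_trans (sU n x xAB) _; rewrite ler_wpM2l //.
    have : Num.sqrt (s_ n) <= 1 by rewrite -(sqrtr1 R) ler_wsqrtr.
    by have := s1 n; lra.
  by rewrite ler_piMr.
pose c := pi / 2 / d0.
have c0 : 0 <= c by rewrite !divr_ge0 // ltW.
pose h n x := Num.max (`|W x (s_ n)| - c * \1_T x) 0.
have mW n : measurable_fun `[A, B] (W ^~ (s_ n)).
  by have /integrableP[/measurable_EFinP] :=
    @continuous_itv_integrable R _ A B (W_cont (s0 n)).
have mh n : measurable_fun `[A, B] (h n).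
  apply: measurable_maxr => //; apply: measurable_funB; first exact: measurableT_comp.
  by apply: measurable_funM => //; apply: measurable_funTS; exact: measurable_indic.
have h_ge0 n x : 0 <= h n x by rewrite /h le_max lexx orbT.
have hM n x : `[A, B]%classic x -> h n x <= M.
  move=> xAB; rewrite /h ge_max M0 andbT; apply: le_trans (WM n x xAB).
  by rewrite gerBl mulr_ge0 // indicE.
have ptw : {ae mu, forall x, `[A, B]%classic x -> (h n x)%:E @[n --> \oo] --> 0%E}.
  have nx0 : {ae mu, forall x : R, x != x0}.
    exists [set x0]; split => //; first by rewrite lebesgue_measure_set1.
    by move=> x /= /negP; rewrite negbK => /eqP.
  have FF := ae_filter_ringOfSetsType mu.
  apply: (@filterS2 _ _ FF _ _ _ _ flim nx0) => x hx xx0 xAB.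
  have r0 : 0 < `|x - x0| by rewrite normr_gt0 subr_eq0.
  pose r := `|x - x0|.
  apply: cvg_EFin; first by apply: nearW.
  apply/cvgrPdist_le => e e0.
  have er : 0 < e / 2 * r by rewrite !mulr_gt0 // invr_gt0.
  have [s1' s1'0 hs1] := hx _ er.
  have e2 : 0 < e / 2 * r ^+ 2 by rewrite mulr_gt0 ?divr_gt0 // exprn_gt0.
  have cv : (KU * (s_ n + Num.sqrt (s_ n)) + `|U0| * s_ n) @[n --> \oo] --> (0 : R).
    have -> : 0 = KU * (0 + Num.sqrt 0) + `|U0| * 0 :> R by rewrite sqrtr0 addr0 !mulr0 addr0.
    apply: (@cvgD _ R^o); apply: (@cvgM R); try exact: cvg_cst; last exact: s_cvg.
    apply: (@cvgD _ R^o); first exact: s_cvg.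
    by apply: continuous_cvg => //; exact: sqrt_continuous.
  near=> n; rewrite /= sub0r normrN (ger0_norm (h_ge0 n x)) /h ge_max (ltW e0) andbT.
  have sn : s_ n < s1'.
    near: n; move/cvgrPdist_lt: s_cvg => /(_ _ s1'0); apply: filterS => n.
    by rewrite sub0r normrN gtr0_norm.
  have k1 := Wle x (s_ n) r (s0 n) r0 (lexx _).
  have k2 : `|complex.Im (f x (s_ n))| / r <= c * \1_T x + e / 2.
    rewrite ler_pdivrMr //; apply: le_trans (hs1 _ _) _; first by rewrite s0 sn.
    rewrite [leRHS]mulrDl; apply: lerD; last exact: lexx.
    rewrite indicE; case: (boolP (x \in T)) => xT; last by rewrite !mulr0 mul0r.
    have rd : d0 <= r := T_d0 (set_mem xT).
    by rewrite !mulr1 /c mulrAC ler_pdivlMr // ler_wpM2l // divr_ge0 // ltW.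
  have k3 : (s_ n * `|complex.Re (f x (s_ n))| + `|U0| * s_ n) / r ^+ 2 <= e / 2.
    rewrite ler_pdivrMr ?exprn_gt0 //.
    apply: (@le_trans _ _ (KU * (s_ n + Num.sqrt (s_ n)) + `|U0| * s_ n)).
      by rewrite lerD2r; exact: sU.
    near: n; move/cvgrPdist_le: cv => /(_ _ e2); apply: filterS => n.
    by rewrite sub0r normrN; apply: le_trans; exact: ler_norm.
  by rewrite lerBlDr; lra.
have mu_fin : (mu `[A, B] < +oo)%E.
  have := @lebesgue_measure_itv R `[A, B]; rewrite /= => ->.
  by case: ifP => _; rewrite ?ltry // -EFinB ltry.
have iM : mu.-integrable `[A, B] (EFin \o (cst M : R -> R)).
  by apply: continuous_itv_integrable => x; exact: cvg_cst.
have ih n : mu.-integrable `[A, B] (EFin \o h n).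
  apply: measurable_bounded_integrable => //; first exact: mh.
  exists M; split; first exact: num_real.
  by move=> K KM x xAB; rewrite /= ger0_norm //; apply: le_trans (hM n x xAB) (ltW KM).
have hcv : (\int[mu]_(x in `[A, B]) h n x) @[n --> \oo] --> (0 : R).
  have [] := @dominated_convergence _ _ _ mu `[A, B]%classic (measurable_itv _)
    (fun n => EFin \o h n) (cst 0%E) (EFin \o (cst M : R -> R)).
  - by move=> n; apply/measurable_EFinP; exact: mh.
  - exact: measurable_cst.
  - exact: ptw.
  - exact: iM.
  - apply: aeW => x n xAB /=; rewrite lee_fin ger0_norm //; exact: hM.
  move=> _ _; rewrite integral_cst // mul0e => cv.
  exact: (@fine_cvg _ _ _ _ _ 0%R cv).
have iW n : mu.-integrable `[A, B] (EFin \o (W ^~ (s_ n))).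
  by apply: continuous_itv_integrable; exact: W_cont.
have iT : mu.-integrable `[A, B] (EFin \o (fun x => c * \1_T x)).
  apply: measurable_bounded_integrable => //.
    by apply: measurable_funM => //; apply: measurable_funTS; exact: measurable_indic.
  exists c; split; first exact: num_real.
  move=> K KM x xAB /=; rewrite indicE; case: (x \in T); rewrite ?mulr1 ?mulr0 ?normr0.
    by rewrite ger0_norm // ltW.
  by apply: ltW; apply: le_lt_trans KM.
have intT : \int[mu]_(x in `[A, B]) (c * \1_T x) <= c * tau.
  rewrite /Rintegral; under eq_integral do rewrite EFinM.
  rewrite ge0_integralZl //=; last first.
    by apply/measurable_EFinP; apply: measurable_funTS; exact: measurable_indic.
  rewrite integral_indic //.
  have le1 : (mu (T `&` `[A, B]) <= tau%:E)%E.
    apply: le_trans T_tau; apply: le_measure; rewrite ?inE //.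
    exact: measurableI.
  have fin1 : mu (T `&` `[A, B]) \is a fin_num.
    by rewrite ge0_fin_numE // (le_lt_trans le1) ?ltry.
  by rewrite fineM //= ler_wpM2l // -lee_fin fineK.
have bound n : `|U0| * (2 * atan (L / s_ n)) <= C / L + c * tau + \int[mu]_(x in `[A, B]) h n x.
  have pc : continuous (fun x => s_ n / ((x - x0) ^+ 2 + s_ n ^+ 2)).
    exact: poisson_cont.
  have ip : mu.-integrable `[A, B] (EFin \o (fun x => s_ n / ((x - x0) ^+ 2 + s_ n ^+ 2))).
    exact: continuous_itv_integrable.
  have iUp : mu.-integrable `[A, B] (EFin \o (fun x => U0 * (s_ n / ((x - x0) ^+ 2 + s_ n ^+ 2)))).
    by apply: continuous_itv_integrable => x; apply: (@cvgM R); [exact: cvg_cst|exact: pc].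
  have ik : mu.-integrable `[A, B] (EFin \o (fun x => complex.Im (ckern f x0 x (s_ n)))).
    by apply: continuous_itv_integrable; exact: ckern_im_cont.
  have EW : \int[mu]_(x in `[A, B]) W x (s_ n) = hint f x0 L (s_ n) + U0 * (2 * atan (L / s_ n)).
    by rewrite RintegralD // RintegralZl // poisson_int.
  have b1 : `|hint f x0 L (s_ n)| <= C / L by apply: hC => //; rewrite s0 s1.
  have b2 : `|\int[mu]_(x in `[A, B]) W x (s_ n)| <= c * tau + \int[mu]_(x in `[A, B]) h n x.
    apply: le_trans (le_normr_Rintegral _ (iW n)) _ => //.
    apply: (@le_trans _ _ (\int[mu]_(x in `[A, B]) (c * \1_T x + h n x))).
      apply: le_Rintegral => //.
      - by apply: continuous_itv_integrable => x; apply: cvg_norm; exact: W_cont.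
      - exact: (@integrableD _ _ R mu _ (measurable_itv _) _ _ iT (ih n)).
      - by move=> x _; rewrite -lerBlDl /h le_max lexx.
    by rewrite RintegralD // lerD2r.
  have at0 : 0 <= 2 * atan (L / s_ n).
    by rewrite mulr_ge0 // -(atan0 R) ltW // lt_atan // divr_gt0.
  rewrite -(ger0_norm at0) -normrM.
  have -> : U0 * (2 * atan (L / s_ n)) = \int[mu]_(x in `[A, B]) W x (s_ n) - hint f x0 L (s_ n).
    by rewrite EW; ring.
  apply: le_trans (ler_normB _ _) _.
  by rewrite [leLHS]addrC -addrA; exact: lerD.
apply/ler_addgt0Pr => e e0.
have lo n : 2 * atan (L / s_ n) >= pi - 2 * (s_ n / L).
  have := @atan_inv_bound R L (s_ n) (s0 n); rewrite gt_eqF // => /(_ isT).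
  rewrite gtr0_sg // mul1r (gtr0_norm L0) ler_norml => /andP[h1 _]; clear intT; lra.
have cv : (`|U0| * (2 * (s_ n / L)) + \int[mu]_(x in `[A, B]) h n x) @[n --> \oo] --> (0 : R).
  have -> : 0 = `|U0| * (2 * (0 / L)) + 0 :> R by rewrite mul0r !mulr0 addr0.
  apply: (@cvgD _ R^o) => //; apply: (@cvgM R); first exact: cvg_cst.
  apply: (@cvgM R); first exact: cvg_cst.
  by apply: (@cvgM R) => //; exact: cvg_cst.
move/cvgrPdist_le: cv => /(_ _ e0) [N _ /(_ N (leqnn N))] /=.
rewrite sub0r normrN => /(le_trans (ler_norm _)) hN.
have := ler_wpM2l (normr_ge0 U0) (lo N); move: (bound N) hN; rewrite mulrBr -/c.
by clear intT; move: (\int[mu]_(x in `[A, B]) h N x) => I; lra.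
Unshelve. all: by end_near. Qed.

End BoundaryValue.

(** * The logarithm of Green's function against a finite product *)
Section GreenLog.
Variable R : realType.
Variables (a b : int -> R) (C : R).
Hypothesis aC : forall n, `|a n| <= C.
Hypothesis bC : forall n, `|b n| <= C.
Hypothesis hz : forall z : R[i], 0 < complex.Im z -> exists M, inv_by (jacobi_shift a b z) M.

Definition gg (z : R[i]) : R[i] := gmat a b z 0 0.

Lemma dgreen_bound (z : R[i]) : 0 < complex.Im z ->
  normc (dgreen a b z) <= complex.Im (gg z) / complex.Im z.
Proof.
move=> y0; have [M iM] := hz y0.
pose u := gmat a b z ^~ 0; pose v := resolvent a b z u.
have uB : l2_le u M := l2_le_gmat 0 iM.
have vB := l2_le_resolvent iM uB.
apply/ler_addgt0Pr => e e0.
have [N h] := green_formula b aC uB vB e0.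
have := h N (leqnn N).
rewrite (eq_bigr (fun k => (if k == 0 then v k else 0) - u k ^+ 2)); last first.
  move=> k _; rewrite /u (gmat_jacobi _ _ iM).
  have -> : jacobi a b (resolvent a b z (gmat a b z ^~ 0)) k = z * v k + u k.
    by move/funeqP: (resolventK iM (l2_le_l2 uB)) => /(_ k) <-; rewrite /jacobi_shift -/v; ring.
  rewrite -/(v k); case: (k == 0) => /=; rewrite /u; ring.
rewrite big_split /= sumrN sum_win_delta; last by lia.
rewrite -[dgreen _ _ _]/(v 0) => h1.
rewrite -(subrK (\sum_(i <- win N) u i ^+ 2) (v 0)).
apply: le_trans (normcD _ _) _; rewrite addrC; apply: lerD => //.
rewrite ler_pdivlMr // mulrC.
apply: le_trans (gmat_im aC 0 iM (win_uniq N) y0).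
rewrite ler_pM2l //.
elim: (win N) => [|k s IH]; first by rewrite !big_nil normc0.
rewrite !big_cons; apply: le_trans (normcD _ _) _; apply: lerD => //.
by rewrite expr2 normcM expr2.
Qed.

Lemma im_gg_gt0 (z : R[i]) : 0 < complex.Im z -> 0 < complex.Im (gg z).
Proof.
move=> y0; have [M iM] := hz y0.
have C0 : 0 <= C by apply: le_trans (aC 0).
have := green_im_lower aC bC iM y0; rewrite -/(gg z) => h.
have k0 : 0 <= 3 * (C + normc z) ^+ 2 by rewrite mulr_ge0 // sqr_ge0.
by have := lt_le_trans y0 h; rewrite pmulr_rgt0 // lt_neqAle k0 andbT; apply/eqP => e0; move: (lt_le_trans y0 h); rewrite -e0 mul0r ltxx.
Qed.

Lemma gg_x (x y : R) : 0 < y -> cder (fun x => gg (x +i* y)%C) x (dgreen a b (x +i* y)%C).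
Proof.
move=> y0; have [M iM] := @hz (x +i* y)%C y0.
have M0 : 0 <= M by case: iM.
apply: (@cder_quad _ _ _ _ (2 * M ^+ 3) (2^-1 / (M + 1))) => [|h hh].
  by rewrite divr_gt0 ?invr_gt0 // ltr_wpDl.
have E : ((x + h) +i* y)%C - (x +i* y)%C = h%:C%C.
  by apply: complexP => /=; ring.
have hM : normc (((x + h) +i* y)%C - (x +i* y)%C) * M <= 2^-1.
  rewrite E normc_real; apply: le_trans (ler_wpM2r M0 hh) _.
  by rewrite -mulrA ler_piMr // mulrC ler_pdivrMr ?mul1r ?lerDl // ltr_wpDl.
have [_ h2 _] := green_zquad aC bC iM hM.
by move: h2; rewrite E normc_real (real_normK (num_real h)).
Qed.

Lemma gg_y (x y : R) : 0 < y -> cder (fun y => gg (x +i* y)%C) y ('i%C * dgreen a b (x +i* y)%C).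
Proof.
move=> y0; have [M iM] := @hz (x +i* y)%C y0.
have M0 : 0 <= M by case: iM.
apply: (@cder_quad _ _ _ _ (2 * M ^+ 3) (2^-1 / (M + 1))) => [|h hh].
  by rewrite divr_gt0 ?invr_gt0 // ltr_wpDl.
have E : (x +i* (y + h))%C - (x +i* y)%C = 'i%C * h%:C%C.
  by apply: complexP => /=; ring.
have ni : normc ('i%C * h%:C%C : R[i]) = `|h|.
  by rewrite normcM normc_real /= expr0n add0r expr1n sqrtr1 mul1r.
have hM : normc ((x +i* (y + h))%C - (x +i* y)%C) * M <= 2^-1.
  rewrite E ni; apply: le_trans (ler_wpM2r M0 hh) _.
  by rewrite -mulrA ler_piMr // mulrC ler_pdivrMr ?mul1r ?lerDl // ltr_wpDl.
have [_ h2 _] := green_zquad aC bC iM hM.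
have -> : h%:C%C * ('i%C * dgreen a b (x +i* y)%C) = 'i%C * h%:C%C * dgreen a b (x +i* y)%C by ring.
by move: h2; rewrite E ni (real_normK (num_real h)).
Qed.

Lemma ccont_lip (f : R -> R[i]) : (forall x : R, exists d K : R, 0 < d /\ forall x', `|x' - x| <= d ->
  normc (f x' - f x) <= K * `|x' - x|) -> ccont f.
Proof.
move=> H.
have main (p : R[i] -> R) : (forall z w, `|p z - p w| <= normc (z - w)) -> continuous (fun s => p (f s)).
  move=> hp x; apply/cvgrPdist_le => e e0; have [d [K [d0 hK]]] := H x.
  near=> x'; rewrite distrC; apply: le_trans (hp _ _) _.
  have xd : `|x' - x| <= d.
    by rewrite distrC; near: x'; exact: (@cvgr_dist_le _ _ _ _ _ id).
  have xe : `|x' - x| <= e / (`|K| + 1).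
    rewrite distrC; near: x'; apply: (@cvgr_dist_le _ _ _ _ _ id) => //.
    by rewrite divr_gt0 // ltr_wpDl.
  apply: le_trans (hK _ xd) _.
  apply: (@le_trans _ _ ((`|K| + 1) * `|x' - x|)).
    by rewrite ler_wpM2r // (le_trans (ler_norm K)) // lerDl.
  by rewrite mulrC -ler_pdivlMr // ltr_wpDl.
split.
- by apply: (main (@complex.Re R)) => z w; apply: le_trans (Re_le_normc _); rewrite Re_add Re_opp.
- by apply: (main (@complex.Im R)) => z w; apply: le_trans (Im_le_normc _); rewrite Im_add Im_opp.
Unshelve. all: by end_near. Qed.

Lemma dgreen_cont y : 0 < y -> ccont (fun x => dgreen a b (x +i* y)%C).
Proof.
move=> y0; apply: ccont_lip => x.
have [M iM] := @hz (x +i* y)%C y0.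
have M0 : 0 <= M by case: iM.
exists (2^-1 / (M + 1)), (6 * M ^+ 3); split.
  by rewrite divr_gt0 ?invr_gt0 // ltr_wpDl.
move=> x' hh.
have E : (x' +i* y)%C - (x +i* y)%C = (x' - x)%:C%C.
  by apply: complexP => /=; ring.
have hM : normc ((x' +i* y)%C - (x +i* y)%C) * M <= 2^-1.
  rewrite E normc_real; apply: le_trans (ler_wpM2r M0 hh) _.
  by rewrite -mulrA ler_piMr // mulrC ler_pdivrMr ?mul1r ?lerDl // ltr_wpDl.
have [_ _ h2] := green_zquad aC bC iM hM.
by move: h2; rewrite E normc_real.
Qed.

(** A pair (w, c) in wl stands for a factor (z - c)^w.  Total weight -1 makes the algebraic
    function as large as Green's function at infinity, so that flog decays there. *)
Variable wl : seq (R * R).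
Hypothesis wl1 : \sum_(p <- wl) p.1 = -1.

Definition llog (z : R[i]) : R[i] := \sum_(p <- wl) (p.1)%:C%C * logc (z - p.2%:C%C).
Definition dllog (z : R[i]) : R[i] := \sum_(p <- wl) (p.1)%:C%C * (z - p.2%:C%C)^-1.

Definition flog (x y : R) : R[i] := logc (gg (x +i* y)%C) - llog (x +i* y)%C.
Definition dflog (x y : R) : R[i] :=
  dgreen a b (x +i* y)%C * (gg (x +i* y)%C)^-1 - dllog (x +i* y)%C.

Lemma cder_sum (T : Type) (s : seq T) (f : T -> R -> R[i]) (t : R) d :
  (forall i, cder (f i) t (d i)) ->
  cder (fun u => \sum_(i <- s) f i u) t (\sum_(i <- s) d i).
Proof.
move=> h; elim: s => [|i s IH].
  rewrite big_nil; under eq_fun do rewrite big_nil.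
  by apply: (@cder_quad _ _ _ _ 0 1) => // e _; rewrite mulr0 !subr0 normc0 mul0r.
rewrite big_cons; under eq_fun do rewrite big_cons.
exact: cderD.
Qed.

Lemma cder_cst_mul (c : R) (f : R -> R[i]) (t : R) d : cder f t d ->
  cder (fun s => c%:C%C * f s) t (c%:C%C * d).
Proof.
move=> h; apply: cder_eq (@cderMr _ (fun=> c) 0 f t d _ h) _; last by rewrite mul0r add0r.
Qed.

Lemma zc_x (c x y : R) : cder (fun x => (x +i* y)%C - c%:C%C) x 1.
Proof.
apply: (@cder_quad _ _ _ _ 0 1) => // e _.
rewrite (_ : _ - _ = 0) ?normc0 ?mul0r //; apply: complexP => /=; ring.
Qed.

Lemma zc_y (c x y : R) : cder (fun y => (x +i* y)%C - c%:C%C) y 'i%C.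
Proof.
apply: (@cder_quad _ _ _ _ 0 1) => // e _.
rewrite (_ : _ - _ = 0) ?normc0 ?mul0r //; apply: complexP => /=; ring.
Qed.

Lemma zc_im (c x y : R) : complex.Im ((x +i* y)%C - c%:C%C) = y.
Proof. by rewrite /= subr0. Qed.

Lemma flog_x (x y : R) : 0 < y -> cder (flog ^~ y) x (dflog x y).
Proof.
move=> y0; apply: cderD.
  exact: cder_log (gg_x x y0) (im_gg_gt0 _).
apply: cderN; apply: cder_sum => p; apply: cder_cst_mul.
rewrite -[_^-1]mul1r; apply: cder_log; first exact: zc_x.
by rewrite zc_im.
Qed.

Lemma flog_y (x y : R) : 0 < y -> cder (flog x) y ('i%C * dflog x y).
Proof.
move=> y0; rewrite /dflog mulrBr; apply: cderD.
  rewrite mulrA; exact: cder_log (gg_y x y0) (im_gg_gt0 _).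
rewrite -mulrN; apply: cder_eq (_ : cder _ _ (- ('i%C * dllog (x +i* y)%C))) _; last by rewrite mulrN.
apply: cderN; rewrite mulr_sumr; apply: cder_sum => p.
rewrite mulrCA; apply: cder_cst_mul.
apply: cder_log; first exact: zc_y.
by rewrite zc_im.
Qed.

Lemma ccont_sum (T : Type) (s : seq T) (f : T -> R -> R[i]) : (forall i, ccont (f i)) ->
  ccont (fun u => \sum_(i <- s) f i u).
Proof.
move=> h; elim: s => [|i s IH].
  under eq_fun do rewrite big_nil.
  by split=> x; exact: cvg_cst.
under eq_fun do rewrite big_cons.
have : ccont (fun u => f i u - (0 - \sum_(j <- s) f j u)).
  by apply: ccontB => //; apply: ccontB => //; split=> x; exact: cvg_cst.
by under eq_fun do rewrite sub0r opprK.
Qed.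

Lemma dflog_cont y : 0 < y -> ccont (dflog ^~ y).
Proof.
move=> y0; apply: ccontB.
  apply: ccontM; first exact: dgreen_cont.
  exact: (cder_ccont (fun x => cderV (gg_x x y0) (im_gg_gt0 _))).
apply: ccont_sum => p; apply: ccontM; first by split=> x; exact: cvg_cst.
apply: (cder_ccont (fun x => cderV (zc_x p.2 x y) _)).
by move=> x; rewrite zc_im.
Qed.

Lemma normc_sum_le (T : Type) (s : seq T) (f : T -> R[i]) (B : T -> R) :
  (forall i, normc (f i) <= B i) -> normc (\sum_(i <- s) f i) <= \sum_(i <- s) B i.
Proof.
move=> h; elim: s => [|i s IH]; first by rewrite !big_nil normc0.
by rewrite !big_cons; apply: le_trans (normcD _ _) (lerD (h i) IH).
Qed.

Lemma zc_normc (c x y : R) : 0 < y -> y <= normc ((x +i* y)%C - c%:C%C).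
Proof.
by move=> y0; apply: le_trans (Im_le_normc _); rewrite zc_im ger0_norm // ltW.
Qed.

Lemma dflog_bound : exists K, forall x y : R, 0 < y -> normc (dflog x y) <= K / y.
Proof.
exists (1 + \sum_(p <- wl) `|p.1|) => x y y0.
rewrite mulrDl mul1r; apply: le_trans (normcB _ _) _; apply: lerD.
  have g0 := @im_gg_gt0 (x +i* y)%C y0.
  rewrite normcM normcV ler_pdivrMr ?normc_gt0 //.
  apply: le_trans (@dgreen_bound (x +i* y)%C y0) _.
  rewrite /= mulrC ler_pM2l ?invr_gt0 //.
  by apply: le_trans (ler_norm _) (Im_le_normc _).
rewrite mulr_suml; apply: normc_sum_le => p.
rewrite normcM normc_real ler_wpM2l // normcV.
have := zc_normc p.2 x y0 => h.
by rewrite lef_pV2 // posrE // (lt_le_trans y0).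
Qed.

Lemma Im_logc_bound (w : R[i]) : `|complex.Im (logc w)| <= pi / 2.
Proof.
by rewrite /logc /= normrN ler_norml ltW ?atan_gtNpi2 // ltW // atan_ltpi2.
Qed.

Lemma Im_llog z : complex.Im (llog z) = \sum_(p <- wl) p.1 * complex.Im (logc (z - p.2%:C%C)).
Proof.
rewrite /llog; elim: wl => [|p s IH]; first by rewrite !big_nil.
by rewrite !big_cons Im_add Im_mul /= mul0r addr0 -IH.
Qed.

Lemma Re_llog z : complex.Re (llog z) = \sum_(p <- wl) p.1 * complex.Re (logc (z - p.2%:C%C)).
Proof.
rewrite /llog; elim: wl => [|p s IH]; first by rewrite !big_nil.
by rewrite !big_cons Re_add Re_mul /= mul0r subr0 -IH.
Qed.

Lemma flog_im_bound : exists2 K, 0 <= K & forall x y : R, 0 < y -> `|complex.Im (flog x y)| <= K.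
Proof.
have pi0 := pi_ge0 R.
exists (pi / 2 + \sum_(p <- wl) `|p.1| * (pi / 2)).
  by rewrite addr_ge0 ?divr_ge0 // sumr_ge0 // => p _; rewrite mulr_ge0 // divr_ge0.
move=> x y y0; rewrite Im_add Im_opp; apply: le_trans (ler_normB _ _) _; apply: lerD.
  exact: Im_logc_bound.
rewrite Im_llog; apply: le_trans (ler_norm_sum _ _ _) _; apply: ler_sum => p _.
by rewrite normrM ler_wpM2l // Im_logc_bound.
Qed.

Lemma ln_sqrt_bound (t : R) : 0 < t -> `|ln t| <= 2 * (Num.sqrt t + (Num.sqrt t)^-1).
Proof.
move=> t0; have s0 : 0 < Num.sqrt t by rewrite sqrtr_gt0.
have E : ln t = 2 * ln (Num.sqrt t).
  by rewrite -[in LHS](sqr_sqrtr (ltW t0)) lnXn // mulr_natl.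
have h1 : ln (Num.sqrt t) <= Num.sqrt t.
  exact: ltW (ln_sublinear s0).
have h2 : - ln (Num.sqrt t) <= (Num.sqrt t)^-1.
  rewrite -lnV // ltW // ln_sublinear // invr_gt0 //.
have i0 : 0 < (Num.sqrt t)^-1 by rewrite invr_gt0.
by rewrite E ler_norml; lra.
Qed.

Lemma Re_logc (w : R[i]) : 0 < normc w -> complex.Re (logc w) = ln (normc w).
Proof. by move=> h; rewrite /logc /= lnXn // -mulr_natr; field. Qed.

Lemma flog_re_bound X : exists2 K, 0 <= K & forall x y : R, `|x| <= X -> 0 < y <= X ->
  `|complex.Re (flog x y)| <= K * (1 + (Num.sqrt y)^-1).
Proof.
have C0 : 0 <= C by apply: le_trans (aC 0).
pose m := 3 * (C + (X + X)) ^+ 2 + 1.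
have m0 : 0 < m by rewrite ltr_wpDl // mulr_ge0 // sqr_ge0.
pose Q p := 2 * (Num.sqrt (`|X| + `|X| + `|p : R|) + 1).
have Q0 p : 0 <= Q p by rewrite mulr_ge0 // addr_ge0 // sqrtr_ge0.
exists (2 * (1 + Num.sqrt m) + \sum_(p <- wl) `|p.1| * Q p.2).
  rewrite addr_ge0 ?mulr_ge0 ?addr_ge0 ?sqrtr_ge0 // sumr_ge0 // => p _.
  by rewrite mulr_ge0.
move=> x y xX /andP[y0 yX].
have X0 : 0 <= X by apply: le_trans xX.
have sy : 0 < Num.sqrt y by rewrite sqrtr_gt0.
have iy : 0 <= (Num.sqrt y)^-1 by rewrite invr_ge0 ltW.
have zb : normc (x +i* y)%C <= X + X.
  apply: le_trans (normc_le_ReIm _) _; rewrite /= (gtr0_norm y0); exact: lerD.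
rewrite Re_add Re_opp; apply: le_trans (ler_normB _ _) _; rewrite mulrDl; apply: lerD.
  have g0 := @im_gg_gt0 (x +i* y)%C y0.
  have n0 := normc_gt0 g0.
  rewrite Re_logc //; apply: le_trans (ln_sqrt_bound n0) _.
  have [M iM] := @hz (x +i* y)%C y0.
  have up := green_upper aC iM y0; have lo := green_im_lower aC bC iM y0.
  rewrite -/(gg _) /= in up lo.
  have u1 : Num.sqrt (normc (gg (x +i* y)%C)) <= (Num.sqrt y)^-1.
    rewrite -sqrtrV ?(ltW y0) // ler_wsqrtr //.
    by rewrite -[leRHS]mul1r ler_pdivlMr // mulrC.
  have u2 : (Num.sqrt (normc (gg (x +i* y)%C)))^-1 <= Num.sqrt m * (Num.sqrt y)^-1.
    have h : y <= m * normc (gg (x +i* y)%C).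
      apply: le_trans lo _; apply: ler_pM.
      - by rewrite mulr_ge0 // sqr_ge0.
      - exact: ltW.
      - rewrite /m; apply: (@le_trans _ _ (3 * (C + (X + X)) ^+ 2)); last by rewrite lerDl.
        rewrite ler_pM2l // ler_pXn2r ?nnegrE ?addr_ge0 ?sqrtr_ge0 //.
        by rewrite lerD2l.
      - by apply: le_trans (ler_norm _) (Im_le_normc _).
    rewrite -[leRHS]invrK lef_pV2 ?posrE ?sqrtr_gt0 //; last first.
      by rewrite invr_gt0 mulr_gt0 ?invr_gt0 // sqrtr_gt0.
    rewrite invfM invrK mulrC ler_pdivrMr ?sqrtr_gt0 // -sqrtrM ?normc_ge0 //.
    by rewrite ler_wsqrtr // mulrC.
  have ms : 0 <= Num.sqrt m := sqrtr_ge0 _.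
  nra.
rewrite Re_llog mulr_suml; apply: le_trans (ler_norm_sum _ _ _) _; apply: ler_sum => p _.
rewrite normrM -mulrA ler_wpM2l //.
have yn := zc_normc p.2 x y0.
have n0 : 0 < normc ((x +i* y)%C - p.2%:C%C) by apply: lt_le_trans yn.
rewrite Re_logc //; apply: le_trans (ln_sqrt_bound n0) _.
rewrite /Q -mulrA ler_pM2l //.
have u1 : Num.sqrt (normc ((x +i* y)%C - p.2%:C%C)) <= Num.sqrt (`|X| + `|X| + `|p.2|).
  rewrite ler_wsqrtr // (le_trans (normcB _ _)) // normc_real lerD2r (le_trans zb) //.
  by rewrite lerD // ler_norm.
have u2 : (Num.sqrt (normc ((x +i* y)%C - p.2%:C%C)))^-1 <= (Num.sqrt y)^-1.
  by rewrite lef_pV2; [exact: ler_wsqrtr|rewrite posrE sqrtr_gt0|rewrite posrE].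
have := sqrtr_ge0 (`|X| + `|X| + `|p.2|); nra.
Qed.

Lemma flog_decay : exists K R0, [/\ 0 <= K, 0 < R0 & forall x y : R, 0 < y ->
  R0 <= normc (x +i* y)%C -> normc (flog x y) <= K / normc (x +i* y)%C].
Proof.
have C0 : 0 <= C by apply: le_trans (aC 0).
pose B := \sum_(p <- wl) `|p.2|.
have B0 : 0 <= B by apply: sumr_ge0.
have pB p : p \in wl -> `|p.2| <= B.
  move=> pw; rewrite /B big_seq.
  rewrite -big_seq (perm_big _ (perm_to_rem pw)) big_cons lerDl.
  by apply: sumr_ge0.
exists (24 * C + \sum_(p <- wl) `|p.1| * (4 * `|p.2|)), (9 * C + 2 * B + 1); split.
- rewrite addr_ge0 ?mulr_ge0 // sumr_ge0 // => p _; rewrite !mulr_ge0 //.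
- by rewrite ltr_wpDl // addr_ge0 // mulr_ge0.
move=> x y y0; set z := (x +i* y)%C => hz9.
have z0 : 0 < normc z by apply: normc_gt0.
have [M iM] := @hz z y0.
have zI : 0 < complex.Im z by [].
have zn : z != 0 by exact: normc_neq0.
have zVI : 0 < complex.Im (- z^-1).
  by rewrite Im_opp Im_inv mulNr opprK divr_gt0 // exprn_gt0.
have -> : flog x y = (logc (gg z) - logc (- z^-1)) +
    \sum_(p <- wl) (p.1)%:C%C * (logc z - logc (z - p.2%:C%C)).
  have -> : \sum_(p <- wl) (p.1)%:C%C * (logc z - logc (z - p.2%:C%C)) =
     (\sum_(p <- wl) p.1)%:C%C * logc z - llog z.
    rewrite /llog; elim: wl => [|p s IH]; first by rewrite !big_nil mul0r subr0.
    by rewrite !big_cons IH rmorphD /=; ring.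
  by rewrite wl1 logc_oppV // rmorphN rmorph1 /flog -/z; ring.
rewrite mulrDl; apply: le_trans (normcD _ _) _; apply: lerD.
  have C3 : 3 * C < normc z by lra.
  have := green_infinity aC bC iM C3; rewrite -/(gg z) => hi.
  have p : 0 < normc z - 3 * C by rewrite subr_gt0.
  have e1 : normc (gg z - - z^-1) = normc (z * gg z + 1) / normc z.
    by rewrite -normcV -normcM opprK mulrDl mul1r mulrAC divff // mul1r.
  have e2 : normc (- z^-1) = (normc z)^-1 by rewrite normcN normcV.
  apply: le_trans (logc_lip (im_gg_gt0 zI) zVI _) _.
    rewrite e1 e2 ler_pM2r ?invr_gt0 //; apply: le_trans hi _.
    by rewrite ler_pdivrMr //; lra.
  rewrite e1 e2 invrK divfK ?gt_eqF //.
  apply: (@le_trans _ _ (4 * (3 * C / (normc z - 3 * C)))); first by rewrite ler_pM2l.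
  rewrite mulrA ler_pdivrMr // mulrAC ler_pdivlMr //.
  nra.
rewrite mulr_suml big_seq [leRHS]big_seq.
have -> : \sum_(i <- wl | i \in wl) (i.1)%:C%C * (logc z - logc (z - (i.2)%:C%C)) =
  \sum_(i <- [seq p <- wl | p \in wl]) (i.1)%:C%C * (logc z - logc (z - (i.2)%:C%C)).
  by rewrite big_filter.
rewrite -[leRHS]big_filter.
have : {subset [seq p <- wl | p \in wl] <= wl} by move=> p; rewrite mem_filter => /andP[].
elim: [seq p <- wl | p \in wl] => [|p s IH] sub; first by rewrite !big_nil normc0.
rewrite !big_cons; apply: le_trans (normcD _ _) _; apply: lerD; last first.
  by apply: IH => q qs; apply: sub; rewrite inE qs orbT.
have pw : p \in wl by apply: sub; rewrite inE eqxx.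
rewrite normcM normc_real -mulrA ler_wpM2l // -normcN opprB.
have e1 : normc (z - p.2%:C%C - z) = `|p.2|.
  by rewrite addrC addKr normcN normc_real.
apply: le_trans (logc_lip (_ : 0 < complex.Im (z - p.2%:C%C)) zI _) _.
- by rewrite zc_im.
- rewrite e1; have := pB _ pw; lra.
- by rewrite e1 mulrA.
Qed.

End GreenLog.

(** * The product formula for Green's function in a gap *)
Section ProductFormula.
Variable R : realType.
Local Notation mu := (@lebesgue_measure R).
Variables (a b : int -> R) (C : R).
Hypothesis aC : forall n, `|a n| <= C.
Hypothesis bC : forall n, `|b n| <= C.
Hypothesis hz : forall z : R[i], 0 < complex.Im z -> exists M, inv_by (jacobi_shift a b z) M.
Variables (E : set R) (I : countType) (Em Ep mu_ : I -> R) (e0 e1 : R).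
Hypothesis e01 : e0 < e1.
Hypothesis gap_in : forall k, [/\ e0 <= Em k, Em k < Ep k & Ep k <= e1].
Hypothesis gap_disj : forall k l, k != l -> Ep k <= Em l \/ Ep l <= Em k.
Hypothesis gap_cover : forall x, e0 <= x <= e1 -> ~ E x -> exists k, Em k < x < Ep k.
Hypothesis E_in : forall x, E x -> e0 <= x <= e1 /\ forall k, ~ (Em k < x < Ep k).
Hypothesis hr : forall x, ~ E x -> exists M, inv_by (jacobi_shift a b x%:C%C) M.
Definition gre (x : R) : R := complex.Re (gg a b x%:C%C).
Hypothesis refl : {ae mu, forall x : R, E x -> forall e : R, 0 < e -> exists2 s0 : R, 0 < s0 &
  forall s, 0 < s < s0 -> `|complex.Re (gg a b (x +i* s)%C)| <= e * complex.Im (gg a b (x +i* s)%C)}.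
Hypothesis mu_in : forall k, Em k <= mu_ k <= Ep k.
Hypothesis mu_sg : forall k x, Em k < x < Ep k -> x != mu_ k -> Num.sg (gre x) = Num.sg (x - mu_ k).
Hypothesis gre_left : forall x, x < e0 -> 0 < gre x.
Hypothesis gre_right : forall x, e1 < x -> gre x < 0.

(** The divisor of the approximating algebraic function: zeros at the mu_k and
    square-root branch points at the edges, for the gaps in K only. *)
Definition divisor (K : seq I) : seq (R * R) :=
  [:: (- 2^-1, e0); (- 2^-1, e1)] ++
  flatten [seq [:: (1, mu_ k); (- 2^-1, Em k); (- 2^-1, Ep k)] | k <- K].

Lemma sum_divisor (V : zmodType) (K : seq I) (F : R * R -> V) :
  \sum_(p <- divisor K) F p = F (- 2^-1, e0) + F (- 2^-1, e1) +
   \sum_(k <- K) (F (1, mu_ k) + F (- 2^-1, Em k) + F (- 2^-1, Ep k)).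
Proof.
rewrite /divisor big_cat /= !big_cons big_nil addr0; congr (_ + _).
rewrite big_flatten /= big_map; apply: eq_bigr => k _.
by rewrite !big_cons big_nil addr0 addrA.
Qed.

Lemma divisor_deg K : \sum_(p <- divisor K) p.1 = -1 :> R.
Proof.
rewrite sum_divisor /= big1 ?addr0; first by field.
by move=> k _; field.
Qed.

Definition sgsum K (x : R) : R := \sum_(p <- divisor K) p.1 * Num.sg (x - p.2).

Lemma sg_pos (x : R) : 0 < x -> Num.sg x = 1. Proof. exact: gtr0_sg. Qed.
Lemma sg_neg (x : R) : x < 0 -> Num.sg x = -1. Proof. exact: ltr0_sg. Qed.

Lemma gap_term_out k x : x < Em k \/ Ep k < x ->
  1 * Num.sg (x - mu_ k) + - 2^-1 * Num.sg (x - Em k) + - 2^-1 * Num.sg (x - Ep k) = 0.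
Proof.
have /andP[m1 m2] := mu_in k; have [_ lt _] := gap_in k.
move=> [h|h].
  have -> : Num.sg (x - mu_ k) = -1 by apply: sg_neg; lra.
  have -> : Num.sg (x - Em k) = -1 by apply: sg_neg; lra.
  have -> : Num.sg (x - Ep k) = -1 by apply: sg_neg; lra.
  by field.
have -> : Num.sg (x - mu_ k) = 1 by apply: sg_pos; lra.
have -> : Num.sg (x - Em k) = 1 by apply: sg_pos; lra.
have -> : Num.sg (x - Ep k) = 1 by apply: sg_pos; lra.
by field.
Qed.

Lemma gap_term_in k x : Em k < x < Ep k ->
  1 * Num.sg (x - mu_ k) + - 2^-1 * Num.sg (x - Em k) + - 2^-1 * Num.sg (x - Ep k)
  = Num.sg (x - mu_ k).
Proof.
move=> /andP[h1 h2].
have -> : Num.sg (x - Em k) = 1 by apply: sg_pos; lra.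
have -> : Num.sg (x - Ep k) = -1 by apply: sg_neg; lra.
by field.
Qed.

Lemma sgsum_nogap K x : (forall k, k \in K -> x < Em k \/ Ep k < x) ->
  sgsum K x = - 2^-1 * Num.sg (x - e0) + - 2^-1 * Num.sg (x - e1).
Proof.
move=> H; rewrite /sgsum sum_divisor /= big_seq big1 ?addr0 // => k kK.
exact: gap_term_out (H k kK).
Qed.

Lemma gap_other k l x : k != l -> Em k < x < Ep k -> x < Em l \/ Ep l < x.
Proof. by move=> /gap_disj[h|h] /andP[h1 h2]; [left|right]; lra. Qed.

Lemma sgsum_gap_in K k x : uniq K -> k \in K -> Em k < x < Ep k ->
  sgsum K x = Num.sg (x - mu_ k).
Proof.
move=> uK kK hx; have [h1 h2 h3] := gap_in k.
rewrite /sgsum sum_divisor /= (bigD1_seq k) //= gap_term_in // big1 ?addr0; last first.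
  by move=> l lk; apply: gap_term_out; apply: gap_other hx; rewrite eq_sym.
have -> : Num.sg (x - e0) = 1 by apply: sg_pos; lra.
have -> : Num.sg (x - e1) = -1 by apply: sg_neg; lra.
by field.
Qed.

Lemma sgsum_gap_out K k x : k \notin K -> Em k < x < Ep k -> sgsum K x = 0.
Proof.
move=> kK hx; have [h1 h2 h3] := gap_in k.
rewrite sgsum_nogap; last first.
  move=> l lK; apply: gap_other hx; apply: contraNneq kK => -> //.
have -> : Num.sg (x - e0) = 1 by apply: sg_pos; lra.
have -> : Num.sg (x - e1) = -1 by apply: sg_neg; lra.
by field.
Qed.

Definition cuts K : seq R := [seq p.2 | p <- divisor K].

Lemma cuts_edges K k : k \in K -> [/\ mu_ k \in cuts K, Em k \in cuts K & Ep k \in cuts K].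
Proof.
move=> kK.
have h p : p \in [:: (1, mu_ k); (- 2^-1, Em k); (- 2^-1, Ep k)] -> p \in divisor K.
  by move=> hp; rewrite mem_cat; apply/orP; right; apply/flatten_mapP; exists k.
split; apply/mapP.
- by exists (1, mu_ k) => //; apply: h; rewrite inE eqxx.
- by exists (- 2^-1, Em k) => //; apply: h; rewrite !inE eqxx orbT.
- by exists (- 2^-1, Ep k) => //; apply: h; rewrite !inE eqxx !orbT.
Qed.

Lemma cuts_e K : (e0 \in cuts K) /\ (e1 \in cuts K).
Proof. by split; rewrite /cuts /= !inE eqxx ?orbT. Qed.

Lemma sgsum_E K x : E x -> x \notin cuts K -> sgsum K x = 0.
Proof.
move=> Ex xc; have [/andP[x0 x1] ng] := E_in Ex.
have [c0 c1] := cuts_e K.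
have n0 : x != e0 by apply: contraNneq xc => ->.
have n1 : x != e1 by apply: contraNneq xc => ->.
rewrite sgsum_nogap.
  have -> : Num.sg (x - e0) = 1 by apply: sg_pos; rewrite subr_gt0 lt_neqAle eq_sym n0.
  have -> : Num.sg (x - e1) = -1 by apply: sg_neg; rewrite subr_lt0 lt_neqAle n1.
  by field.
move=> k kK; have [_ cm cp] := cuts_edges kK.
have nm : x != Em k by apply: contraNneq xc => ->.
have np : x != Ep k by apply: contraNneq xc => ->.
have [h|h] := ltP x (Em k); first by left.
right; rewrite lt_neqAle eq_sym np leNgt; apply/negP => h2; apply: (ng k).
by rewrite h2 lt_neqAle eq_sym nm h.
Qed.

(** Off E, and away from the gaps left out of K, Green's function and minus the algebraic
    function have the same argument. *)
Lemma sgsum_gre K x : uniq K -> ~ E x -> x \notin cuts K ->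
  (forall k, k \notin K -> ~ (Em k < x < Ep k)) -> Num.sg (gre x) = sgsum K x /\ gre x != 0.
Proof.
move=> uK nE xc hx; have h01 := e01.
have [xl|xl] := ltP x e0.
  have g0 := gre_left xl; split; last by rewrite gt_eqF.
  rewrite (sg_pos g0) sgsum_nogap; last by move=> k _; left; have [h _ _] := gap_in k; lra.
  have -> : Num.sg (x - e0) = -1 by apply: sg_neg; lra.
  have -> : Num.sg (x - e1) = -1 by apply: sg_neg; lra.
  by field.
have [xr|xr] := ltP e1 x.
  have g0 := gre_right xr; split; last by rewrite lt_eqF.
  rewrite (sg_neg g0) sgsum_nogap; last by move=> k _; right; have [_ _ h] := gap_in k; lra.
  have -> : Num.sg (x - e0) = 1 by apply: sg_pos; lra.
  have -> : Num.sg (x - e1) = 1 by apply: sg_pos; lra.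
  by field.
have [|k hk] := @gap_cover x _ nE; first by rewrite xl xr.
have kK : k \in K by apply: contrapT => /negP h; exact: hx k h hk.
have [cm _ _] := cuts_edges kK.
have nm : x != mu_ k by apply: contraNneq xc => ->.
split; first by rewrite (sgsum_gap_in uK kK hk); exact: mu_sg.
by rewrite -sgr_eq0 (mu_sg hk nm) sgr_eq0 subr_eq0.
Qed.

Definition resid (K : seq I) : set R := \bigcup_(k in [set k : I | k \notin K]) `]Em k, Ep k[%classic.

Lemma resid_measurable K : measurable (resid K).
Proof.
apply: open_measurable; apply: bigcup_open => k _; exact: interval_open.
Qed.

Lemma atan_abs (u : R) : `|atan u| <= `|u|.
Proof.
have := @mvt_le R atan (fun s => (1 + s ^+ 2)^-1) 0 u 1 (fun s => is_derive1_atan s).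
rewrite atan0 !subr0 mul1r; apply => s _.
have p1 : 0 < 1 + s ^+ 2 by rewrite ltr_pwDl // sqr_ge0.
by rewrite ger0_norm ?invr_ge0 ?(ltW p1) // invf_le1 // lerDl sqr_ge0.
Qed.

Lemma Im_llog_limit K (x s : R) : x \notin cuts K -> 0 < s ->
  `|complex.Im (llog (divisor K) (x +i* s)%C) + sgsum K x * (pi / 2)| <=
  s * \sum_(p <- divisor K) `|p.1| / `|x - p.2|.
Proof.
move=> xc s0; rewrite Im_llog /sgsum /cuts in xc *.
elim: (divisor K) xc => [|p l IH]; first by rewrite !big_nil mul0r addr0 normr0 mulr0.
rewrite inE negb_or => /andP[xp xl]; rewrite !big_cons.
have -> : p.1 * complex.Im (logc ((x +i* s)%C - (p.2)%:C%C)) +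
   \sum_(j <- l) j.1 * complex.Im (logc ((x +i* s)%C - (j.2)%:C%C)) +
   (p.1 * Num.sg (x - p.2) + \sum_(j <- l) j.1 * Num.sg (x - j.2)) * (pi / 2) =
   p.1 * (complex.Im (logc ((x +i* s)%C - (p.2)%:C%C)) + Num.sg (x - p.2) * (pi / 2)) +
   (\sum_(j <- l) j.1 * complex.Im (logc ((x +i* s)%C - (j.2)%:C%C)) +
   (\sum_(j <- l) j.1 * Num.sg (x - j.2)) * (pi / 2)) by ring.
apply: le_trans (ler_normD _ _) _; rewrite [leRHS]mulrDr; apply: lerD; last exact: IH.
rewrite normrM; have -> : s * (`|p.1| / `|x - p.2|) = `|p.1| * (s / `|x - p.2|) by rewrite mulrCA.
apply: ler_pM => //.
have xn : x - p.2 != 0 by rewrite subr_eq0.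
have := atan_inv_bound s0 xn; rewrite /logc /= subr0 -normrN opprB.
by rewrite addrC.
Qed.

Lemma gg_near_real x M : inv_by (jacobi_shift a b x%:C%C) M -> gg a b x%:C%C = (gre x)%:C%C.
Proof.
by move=> iM; apply: complexP => //=; exact: gmat_real 0 0 iM.
Qed.

Lemma gg_lip x M : inv_by (jacobi_shift a b x%:C%C) M -> forall w, normc (w - x%:C%C) * M <= 2^-1 ->
  normc (gg a b w - (gre x)%:C%C) <= 2 * M ^+ 2 * normc (w - x%:C%C).
Proof.
by move=> iM w hw; rewrite -(gg_near_real iM); have [h _ _] := green_zquad aC bC iM hw.
Qed.

Lemma logc_gg_near x : ~ E x -> gre x != 0 -> exists K d : R, [/\ 0 <= K, 0 < d &
  forall w, 0 < complex.Im w -> normc (w - x%:C%C) <= d ->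
  normc (logc (gg a b w) - (ln `|gre x| +i* (- (Num.sg (gre x) * (pi / 2))))%C) <= K * normc (w - x%:C%C)].
Proof.
move=> nE g0; have [M iM] := hr nE; have M0 : 0 <= M by case: iM.
have a0 : 0 < `|gre x| by rewrite normr_gt0.
have M2 : 0 <= 2 * M ^+ 2 by rewrite mulr_ge0 // sqr_ge0.
exists (8 * (2 * M ^+ 2) / `|gre x|), (Num.min (2^-1 / (M + 1)) (`|gre x| / 8 / (2 * M ^+ 2 + 1))); split.
- by rewrite divr_ge0 // mulr_ge0.
- by rewrite lt_min !divr_gt0 // ?invr_gt0 // ltr_wpDl.
move=> w w0; rewrite le_min => /andP[h1 h2].
apply: logc_near_real => //.
- exact: im_gg_gt0 aC bC hz _ w0.
- apply: gg_lip iM _ _; apply: le_trans (ler_wpM2r M0 h1) _.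
  by rewrite -mulrA ler_piMr // mulrC ler_pdivrMr ?mul1r ?lerDl // ltr_wpDl.
- apply: le_trans (ler_wpM2l M2 h2) _.
  by rewrite mulrCA ler_piMr ?divr_ge0 ?(ltW a0) // ler_pdivrMr ?mul1r ?lerDl // ltr_wpDl.
Qed.

(** On E the argument of Green's function tends to pi/2 by the reflectionless property, and so
    does the argument of minus the algebraic function. *)
Lemma flog_limit K : uniq K -> {ae mu, forall x : R, forall e : R, 0 < e ->
  exists2 s0 : R, 0 < s0 & forall s, 0 < s < s0 ->
  `|complex.Im (flog a b (divisor K) x s)| <= (pi / 2) * \1_(resid K) x + e}.
Proof.
move=> uK.
have nc : {ae mu, forall x : R, x \notin cuts K}.
  exists [set` cuts K]; split => //.
  - apply: countable_measurable; first by move=> t; exact: measurable_set1.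
    by apply: finite_set_countable; exact: finite_seq.
  - by apply: countable_lebesgue_measure0; apply: finite_set_countable; exact: finite_seq.
  - by move=> x /= /negP; rewrite negbK.
have FF := ae_filter_ringOfSetsType mu.
apply: (@filterS2 _ _ FF _ _ _ _ refl nc) => x hx xc e ep.
have pi0 := pi_ge0 R.
set S := \sum_(p <- divisor K) `|p.1| / `|x - p.2|.
have S0 : 0 <= S by apply: sumr_ge0 => p _; rewrite divr_ge0.
have IL s := Im_llog_limit (s := s) xc; rewrite -/S in IL.
have s10 : 0 < e / 2 / (S + 1) by rewrite !divr_gt0 // ltr_wpDl.
have ILe s : 0 < s < e / 2 / (S + 1) ->
   `|complex.Im (llog (divisor K) (x +i* s)%C) + sgsum K x * (pi / 2)| <= e / 2.
  move=> /andP[p h]; apply: le_trans (IL s p) _.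
  move/ltW: h; rewrite ler_pdivlMr ?ltr_wpDl // => h.
  by apply: le_trans h; rewrite ler_wpM2l ?lerDl // ltW.
have ind_ge0 : 0 <= (pi / 2 * \1_(resid K) x : R).
  have i0 : 0 <= (\1_(resid K) x : R) by rewrite indicE; exact: ler0n.
  by rewrite mulr_ge0 // divr_ge0.
have [Ex|nE] := pselect (E x).
  have [s2 s20 hs2] := hx Ex (e / 2) (divr_gt0 ep (ltr0n R 2)).
  exists (Num.min s2 (e / 2 / (S + 1))); first by rewrite lt_min s20.
  move=> s; rewrite lt_min => /and3P[p h1 h2].
  have h3 := ILe s; rewrite p h2 sgsum_E // mul0r addr0 in h3.
  have {}h3 := h3 isT.
  apply: (@le_trans _ _ e); last by rewrite lerDr.
  rewrite /flog Im_add Im_opp; apply: le_trans (ler_normB _ _) _.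
  rewrite [leRHS](splitr e); apply: lerD => //.
  have g0 : 0 < complex.Im (gg a b (x +i* s)%C) by exact: (im_gg_gt0 aC bC hz).
  rewrite /logc /= normrN; apply: le_trans (atan_abs _) _.
  rewrite normrM normfV (gtr0_norm g0) ler_pdivrMr //; apply: hs2.
  by rewrite p h1.
have [[k kK hk]|nk] := pselect (exists2 k, k \notin K & Em k < x < Ep k).
  have -> : \1_(resid K) x = 1 :> R.
    by rewrite indicE mem_set //; exists k => //=; rewrite in_itv.
  exists (e / 2 / (S + 1)) => // s hs; rewrite mulr1.
  have h3 := ILe s hs; rewrite (sgsum_gap_out kK hk) mul0r addr0 in h3.
  rewrite /flog Im_add Im_opp; apply: le_trans (ler_normB _ _) _.
  by apply: lerD; [exact: Im_logc_bound|lra].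
have hx' k : k \notin K -> ~ (Em k < x < Ep k) by move=> kK hk; apply: nk; exists k.
have [sg0 g0] := sgsum_gre uK nE xc hx'.
have [K1 [d [K10 d0 hK1]]] := logc_gg_near nE g0.
pose s3 := e / 2 / (K1 + 1).
have s30 : 0 < s3 by rewrite !divr_gt0 // ltr_wpDl.
exists (Num.min (Num.min d s3) (e / 2 / (S + 1))); first by rewrite !lt_min d0 s30.
move=> s; rewrite !lt_min => /andP[p /andP[/andP[h1 h1'] h2]].
have h3 := ILe s; rewrite p h2 in h3; have {}h3 := h3 isT.
have zE : (x +i* s)%C - x%:C%C = (0 +i* s)%C by apply: complexP => /=; ring.
have nz : normc ((x +i* s)%C - x%:C%C) = s.
  by rewrite zE /= expr0n add0r sqrtr_sqr gtr0_norm.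
have := hK1 (x +i* s)%C p; rewrite nz => /(_ (ltW h1)) /(le_trans (Im_le_normc _)).
rewrite Im_add Im_opp /= opprK sg0 => h4.
apply: (@le_trans _ _ e); last by rewrite lerDr.
rewrite /flog Im_add Im_opp.
have -> : complex.Im (logc (gg a b (x +i* s)%C)) - complex.Im (llog (divisor K) (x +i* s)%C) =
  (complex.Im (logc (gg a b (x +i* s)%C)) + sgsum K x * (pi / 2)) -
  (complex.Im (llog (divisor K) (x +i* s)%C) + sgsum K x * (pi / 2)) by ring.
apply: le_trans (ler_normB _ _) _; rewrite [leRHS](splitr e); apply: lerD => //.
apply: le_trans h4 _; move/ltW: h1'; rewrite /s3 ler_pdivlMr ?ltr_wpDl // => h.
by apply: le_trans h; rewrite mulrC ler_wpM2l ?lerDl // ltW.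
Qed.

(** The boundary value of flog at a point of a gap in K, where the arguments cancel. *)
Definition ulog K x : R := ln `|gre x| - \sum_(p <- divisor K) p.1 * ln `|x - p.2|.

Lemma llog_near (l : seq (R * R)) (x : R) : x \notin [seq p.2 | p <- l] -> exists K d : R, [/\ 0 <= K, 0 < d &
  forall w : R[i], 0 < complex.Im w -> normc (w - x%:C%C) <= d ->
  normc (llog l w - ((\sum_(p <- l) p.1 * ln `|x - p.2|) +i*
     (- ((\sum_(p <- l) p.1 * Num.sg (x - p.2)) * (pi / 2))))%C) <= K * normc (w - x%:C%C)].
Proof.
elim: l => [|p l IH].
  move=> _; exists 0, 1; split=> // w _ _; rewrite /llog !big_nil mul0r oppr0 mul0r.
  by rewrite (_ : _ - _ = 0) ?normc0 //; apply: complexP => /=; ring.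
rewrite inE negb_or => /andP[xp xl]; have [K [d [K0 d0 hK]]] := IH xl.
have xn : x - p.2 != 0 by rewrite subr_eq0.
have a0 : 0 < `|x - p.2| by rewrite normr_gt0.
exists (`|p.1| * (8 * 1 / `|x - p.2|) + K), (Num.min d (`|x - p.2| / 8)); split.
- by rewrite addr_ge0 // mulr_ge0 // divr_ge0.
- by rewrite lt_min d0 divr_gt0.
move=> w w0; rewrite le_min => /andP[h1 h2].
have E0 : w - (p.2)%:C%C - (x - p.2)%:C%C = w - x%:C%C by rewrite rmorphB /=; ring.
have wI : 0 < complex.Im (w - (p.2)%:C%C) by rewrite Im_add Im_opp /= subr0.
have h3 := @logc_near_real R (x - p.2) 1 (w - (p.2)%:C%C) (normc (w - x%:C%C)) xn wI.
rewrite E0 mul1r in h3; have {}h3 := h3 (lexx _) h2.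
rewrite /llog !big_cons -/(llog l w).
set A := logc _ in h3 *; set B := llog l w.
have -> : p.1%:C%C * A + B - ((p.1 * ln `|x - p.2| + \sum_(j <- l) j.1 * ln `|x - j.2|) +i*
     (- ((p.1 * Num.sg (x - p.2) + \sum_(j <- l) j.1 * Num.sg (x - j.2)) * (pi / 2))))%C =
  p.1%:C%C * (A - (ln `|x - p.2| +i* (- (Num.sg (x - p.2) * (pi / 2))))%C) +
  (B - ((\sum_(p <- l) p.1 * ln `|x - p.2|) +i*
     (- ((\sum_(p <- l) p.1 * Num.sg (x - p.2)) * (pi / 2))))%C).
  by case: (A) (B) => a1 a2 [b1 b2]; apply: complexP => /=; ring.
rewrite [leRHS]mulrDl; apply: le_trans (normcD _ _) _; apply: lerD; last exact: hK.
rewrite normcM normc_real -[leRHS]mulrA; apply: ler_pM => //; exact: normc_ge0.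
Qed.

(** The difference of the two logarithms has a boundary argument of size at most pi/2, carried
    by the omitted gaps; boundary_value_bound turns it into a bound on its real part. *)
Theorem product_estimate K j x (tau : R) : uniq K -> j \in K -> Em j < x < Ep j ->
  x != mu_ j -> (mu (resid K) <= tau%:E)%E ->
  2 * Num.min (x - Em j) (Ep j - x) * `|ulog K x| <= tau.
Proof.
move=> uK jK hx xm htau; have /andP[x1 x2] := hx.
have nE : ~ E x by move=> Ex; have [_ h] := E_in Ex; exact: h j hx.
have xc : x \notin cuts K.
  rewrite /cuts; apply/negP => /mapP[p]; rewrite mem_cat => /orP[].
    have [g1 g2 g3] := gap_in j.
    by rewrite !inE => /orP[] /eqP -> /= h; lra.
  move=> /flatten_mapP[k kK]; have [<-|jk] := eqVneq j k.
    rewrite !inE => /or3P[] /eqP -> /= h; [|lra|lra].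
    by rewrite h eqxx in xm.
  have /andP[m1 m2] := mu_in k; have [_ g2 _] := gap_in k.
  by have := gap_other jk hx; rewrite !inE => o /or3P[] /eqP -> /= h; lra.
have g0 : gre x != 0 by rewrite -sgr_eq0 (mu_sg hx xm) sgr_eq0 subr_eq0.
have sE : Num.sg (gre x) = sgsum K x by rewrite (sgsum_gap_in uK jK hx) (mu_sg hx xm).
have wl1 := divisor_deg K.
apply: (@boundary_value_bound R (flog a b (divisor K)) (dflog a b (divisor K)) x (ulog K x) _ tau (resid K)).
- by move=> u y y0; exact: flog_x aC bC hz _ _ _ y0.
- exact: (flog_re_bound aC bC hz).
- exact: flog_im_bound.
- apply: (hint_bound (F := dflog a b (divisor K))).
  + by move=> u y y0; exact: flog_x aC bC hz _ _ _ y0.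
  + by move=> u y y0; exact: flog_y aC bC hz _ _ _ y0.
  + by move=> y y0; exact: dflog_cont aC bC hz _ _ y0.
  + exact: (dflog_bound aC bC hz).
  + exact: (flog_re_bound aC bC hz).
  + exact: flog_im_bound.
  + exact: (flog_decay aC bC hz wl1).
- have [K1 [d1 [K10 d10 h1]]] := logc_gg_near nE g0.
  have [K2 [d2 [K20 d20 h2]]] := llog_near xc.
  pose d := Num.min d1 d2.
  exists (K1 + K2), (d / 2); split; first exact: addr_ge0.
    by rewrite divr_gt0 // lt_min d10.
  move=> u y ud /andP[y0 yd].
  have zE : (u +i* y)%C - x%:C%C = ((u - x) +i* y)%C by apply: complexP => /=; ring.
  have nz : normc ((u - x) +i* y)%C <= d.
    apply: le_trans (normc_le_ReIm _) _; rewrite /= (gtr0_norm y0) [leRHS](splitr d).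
    exact: lerD.
  move: (nz); rewrite {1}/d le_min => /andP[n1 n2].
  have := h1 (u +i* y)%C y0; have := h2 (u +i* y)%C y0; rewrite zE => /(_ n2) k2 /(_ n1) k1.
  rewrite mulrDl; apply: le_trans (lerD k1 k2).
  apply: le_trans (normcB _ _).
  rewrite le_eqVlt; apply/orP; left; apply/eqP; congr normc.
  rewrite /flog /ulog sE /sgsum.
  set A := logc _; set B := llog _ _.
  by case: (A) (B) => a1 a2 [b1 b2]; apply: complexP => /=; ring.
- exact: resid_measurable.
- exact: htau.
- by rewrite lt_min; apply/andP; split; lra.
- move=> u [k /= kK]; rewrite in_itv /= => hu.
  have jk : k != j by apply: contraNneq kK => ->.
  have [_ hj _] := gap_in j.
  rewrite ge_min; case: (gap_other jk hu) => h; apply/orP.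
    by left; rewrite ler0_norm; lra.
  by right; rewrite ger0_norm; lra.
- exact: flog_limit.
Qed.

End ProductFormula.

(** * Gaps of a Craig-type set *)
Section SummableTail.
Variables (R : realType) (I : choiceType) (P : pred I) (w : I -> R).
Hypothesis w0 : forall k, P k -> 0 <= w k.

Lemma summable_tail S : (forall s : seq I, uniq s -> all P s -> \sum_(k <- s) w k <= S) ->
  forall e, 0 < e -> exists s0 : seq I, forall s : seq I, uniq s -> all P s ->
    (forall k, k \in s -> k \notin s0) -> \sum_(k <- s) w k <= e.
Proof.
move=> hS e ep.
pose A : set R := [set x | exists s : seq I, [/\ uniq s, all P s & x = \sum_(k <- s) w k]].
have hA : has_sup A.
  split; first by exists 0, [::]; rewrite big_nil.
  by exists S => _ [s [us Ps ->]]; exact: hS.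
have [_ [s0 [us0 Ps0 ->]] hs0] := sup_adherent ep hA.
exists s0 => s us Ps dis.
have : \sum_(k <- s0 ++ s) w k <= sup A.
  apply: sup_upper_bound => //; exists (s0 ++ s); split=> //.
    rewrite cat_uniq us0 us andbT -all_predC /=; apply/allP => k ks /=; exact: dis.
  by rewrite all_cat Ps0.
by rewrite big_cat /=; lra.
Qed.

End SummableTail.

Section GapGeometry.
Variables (R : realType) (E : set R) (I : countType) (Em Ep : I -> R).
Local Notation mu := (@lebesgue_measure R).
Hypothesis mE : (0 < mu E)%E.
Hypothesis gfE : gap_family E Em Ep.
Local Notation e0 := (inf E).
Local Notation e1 := (sup E).

Lemma gap_E_in x : E x -> e0 <= x <= e1 /\ forall k, ~ (Em k < x < Ep k).
Proof.
have [_ _ EE] := gfE; rewrite [X in X x]EE => -[/= + h]; rewrite in_itv /= => h1.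
by split=> // k hk; apply: h; exists k => //=; rewrite in_itv.
Qed.

Lemma gap_E_cover x : e0 <= x <= e1 -> ~ E x -> exists k, Em k < x < Ep k.
Proof.
have [_ _ EE] := gfE => hx nE; apply: contrapT => h; apply: nE; rewrite EE; split.
  by rewrite /= in_itv.
by move=> [k _ /=]; rewrite in_itv /= => hk; apply: h; exists k.
Qed.

Lemma gap_E_nonempty : exists x, E x.
Proof.
apply: contrapT => h; move: mE; rewrite (_ : E = set0) ?measure0 ?ltxx //.
by apply/seteqP; split=> // x Ex; apply: h; exists x.
Qed.

Lemma gap_e01 : e0 < e1.
Proof.
rewrite ltNge; apply/negP => h.
have /subset_set1[E0|E1] : E `<=` [set e0].
- by move=> x /gap_E_in[/andP[h1 h2] _]; apply/eqP; rewrite eq_le h1 (le_trans h2 h).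
- by move: mE; rewrite E0 measure0 ltxx.
- by move: mE; rewrite E1 lebesgue_measure_set1 ltxx.
Qed.

Lemma gap_E_inf : has_inf E.
Proof. by split; [exact: gap_E_nonempty | exists e0 => x /gap_E_in[/andP[]]]. Qed.

Lemma gap_E_sup : has_sup E.
Proof. by split; [exact: gap_E_nonempty | exists e1 => x /gap_E_in[/andP[]]]. Qed.

Lemma gap_range k : [/\ e0 <= Em k, Em k < Ep k & Ep k <= e1].
Proof.
have [hg _ _] := gfE; have [lt sub mx] := hg k.
have nE x : Em k < x -> x < Ep k -> ~ E x.
  by move=> h1 h2; apply: sub; rewrite /= in_itv /= h1.
split=> //.
- rewrite leNgt; apply/negP => h.
  have pe : Ep k <= e0.
    rewrite leNgt; apply/negP => h2.
    have d0 : 0 < Ep k - e0 by rewrite subr_gt0.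
    have [x Ex hx] := inf_adherent d0 gap_E_inf.
    have [/andP[x0 _] _] := gap_E_in Ex.
    by apply: (nE x) => //; lra.
  have [||m1 _] := mx (Em k - 1) (Ep k).
  + by move=> x; rewrite /= !in_itv /= => /andP[h1 h2]; apply/andP; split=> //; lra.
  + move=> x; rewrite /= in_itv /= => /andP[h1 h2] Ex.
    by have [/andP[x0 _] _] := gap_E_in Ex; lra.
  by lra.
- rewrite leNgt; apply/negP => h.
  have pe : e1 <= Em k.
    rewrite leNgt; apply/negP => h2.
    have d0 : 0 < e1 - Em k by rewrite subr_gt0.
    have [x Ex hx] := sup_adherent d0 gap_E_sup.
    have [/andP[_ x0] _] := gap_E_in Ex.
    by apply: (nE x) => //; lra.
  have [||_ m1] := mx (Em k) (Ep k + 1).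
  + by move=> x; rewrite /= !in_itv /= => /andP[h1 h2]; apply/andP; split=> //; lra.
  + move=> x; rewrite /= in_itv /= => /andP[h1 h2] Ex.
    by have [/andP[_ x0] _] := gap_E_in Ex; lra.
  by lra.
Qed.

(** Two overlapping gaps have a connected union, which by maximality is each of them. *)
Lemma gap_disjoint k l : k != l -> Ep k <= Em l \/ Ep l <= Em k.
Proof.
move=> /eqP kl; have [hg inj _] := gfE.
have [|h1] := leP (Ep k) (Em l); first by left.
have [|h2] := leP (Ep l) (Em k); first by right.
exfalso; apply: kl; apply: inj.
have [lk sk mk] := hg k; have [ll sl ml] := hg l.
have sub : `]Num.min (Em k) (Em l), Num.max (Ep k) (Ep l)[%classic `<=` ~` E.
  move=> x; rewrite /= in_itv /= gt_min lt_max => /andP[/orP hm /orP hp].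
  have [hxk|nk] := pselect (Em k < x < Ep k); first by apply: sk; rewrite /= in_itv.
  apply: sl; rewrite /= in_itv /=; apply/andP; split.
    case: hm => // hm; case: hp => hp; first by exfalso; apply: nk; rewrite hm.
    by rewrite ltNge; apply/negP => h3; apply: nk; rewrite hm; lra.
  case: hp => // hp; case: hm => hm; first by exfalso; apply: nk; rewrite hm.
  by rewrite ltNge; apply/negP => h3; apply: nk; rewrite hp andbT; lra.
have [|a1 a2] := mk _ _ _ sub.
  move=> x; rewrite /= !in_itv /= gt_min lt_max => /andP[c1 c2].
  by rewrite c1 c2.
have [|c1 c2] := ml _ _ _ sub.
  move=> x; rewrite /= !in_itv /= gt_min lt_max => /andP[d1 d2].
  by rewrite d1 d2 !orbT.
by rewrite -a1 -a2 c1 c2.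
Qed.

Hypothesis craig : craig_condition E Em Ep.

Definition wgt j k : R := gap_length Em Ep k / gap_dist Em Ep j k.

Lemma gap_dist_ge0 j k : 0 <= gap_dist Em Ep j k.
Proof. by rewrite /gap_dist le_min !normr_ge0. Qed.

(** An infinite sum, or a vanishing denominator, would make the first or the second supremum
    of the Craig-type condition infinite. *)
Lemma craig_esum j :
  (\esum_(k in [set k | k != j]) ((gap_length Em Ep k)%:E / (gap_dist Em Ep j k)%:E) < +oo)%E
  /\ gap_edge_dist E Em Ep j != 0.
Proof.
have [c1 c2 _] := craig; have [g1 g2 g3] := gap_range j.
set X := esum _ _.
have X0 : (0 <= X)%E.
  apply: esum_ge0 => k _; have [_ h _] := gap_range k.
  by rewrite mule_ge0 ?lee_fin ?inve_ge0 ?lee_fin ?gap_dist_ge0 // subr_ge0 ltW.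
have s0 : 0 < Num.sqrt (e1 - e0 - gap_edge_dist E Em Ep j).
  rewrite sqrtr_gt0 /gap_edge_dist.
  have : Num.min `|Ep j - e1| `|Em j - e0| <= Em j - e0.
    by rewrite ge_min (ger0_norm (x := Em j - e0)) ?lexx ?orbT // subr_ge0.
  by lra.
have L0 : 0 < gap_length Em Ep j by rewrite subr_gt0.
have c1j : ((gap_length Em Ep j)%:E * craig_const E Em Ep j < +oo)%E.
  by apply: le_lt_trans c1; apply: ereal_sup_ubound; exists j.
have c2j : ((gap_length Em Ep j)%:E / (gap_edge_dist E Em Ep j)%:E * craig_const E Em Ep j < +oo)%E.
  by apply: le_lt_trans c2; apply: ereal_sup_ubound; exists j.
split.
  rewrite ltey; apply/eqP => Xy; move: c1j; rewrite /craig_const -/X Xy.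
  by rewrite gt0_muley ?lte_fin ?invr_gt0 //= gt0_muley ?lte_fin // gt0_muley ?lte_fin.
apply/eqP => n0; move: c2j; rewrite n0 inve0 gt0_muley ?lte_fin // gt0_mulye //.
rewrite /craig_const mule_gt0 ?lte_fin //; apply: expeR_gt0.
by apply: lt_le_trans (mule_ge0 _ X0); rewrite ?ltNyr // lee_fin invr_ge0.
Qed.

Lemma gap_dist_gt0 j k : k != j -> 0 < gap_dist Em Ep j k.
Proof.
move=> kj; rewrite lt_neqAle gap_dist_ge0 andbT eq_sym; apply/eqP => g0.
have [/lt_geF h _] := craig_esum j; move/negP: (negbT h); apply.
have [_ hk _] := gap_range k.
apply: esum_ge; exists [set k]; first by split; [exact: finite_set1 | move=> l /= ->].
by rewrite fsbig_set1 g0 inve0 gt0_muley // lte_fin subr_gt0.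
Qed.

Lemma wgt_ge0 j k : k != j -> 0 <= wgt j k.
Proof. by move=> kj; have [_ h _] := gap_range k; rewrite divr_ge0 ?gap_dist_ge0 // subr_ge0 ltW. Qed.

Lemma wgt_tail j e : 0 < e -> exists s0 : seq I, forall s : seq I, uniq s ->
  (forall k, k \in s -> k != j /\ k \notin s0) -> \sum_(k <- s) wgt j k <= e.
Proof.
move=> ep; have [hX _] := craig_esum j; set X := esum _ _ in hX.
have hS s : uniq s -> all (fun k => k != j) s -> \sum_(k <- s) wgt j k <= fine X.
  move=> us /allP Ps.
  have le1 : ((\sum_(k <- s) wgt j k)%:E <= X)%E.
    apply: esum_ge; exists [set` s].
      by split; [exact: finite_seq | move=> k /= /Ps].
    rewrite -fsbig_seq // -sumEFin le_eqVlt; apply/orP; left; apply/eqP.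
    apply: eq_big_seq => k /Ps kj.
    by rewrite inver gt_eqF ?gap_dist_gt0.
  rewrite -lee_fin fineK //; rewrite ge0_fin_numE //; apply: le_trans le1.
  by rewrite lee_fin big_seq sumr_ge0 // => k /Ps; exact: wgt_ge0.
have [s0 hs0] := summable_tail hS ep.
exists s0 => s us h; apply: hs0 => //.
- by apply/allP => k /h[].
- by move=> k /h[].
Qed.

Lemma gap_edges j : e0 < Em j /\ Ep j < e1.
Proof.
have [_ n0] := craig_esum j; have [g1 g2 g3] := gap_range j.
split; rewrite lt_neqAle ?g1 ?g3 andbT; apply: contraNneq n0 => h.
  rewrite eq_le /gap_edge_dist le_min !normr_ge0 ge_min h.
  by rewrite subrr normr0 lexx orbT.
by rewrite eq_le /gap_edge_dist le_min !normr_ge0 ge_min h subrr normr0 lexx.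
Qed.

Lemma gap_side j k : k != j ->
  Em k - Ep j >= gap_dist Em Ep j k \/ Em j - Ep k >= gap_dist Em Ep j k.
Proof.
move=> kj; have [h|h] := gap_disjoint kj; [right|left]; rewrite /gap_dist ge_min.
  by rewrite (ger0_norm (x := Em j - Ep k)) ?lexx ?orbT // subr_ge0.
by rewrite distrC (ger0_norm (x := Em k - Ep j)) ?lexx // subr_ge0.
Qed.

(** The total length of the gaps outside a large finite set is small, because
    gamma_k <= (sup E - inf E) gamma_k / eta_jk. *)
Lemma resid_tail (j : I) e : 0 < e -> exists s0 : seq I, forall K : seq I,
  {subset s0 <= K} -> (mu (resid Em Ep K) <= e%:E)%E.
Proof.
move=> ep; have d0 : 0 < e1 - e0 by rewrite subr_gt0 gap_e01.
have [s0 hs0] := wgt_tail j (divr_gt0 ep d0).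
exists (j :: s0) => K sK.
have hlen s : uniq s -> (forall k, k \in s -> k \notin K) -> \sum_(k <- s) (Ep k - Em k) <= e.
  move=> us hs.
  have h : \sum_(k <- s) wgt j k <= e / (e1 - e0).
    apply: hs0 => // k ks; split.
      by apply: contraNneq (hs k ks) => ->; apply: sK; rewrite mem_head.
    by apply: contra (hs k ks) => k0; apply: sK; rewrite inE k0 orbT.
  move: h; rewrite ler_pdivlMr // => h; apply: le_trans h.
  rewrite mulr_suml big_seq [leRHS]big_seq; apply: ler_sum => k ks.
  have kj : k != j by apply: contraNneq (hs k ks) => ->; apply: sK; rewrite mem_head.
  have [k1 k2 k3] := gap_range k; have [j1 j2 j3] := gap_range j.
  have gp := gap_dist_gt0 kj.
  rewrite /wgt mulrAC ler_pdivlMr //; apply: ler_wpM2l; first by rewrite subr_ge0 ltW.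
  rewrite /gap_dist ge_min; apply/orP; left.
  by rewrite ler_norml; apply/andP; split; lra.
pose F (n : nat) : set R := if pickle_inv n is Some k then
   (if k \in K then set0 else `]Em k, Ep k[%classic) else set0.
have mF n : measurable (F n) by rewrite /F; case: pickle_inv => // k; case: ifP.
apply: (@le_trans _ _ (\sum_(0 <= n <oo) mu (F n))%E).
  apply: (@measure_sigma_subadditive _ _ _ mu _ _ mF (resid_measurable Em Ep K)).
  move=> x [k /= kK hx]; exists (choice.pickle k) => //.
  by rewrite /F pickleK_inv (negbTE kK).
apply: lime_le; first by apply: is_cvg_nneseries => n _ _; exact: measure_ge0.
apply: nearW => N.
have -> : (\sum_(0 <= n < N) mu (F n) =
  (\sum_(k <- [seq k <- pmap pickle_inv (iota 0 N) | k \notin K]) (Ep k - Em k))%:E)%E.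
  rewrite -sumEFin big_filter [RHS]big_mkcond /= big_pmap /index_iota subn0.
  apply: eq_bigr => n _; rewrite /F; case: pickle_inv => [k|] /=; last by rewrite measure0.
  case: ifP => //= _; rewrite ?measure0 // lebesgue_measure_itv /= lte_fin.
  by have [_ -> _] := gap_range k; rewrite EFinN EFinB.
rewrite lee_fin; apply: hlen; last by move=> k; rewrite mem_filter => /andP[].
by rewrite filter_uniq // (pmap_uniq (@pickle_invK I)) // iota_uniq.
Qed.

(** ** The infinite product over the other gaps *)
Definition fac k (x m : R) : R := (Em k - x) * (Ep k - x) / (m - x) ^+ 2.

(** The quotient p q / m^2 lies between p / q and q / p, and ln (q / p) <= (q - p) / p. *)
Lemma fac_bound_pos (p q m d : R) : 0 < d -> d <= p -> p <= m -> m <= q ->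
  0 < p * q / m ^+ 2 /\ `|ln (p * q / m ^+ 2)| <= (q - p) / d.
Proof.
move=> d0 dp pm mq; have p0 : 0 < p by apply: lt_le_trans dp.
have m0 : 0 < m by apply: lt_le_trans pm.
have q0 : 0 < q by apply: lt_le_trans mq.
have F0 : 0 < p * q / m ^+ 2 by rewrite divr_gt0 ?mulr_gt0 // exprn_gt0.
have qp0 : 0 < q / p by rewrite divr_gt0.
split=> //.
have lb : ln (q / p) <= (q - p) / d.
  have -> : q / p = 1 + (q - p) / p by field; rewrite gt_eqF.
  apply: (@le_trans _ _ ((q - p) / p)).
    by apply: le_ln1Dx; apply: lt_le_trans (_ : 0 <= _); rewrite ?ltrN10 // divr_ge0 ?(ltW p0) // subr_ge0 (le_trans pm).
  by apply: ler_wpM2l; [rewrite subr_ge0 (le_trans pm) | rewrite lef_pV2 ?posrE].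
rewrite ler_norml; apply/andP; split.
  rewrite lerNl; apply: le_trans lb; rewrite -lnV ?posrE // ler_ln ?posrE ?invr_gt0 //.
  rewrite invf_div ler_pdivrMr ?mulr_gt0 // mulrAC ler_pdivlMr //.
  have : m ^+ 2 <= q ^+ 2 by rewrite ler_sqr ?nnegrE ?(ltW m0) ?(ltW q0).
  by nra.
apply: le_trans lb; rewrite ler_ln ?posrE // ler_pdivrMr ?exprn_gt0 // mulrAC ler_pdivlMr //.
have : p ^+ 2 <= m ^+ 2 by rewrite ler_sqr ?nnegrE ?(ltW m0) ?(ltW p0).
by nra.
Qed.

Lemma fac_bound j k x m : k != j -> Em j <= x <= Ep j -> Em k <= m <= Ep k ->
  0 < fac k x m /\ `|ln (fac k x m)| <= wgt j k.
Proof.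
move=> kj /andP[x1 x2] /andP[m1 m2]; have gp := gap_dist_gt0 kj.
have [h|h] := gap_side kj.
  have -> : wgt j k = ((Ep k - x) - (Em k - x)) / gap_dist Em Ep j k.
    by rewrite /wgt /gap_length; congr (_ / _); ring.
  by apply: fac_bound_pos => //; lra.
have -> : wgt j k = ((x - Em k) - (x - Ep k)) / gap_dist Em Ep j k.
  by rewrite /wgt /gap_length; congr (_ / _); ring.
have -> : fac k x m = (x - Ep k) * (x - Em k) / (x - m) ^+ 2.
  by rewrite /fac -(opprB x m) sqrrN; congr (_ / _); ring.
by apply: fac_bound_pos => //; lra.
Qed.

Definition lsum j (x : R) (m : I -> R) (K : seq I) : R :=
  \sum_(k <- K | k != j) ln (fac k x (m k)).

Definition wprod j (x : R) (m : I -> R) : R :=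
  infinite_prod (fun k => k != j) (fun k => fac k x (m k)).

Lemma lsum_tail j e : 0 < e -> exists s0 : {fset I}, forall x m,
  Em j <= x <= Ep j -> (forall k, Em k <= m k <= Ep k) ->
  forall A K : {fset I}, (s0 `<=` K)%fset -> (K `<=` A)%fset ->
  `|lsum j x m A - lsum j x m K| <= e.
Proof.
move=> ep; have [s hs] := wgt_tail j ep.
exists [fset k in s]%fset => x m hx hm A K /fsubsetP sK /fsubsetP KA.
have -> : lsum j x m A - lsum j x m K =
   \sum_(k <- [seq k <- A | (k != j) && (k \notin K)]) ln (fac k x (m k)).
  rewrite /lsum (bigID (fun k => k \in K)) /= big_filter addrC.
  rewrite [X in _ + X - _](_ : _ = \sum_(k <- K | k != j) ln (fac k x (m k))) ?addrK //.
  under eq_bigl do rewrite andbC.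
  rewrite -big_filter_cond; apply: perm_big; apply: uniq_perm; rewrite ?filter_uniq ?fset_uniq //.
  by move=> k; rewrite mem_filter; case kK: (k \in K) => //=; rewrite KA.
apply: le_trans (ler_norm_sum _ _ _) _.
apply: (@le_trans _ _ (\sum_(k <- [seq k <- A | (k != j) && (k \notin K)]) wgt j k)).
  rewrite big_seq [leRHS]big_seq; apply: ler_sum => k; rewrite mem_filter => /andP[/andP[kj _] _].
  by have [_] := fac_bound kj hx (hm k).
apply: hs; first by rewrite filter_uniq // fset_uniq.
move=> k; rewrite mem_filter => /andP[/andP[kj kK] _]; split=> //.
by apply: contra kK => ks; apply: sK; rewrite inE.
Qed.

(** The finite set s0 is the same for all points x and all data m, because the logarithms of
    the factors are dominated by the weights gamma_k / eta_jk. *)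
Lemma wprod_tail j e : 0 < e -> exists s0 : {fset I}, forall x m,
  Em j <= x <= Ep j -> (forall k, Em k <= m k <= Ep k) -> 0 < wprod j x m /\
  forall K : {fset I}, (s0 `<=` K)%fset -> `|ln (wprod j x m) - lsum j x m K| <= e.
Proof.
move=> ep; have [s0 hs0] := lsum_tail j ep; exists s0 => x m hx hm.
pose L (A : {fset I}) : R := lsum j x m A.
have LE (A : {fset I}) : \prod_(k <- A | k != j) fac k x (m k) = expR (L A).
  rewrite /L /lsum (big_morph _ (@expRD R) (@expR0 R)); apply: eq_bigr => k kj.
  by rewrite lnK // posrE; have [] := fac_bound kj hx (hm k).
have Lcvg : cvg (L @ totally).
  have PF : ProperFilter (L @ totally) by apply: fmap_proper_filter; exact: totally_filter.
  apply/cauchy_cvgP; apply/cauchyP => d d0.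
  have [s1 hs1] := lsum_tail j (divr_gt0 d0 (ltr0n R 2)).
  exists (L s1); exists s1 => // A /= sA; rewrite /ball /= distrC.
  apply: le_lt_trans (hs1 x m hx hm A s1 (fsubset_refl _) sA) _.
  by rewrite ltr_pdivrMr // ltr_pMr // ltr1n.
have WE : wprod j x m = expR (lim (L @ totally)).
  rewrite /wprod /infinite_prod; apply: cvg_lim; first exact: Rhausdorff.
    exact: totally_filter.
  under eq_fun do rewrite LE.
  have ce := @continuous_expR R (lim (L @ totally)).
  exact: (cvg_comp L (@expR R) Lcvg ce).
rewrite WE expR_gt0 expRK; split=> // K sK; apply/ler_addgt0Pr => d d0.
have FT : Filter (nbhs (@totally I)) by have [_ FT] := @totally_filter I.
have [s1 _ hs1] := (@cvgrPdist_le _ R _ _ FT _ _).1 Lcvg d d0.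
pose A := (s1 `|` K)%fset.
have -> : lim (L @ totally) - lsum j x m K = (lim (L @ totally) - L A) + (L A - L K) by rewrite /L; ring.
apply: le_trans (ler_normD _ _) _; rewrite addrC; apply: lerD.
  by apply: hs0 => //; exact: fsubsetUr.
by apply: hs1; exact: fsubsetUl.
Qed.

Lemma wprod_gt0 j x m : Em j <= x <= Ep j -> (forall k, Em k <= m k <= Ep k) -> 0 < wprod j x m.
Proof. by move=> hx hm; have [s0 h] := wprod_tail j (@ltr01 R); have [] := h x m hx hm. Qed.

Lemma wprod_lower j : exists2 c : R, 0 < c & forall x m,
  Em j <= x <= Ep j -> (forall k, Em k <= m k <= Ep k) -> c <= wprod j x m.
Proof.
have [s0 h] := wprod_tail j (@ltr01 R).
exists (expR (- (1 + \sum_(k <- s0 | k != j) wgt j k))); first exact: expR_gt0.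
move=> x m hx hm; have [W0 hW] := h x m hx hm.
rewrite -[leRHS]lnK ?posrE // ler_expR.
have := hW s0 (fsubset_refl _); rewrite ler_norml => /andP[h1 _].
have : `|lsum j x m s0| <= \sum_(k <- s0 | k != j) wgt j k.
  apply: le_trans (ler_norm_sum _ _ _) _; apply: ler_sum => k kj.
  by have [_] := fac_bound kj hx (hm k).
by rewrite ler_norml => /andP[h2 _]; lra.
Qed.

(** By the uniform tails, only finitely many factors have to be followed. *)
Lemma wprod_cvg j (T : Type) (F : set_system T) {FF : Filter F} (x : T -> R) (m : T -> I -> R) x0 m0 :
  (forall s, Em j <= x s <= Ep j) -> (forall s k, Em k <= m s k <= Ep k) ->
  Em j <= x0 <= Ep j -> (forall k, Em k <= m0 k <= Ep k) ->
  x s @[s --> F] --> x0 -> (forall k, m s k @[s --> F] --> m0 k) ->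
  wprod j (x s) (m s) @[s --> F] --> wprod j x0 m0.
Proof.
move=> hx hm hx0 hm0 cx cm.
suff cl : ln (wprod j (x s) (m s)) @[s --> F] --> ln (wprod j x0 m0).
  have W0 s := wprod_gt0 (hx s) (hm s); have W00 := wprod_gt0 hx0 hm0.
  have -> : (fun s => wprod j (x s) (m s)) = (fun s => expR (ln (wprod j (x s) (m s)))).
    by apply/funext => s; rewrite lnK // posrE.
  by rewrite -[X in _ --> X]lnK ?posrE //; apply: continuous_cvg cl; exact: continuous_expR.
apply/cvgrPdist_le => e ep.
have e3 : 0 < e / 3 by rewrite divr_gt0.
have [s0 hs0] := wprod_tail j e3.
have cL : lsum j (x s) (m s) s0 @[s --> F] --> lsum j x0 m0 s0.
  rewrite /lsum; elim: (enum_fset s0) => [|k l IH].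
    by under eq_fun do rewrite big_nil; rewrite big_nil; exact: cvg_cst.
  under eq_fun do rewrite big_cons.
  rewrite big_cons; case: ifP => // kj; apply: cvgD => //.
  have [f0 _] := fac_bound kj hx0 (hm0 k).
  have mx0 : (m0 k - x0) ^+ 2 != 0.
    by apply: contraTneq f0 => h; rewrite /fac h invr0 mulr0 ltxx.
  apply: (continuous_cvg _ (continuous_ln f0)).
  apply: cvgM.
    by apply: cvgM; apply: cvgB => //; exact: cvg_cst.
  by apply: cvgV => //; apply: cvgM; apply: cvgB.
near=> s.
have hs : `|lsum j x0 m0 s0 - lsum j (x s) (m s) s0| <= e / 3.
  by near: s; exact: (cvgrPdist_le _ _).1 cL _ e3.
have [_ h1] := hs0 _ _ hx0 hm0; have [_ h2] := hs0 _ _ (hx s) (hm s).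
have := h1 s0 (fsubset_refl _); have := h2 s0 (fsubset_refl _); move: hs.
by rewrite !ler_norml => /andP[? ?] /andP[? ?] /andP[? ?]; apply/andP; split; lra.
Unshelve. all: by end_near. Qed.

End GapGeometry.

(** * Dirichlet data and Green's function at a fixed time *)
Section FixedTime.
Variables (R : realType) (E : set R) (I : countType) (Em Ep : I -> R).
Local Notation mu := (@lebesgue_measure R).
Hypothesis mE : (0 < mu E)%E.
Hypothesis gfE : gap_family E Em Ep.
Local Notation e0 := (inf E).
Local Notation e1 := (sup E).
Variables (a b : int -> R) (C : R).
Hypothesis aC : forall n, `|a n| <= C.
Hypothesis bC : forall n, `|b n| <= C.
Hypothesis hr : forall x, ~ E x -> exists M, inv_by (jacobi_shift a b x%:C%C) M.

Lemma gre_derive x : ~ E x ->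
  is_derive x 1 (gre a b) (complex.Re (dgreen a b x%:C%C)).
Proof.
move=> nE; have [M iM] := hr nE; have M0 : 0 <= M by case: iM.
apply: (@is_derive_quad _ _ _ _ (2 * M ^+ 3) (2^-1 / (M + 1))).
  by rewrite divr_gt0 ?invr_gt0 // ltr_wpDl.
move=> h hh.
have wz : (x + h)%:C%C - x%:C%C = h%:C%C by rewrite rmorphD /=; ring.
have hw : normc ((x + h)%:C%C - x%:C%C) * M <= 2^-1.
  rewrite wz normc_real; apply: le_trans (ler_wpM2r M0 hh) _.
  by rewrite -mulrA ler_piMr // mulrC ler_pdivrMr ?mul1r ?lerDl // ltr_wpDl.
have [_ h2 _] := green_zquad aC bC iM hw.
rewrite wz normc_real real_normK ?num_real // in h2.
apply: le_trans h2; apply: le_trans (Re_le_normc _).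
by rewrite /gre /gg !Re_add !Re_opp Re_mul /= mul0r subr0.
Qed.

Lemma gre_lt x y : x < y -> (forall s, x <= s <= y -> ~ E s) -> gre a b x < gre a b y.
Proof.
move=> xy h.
have dv s : x <= s <= y -> is_derive s 1 (gre a b) (complex.Re (dgreen a b s%:C%C)).
  by move=> hs; apply: gre_derive; exact: h.
have [c hc eq] : exists2 c, c \in `]x, y[%R &
   gre a b y - gre a b x = complex.Re (dgreen a b c%:C%C) * (y - x).
  apply: (MVT xy (df := fun s => complex.Re (dgreen a b s%:C%C))).
    by move=> s; rewrite in_itv /= => /andP[h1 h2]; apply: dv; rewrite !ltW.
  apply: derivable_within_continuous => s; rewrite in_itv /= => hs.
  by case: (dv s hs).
rewrite -subr_gt0 eq mulr_gt0 ?subr_gt0 //.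
have [|M iM] := @hr c.
  by apply: h; move: hc; rewrite in_itv /= => /andP[h1 h2]; rewrite !ltW.
exact: (dgreen_gt0 aC iM).
Qed.

Lemma gre_far x : ~ E x -> 6 * C < `|x| -> x * gre a b x < 0.
Proof.
move=> nE hx; have [M iM] := hr nE.
have C0 : 0 <= C by apply: le_trans (aC 0).
have h3 : 3 * C < normc x%:C%C by rewrite normc_real; lra.
have := green_infinity aC bC iM h3; rewrite normc_real => h.
have : `|x * gre a b x + 1| < 1.
  apply: le_lt_trans (_ : normc (x%:C%C * gmat a b x%:C%C 0 0 + 1) < 1).
    apply: le_trans (Re_le_normc _); rewrite Re_add Re_mul /= mul0r subr0 //.
  apply: le_lt_trans h _; rewrite ltr_pdivrMr; lra.
by rewrite ltr_norml => /andP[_]; lra.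
Qed.

Lemma gre_left_pos x : x < e0 -> 0 < gre a b x.
Proof.
move=> xl; have C0 : 0 <= C by apply: le_trans (aC 0).
pose y := Num.min (x - 1) (- (6 * C + 1)).
have yx : y < x by rewrite /y gt_min; apply/orP; left; lra.
have y6 : y <= - (6 * C + 1) by rewrite /y ge_min lexx orbT.
have nE s : s <= x -> ~ E s by move=> sx /(gap_E_in gfE)[/andP[h _] _]; lra.
have lt1 : gre a b y < gre a b x by apply: gre_lt => // s /andP[_ h]; exact: nE.
have ny : `|y| = - y by rewrite ler0_norm //; lra.
have := @gre_far y (nE y (ltW yx)); rewrite ny => h.
have {}h : y * gre a b y < 0 by apply: h; lra.
have y0 : y < 0 by lra.
by rewrite nmulr_rlt0 // in h; lra.
Qed.

Lemma gre_right_neg x : e1 < x -> gre a b x < 0.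
Proof.
move=> xl; have C0 : 0 <= C by apply: le_trans (aC 0).
pose y := Num.max (x + 1) (6 * C + 1).
have yx : x < y by rewrite /y lt_max; apply/orP; left; lra.
have y6 : 6 * C + 1 <= y by rewrite /y le_max lexx orbT.
have nE s : x <= s -> ~ E s by move=> sx /(gap_E_in gfE)[/andP[_ h] _]; lra.
have lt1 : gre a b x < gre a b y by apply: gre_lt => // s /andP[h _]; exact: nE.
have ny : `|y| = y by rewrite ger0_norm //; lra.
have := @gre_far y (nE y (ltW yx)); rewrite ny => h.
have {}h : y * gre a b y < 0 by apply: h; lra.
have y0 : 0 < y by lra.
by rewrite pmulr_rlt0 // in h; lra.
Qed.

Lemma green_gre x : ~ E x -> green a b 0 x%:C%C = (gre a b x)%:C%C.
Proof. by move=> nE; have [M iM] := hr nE; exact: (gg_near_real iM). Qed.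

(** All three alternatives in the definition of the Dirichlet datum say that Green's
    function has the sign of x - mu on the gap. *)
Lemma dirichlet_muP l r : l < r -> (forall x, l < x < r -> ~ E x) ->
  l <= dirichlet_mu a b l r <= r /\
  forall x, l < x < r -> Num.sg (gre a b x) = Num.sg (x - dirichlet_mu a b l r).
Proof.
move=> lr nE.
have inc x y : l < x -> x < y -> y < r -> gre a b x < gre a b y.
  move=> h1 h2 h3; apply: gre_lt => // s /andP[s1 s2]; apply: nE.
  by rewrite (lt_le_trans h1 s1) (le_lt_trans s2 h3).
have zero x y : l < x -> x < y -> y < r -> gre a b x <= 0 -> 0 <= gre a b y ->
    exists2 c, l < c < r & gre a b c = 0.
  move=> h1 h2 h3 h4 h5.
  have [c] : exists2 c, c \in `[x, y]%R & gre a b c = 0.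
    apply: IVT; [exact: ltW| |by rewrite ge_min le_max h4 h5 orbT].
    apply: derivable_within_continuous => s; rewrite in_itv /= => /andP[s1 s2].
    have [|//] := @gre_derive s; apply: nE.
    by rewrite (lt_le_trans h1 s1) (le_lt_trans s2 h3).
  by rewrite in_itv /= => /andP[c1 c2] c0; exists c => //; rewrite (lt_le_trans h1 c1) (le_lt_trans c2 h3).
set S := [set m | [\/ l < m < r /\ green a b 0 m%:C%C = 0,
      m = r /\ (forall x, l < x < r -> green a b 0 x%:C%C < 0) |
      m = l /\ (forall x, l < x < r -> 0 < green a b 0 x%:C%C)]].
have Sex : exists m, S m.
  have [[c hc c0]|nz] := pselect (exists2 c, l < c < r & gre a b c = 0).
    by exists c; apply: Or31; split=> //; rewrite green_gre ?c0 //; exact: nE.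
  pose c := (l + r) / 2.
  have hc1 : l < c by rewrite /c; lra.
  have hc2 : c < r by rewrite /c; lra.
  have nz' x : l < x < r -> gre a b x != 0 by move=> hx; apply/eqP => x0; apply: nz; exists x.
  have [h|h|h] := ltgtP (gre a b c) 0; last by exfalso; apply: nz; exists c; rewrite ?hc1.
    exists r; apply: Or32; split=> // x hx; rewrite green_gre; last exact: nE.
    rewrite -[0]/(0%:C%C) ltcR ltNge; apply/negP => x0; case/andP: (hx) => x1 x2.
    apply: nz; have [xc|xc|xc] := ltgtP x c.
    - by have := inc _ _ x1 xc hc2; lra.
    - exact: (zero c x hc1 xc x2 (ltW h) x0).
    - by move: h; rewrite -xc; lra.
  exists l; apply: Or33; split=> // x hx; rewrite green_gre; last exact: nE.
  rewrite -[0]/(0%:C%C) ltcR ltNge; apply/negP => x0; case/andP: (hx) => x1 x2.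
  apply: nz; have [xc|xc|xc] := ltgtP x c.
  - exact: (zero x c x1 xc hc2 x0 (ltW h)).
  - by have := inc _ _ hc1 xc x2; lra.
  - by move: h; rewrite -xc; lra.
have := xgetPex l Sex; rewrite -/(dirichlet_mu a b l r); set m := dirichlet_mu _ _ _ _.
have pos x y : 0 < x -> 0 < y -> Num.sg x = Num.sg y :> R by move=> h1 h2; rewrite !gtr0_sg.
have neg x y : x < 0 -> y < 0 -> Num.sg x = Num.sg y :> R by move=> h1 h2; rewrite !ltr0_sg.
case=> [[/andP[m1 m2] gm]|[-> gm]|[-> gm]].
- rewrite green_gre in gm; last by apply: nE; rewrite m1.
  move: gm => [gm]; split; first by rewrite !ltW.
  move=> x /andP[x1 x2]; have [xm|xm|->] := ltgtP x m.
  + by apply: neg; [rewrite -gm; exact: inc | rewrite subr_lt0].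
  + by apply: pos; [rewrite -gm; exact: inc | rewrite subr_gt0].
  + by rewrite gm subrr.
- split; first by rewrite ltW /=.
  move=> x hx; have := gm x hx; rewrite green_gre; last exact: nE.
  rewrite -[0]/(0%:C%C) ltcR => g0; apply: neg => //; rewrite subr_lt0; by case/andP: hx.
- split; first by rewrite lexx ltW.
  move=> x hx; have := gm x hx; rewrite green_gre; last exact: nE.
  rewrite -[0]/(0%:C%C) ltcR => g0; apply: pos => //; rewrite subr_gt0; by case/andP: hx.
Qed.

Definition dmu k : R := dirichlet_mu a b (Em k) (Ep k).

Lemma gap_notin k x : Em k < x < Ep k -> ~ E x.
Proof. by move=> hx /(gap_E_in gfE)[_ h]; exact: h k hx. Qed.

Lemma dmu_in k : Em k <= dmu k <= Ep k.
Proof. by have [_ lt _] := gap_range mE gfE k; have [] := dirichlet_muP lt (@gap_notin k). Qed.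

Lemma dmu_sg k x : Em k < x < Ep k -> Num.sg (gre a b x) = Num.sg (x - dmu k).
Proof.
by have [_ lt _] := gap_range mE gfE k; have [_ h] := dirichlet_muP lt (@gap_notin k); exact: h.
Qed.

Hypothesis craig : craig_condition E Em Ep.
Hypothesis hz : forall z : R[i], 0 < complex.Im z -> exists M, inv_by (jacobi_shift a b z) M.
Hypothesis refl : {ae mu, forall x : R, E x -> forall e : R, 0 < e -> exists2 s0 : R, 0 < s0 &
  forall s, 0 < s < s0 -> `|complex.Re (gg a b (x +i* s)%C)| <= e * complex.Im (gg a b (x +i* s)%C)}.

Definition edge_poly j (x : R) : R := (x - e0) * (e1 - x) * ((x - Em j) * (Ep j - x)).

Lemma edge_poly_gt0 j x : Em j < x < Ep j -> 0 < edge_poly j x.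
Proof.
move=> /andP[x1 x2]; have [g1 g2 g3] := gap_range mE gfE j.
by rewrite /edge_poly !mulr_gt0 // subr_gt0; lra.
Qed.

Lemma ulog_lsum j x (K : seq I) : uniq K -> j \in K -> Em j < x < Ep j -> x != dmu j ->
  2 * ulog a b Em Ep dmu e0 e1 K x = ln (gre a b x ^+ 2 * edge_poly j x)
   - 2 * ln `|x - dmu j| + lsum Em Ep j x dmu K.
Proof.
move=> uK jK hx xm; have /andP[x1 x2] := hx.
have [g1 g2 g3] := gap_range mE gfE j.
have g0 : gre a b x != 0 by rewrite -sgr_eq0 (dmu_sg hx) sgr_eq0 subr_eq0.
have ag : 0 < `|gre a b x| by rewrite normr_gt0.
have p1 : 0 < x - e0 by lra.
have p2 : 0 < e1 - x by lra.
have p3 : 0 < x - Em j by lra.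
have p4 : 0 < Ep j - x by lra.
have -> : ln (gre a b x ^+ 2 * edge_poly j x) = 2 * ln `|gre a b x| + ln (x - e0) + ln (e1 - x)
    + ln (x - Em j) + ln (Ep j - x).
  rewrite -real_normK ?num_real // /edge_poly.
  rewrite lnM ?posrE ?exprn_gt0 ?mulr_gt0 // lnM ?posrE ?mulr_gt0 // lnM ?posrE // lnM ?posrE //.
  by rewrite lnXn // mulr2n; ring.
rewrite /ulog sum_divisor /= (bigD1_seq j) //= (distrC x e1) (distrC x (Ep j)).
rewrite (gtr0_norm p1) (gtr0_norm p2) (gtr0_norm p3) (gtr0_norm p4).
have -> : lsum Em Ep j x dmu K = - 2 * \sum_(k <- K | k != j)
    (1 * ln `|x - dmu k| + - 2^-1 * ln `|x - Em k| + - 2^-1 * ln `|x - Ep k|).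
  rewrite /lsum mulr_sumr; apply: eq_bigr => k kj.
  have [|f0 _] := fac_bound mE gfE craig kj _ (dmu_in k) (x := x); first by rewrite !ltW.
  have n1 : x - dmu k != 0.
    by apply: contraTneq f0 => h; rewrite /fac -(opprB x (dmu k)) h oppr0 expr0n /= invr0 mulr0 ltxx.
  have n2 : x - Em k != 0.
    by apply: contraTneq f0 => h; rewrite /fac -(opprB x (Em k)) h oppr0 !mul0r ltxx.
  have n3 : x - Ep k != 0.
    by apply: contraTneq f0 => h; rewrite /fac -[Ep k - x]opprB h oppr0 mulr0 mul0r ltxx.
  rewrite -(gtr0_norm f0) /fac !normrM normfV normrX !(distrC _ x).
  rewrite lnM ?posrE ?mulr_gt0 ?invr_gt0 ?exprn_gt0 ?normr_gt0 //.
  rewrite lnM ?posrE ?normr_gt0 // lnV ?posrE ?exprn_gt0 ?normr_gt0 // lnXn ?normr_gt0 //.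
  by rewrite mulr2n; field.
by field.
Qed.

Lemma ulog_small j x e : Em j < x < Ep j -> x != dmu j -> 0 < e ->
  exists s0 : seq I, forall K : seq I, uniq K -> {subset s0 <= K} -> j \in K ->
  2 * `|ulog a b Em Ep dmu e0 e1 K x| <= e.
Proof.
move=> hx xm ep; have /andP[x1 x2] := hx.
have d0 : 0 < Num.min (x - Em j) (Ep j - x) by rewrite lt_min !subr_gt0 x1.
have [s0 hs0] := resid_tail mE gfE craig j (mulr_gt0 ep d0).
exists s0 => K uK sK jK.
have hmu k y (h : Em k < y < Ep k) (_ : y != dmu k) := dmu_sg h.
have := product_estimate aC bC hz (gap_e01 mE gfE) (gap_range mE gfE) (gap_disjoint gfE)
  (gap_E_cover gfE) (gap_E_in gfE) hr refl dmu_in hmu gre_left_pos gre_right_neg uK jK hx xm (hs0 K sK).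
by rewrite mulrAC ler_pM2r.
Qed.

(** Let K exhaust the gaps in product_estimate: the total length of the omitted gaps tends to
    0, and the part of the divisor sum that belongs to the other gaps tends to ln W_j. *)
Theorem green_product j x : Em j < x < Ep j ->
  gre a b x ^+ 2 * edge_poly j x * wprod Em Ep j x dmu = (x - dmu j) ^+ 2.
Proof.
move=> hx; have [xm|xm] := eqVneq x (dmu j).
  have := dmu_sg hx; rewrite -xm subrr sgr0 => /eqP; rewrite sgr_eq0 => /eqP ->.
  by rewrite expr0n /= !mul0r.
have hx' : Em j <= x <= Ep j by case/andP: hx => h1 h2; rewrite !ltW.
have W0 := wprod_gt0 mE gfE craig hx' dmu_in.
have g0 : gre a b x != 0 by rewrite -sgr_eq0 (dmu_sg hx) sgr_eq0 subr_eq0.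
have S0 := edge_poly_gt0 hx.
have g2 : 0 < gre a b x ^+ 2 by rewrite exprn_even_gt0.
have xm0 : 0 < `|x - dmu j| by rewrite normr_gt0 subr_eq0.
pose V := ln (gre a b x ^+ 2 * edge_poly j x) - 2 * ln `|x - dmu j|.
suff V0 : V + ln (wprod Em Ep j x dmu) = 0.
  have l1 : 0 < gre a b x ^+ 2 * edge_poly j x by exact: mulr_gt0.
  rewrite -(real_normK (x := x - dmu j)) ?num_real //.
  apply: ln_inj; [exact: mulr_gt0 | exact: exprn_gt0 |].
  by rewrite (lnM l1 W0) lnXn // mulr2n; move: V0; rewrite /V; lra.
apply/eqP; rewrite -normr_le0; apply/ler_addgt0Pr => e ep; rewrite add0r.
have e2 : 0 < e / 2 by rewrite divr_gt0.
have [s0 hs0] := wprod_tail mE gfE craig j e2.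
have [s1 hs1] := ulog_small hx xm e2.
pose K := (s0 `|` [fset k in j :: s1])%fset.
have [_ h1] := hs0 x dmu hx' dmu_in.
have {}h1 := h1 K (fsubsetUl _ _).
have jK : j \in K by rewrite !inE eqxx orbT.
have h2 : 2 * `|ulog a b Em Ep dmu e0 e1 K x| <= e / 2.
  by apply: hs1 => // [|k ks]; [exact: fset_uniq | rewrite !inE ks !orbT].
have uE := ulog_lsum (fset_uniq K) jK hx xm.
have -> : V + ln (wprod Em Ep j x dmu) =
  2 * ulog a b Em Ep dmu e0 e1 K x + (ln (wprod Em Ep j x dmu) - lsum Em Ep j x dmu K).
  by rewrite uE /V; ring.
apply: le_trans (ler_normD _ _) _; rewrite [leRHS](splitr e); apply: lerD => //.
by rewrite normrM ger0_norm.
Qed.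

Corollary green_product_sqrt j x : Em j < x < Ep j ->
  x - dmu j = gre a b x * Num.sqrt (edge_poly j x * wprod Em Ep j x dmu).
Proof.
move=> hx; have := green_product hx; rewrite -mulrA => h.
have hx' : Em j <= x <= Ep j by case/andP: hx => h1 h2; rewrite !ltW.
have P0 : 0 <= edge_poly j x * wprod Em Ep j x dmu.
  have W0 := wprod_gt0 mE gfE craig hx' dmu_in.
  by apply: ltW; apply: mulr_gt0 => //; exact: edge_poly_gt0.
have n : `|x - dmu j| = `|gre a b x| * Num.sqrt (edge_poly j x * wprod Em Ep j x dmu).
  by rewrite -sqrtr_sqr -h sqrtrM ?sqr_ge0 // sqrtr_sqr.
by rewrite [LHS]numEsg n -(dmu_sg hx) mulrA -numEsg.
Qed.

End FixedTime.

(** * The Toda flow preserves the spectrum and the reflectionless property *)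
Section Preservation.
Variables (R : realType) (E : set R) (a b : R -> int -> R).
Local Notation mu := (@lebesgue_measure R).
Hypothesis sol : toda_solution a b.
Hypothesis jc : jacobi_class E (a 0) (b 0).

Lemma res_all_class z : (forall x, E x -> z != x%:C%C) -> res_all a b z.
Proof.
move=> hz; have [_ _ sp _] := jc.
have rz : resolvent_set (a 0) (b 0) z.
  apply: contrapT => h; have [x Ex xz] := sp z h.
  by have := hz x Ex; rewrite xz eqxx.
have [M iM] := resolvent_set_inv_by rz.
move=> T; have [N hN] := toda_isospectral sol (normr_ge0 T) iM.
by exists N => t tT; apply: hN; apply: le_trans tT (ler_norm T).
Qed.

Lemma res_all_real x : ~ E x -> res_all a b x%:C%C.
Proof.
move=> nE; apply: res_all_class => y Ey; apply/eqP => -[xy].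
by apply: nE; rewrite xy.
Qed.

Lemma res_all_im z : 0 < complex.Im z -> res_all a b z.
Proof.
move=> z0; apply: res_all_class => x _; apply/eqP => zx.
by move: z0; rewrite zx /= ltxx.
Qed.

Lemma right_limit_bound (f : R -> R[i]) (G : R[i]) :
  f e @[e --> (0 : R)^'+] --> (G : R[i]^o) -> complex.Re G = 0 ->
  forall r : R, 0 < r -> exists2 s0 : R, 0 < s0 & forall s, 0 < s < s0 ->
    `|complex.Re (f s)| <= r /\ normc (f s) <= normc G + r.
Proof.
move=> cv ReG r r0.
have r0' : 0 < r%:C%C :> R[i] by rewrite -[0]/(0%:C%C) ltcR.
have [d /= d0 hd] := (@cvgrPdist_le _ R[i]^o _ _ _ _ _).1 cv _ r0'.
exists d => // s /andP[s0 sd].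
have hs : normc (G - f s) <= r.
  by rewrite -lecR; apply: hd => //=; rewrite sub0r normrN (gtr0_norm s0).
split.
  by apply: le_trans hs; apply: le_trans (Re_le_normc _); rewrite Re_add Re_opp ReG sub0r normrN.
have -> : f s = G - (G - f s) by ring.
by apply: le_trans (normcB _ _) _; rewrite lerD2l.
Qed.

(** The three diagonal entries are the Green functions at -1, 0 and 1; the reflectionless
    property does not speak of the off-diagonal h, which is recovered from
    h (b_0 - z) = q_- - q as long as x <> b_0. *)
Lemma energy_limit0 x : E x -> x != b 0 0 ->
  (forall n : int, n \in [:: -1; 0; 1] -> exists G : R[i],
      (green (a 0) (b 0) n (x +i* e)%C : R[i]^o) @[e --> (0 : R)^'+] --> (G : R[i]^o) /\
      complex.Re G = 0) ->
  exists2 B : R, 0 <= B & forall r : R, 0 < r -> exists2 s0 : R, 0 < s0 & forall s, 0 < s < s0 ->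
    energy a b (x +i* s)%C 0 <= B /\ re_energy a b (x +i* s)%C 0 <= r.
Proof.
move=> Ex xb hG.
have [|Gm [cm Rm]] := hG (-1); first by rewrite !inE eqxx.
have [|G0 [c0 R0]] := hG 0; first by rewrite !inE eqxx.
have [|G1 [c1 R1]] := hG 1; first by rewrite !inE eqxx.
pose M := normc Gm + normc G0 + normc G1 + 1.
have nm := normc_ge0 Gm; have n0 := normc_ge0 G0; have n1 := normc_ge0 G1.
have M0 : 0 <= M by rewrite /M; lra.
pose p := a 0 0 ^+ 2; pose pm := a 0 (-1) ^+ 2.
have p0 : 0 <= p by exact: sqr_ge0.
have pm0 : 0 <= pm by exact: sqr_ge0.
pose dl := `|b 0 0 - x|.
have dl0 : 0 < dl by rewrite normr_gt0 subr_eq0 eq_sym.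
pose Bh := (p * M + pm * M) / dl.
have Bh0 : 0 <= Bh by rewrite divr_ge0 ?(ltW dl0) // addr_ge0 // mulr_ge0.
pose k := (p + pm + Bh) / dl.
have k0 : 0 <= k by rewrite divr_ge0 ?(ltW dl0) // !addr_ge0.
pose Kc := 1 + k ^+ 2 + p ^+ 2 + pm ^+ 2.
have Kc0 : 0 <= Kc by rewrite !addr_ge0 ?sqr_ge0.
exists (M ^+ 2 + Bh ^+ 2 + (p * M) ^+ 2 + (pm * M) ^+ 2); first by rewrite !addr_ge0 ?sqr_ge0.
move=> r1 r10; pose r := Num.min 1 (r1 / (Kc + 1)).
have r0 : 0 < r by rewrite lt_min ltr01 divr_gt0 // ltr_wpDl.
have rle1 : r <= 1 by rewrite /r ge_min lexx.
have rK : r ^+ 2 * Kc <= r1.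
  have h : r <= r1 / (Kc + 1) by rewrite /r ge_min lexx orbT.
  rewrite ler_pdivlMr ?ltr_wpDl // in h; apply: le_trans h.
  rewrite expr2 -mulrA; apply: ler_wpM2l; first exact: ltW.
  by apply: le_trans (_ : 1 * Kc <= _); rewrite ?ler_wpM2r // mul1r lerDl.
clearbody r.
have [sm sm0 hm] := right_limit_bound cm Rm r0.
have [sz sz0 hz] := right_limit_bound c0 R0 r0.
have [so so0 ho] := right_limit_bound c1 R1 r0.
exists (Num.min (Num.min sm sz) (Num.min so r)); first by rewrite !lt_min sm0 sz0 so0 r0.
move=> s; rewrite !lt_min => /andP[s0 /andP[/andP[h1 h2] /andP[h3 h4]]].
have [|rm bm] := hm s; first by rewrite s0.
have [|rz bz] := hz s; first by rewrite s0.
have [|ro bo] := ho s; first by rewrite s0.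
pose z : R[i] := (x +i* s)%C.
have hz' : res_all a b z by apply: res_all_im.
set g := gf a b z 0; set h := hf a b z 0; set q := qf a b z 0; set qm := qmf a b z 0.
have gB : normc g <= M by apply: le_trans bz _; rewrite /M; lra.
have gr : `|complex.Re g| <= r by exact: rz.
have qE : normc q = p * normc (green (a 0) (b 0) 1 z).
  by rewrite /q /qf normcM normc_real ger0_norm.
have qmE : normc qm = pm * normc (green (a 0) (b 0) (-1) z).
  by rewrite /qm /qmf normcM normc_real ger0_norm.
have qB : normc q <= p * M by rewrite qE; apply: ler_wpM2l => //; apply: le_trans bo _; rewrite /M; lra.
have qmB : normc qm <= pm * M by rewrite qmE; apply: ler_wpM2l => //; apply: le_trans bm _; rewrite /M; lra.
have qr : `|complex.Re q| <= p * r.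
  rewrite /q /qf Re_mul /= mul0r subr0 normrM (ger0_norm p0).
  by apply: ler_wpM2l => //; exact: ro.
have qmr : `|complex.Re qm| <= pm * r.
  rewrite /qm /qmf Re_mul /= mul0r subr0 normrM (ger0_norm pm0).
  by apply: ler_wpM2l => //; exact: rm.
have hc : h * cf b z 0 = qm - q by exact: hc_id hz' 0.
have cR : complex.Re (cf b z 0) = b 0 0 - x by rewrite /cf Re_add Re_opp.
have cI : complex.Im (cf b z 0) = - s by rewrite /cf Im_add Im_opp /= sub0r.
have hB : normc h <= Bh.
  rewrite /Bh ler_pdivlMr //.
  apply: (@le_trans _ _ (normc (h * cf b z 0))).
    rewrite normcM; apply: ler_wpM2l; first exact: normc_ge0.
    by rewrite /dl -cR; exact: Re_le_normc.
  by rewrite hc; apply: le_trans (normcB _ _) _; rewrite addrC; exact: lerD.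
have hr : `|complex.Re h| <= k * r.
  rewrite /k mulrAC ler_pdivlMr // -normrM.
  have -> : complex.Re h * (b 0 0 - x) = complex.Re qm - complex.Re q - s * complex.Im h.
    have := congr1 (@complex.Re R) hc; rewrite (Re_mul h) cR cI (Re_add qm (- q)) (Re_opp q) => hcR.
    by lra.
  apply: le_trans (ler_normB _ _) _; rewrite mulrDl; apply: lerD.
    by apply: le_trans (ler_normB _ _) _; rewrite mulrDl addrC lerD.
  rewrite normrM (gtr0_norm s0) mulrC; apply: ler_pM; rewrite ?(ltW s0) ?(ltW h4) //.
  exact: le_trans (Im_le_normc h) hB.
have sq u v : 0 <= u -> u <= v -> u ^+ 2 <= v ^+ 2 :> R.
  by move=> u0 uv; rewrite ler_sqr ?nnegrE // (le_trans u0).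
split.
  by rewrite /energy !lerD // sq ?normc_ge0.
apply: le_trans rK; rewrite /re_energy -/g -/h -/q -/qm.
have -> : r ^+ 2 * Kc = r ^+ 2 + (k * r) ^+ 2 + (p * r) ^+ 2 + (pm * r) ^+ 2 by rewrite /Kc; ring.
have ab u v : `|u| <= v -> u ^+ 2 <= v ^+ 2 :> R.
  by move=> uv; rewrite -real_normK ?num_real //; exact: sq.
by rewrite !lerD // ab.
Qed.

Lemma energy_limit x t : E x -> x != b 0 0 ->
  (forall n : int, n \in [:: -1; 0; 1] -> exists G : R[i],
      (green (a 0) (b 0) n (x +i* e)%C : R[i]^o) @[e --> (0 : R)^'+] --> (G : R[i]^o) /\
      complex.Re G = 0) ->
  exists2 B : R, 0 <= B & forall r : R, 0 < r -> exists2 s0 : R, 0 < s0 & forall s, 0 < s < s0 ->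
    energy a b (x +i* s)%C t <= B /\ re_energy a b (x +i* s)%C t <= r.
Proof.
move=> Ex xb hG; have [B B0 hB] := energy_limit0 Ex xb hG.
have Z0 : 0 <= `|x| + 1 by rewrite addr_ge0.
have [K1 [K10 h1]] := energy_bound sol `|t| Z0.
have [K2 [K20 h2]] := re_energy_bound sol `|t| Z0.
exists (B * K1); first exact: mulr_ge0.
move=> r r0.
pose r2 := r / (2 * (K2 + 1)).
have r20 : 0 < r2 by rewrite divr_gt0 // mulr_gt0 // ltr_wpDl.
have r2K : r2 * K2 <= r / 2.
  have : r2 * (2 * (K2 + 1)) = r by rewrite /r2 divfK // gt_eqF // mulr_gt0 // ltr_wpDl.
  by move: (r2) r20 => u u0; lra.
have [s0 s00 hs] := hB r2 r20.
exists (Num.min s0 (Num.min 1 (r2 / (B + 1)))).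
  by rewrite !lt_min s00 ltr01 divr_gt0 // ltr_wpDl.
move=> s; rewrite !lt_min => /and4P[sp sa sb sc].
have [|e1 e2] := hs s; first by rewrite sp.
have hz : res_all a b (x +i* s)%C by apply: res_all_im.
have nz : normc (x +i* s)%C <= `|x| + 1.
  by apply: le_trans (normc_le_ReIm _) _; rewrite /= lerD2l (gtr0_norm sp) ltW.
split; first by apply: le_trans (h1 _ hz nz t (lexx _)) _; exact: ler_wpM2r.
apply: le_trans (h2 _ hz nz t (lexx _)) _.
have sB : s ^+ 2 * energy a b (x +i* s)%C 0 <= r2.
  apply: (@le_trans _ _ (s * (B + 1))).
    rewrite expr2 -mulrA; apply: ler_wpM2l; first exact: ltW.
    apply: (@le_trans _ _ (1 * B)); last by rewrite mul1r lerDl.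
    by apply: ler_pM => //; [exact: ltW|exact: energy_ge0|exact: ltW].
  by move/ltW: sc; rewrite ler_pdivlMr // ltr_wpDl.
apply: (@le_trans _ _ ((r2 + r2) * K2)); first by apply: ler_wpM2r => //=; exact: lerD.
by rewrite mulrDl [leRHS](splitr r); exact: lerD.
Qed.

(** Where Re g, Re h and Re q tend to 0, the identity 4 g q = (h - c g)^2 - 1 has a right-hand
    side of real part below -1/2; hence g stays away from 0, so that Re g -> 0 makes Re g
    small compared with Im g. *)
Lemma reflectionless_time t :
  {ae mu, forall x : R, E x -> forall e : R, 0 < e -> exists2 s0 : R, 0 < s0 &
  forall s, 0 < s < s0 -> `|complex.Re (gg (a t) (b t) (x +i* s)%C)|
     <= e * complex.Im (gg (a t) (b t) (x +i* s)%C)}.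
Proof.
have [_ _ _ rfl] := jc.
have nb : {ae mu, forall x : R, x != b 0 0}.
  exists [set b 0 0]; split.
  - exact: measurable_set1.
  - exact: lebesgue_measure_set1.
  - by move=> x /= /negP; rewrite negbK => /eqP.
have FF := ae_filter_ringOfSetsType mu.
apply: (@filterS2 _ _ FF _ _ _ _ (@filterI _ _ FF _ _ (rfl 0) nb) (@filterI _ _ FF _ _ (rfl 1) (rfl (-1)))).
move=> x [r0 xb] [r1 rm] Ex e e0.
have hG (n : int) : n \in [:: -1; 0; 1] -> exists G : R[i],
      (green (a 0) (b 0) n (x +i* e)%C : R[i]^o) @[e --> (0 : R)^'+] --> (G : R[i]^o) /\
      complex.Re G = 0.
  by rewrite !inE => /or3P[] /eqP ->; [exact: rm|exact: r0|exact: r1].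
have [B1 B10 hB1] := energy_limit t Ex xb hG.
pose B := B1 + 1.
have B0 : 0 < B by rewrite ltr_wpDl.
have B1B : B1 <= B ^+ 2 by rewrite /B; nra.
pose d := `|b t 0 - x|; have d0 : 0 <= d by exact: normr_ge0.
pose r := Num.min (e / (8 * B) / (1 + e)) ((8 * (1 + d))^-1).
have eB : 0 < e / (8 * B) by rewrite divr_gt0 // mulr_gt0.
have e1 : 0 < 1 + e by rewrite ltr_pwDl // ltW.
have d1 : 0 < 8 * (1 + d) by rewrite mulr_gt0 // ltr_pwDl.
have rp : 0 < r by rewrite lt_min divr_gt0 // invr_gt0.
have ra : r * (1 + e) <= e / (8 * B) by rewrite -ler_pdivlMr // /r ge_min lexx.
have rb : r * (8 * (1 + d)) <= 1 by rewrite -ler_pdivlMr // div1r /r ge_min lexx orbT.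
have [s0 s00 hs] := hB1 (r ^+ 2) (exprn_gt0 2 rp).
exists (Num.min s0 (8 * B)^-1); first by rewrite lt_min s00 invr_gt0 mulr_gt0.
move=> s; rewrite lt_min => /and3P[sp sa sb].
have [|en re] := hs s; first by rewrite sp.
pose z : R[i] := (x +i* s)%C.
have hz : res_all a b z by apply: res_all_im.
rewrite -/z in en re *; rewrite -[gg (a t) (b t) z]/(gf a b z t).
have {}en := le_trans en B1B.
set g := gf a b z t; pose h := hf a b z t; pose q := qf a b z t; pose qm := qmf a b z t.
have nn u v : 0 <= v -> u ^+ 2 <= v ^+ 2 -> `|u| <= v :> R.
  by move=> v0; rewrite -(real_normK (x := u)) ?num_real // ler_sqr ?nnegrE.
rewrite /energy -/g -/h -/q -/qm in en; rewrite /re_energy -/g -/h -/q -/qm in re.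
have s1 := sqr_ge0 (normc g); have s2 := sqr_ge0 (normc h).
have s3 := sqr_ge0 (normc q); have s4 := sqr_ge0 (normc qm).
have t1 := sqr_ge0 (complex.Re g); have t2 := sqr_ge0 (complex.Re h).
have t3 := sqr_ge0 (complex.Re q); have t4 := sqr_ge0 (complex.Re qm).
have gB : normc g <= B by rewrite -(ger0_norm (normc_ge0 g)); apply: nn; [exact: ltW|lra].
have qB : normc q <= B by rewrite -(ger0_norm (normc_ge0 q)); apply: nn; [exact: ltW|lra].
have gr : `|complex.Re g| <= r by apply: nn; [exact: ltW|lra].
have hr : `|complex.Re h| <= r by apply: nn; [exact: ltW|lra].
have [C aC] := coef_bound sol t.
have gI : 0 < complex.Im g.
  have [C' [C1 hC]] := toda_bound sol `|t|.
  have aC' n : `|a t n| <= C' by have [] := hC t n (lexx _).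
  have bC' n : `|b t n| <= C' by have [] := hC t n (lexx _).
  apply: (im_gg_gt0 aC' bC') => // w w0.
  exact: res_all_at (res_all_im w0) t.
pose w := h - cf b z t * g.
have wR : `|complex.Re w| <= 2^-1.
  have -> : complex.Re w = complex.Re h - (b t 0 - x) * complex.Re g - s * complex.Im g.
    by rewrite /w /cf Re_add Re_opp Re_mul Re_add Im_add Re_opp Im_opp /=; ring.
  have u1 : `|(b t 0 - x) * complex.Re g| <= d * r by rewrite normrM ler_wpM2l.
  have u2 : `|s * complex.Im g| <= 8^-1.
    rewrite normrM (gtr0_norm sp); apply: (@le_trans _ _ ((8 * B)^-1 * B)).
      by apply: ler_pM => //; [exact: ltW|exact: ltW|exact: le_trans (Im_le_normc g) gB].
    by rewrite le_eqVlt; apply/orP; left; apply/eqP; field; rewrite gt_eqF.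
  apply: le_trans (ler_normB _ _) _; apply: le_trans (lerD (ler_normB _ _) (lexx _)) _.
  move: rb hr u1 u2; rewrite mulrCA mulrDr mulr1 mulrC (mulrC d).
  set A1 := `|complex.Re h|; set A2 := `|_ * _|; set A3 := `|_ * _|; lra.
have nqg : 2^-1 <= normc (4 * g * q).
  rewrite (gq_id sol hz t) -/g -/h -/w.
  apply: le_trans (Re_le_normc _); rewrite ler_normr; apply/orP; right.
  rewrite Re_add Re_opp expr2 Re_mul /= -!expr2.
  have : complex.Re w ^+ 2 <= 2^-1 ^+ 2.
    by rewrite -real_normK ?num_real // ler_sqr ?nnegrE // invr_ge0.
  have := sqr_ge0 (complex.Im w); lra.
have gl : (8 * B)^-1 <= normc g.
  rewrite -div1r ler_pdivrMr ?mulr_gt0 //.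
  have : normc (4 * g * q) <= 4 * normc g * B.
    have -> : normc (4 * g * q) = 4 * (normc g * normc q).
      by rewrite normcM (normcM 4 g) (normc_nat R 4) mulrA.
    rewrite -mulrA; apply: ler_wpM2l; first exact: ler0n.
    by apply: ler_wpM2l => //; exact: normc_ge0.
  lra.
have gs : normc g <= r + complex.Im g.
  by apply: le_trans (normc_le_ReIm g) _; rewrite (gtr0_norm gI) lerD2r.
apply: le_trans gr _.
have : e * (8 * B)^-1 <= e * (r + complex.Im g) by rewrite ler_wpM2l ?(ltW e0) // (le_trans gl gs).
by move: ra; rewrite mulrDr mulrDr mulr1 (mulrC r e); lra.
Qed.

(** The equation for a_n is linear in a_n, so a zero at one time would propagate to time 0. *)
Lemma toda_a_neq0 t n : a t n != 0.
Proof.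
have [_ apos _ _] := jc; have [_ da _] := sol.
apply/eqP => at0.
have [C [C1 hC]] := toda_bound sol (`|t| + `|t|).
have C0 : 0 <= C by apply: le_trans C1.
(* time is counted from the supposed zero, so that Gronwall gives a = 0 at time 0 *)
pose f (s : R) := (a (t + s) n) ^+ 2.
pose df (s : R) := 2 * (a (t + s) n * (a (t + s) n * (b (t + s) (n + 1) - b (t + s) n))).
have hdf (s : R) : is_derive s 1 f (df s).
  have h0 : is_derive s 1 (fun s : R => t + s) 1 by have := @is_deriveD _ _ _ (cst t) id s 1 _ _ (is_derive_cst _ _ _) (is_derive_id _ _); rewrite add0r.
  have h1 := @is_derive1_comp R (a ^~ n) (fun s => t + s) s _ _ (da (t + s) n) h0.
  have h2 := is_derive_sq h1.
  by rewrite mulr1 in h2; exact: h2.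
have K1 (s : R) : `|s| <= `|t| -> `|df s| <= 4 * C * f s.
  move=> st; have ts : `|t + s| <= `|t| + `|t|.
    by apply: le_trans (ler_normD _ _) _; rewrite lerD2l.
  have [_ b1] := hC _ (n + 1) ts; have [_ b2] := hC _ n ts.
  have -> : df s = 2 * f s * (b (t + s) (n + 1) - b (t + s) n) by rewrite /df /f; ring.
  have f0 : 0 <= 2 * f s by apply: mulr_ge0 => //; exact: sqr_ge0.
  rewrite normrM (ger0_norm f0).
  have -> : 4 * C * f s = 2 * f s * (C + C) by ring.
  apply: ler_wpM2l => //.
  by apply: le_trans (ler_normB _ _) _; exact: lerD.
have := gronwall hdf K1 (t := - t); rewrite normrN => /(_ (lexx _)).
rewrite {1 2}/f subrr addr0 at0 expr0n /= mul0r leNgt exprn_even_gt0 //=.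
by rewrite gt_eqF.
Qed.

End Preservation.

(** * Weyl functions and the sign of a Dirichlet datum *)
Section Weyl.
Variable R : realType.
Variables (a b : int -> R) (C : R).
Hypothesis aC : forall n, `|a n| <= C.
Hypothesis bC : forall n, `|b n| <= C.
Hypothesis an : forall n, a n != 0.
Implicit Types (u v : int -> R[i]) (z w : R[i]) (M : R).

Lemma aC_neq0 n : (a n)%:C%C != 0 :> R[i].
Proof. by apply/eqP => -[] /eqP; rewrite (negbTE (an n)). Qed.

Section Recursion.
Variables (z c0 c1 : R[i]).

Fixpoint fwd (n : nat) : R[i] * R[i] := if n is m.+1 then
  ((fwd m).2, ((z - (b m.+1%:Z)%:C%C) * (fwd m).2 - (a m%:Z)%:C%C * (fwd m).1) / (a m.+1%:Z)%:C%C)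
  else (c0, c1).

Fixpoint bwd (n : nat) : R[i] * R[i] := if n is m.+1 then
  (((z - (b (- m%:Z))%:C%C) * (bwd m).1 - (a (- m%:Z))%:C%C * (bwd m).2) / (a (- m%:Z - 1))%:C%C, (bwd m).1)
  else (c0, c1).

Definition jsol (n : int) : R[i] := match n with Posz n => (fwd n).1 | Negz n => (bwd n.+1).1 end.

Lemma jsol_eq : jacobi a b jsol = fun n => z * jsol n.
Proof.
apply/funext => -[[|m]|m]; rewrite /jacobi.
- have -> : (0 + 1 : int) = Posz 1 by [].
  have -> : (0 - 1 : int) = Negz 0 by [].
  rewrite /= oppr0 sub0r (_ : Posz 0 = 0) //.
  by have h := aC_neq0 (-1); field.
- have -> : (Posz m.+1 + 1 : int) = Posz m.+2 by lia.
  have -> : (Posz m.+1 - 1 : int) = Posz m by lia.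
  by have h := aC_neq0 m.+1; rewrite /=; field.
- have -> : (Negz m - 1 : int) = Negz m.+1 by lia.
  have -> : jsol (Negz m + 1) = (bwd m).1.
    by case: m => [|m] //; have -> : (Negz m.+1 + 1 : int) = Negz m by lia.
  have E : - m.+1%:Z = Negz m by lia.
  have E2 : Negz m.+1 = Negz m - 1 by lia.
  have h := aC_neq0 (Negz m - 1).
  have e1 : jsol (Negz m) = (bwd m.+1).1 by [].
  have e2 : jsol (Negz m.+1) = ((z - (b (Negz m))%:C%C) * (bwd m.+1).1 -
     (a (Negz m))%:C%C * (bwd m).1) / (a (Negz m - 1))%:C%C by rewrite -E.
  by rewrite e1 e2 E2; field.
Qed.

Lemma jsol0 : jsol 0 = c0. Proof. by []. Qed.
Lemma jsol1 : jsol 1 = c1. Proof. by []. Qed.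

End Recursion.

(** The coefficients a_n do not vanish, so the values at two neighbouring sites determine a
    solution of the three-term recursion. *)
Lemma jacobi_agree_up z u v (N : int) :
  (forall n, N < n -> jacobi a b u n = z * u n) -> (forall n, N < n -> jacobi a b v n = z * v n) ->
  u N = v N -> u (N + 1) = v (N + 1) -> forall n, N <= n -> u n = v n.
Proof.
move=> hu hv e0 e1 n Nn.
suff H (k : nat) : u (N + k%:Z) = v (N + k%:Z) /\ u (N + k%:Z + 1) = v (N + k%:Z + 1).
  have [] := H (absz (n - N)); have -> : N + absz (n - N) = n by lia.
  by [].
elim: k => [|k [i1 i2]]; first by rewrite addr0.
have E : N + k.+1%:Z = N + k%:Z + 1 by lia.
rewrite E; split=> //.
set m := N + k%:Z + 1 in i2 *; have Em : m - 1 = N + k%:Z by rewrite /m; lia.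
have Nm : N < m by rewrite /m; lia.
have := hu m Nm; have := hv m Nm; rewrite /jacobi Em i1 i2 => <- h.
by apply: (mulfI (aC_neq0 m)); move: h => /addIr /addIr.
Qed.

Lemma jacobi_agree_down z u v (N : int) :
  (forall n, n < N -> jacobi a b u n = z * u n) -> (forall n, n < N -> jacobi a b v n = z * v n) ->
  u N = v N -> u (N - 1) = v (N - 1) -> forall n, n <= N -> u n = v n.
Proof.
move=> hu hv e0 e1 n Nn.
suff H (k : nat) : u (N - k%:Z) = v (N - k%:Z) /\ u (N - k%:Z - 1) = v (N - k%:Z - 1).
  have [] := H (absz (N - n)); have -> : N - Posz (absz (N - n)) = n by lia.
  by [].
elim: k => [|k [i1 i2]]; first by rewrite subr0.
have E : N - k.+1%:Z = N - k%:Z - 1 by lia.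
rewrite E; split=> //.
set m := N - k%:Z - 1 in i2 *; have Em : m + 1 = N - k%:Z by rewrite /m; lia.
have Nm : m < N by rewrite /m; lia.
have := hu m Nm; have := hv m Nm; rewrite /jacobi Em i1 i2 => <- h.
by apply: (mulfI (aC_neq0 (m - 1))); move: h => /addrI.
Qed.

Definition half_line (s : int) u : Prop := (\esum_(n in [set n : int | (0 <= n)%R])
   (normc (u (s * n)%R) ^+ 2)%:E < +oo)%E.

Lemma half_lineE (s : int) u : s = 1 \/ s = -1 -> (\esum_(n in [set n : int | (0 <= n)%R])
   (normc (u (s * n)%R) ^+ 2)%:E =
   \esum_(n in [set: int]) (if (0 <= s * n)%R then normc (u n) ^+ 2 else 0)%:E)%E.
Proof.
move=> hs; have ss n : s * (s * n) = n by case: hs => ->; lia.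
rewrite -(@reindex_esum R _ _ [set n : int | (0 <= n)%R] [set n : int | (0 <= s * n)%R]
  (fun n => s * n) (fun n => (normc (u n) ^+ 2)%:E)).
  rewrite esum_mkcond; apply: eq_esum => n _.
  by case: (boolP (0 <= s * n)) => h; [rewrite mem_set | rewrite memNset //=; apply/negP].
split.
- by move=> n /= n0; rewrite ss.
- by move=> m n _ _ /(congr1 (fun k => s * k)); rewrite !ss.
- by move=> n /= n0; exists (s * n) => //; rewrite ss.
Qed.

Lemma half_line_cut (s : int) u v : s = 1 \/ s = -1 -> half_line s u ->
  (forall n, v n = 0 \/ (0 <= s * n /\ v n = u n)) -> l2 v.
Proof.
move=> hs; rewrite /half_line half_lineE // => h hv; apply: le_lt_trans h.
apply: le_esum => n _; rewrite lee_fin.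
by have [->|[-> ->]] := hv n; rewrite ?normc0 ?expr0n //=; case: ifP => // _; exact: sqr_ge0.
Qed.

Lemma l2_half_line (s : int) u v : s = 1 \/ s = -1 -> l2 v ->
  (forall n, 0 <= s * n -> u n = v n) -> half_line s u.
Proof.
move=> hs lv h; rewrite /half_line half_lineE //; apply: le_lt_trans lv.
by apply: le_esum => n _; rewrite lee_fin; case: ifP => [/h ->|_] //; exact: sqr_ge0.
Qed.

Section AtPoint.
Variables (z : R[i]) (M : R).
Hypothesis iM : inv_by (jacobi_shift a b z) M.
Local Notation G := (gmat a b z).

Lemma cut_green v (c0 c1 : R[i]) : l2 v ->
  (forall n, jacobi_shift a b z v n = c0 * delta R 0 n + c1 * delta R 1 n) ->
  forall m, v m = c0 * G m 0 + c1 * G m 1.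
Proof.
move=> lv hv m.
have l0 := @l2_delta R 0; have l1 := @l2_delta R 1.
have lf : l2 (fun n => c1 * delta R 1 n) by exact: l2_le_l2 (l2_leZ c1 (l2_le_delta R 1)).
have lg : l2 (fun n => c0 * delta R 0 n + c1 * delta R 1 n).
  exact: l2_le_l2 (l2_leD (l2_leZ c0 (l2_le_delta R 0)) (l2_leZ c1 (l2_le_delta R 1))).
have := resolvent_uniq iM lg lv (funext hv); rewrite (resolvent_lin iM c0 l0 lf) (resolventZ iM c1 l1).
by move=> /funeqP /(_ m) <-.
Qed.

(** Cutting a Weyl solution off at the origin gives an l^2 sequence that J - z maps into the
    span of delta_0 and delta_1; this compares it with the Green matrix. *)
Lemma weyl_plus_green u : weyl_solution a b 1 z u -> u 1 * G 0 0 = u 0 * G 1 0.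
Proof.
move=> [_ hu hl].
pose v n := if 1 <= n then u n else 0.
have lv : l2 v.
  apply: (half_line_cut (or_introl erefl) hl) => n; rewrite /v; case: ifP => h; last by left.
  by right; split=> //; lia.
have hv n : jacobi_shift a b z v n =
    ((a 0)%:C%C * u 1) * delta R 0 n + (- ((a 0)%:C%C * u 0)) * delta R 1 n.
  have := congr1 (fun f => f n) hu; rewrite /jacobi_shift /jacobi /v /delta => h.
  have [n0|n0|n0] := ltgtP n 0.
  - have -> : (1 <= n + 1) = false by lia.
    have -> : (1 <= n) = false by lia.
    have -> : (1 <= n - 1) = false by lia.
    have -> : (n == 1) = false by lia.
    by rewrite /=; ring.
  - have -> : (1 <= n + 1) = true by lia.
    have -> : (1 <= n) = true by lia.
    have [n1|n1] := eqVneq n 1.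
      have e : (1 - 1 : int) = 0 by [].
      by rewrite n1 e in h *; rewrite -h /=; ring.
    have -> : (1 <= n - 1) = true by lia.
    by rewrite h /=; ring.
  - by rewrite n0 /=; ring.
have := cut_green lv hv 0; rewrite /v /= (gmat_sym aC 0 1 iM) => h.
apply: (mulfI (aC_neq0 0)); apply/eqP; rewrite -subr_eq0; apply/eqP.
by rewrite [RHS]h; ring.
Qed.

Lemma weyl_minus_green u : weyl_solution a b (-1) z u ->
  u 0 * (1 - (a 0)%:C%C * G 1 0) = - ((a 0)%:C%C * u 1 * G 0 0).
Proof.
move=> [_ hu hl].
pose v (n : int) := if n <= 0 then u n else 0.
have lv : l2 v.
  apply: (half_line_cut (or_intror erefl) hl) => n; rewrite /v; case: ifP => h; last by left.
  by right; split=> //; lia.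
have hv n : jacobi_shift a b z v n =
    (- ((a 0)%:C%C * u 1)) * delta R 0 n + ((a 0)%:C%C * u 0) * delta R 1 n.
  have := congr1 (fun f => f n) hu; rewrite /jacobi_shift /jacobi /v /delta => h.
  have [n0|n0|n0] := ltgtP n 0.
  - have -> : (n + 1 <= 0) = true by lia.
    have -> : (n - 1 <= 0) = true by lia.
    have -> : (n == 1) = false by lia.
    by rewrite h /=; ring.
  - have -> : (n + 1 <= 0) = false by lia.
    have [n1|n1] := eqVneq n 1.
      have e : (1 - 1 : int) = 0 by [].
      by rewrite n1 e /=; ring.
    have -> : (n - 1 <= 0) = false by lia.
    by rewrite /=; ring.
  - have e : (0 + 1 : int) = 1 by [].
    by rewrite n0 e in h *; rewrite -h /=; ring.
have := cut_green lv hv 0; rewrite /v /= (gmat_sym aC 0 1 iM) => h.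
by rewrite mulrBr mulr1 {1}h; ring.
Qed.

Hypothesis g0 : G 0 0 != 0.

Lemma gmat_col_eq n : n != 0 -> jacobi a b (G ^~ 0) n = z * G n 0.
Proof. by move=> n0; rewrite (gmat_jacobi n 0 iM) (negbTE n0) addr0. Qed.

Lemma weyl_plus_ex : exists u, weyl_solution a b 1 z u.
Proof.
pose u := jsol z (G 0 0) (G 1 0).
have hu := jsol_eq z (G 0 0) (G 1 0); rewrite -/u in hu.
exists u; split=> //.
  by move=> /(congr1 (fun f => f 0)) /eqP; rewrite /u jsol0 (negbTE g0).
apply: (l2_half_line (or_introl erefl) (l2_le_l2 (l2_le_gmat 0 iM))) => n; rewrite mul1r => n0.
apply: (@jacobi_agree_up z u (G ^~ 0) 0) => // m m0; first by rewrite hu.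
by apply: gmat_col_eq; lia.
Qed.

Lemma weyl_minus_ex : exists u, weyl_solution a b (-1) z u.
Proof.
pose c1 := ((z - (b 0)%:C%C) * G 0 0 - (a (-1))%:C%C * G (-1) 0) / (a 0)%:C%C.
pose u := jsol z (G 0 0) c1.
have hu := jsol_eq z (G 0 0) c1; rewrite -/u in hu.
have um : u (-1) = G (-1) 0.
  have := congr1 (fun f => f 0) hu; rewrite /jacobi.
  have -> : (0 + 1 : int) = 1 by [].
  have -> : (0 - 1 : int) = -1 by [].
  rewrite {1 2 4}/u jsol0 jsol1 /c1 => h.
  apply: (mulfI (aC_neq0 (-1))); apply/eqP; rewrite -subr_eq0; apply/eqP.
  by have h0 := aC_neq0 0; rewrite -[RHS](subrr (z * G 0 0)) -{1}h; field.
exists u; split=> //.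
  by move=> /(congr1 (fun f => f 0)) /eqP; rewrite /u jsol0 (negbTE g0).
apply: (l2_half_line (or_intror erefl) (l2_le_l2 (l2_le_gmat 0 iM))) => n n0.
apply: (@jacobi_agree_down z u (G ^~ 0) 0) => //; last by lia.
- by move=> m m0; rewrite hu.
- by move=> m m0; apply: gmat_col_eq; lia.
Qed.

Lemma weyl_zero (s : int) u : weyl_solution a b s z u -> u 0 = 0 -> u 1 = 0 -> False.
Proof.
move=> [u0 hu _] z0 z1; apply: u0; apply/funext => n.
have h0 m : jacobi a b (fun=> 0) m = z * 0 :> R[i] by rewrite /jacobi; ring.
have [n0|n0] := leP 0 n.
  apply: (@jacobi_agree_up z u (fun=> 0) 0) => // m _; by rewrite ?hu ?h0.
apply: (@jacobi_agree_down z u (fun=> 0) 1) => //; last by lia.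
  by move=> m _; rewrite hu.
Qed.

Lemma weyl_m_plus : weyl_m a b 1 z = - (G 1 0 / ((a 0)%:C%C * G 0 0)).
Proof.
rewrite /weyl_m; set u := xget _ _.
have hu : weyl_solution a b 1 z u by exact: xgetPex weyl_plus_ex.
have h := weyl_plus_green hu; have a0 := aC_neq0 0.
have u0 : u 0 != 0.
  apply/eqP => z0; apply: (weyl_zero hu z0); apply: (mulIf g0).
  by rewrite h z0 !mul0r.
have -> : G 1 0 = u 1 * G 0 0 / u 0 by rewrite h mulrC mulKf.
by field; rewrite a0 u0 g0.
Qed.

Lemma weyl_m_minus : weyl_m a b (-1) z = ((a 0)%:C%C * G 1 0 - 1) / (((a 0) ^+ 2)%:C%C * G 0 0).
Proof.
rewrite /weyl_m; set u := xget _ _.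
have hu : weyl_solution a b (-1) z u by exact: xgetPex weyl_minus_ex.
have h := weyl_minus_green hu; have a0 := aC_neq0 0.
have u0 : u 0 != 0.
  apply/eqP => z0; apply: (weyl_zero hu z0); apply: (mulIf g0); apply: (mulfI a0).
  by move: h; rewrite z0 mul0r => /esym /eqP; rewrite oppr_eq0 mulrA => /eqP ->; rewrite mul0r mulr0.
have -> : (a 0)%:C%C * G 1 0 - 1 = (a 0)%:C%C * u 1 * G 0 0 / u 0.
  by apply: (mulfI u0); rewrite mulrCA mulfV // mulr1 -opprB mulrN h opprK.
by rewrite rmorphXn /=; field; rewrite a0 u0 g0.
Qed.

End AtPoint.

Lemma gmat_lip z w M m n : inv_by (jacobi_shift a b z) M -> normc (w - z) * M <= 2^-1 ->
  normc (gmat a b w m n - gmat a b z m n) <= 2 * M ^+ 2 * normc (w - z).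
Proof.
move=> iM hw; have iN := inv_by_shift aC bC iM hw.
have ld := @l2_delta R n.
rewrite /gmat -normcN opprB (resolvent_id iM iN ld) normcM -normcN opprB mulrC.
apply: ler_wpM2r; first exact: normc_ge0.
have := l2_le_pt m (l2_le_resolvent iM (l2_le_resolvent iN (l2_le_delta R n))).
by rewrite mulr1 mulrCA -expr2.
Qed.

Lemma has_poleP (f : R[i] -> R[i]) (x : R) :
  (forall K : R, exists2 d : R, 0 < d & forall z, z != x%:C%C -> normc (z - x%:C%C) < d -> K < normc (f z)) ->
  has_pole f x.
Proof.
move=> h A [K [Kr KA]].
have [d d0 hd] := h (complex.Re K).
have d0' : 0 < d%:C%C :> R[i] by rewrite -[0]/(0%:C%C) ltcR.
exists d%:C%C => // z /=; rewrite /ball /= => zd zx; apply: KA.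
have -> : K = (complex.Re K)%:C%C by apply: complexP => //=; move: Kr; case: (K) => k1 k2; rewrite complex_real => /eqP.
rewrite (_ : `|f z| = (normc (f z))%:C%C) // ltcR; apply: hd => //.
by rewrite -ltcR -normcN opprB.
Qed.

Lemma not_has_pole (f : R[i] -> R[i]) (x K d : R) : 0 < d ->
  (forall z, z != x%:C%C -> normc (z - x%:C%C) < d -> normc (f z) <= K) -> ~ has_pole f x.
Proof.
move=> d0 h hp.
have hA : (+oo : set_system R[i]) [set y : R[i] | K%:C%C < y].
  by exists K%:C%C; split=> //; rewrite complex_real.
have := hp _ hA.
case=> r /= r0 hr.
have rE : r = (complex.Re r)%:C%C.
  by have := ltW r0; rewrite lecE => /andP[/eqP /= ri _]; apply: complexP => //=.
have r0' : 0 < complex.Re r by move: r0; rewrite {1}rE -[0]/(0%:C%C) ltcR.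
pose e := Num.min (complex.Re r) d / 2.
have m0 : 0 < Num.min (complex.Re r) d by rewrite lt_min r0' d0.
have e0 : 0 < e by rewrite divr_gt0.
pose z : R[i] := x%:C%C + e%:C%C.
have zE : z - x%:C%C = e%:C%C by rewrite /z; ring.
have nz : normc (z - x%:C%C) = e by rewrite zE normc_real gtr0_norm.
have em : e < Num.min (complex.Re r) d by rewrite /e ltr_pdivrMr // ltr_pMr // ltr1n.
have zx : z != x%:C%C by rewrite -subr_eq0 zE; apply/eqP => -[] /eqP; rewrite gt_eqF.
have := hr z; rewrite /ball /= => hz.
have : K%:C%C < `|f z|.
  apply: hz => //; rewrite rE (_ : `|_| = (normc (x%:C%C - z))%:C%C) // ltcR.
  by rewrite -normcN opprB nz; move: em; rewrite lt_min => /andP[].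
rewrite (_ : `|f z| = (normc (f z))%:C%C) // ltcR ltNge => /negP; apply.
by apply: h => //; rewrite nz; move: em; rewrite lt_min => /andP[].
Qed.

(** At a zero of g the function A = a_0 G_10 satisfies A^2 = A, and A = (1 + h)/2.
    The Weyl functions are -A/(a_0^2 g) and (A - 1)/(a_0^2 g), so the one whose numerator does
    not vanish has the pole; the other is bounded because A^2 - A = a_0^2 g G_11. *)
Lemma dirichlet_signE (x h : R) M : inv_by (jacobi_shift a b x%:C%C) M ->
  gmat a b x%:C%C 0 0 = 0 -> (a 0)%:C%C * gmat a b x%:C%C 1 0 = ((1 + h) / 2)%:C%C ->
  (h = 1 -> dirichlet_sign a b x = 1) /\ (h = -1 -> dirichlet_sign a b x = -1).
Proof.
move=> iM gx Ax; have M0 : 0 <= M by case: iM.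
have a0 := aC_neq0 0.
have a2 : 0 < a 0 ^+ 2 by rewrite exprn_even_gt0 //= an.
pose c := complex.Re (dgreen a b x%:C%C).
have c0 : 0 < c := dgreen_gt0 aC iM.
pose L := 2 * M ^+ 2.
have L0 : 0 <= L by rewrite mulr_ge0 // sqr_ge0.
pose d := Num.min (2^-1 / (M + 1)) (Num.min (2^-1 / (`|a 0| * L + 1)) (c / (2 * M ^+ 3 + 1))).
have M3 : 0 <= 2 * M ^+ 3 by rewrite mulr_ge0 // exprn_ge0.
have aL : 0 <= `|a 0| * L by rewrite mulr_ge0.
have d0 : 0 < d by rewrite !lt_min !divr_gt0 ?invr_gt0 // ltr_wpDl.
have near z : z != x%:C%C -> normc (z - x%:C%C) < d ->
  [/\ inv_by (jacobi_shift a b z) (2 * M), gmat a b z 0 0 != 0,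
   normc (gmat a b z 0 0) <= L * normc (z - x%:C%C) &
   normc ((a 0)%:C%C * gmat a b z 1 0 - ((1 + h) / 2)%:C%C) <= 2^-1].
  move=> zx; rewrite !lt_min => /and3P[/ltW h1 /ltW h2 h3].
  have r0 : 0 < normc (z - x%:C%C).
    by rewrite lt_neqAle normc_ge0 andbT eq_sym; apply: contra zx => /eqP /eq0_normc /eqP; rewrite subr_eq0.
  have hw : normc (z - x%:C%C) * M <= 2^-1.
    apply: le_trans (ler_wpM2r M0 h1) _.
    by rewrite -mulrA ler_piMr // mulrC ler_pdivrMr ?mul1r ?lerDl // ltr_wpDl.
  have [k1 k2 _] := green_zquad aC bC iM hw.
  split.
  - exact: inv_by_shift aC bC iM hw.
  - apply/eqP => gz; move: k2; rewrite gz gx subrr sub0r normcN normcM.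
    rewrite expr2 mulrA mulrC ler_pM2r // leNgt => /negP; apply.
    apply: lt_le_trans (_ : c <= _); last by apply: le_trans (Re_le_normc _); rewrite -/c ler_norm.
    move: h3; rewrite ltr_pdivlMr ?ltr_wpDl // mulrC; apply: le_lt_trans.
    by rewrite [leRHS]mulrDl mul1r lerDl ltW.
  - by move: k1; rewrite gx subr0.
  - rewrite -Ax -mulrBr normcM normc_real.
    apply: le_trans (ler_wpM2l (normr_ge0 _) (gmat_lip 1 0 iM hw)) _; rewrite -/L mulrA.
    apply: le_trans (ler_wpM2l aL h2) _.
    by rewrite mulrCA ler_piMr // ?invr_ge0 // ler_pdivrMr ?mul1r ?lerDl // ltr_wpDl.
have wr z N : inv_by (jacobi_shift a b z) N -> let A := (a 0)%:C%C * gmat a b z 1 0 in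
   A * (A - 1) = ((a 0) ^+ 2)%:C%C * gmat a b z 0 0 * gmat a b z 1 1.
  move=> iN /=; have := gmat_wronskian aC 0 iN; rewrite add0r => wE.
  by rewrite mulrBr mulr1 -{3}wE rmorphXn /=; ring.
(* the Weyl function whose numerator N stays away from 0 has a pole *)
have pole (f : R[i] -> R[i]) (N : R[i] -> R[i]) :
    (forall z, z != x%:C%C -> normc (z - x%:C%C) < d ->
      f z = N z / (((a 0) ^+ 2)%:C%C * gmat a b z 0 0) /\ 2^-1 <= normc (N z)) -> has_pole f x.
  move=> hf; apply: has_poleP => K.
  pose K' := `|K| + 1; have K0 : 0 < K' by rewrite ltr_wpDl.
  have kk : 0 <= K' * (2 * (a 0 ^+ 2 * L)) 
    by apply: mulr_ge0; [exact: ltW|apply: mulr_ge0 => //; apply: mulr_ge0 => //; exact: ltW].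
  exists (Num.min d (K' * (2 * (a 0 ^+ 2 * L)) + 1)^-1); first by rewrite lt_min d0 invr_gt0 ltr_wpDl.
  move=> z zx; rewrite lt_min => /andP[zd zk].
  have [fE hN] := hf z zx zd; have [_ gz gL _] := near z zx zd.
  have g0 : 0 < normc (gmat a b z 0 0).
    by rewrite lt_neqAle normc_ge0 andbT eq_sym; apply: contra gz => /eqP /eq0_normc ->.
  rewrite fE normcM normcV normcM normc_real (gtr0_norm a2).
  apply: (@lt_le_trans _ _ K'); first by rewrite /K'; apply: le_lt_trans (ler_norm K) _; rewrite ltrDl.
  rewrite (ler_pdivlMr _ _ (mulr_gt0 a2 g0)); apply: le_trans hN.
  have : K' * (a 0 ^+ 2 * normc (gmat a b z 0 0)) <= K' * (a 0 ^+ 2 * (L * normc (z - x%:C%C))).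
    by rewrite ler_pM2l // ler_pM2l.
  move/le_trans; apply.
  have : normc (z - x%:C%C) * (K' * (2 * (a 0 ^+ 2 * L)) + 1) <= 1.
    by rewrite -ler_pdivlMr ?ltr_wpDl // div1r ltW.
  have := normc_ge0 (z - x%:C%C); set q := normc (z - _); lra.
have nopole (f : R[i] -> R[i]) (N : R[i] -> R[i]) :
    (forall z, z != x%:C%C -> normc (z - x%:C%C) < d ->
      f z * N z = gmat a b z 1 1 /\ 2^-1 <= normc (N z)) -> ~ has_pole f x.
  move=> hf; apply: (@not_has_pole f x (4 * M) d d0) => z zx zd.
  have [fE hN] := hf z zx zd; have [iN _ _ _] := near z zx zd.
  have := gmat_bound 1 1 iN; rewrite -fE normcM => hb.
  have : normc (f z) * 2^-1 <= normc (f z) * normc (N z) by rewrite ler_wpM2l ?normc_ge0.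
  lra.
have nR (u v : R[i]) : normc (u - v) <= 2^-1 -> normc v = 1 -> 2^-1 <= normc u.
  move=> h1 h2; have : normc v <= normc u + normc (u - v).
    by have := normcB u (u - v); rewrite opprB addrC subrK.
  by rewrite h2; lra.
have fp z (iN : inv_by (jacobi_shift a b z) (2 * M)) (gz : gmat a b z 0 0 != 0) :
   weyl_m a b 1 z = - ((a 0)%:C%C * gmat a b z 1 0) / (((a 0) ^+ 2)%:C%C * gmat a b z 0 0).
  by rewrite (weyl_m_plus iN gz) rmorphXn /=; field; rewrite a0 gz.
have fm z (iN : inv_by (jacobi_shift a b z) (2 * M)) (gz : gmat a b z 0 0 != 0) :=
  weyl_m_minus iN gz.
have a2n : ((a 0) ^+ 2)%:C%C != 0 :> R[i] by rewrite rmorphXn expf_neq0.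
split=> hh.
  have Az z : z != x%:C%C -> normc (z - x%:C%C) < d -> 2^-1 <= normc ((a 0)%:C%C * gmat a b z 1 0).
    move=> zx zd; have [_ _ _ k] := near z zx zd.
    by apply: nR k _ => //; rewrite hh normc_real (_ : (1 + 1) / 2 = 1) ?normr1 //; field.
  have p1 : has_pole (weyl_m a b 1) x.
    apply: (pole _ (fun z => - ((a 0)%:C%C * gmat a b z 1 0))) => z zx zd.
    by have [iN gz _ _] := near z zx zd; rewrite normcN; split; [exact: fp | exact: Az].
  have p2 : ~ has_pole (weyl_m a b (-1)) x.
    apply: (nopole _ (fun z => (a 0)%:C%C * gmat a b z 1 0)) => z zx zd.
    have [iN gz _ _] := near z zx zd; split; last exact: Az.
    rewrite (fm z iN gz) mulrAC [X in X / _]mulrC (wr z _ iN) mulrAC mulfV ?mul1r //.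
    by rewrite mulf_neq0.
  have ex1 : exists s : int, (s = 1 \/ s = -1) /\ has_pole (weyl_m a b s) x.
    by exists 1; split; [left | exact: p1].
  have [[sE|sE] hp] := xgetPex 1 ex1; first exact: sE.
  by exfalso; apply: p2; rewrite sE in hp; exact: hp.
have Az z : z != x%:C%C -> normc (z - x%:C%C) < d -> 2^-1 <= normc ((a 0)%:C%C * gmat a b z 1 0 - 1).
  move=> zx zd; have [_ _ _ k] := near z zx zd.
  apply: (nR _ (-1)) => //; last by rewrite normcN (normc_nat R 1).
  rewrite opprK subrK; move: k; rewrite hh subrr mul0r -[0%:C%C]/(0 : R[i]) subr0 //.
have p1 : has_pole (weyl_m a b (-1)) x.
  apply: (pole _ (fun z => (a 0)%:C%C * gmat a b z 1 0 - 1)) => z zx zd.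
  by have [iN gz _ _] := near z zx zd; split; [exact: fm | exact: Az].
have p2 : ~ has_pole (weyl_m a b 1) x.
  apply: (nopole _ (fun z => - ((a 0)%:C%C * gmat a b z 1 0 - 1))) => z zx zd.
  have [iN gz _ _] := near z zx zd; split; last by rewrite normcN; exact: Az.
  rewrite (fp z iN gz) mulrAC mulrNN (wr z _ iN) mulrAC mulfV ?mul1r //.
  by rewrite mulf_neq0.
have ex1 : exists s : int, (s = 1 \/ s = -1) /\ has_pole (weyl_m a b s) x.
  by exists (-1); split; [right | exact: p1].
have [[sE|sE] hp] := xgetPex 1 ex1; last exact: sE.
by exfalso; apply: p2; rewrite sE in hp; exact: hp.
Qed.

End Weyl.

(** * One-variable calculus for the angles *)
Section Calculus.
Variable R : realType.
Implicit Types (f g c : R -> R) (t d : R).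

Lemma is_derive_epsP f t d : is_derive t 1 f d <->
  (forall e : R, 0 < e -> exists2 dl : R, 0 < dl & forall h, `|h| < dl ->
    `|f (t + h) - f t - h * d| <= e * `|h|).
Proof.
split=> [[dv dE] e e0|H].
  have cv : h^-1 *: (f (h *: (1 : R^o) + t) - f t) @[h --> (0:R)^'] --> d.
    by rewrite -dE; exact: dv.
  have [dl /= dl0 hdl] := (cvgrPdist_le _ _).1 cv e e0.
  exists dl => // h hh; have [->|h0] := eqVneq h 0; first by rewrite addr0 subrr mul0r subrr normr0 mulr0.
  have := hdl h; rewrite /ball /= sub0r normrN => /(_ hh h0).
  rewrite /GRing.scale /= mulr1 (addrC h) => hq.
  have -> : f (t + h) - f t - h * d = - ((d - h^-1 * (f (t + h) - f t)) * h) by field.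
  by rewrite normrN normrM ler_wpM2r.
have cv : h^-1 *: (f (h *: (1 : R^o) + t) - f t) @[h --> (0:R)^'] --> d.
  apply/cvgrPdist_le => e e0; have [dl dl0 hdl] := H e e0.
  near=> h.
  have h0 : h != 0 by near: h; exact: nbhs_dnbhs_neq.
  have hh : `|h| < dl by near: h; exact: dnbhs0_lt.
  rewrite /GRing.scale /= mulr1 (addrC h).
  have -> : d - h^-1 * (f (t + h) - f t) = - (h^-1 * (f (t + h) - f t - h * d)) by field.
  by rewrite normrN normrM normfV ler_pdivrMl ?normr_gt0 // (mulrC `|h| e); exact: hdl.
split; first by apply/cvg_ex; exists d.
by apply/cvg_lim.
Unshelve. all: by end_near. Qed.

Lemma is_derive_near f g t d : (\forall s \near t, f s = g s) ->
  is_derive t 1 g d -> is_derive t 1 f d.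
Proof.
move=> fg /is_derive_epsP H; apply/is_derive_epsP => e e0.
have [dl dl0 hdl] := H e e0; have ft := nbhs_singleton fg.
case: fg => r /= r0 hr; exists (Num.min dl r); first by rewrite lt_min dl0.
move=> h; rewrite lt_min => /andP[h1 h2]; rewrite ft hr; first exact: hdl.
by rewrite /ball /= opprD addrA subrr sub0r normrN.
Qed.

Lemma is_derive_cvg f t d : is_derive t 1 f d -> f s @[s --> t] --> f t.
Proof. by case=> /derivable1_diffP /differentiable_continuous. Qed.

(** Only the first factor has to be expanded, because it vanishes at t.  In the application
    the second one contains an infinite product, which is only known to be continuous. *)
Lemma is_derive_zero_mul f c t d : is_derive t 1 f d -> f t = 0 ->
  c s @[s --> t] --> c t -> is_derive t 1 (fun s => f s * c s) (d * c t).
Proof.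
move=> /is_derive_epsP H ft cc; apply/is_derive_epsP => e e0.
pose A := `|d| + 1; pose B := `|c t| + 1.
have A0 : 0 < A by rewrite ltr_wpDl.
have B0 : 0 < B by rewrite ltr_wpDl.
have ea : 0 < e / 2 / B by rewrite !divr_gt0.
have eb : 0 < Num.min 1 (e / 2 / A) by rewrite lt_min ltr01 !divr_gt0.
have [d1 d10 h1] := H _ ea.
have [d2 /= d20 h2] := (cvgrPdist_le _ _).1 cc _ eb.
exists (Num.min d1 d2); first by rewrite lt_min d10.
move=> h; rewrite lt_min => /andP[hd1 hd2].
have := h1 h hd1; rewrite ft subr0 => k1.
have := h2 (t + h); rewrite /ball /= opprD addrA subrr sub0r normrN => /(_ hd2).
rewrite le_min => /andP[k2 k3].
have cB : `|c (t + h)| <= B.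
  have -> : c (t + h) = c t - (c t - c (t + h)) by ring.
  by apply: le_trans (ler_normB _ _) _; rewrite lerD2l.
have -> : f (t + h) * c (t + h) - 0 * c t - h * (d * c t) =
   (f (t + h) - h * d) * c (t + h) - h * (d * (c t - c (t + h))) by ring.
apply: le_trans (ler_normB _ _) _; rewrite !normrM.
have u1 : `|f (t + h) - h * d| * `|c (t + h)| <= e / 2 / B * `|h| * B by apply: ler_pM.
have u2 : `|d| * `|c t - c (t + h)| <= A * (e / 2 / A) by apply: ler_pM => //; rewrite lerDl.
have u3 : `|h| * (`|d| * `|c t - c (t + h)|) <= `|h| * (A * (e / 2 / A)) by rewrite ler_wpM2l.
have e1 : e / 2 / B * `|h| * B = e / 2 * `|h| by rewrite mulrAC divfK // gt_eqF.
have e2 : A * (e / 2 / A) = e / 2 by rewrite mulrC divfK // gt_eqF.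
by rewrite e1 in u1; rewrite e2 in u3; lra.
Qed.

Lemma is_derive_min_eq0 f t d (r : R) : is_derive t 1 f d -> 0 < r ->
  (forall s, `|s - t| < r -> f t <= f s) -> d = 0.
Proof.
move=> /is_derive_epsP H r0 hm; apply/eqP; apply: contraT => d0.
have ad : 0 < `|d| by rewrite normr_gt0.
have [dl dl0 hdl] := H (`|d| / 2) (divr_gt0 ad (ltr0n R 2)).
pose k := Num.min dl r / 2.
have m0 : 0 < Num.min dl r by rewrite lt_min dl0.
have k0 : 0 < k by rewrite divr_gt0.
have km : k < Num.min dl r by rewrite ltr_pdivrMr // ltr_pMr // ltr1n.
move: km; rewrite lt_min => /andP[kd kr].
pose h := - (Num.sg d * k).
have hk : `|h| = k by rewrite normrN normrM normr_sg d0 mul1r gtr0_norm.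
have := hdl h; rewrite hk => /(_ kd); rewrite ler_norml => /andP[_ u].
have := hm (t + h); rewrite addrC addKr hk => /(_ kr) v.
have hd : h * d = - (k * `|d|) by rewrite /h mulNr mulrAC -normrEsg mulrC.
have kp : 0 < k * `|d| by rewrite mulr_gt0.
by move: u v; rewrite hd; lra.
Qed.

(** By the mean value theorem.  It serves at the times at which a Dirichlet datum sits on a
    gap edge. *)
Lemma is_derive_removable f g t : f s @[s --> t] --> f t -> g s @[s --> t] --> g t ->
  (\forall s \near t^', is_derive (s : R) 1 f (g s)) -> is_derive t 1 f (g t).
Proof.
move=> cf cg [r /= r0 hr]; apply/is_derive_epsP => e e0.
have [dl /= dl0 hdl] := (cvgrPdist_le _ _).1 cg e e0.
have fd s : `|s - t| < r -> s != t -> is_derive s 1 f (g s).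
  by move=> st sn; apply: hr => //; rewrite /ball /= distrC.
have fc s : `|s - t| < r -> {for s, continuous f}.
  move=> st; have [->|sn] := eqVneq s t; first exact: cf.
  exact: is_derive_cvg (fd s st sn).
have main x y : x < y -> (x = t \/ y = t) -> y - x < Num.min dl r ->
   `|f y - f x - (y - x) * g t| <= e * (y - x).
  move=> xy hxy; rewrite lt_min => /andP[ydl yr].
  have cc : {within `[x, y], continuous f}.
    apply: continuous_in_subspaceT => s; rewrite inE /= in_itv /= => /andP[s1 s2].
    by apply: fc; rewrite ltr_norml; case: hxy => <-; apply/andP; split; lra.
  have dd s : s \in `]x, y[%R -> is_derive s 1 f (g s).
    rewrite in_itv /= => /andP[s1 s2]; apply: fd.
      by rewrite ltr_norml; case: hxy => <-; apply/andP; split; lra.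
    by case: hxy => <-; rewrite ?(gt_eqF s1) ?(lt_eqF s2).
  have [c] := MVT xy dd cc; rewrite in_itv /= => /andP[c1 c2] ->.
  rewrite [g c * _]mulrC -mulrBr normrM ger0_norm ?subr_ge0 ?(ltW xy) // mulrC.
  apply: ler_wpM2r; first by rewrite subr_ge0 ltW.
  rewrite distrC; apply: hdl; rewrite /ball /= ltr_norml.
  by case: hxy => <-; apply/andP; split; lra.
exists (Num.min dl r) => [|h hh]; first by rewrite lt_min dl0.
have [h0|h0|->] := ltgtP h 0; last by rewrite addr0 subrr mul0r subrr normr0 mulr0.
  have := @main (t + h) t; rewrite gtrDl h0 => /(_ isT (or_intror erefl)).
  have -> : t - (t + h) = `|h| by rewrite ltr0_norm //; ring.
  move=> /(_ hh); rewrite -normrN; congr (`|_| <= _); rewrite ltr0_norm //; ring.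
have := @main t (t + h); rewrite ltrDl h0 => /(_ isT (or_introl erefl)).
have -> : t + h - t = h by ring.
by move: hh; rewrite (gtr0_norm h0) => hh; apply.
Qed.

End Calculus.

(** * Points of the circle with a given cosine *)
Section CircleCos.
Variable R : realType.

Lemma cos_half_sq (y : R) : cos (y / 2) ^+ 2 = (1 + cos y) / 2.
Proof.
have -> : cos y = cos (y / 2 + y / 2) by congr cos; rewrite -splitr.
by rewrite cosD -!expr2 sin2cos2; field.
Qed.

Lemma cosD_int (y : R) (k : int) : cos (y + k%:~R * (2 * pi)) = cos y.
Proof.
have nat (n : nat) (x : R) : cos (x + n%:R * (2 * pi)) = cos x.
  have e (u : R) : cos (u + 2 * pi) = cos u by rewrite mulr_natl cosD2pi.
  elim: n => [|n IH]; first by rewrite mul0r addr0.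
  by rewrite -natr1 mulrDl mul1r addrA e IH.
case: k => n; first exact: nat.
by rewrite -(nat n.+1) NegzE mulrNz mulNr subrK.
Qed.

Lemma cos_eq_circle (y : R) : exists tau : R, (tau = 1 \/ tau = -1) /\
  circle_of y = circle_of (tau * acos (cos y)).
Proof.
have pi0 := pi_gt0 R; have p2 : 0 < 2 * pi :> R by rewrite mulr_gt0.
pose k := Num.floor (y / (2 * pi)); pose y' := y - k%:~R * (2 * pi).
have yE : y = y' + k%:~R * (2 * pi) by rewrite /y' subrK.
have /andP[k1 k2] : k%:~R <= y / (2 * pi) < (k + 1)%:~R by exact: floor_itv.
have y0 : 0 <= y' by rewrite /y' subr_ge0 -ler_pdivlMr.
have y2 : y' < 2 * pi by rewrite /y' ltrBlDl -[X in _ + X]mul1r -mulrDl -ltr_pdivrMr // -[1]/(1%:~R) -intrD.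
rewrite yE cosD_int; have [yp|yp] := leP y' pi.
  exists 1; split; first by left.
  rewrite cosK ?in_itv /= ?y0 // mul1r; apply/circle_ofP; exists k; ring.
exists (-1); split; first by right.
have cE : cos y' = cos (2 * pi - y') 
  by rewrite -[2 * pi - y']opprB cosN -(cosD_int (y' - 2 * pi) 1) mul1r subrK.
rewrite cE cosK; last by rewrite in_itv /=; apply/andP; split; lra.
by apply/circle_ofP; exists (k + 1); rewrite intrD; ring.
Qed.

End CircleCos.

(** * The Toda flow of the Dirichlet data *)
Section DirichletFlow.
Variables (R : realType) (E : set R) (I : countType) (Em Ep : I -> R).
Local Notation mu := (@lebesgue_measure R).
Hypothesis mE : (0 < mu E)%E.
Hypothesis gfE : gap_family E Em Ep.
Hypothesis craig : craig_condition E Em Ep.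
Local Notation e0 := (inf E).
Local Notation e1 := (sup E).
Variables a b : R -> int -> R.
Hypothesis sol : toda_solution a b.
Hypothesis jc : jacobi_class E (a 0) (b 0).

Definition dm k (t : R) : R := dmu Em Ep (a t) (b t) k.
Definition gx (x t : R) : R := gre (a t) (b t) x.
Definition hx (x t : R) : R := complex.Re (hf a b x%:C%C t).
Definition spoly j (x : R) : R := edge_poly E Em Ep j x.

Lemma flow_bound t : exists C, (forall n, `|a t n| <= C) /\ (forall n, `|b t n| <= C).
Proof.
have [C [_ hC]] := toda_bound sol `|t|; exists C.
by split=> n; have [] := hC t n (lexx _).
Qed.

Lemma flow_res t x : ~ E x -> exists M, inv_by (jacobi_shift (a t) (b t) x%:C%C) M.
Proof. by move=> nE; exact: res_all_at (res_all_real sol jc nE) t. Qed.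

Lemma flow_res_im t z : 0 < complex.Im z -> exists M, inv_by (jacobi_shift (a t) (b t) z) M.
Proof. by move=> z0; exact: res_all_at (res_all_im sol jc z0) t. Qed.

Lemma dm_in t k : Em k <= dm k t <= Ep k.
Proof. by have [C [aC bC]] := flow_bound t; exact: (dmu_in mE gfE aC bC (flow_res t)). Qed.

Lemma dm_sg t k x : Em k < x < Ep k -> Num.sg (gx x t) = Num.sg (x - dm k t).
Proof. by have [C [aC bC]] := flow_bound t; exact: (dmu_sg mE gfE aC bC (flow_res t)). Qed.

Lemma gx_product t j x : Em j < x < Ep j ->
  gx x t ^+ 2 * spoly j x * wprod Em Ep j x (dm ^~ t) = (x - dm j t) ^+ 2.
Proof.
have [C [aC bC]] := flow_bound t => hx.
exact: (green_product mE gfE aC bC (flow_res t) craig (flow_res_im t) (reflectionless_time sol jc t) hx).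
Qed.

Lemma gx_product_sqrt t j x : Em j < x < Ep j ->
  x - dm j t = gx x t * Num.sqrt (spoly j x * wprod Em Ep j x (dm ^~ t)).
Proof.
have [C [aC bC]] := flow_bound t => hx.
exact: (green_product_sqrt mE gfE aC bC (flow_res t) craig (flow_res_im t) (reflectionless_time sol jc t) hx).
Qed.

Section RealPoint.
Variable x : R.
Hypothesis nE : ~ E x.
Let rx := res_all_real sol jc nE.

Lemma real_gmat t m n : complex.Im (gt a b x%:C%C t m n) = 0.
Proof. by have [M iM] := flow_res t nE; exact: gmat_real m n iM. Qed.

Lemma Re_mul2 (z : R[i]) : complex.Re (2 * z) = 2 * complex.Re z.
Proof. by rewrite mulr_natl mulr2n Re_add -mulr2n mulr_natl. Qed.

Lemma Re_mulC (r : R) (z : R[i]) : complex.Re (r%:C%C * z) = r * complex.Re z.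
Proof. by rewrite Re_mul /= mul0r subr0. Qed.

Lemma gx_derive (t : R) : is_derive t 1 (gx x) (2 * hx x t).
Proof.
have [h _] := gf_cder sol rx t.
by rewrite Re_mul2 in h; exact: h.
Qed.

Definition qx t : R := complex.Re (qf a b x%:C%C t).
Definition qmx t : R := complex.Re (qmf a b x%:C%C t).

Lemma hx_derive (t : R) : is_derive t 1 (hx x) (2 * qx t + 2 * qmx t - kf a t * gx x t).
Proof.
have [h _] := hf_cder sol rx t.
have e (u v w : R[i]) (k : R) : complex.Re (2 * u + 2 * v - k%:C%C * w) =
   2 * complex.Re u + 2 * complex.Re v - k * complex.Re w.
  by rewrite Re_add Re_opp Re_add !Re_mul2 Re_mulC.
by rewrite e in h; exact: h.
Qed.

Lemma gfE_real t : gf a b x%:C%C t = (gx x t)%:C%C.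
Proof. by apply: complexP => //=; exact: real_gmat. Qed.

Lemma hfE_real t : hf a b x%:C%C t = (hx x t)%:C%C.
Proof.
apply: complexP => //=; rewrite /hf Im_add Im_opp !Im_mul /= !real_gmat.
by rewrite !mulr0 !mul0r !addr0 subr0.
Qed.

Lemma qfE_real t : qf a b x%:C%C t = (qx t)%:C%C.
Proof. by apply: complexP => //=; rewrite /qf Im_mul /= real_gmat mulr0 mul0r addr0. Qed.

Lemma qmfE_real t : qmf a b x%:C%C t = (qmx t)%:C%C.
Proof. by apply: complexP => //=; rewrite /qmf Im_mul /= real_gmat mulr0 mul0r addr0. Qed.

Lemma cfE_real t : cf b x%:C%C t = (b t 0 - x)%:C%C.
Proof. by rewrite /cf rmorphB. Qed.

Lemma gqx_id t : 4 * gx x t * qx t = (hx x t - (b t 0 - x) * gx x t) ^+ 2 - 1.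
Proof.
have := gq_id sol rx t; rewrite gfE_real hfE_real qfE_real cfE_real.
by rewrite -(rmorph_nat (real_complex R) 4) -!rmorphM -rmorphB -rmorphXn -(rmorph1 (real_complex R)) -rmorphB => -[].
Qed.

Lemma gqmx_id t : 4 * gx x t * qmx t = (hx x t + (b t 0 - x) * gx x t) ^+ 2 - 1.
Proof.
have := gqm_id sol rx t; rewrite gfE_real hfE_real qmfE_real cfE_real.
by rewrite -(rmorph_nat (real_complex R) 4) -!rmorphM -rmorphD -rmorphXn -(rmorph1 (real_complex R)) -rmorphB => -[].
Qed.

Lemma hx_sq t : gx x t = 0 -> hx x t ^+ 2 = 1.
Proof.
move=> g0; have := gqx_id t; rewrite g0 !mulr0 mul0r subr0 => /esym /eqP.
by rewrite subr_eq0 => /eqP.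
Qed.

(** The quadratic identities eliminate q and q_- from h' = 2 q + 2 q_- - kappa g, which leaves
    a Riccati equation. *)
Lemma riccati (t : R) : gx x t != 0 ->
  is_derive t 1 (fun s => - hx x s / gx x s)
   ((- hx x t / gx x t) ^+ 2 + (gx x t ^+ 2)^-1 + kf a t - (b t 0 - x) ^+ 2).
Proof.
move=> g0.
have dg := gx_derive t; have dh := hx_derive t.
have d1 := is_deriveM (is_deriveN dh) (is_deriveV g0 dg).
apply: (is_derive_eq d1).
have e : (2 * qx t + 2 * qmx t) * gx x t = hx x t ^+ 2 + (b t 0 - x) ^+ 2 * gx x t ^+ 2 - 1.
  by have := gqx_id t; have := gqmx_id t; lra.
have -> : (- hx x) t = - hx x t by [].
rewrite /GRing.scale /=.
have e2 : 2 * qx t + 2 * qmx t = (hx x t ^+ 2 + (b t 0 - x) ^+ 2 * gx x t ^+ 2 - 1) / gx x t.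
  by rewrite -e mulfK.
rewrite e2; field; exact: g0.
Qed.

End RealPoint.

Lemma gap_nE k x : Em k < x < Ep k -> ~ E x.
Proof. exact: (gap_notin gfE). Qed.

(** Green's function at points next to mu_k(t0) keeps its sign for nearby times, which traps
    mu_k(t). *)
Lemma dm_cvg k (t0 : R) : dm k t @[t --> t0] --> dm k t0.
Proof.
have [_ lt _] := gap_range mE gfE k.
have lower e : 0 < e -> \forall t \near t0, dm k t0 - e < dm k t.
  move=> ep; have [h|h] := ltP (dm k t0 - e) (Em k).
    by near=> t; apply: lt_le_trans h _; case/andP: (dm_in t k).
  have /andP[m1 m2] := dm_in t0 k.
  pose x := dm k t0 - e / 2.
  have hx' : Em k < x < Ep k by apply/andP; split; rewrite /x; lra.
  have g0 : gx x t0 < 0.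
    by rewrite -sgr_lt0 (dm_sg t0 hx') sgr_lt0 /x; lra.
  have := is_derive_cvg (gx_derive (gap_nE hx') t0) => cg.
  near=> t.
  have gt0 : gx x t < 0 by near: t; exact: (cvgr_lt _ cg _ g0).
  have : Num.sg (x - dm k t) = -1 by rewrite -(dm_sg t hx') ltr0_sg.
  by move=> /eqP; rewrite sgr_cp0 subr_lt0 /x; lra.
have upper e : 0 < e -> \forall t \near t0, dm k t < dm k t0 + e.
  move=> ep; have [h|h] := ltP (Ep k) (dm k t0 + e).
    by near=> t; apply: le_lt_trans h; case/andP: (dm_in t k).
  have /andP[m1 m2] := dm_in t0 k.
  pose x := dm k t0 + e / 2.
  have hx' : Em k < x < Ep k by apply/andP; split; rewrite /x; lra.
  have g0 : 0 < gx x t0.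
    by rewrite -sgr_gt0 (dm_sg t0 hx') sgr_gt0 /x; lra.
  have := is_derive_cvg (gx_derive (gap_nE hx') t0) => cg.
  near=> t.
  have gt0 : 0 < gx x t by near: t; exact: (cvgr_gt _ cg _ g0).
  have : Num.sg (x - dm k t) = 1 by rewrite -(dm_sg t hx') gtr0_sg.
  by move=> /eqP; rewrite sgr_cp0 subr_gt0 /x; lra.
apply/cvgrPdist_lt => e ep; near=> t.
have h1 : dm k t0 - e < dm k t by near: t; exact: lower.
have h2 : dm k t < dm k t0 + e by near: t; exact: upper.
by rewrite ltr_norml; apply/andP; split; lra.
Unshelve. all: by end_near. Qed.

Definition in_gap k t := Em k < dm k t < Ep k.

Lemma in_gap_near k t : in_gap k t -> \forall s \near t, in_gap k s.
Proof.
move=> /andP[h1 h2]; near=> s; apply/andP; split; near: s.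
- exact: (cvgr_gt _ (@dm_cvg k t) _ h1).
- exact: (cvgr_lt _ (@dm_cvg k t) _ h2).
Unshelve. all: by end_near. Qed.

Lemma gx_dm k t : in_gap k t -> gx (dm k t) t = 0.
Proof. by move=> hi; have := dm_sg t hi; rewrite subrr sgr0 => /eqP; rewrite sgr_eq0 => /eqP. Qed.

Lemma wprod_dm_gt0 j t : 0 < wprod Em Ep j (dm j t) (dm ^~ t).
Proof. exact: (wprod_gt0 mE gfE craig (dm_in t j) (dm_in t)). Qed.

Definition speed j t : R := Num.sqrt (spoly j (dm j t) * wprod Em Ep j (dm j t) (dm ^~ t)).

Lemma speed_gt0 j t : in_gap j t -> 0 < speed j t.
Proof.
by move=> hi; rewrite sqrtr_gt0 mulr_gt0 ?wprod_dm_gt0 //; exact: (edge_poly_gt0 mE gfE hi).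
Qed.

(** By the product formula at the fixed point x0 = mu_j(t0), mu_j - x0 is -g(x0, .) times a
    continuous function, and g(x0, .) vanishes at t0 with derivative 2 h. *)
Lemma dm_derive j (t : R) : in_gap j t ->
  is_derive t 1 (dm j) (- (2 * hx (dm j t) t * speed j t)).
Proof.
move=> hi; set x0 := dm j t.
pose c (s : R) : R := Num.sqrt (spoly j x0 * wprod Em Ep j x0 (dm ^~ s)).
have dE : dm j = (fun s => x0 - gx x0 s * c s).
  by apply/funext => s; rewrite /c -(gx_product_sqrt s hi) -/x0 subKr.
have cc : c s @[s --> t] --> c t.
  apply: (@continuous_cvg _ _ _ _ _ _ (@Num.sqrt R)); first exact: sqrt_continuous.
  apply: cvgM; first exact: cvg_cst.
  have hx0 : Em j <= x0 <= Ep j by exact: dm_in.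
  by apply: (wprod_cvg mE gfE craig) => //; [exact: dm_in|exact: dm_in|exact: cvg_cst|move=> k; exact: dm_cvg].
have := is_derive_zero_mul (gx_derive (gap_nE hi) t) (gx_dm hi) cc => dgc.
rewrite {1}dE; have := is_deriveB (is_derive_cst x0 t 1) dgc.
by rewrite sub0r; exact.
Qed.

Lemma no_extremum j t (r : R) : in_gap j t -> 0 < r ->
  ~ (forall s, `|s - t| < r -> dm j t <= dm j s) /\ ~ (forall s, `|s - t| < r -> dm j s <= dm j t).
Proof.
move=> hi r0; have dd := dm_derive hi.
have h2 := hx_sq (gap_nE hi) (gx_dm hi); have sp := speed_gt0 hi.
have d0 : 2 * hx (dm j t) t * speed j t != 0.
  have hn : hx (dm j t) t != 0.
    by apply/eqP => h0; move: h2; rewrite h0 expr0n /= => /eqP; rewrite eq_sym oner_eq0.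
  by rewrite !mulf_neq0 // gt_eqF.
split=> H.
  by have := is_derive_min_eq0 dd r0 H => /eqP; rewrite oppr_eq0 (negbTE d0).
have dn := is_deriveN dd.
have := is_derive_min_eq0 dn r0; rewrite opprK => H2.
by move: d0; rewrite H2 ?eqxx // => s hs; rewrite lerN2; exact: H.
Qed.

(** ** The Dirichlet datum does not stay at a gap edge *)

(** If mu_j is the edge e, the product formula reads g^2 Q W_j = |x - e| with Q and W_j bounded
    below near e. *)
Lemma green_small j (e : R) : e = Em j \/ e = Ep j -> forall eta : R, 0 < eta ->
  exists2 x : R, Em j < x < Ep j & forall t, dm j t = e -> gx x t != 0 /\ gx x t ^+ 2 <= eta.
Proof.
move=> he eta eta0; have [g1 g2 g3] := gap_range mE gfE j; have [d1 d2] := gap_edges mE gfE craig j.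
have [c c0 hc] := wprod_lower mE gfE craig j.
pose rho := Num.min (Em j - e0) (Num.min (e1 - Ep j) ((Ep j - Em j) / 2)).
have rho0 : 0 < rho by rewrite !lt_min; apply/and3P; split; lra.
have : rho <= rho by [].
rewrite {2}/rho !le_min => /and3P[r1 r2 r3].
pose k := rho ^+ 3 * c; have k0 : 0 < k by rewrite mulr_gt0 // exprn_gt0.
pose d := Num.min rho (eta * k) / 2.
have m0 : 0 < Num.min rho (eta * k) by rewrite lt_min rho0 mulr_gt0.
have dpos : 0 < d by rewrite divr_gt0.
have : d < Num.min rho (eta * k) by rewrite ltr_pdivrMr // ltr_pMr // ltr1n.
rewrite lt_min => /andP[dr dk].
(* Q collects the factors of the edge polynomial that do not vanish at the edge e *)
have main x (Q : R) : Em j < x < Ep j -> `|x - e| = d -> spoly j x = Q * d -> rho ^+ 3 <= Q ->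
    forall t, dm j t = e -> gx x t != 0 /\ gx x t ^+ 2 <= eta.
  move=> hx' xe sE hQ t te.
  have xen : x - e != 0 by rewrite -normr_gt0 xe.
  split; first by rewrite -sgr_eq0 (dm_sg t hx') te sgr_eq0.
  have := gx_product t hx'; rewrite te sE -(real_normK (x := x - e)) ?num_real // xe => P.
  have hx2 : Em j <= x <= Ep j by case/andP: hx' => ? ?; rewrite !ltW.
  have W := hc x (dm ^~ t) hx2 (dm_in t); set W' := wprod _ _ _ _ _ in P W.
  have g2' := sqr_ge0 (gx x t).
  have P2 : gx x t ^+ 2 * (Q * W') = d.
    by apply: (mulIf (lt0r_neq0 dpos)); rewrite -[RHS]expr2 -P; ring.
  have kQ : k <= Q * W' by apply: ler_pM => //; [exact/ltW/exprn_gt0|exact: ltW].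
  have : gx x t ^+ 2 * k <= eta * k.
    by apply: le_trans (ltW dk); rewrite -P2; exact: ler_wpM2l.
  by rewrite ler_pM2r.
have p3 (u v w : R) : rho <= u -> rho <= v -> rho <= w -> rho ^+ 3 <= u * v * w.
  move=> u1 v1 w1; rewrite (_ : rho ^+ 3 = rho * rho * rho); last by ring.
  have r0 := ltW rho0.
  by apply: ler_pM => //; [exact: mulr_ge0|apply: ler_pM].
case: he => eE; rewrite eE in main *.
  exists (Em j + d); first by apply/andP; split; lra.
  apply: (main (Em j + d) ((Em j + d - e0) * (e1 - (Em j + d)) * (Ep j - (Em j + d)))).
  - by apply/andP; split; lra.
  - by rewrite (addrC (Em j)) addrK gtr0_norm.
  - by rewrite /spoly /edge_poly; ring.
  - by apply: p3; lra.
exists (Ep j - d); first by apply/andP; split; lra.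
apply: (main (Ep j - d) ((Ep j - d - e0) * (e1 - (Ep j - d)) * (Ep j - d - Em j))).
- by apply/andP; split; lra.
- by rewrite addrC addrA addNr sub0r normrN gtr0_norm.
- by rewrite /spoly /edge_poly; ring.
- by apply: p3; lra.
Qed.

(** While mu_j sits at an edge, g(x, .) is uniformly small for x near that edge, so the Riccati
    equation forces atan(v / N) to grow at speed at least N, with N as large as desired; but
    atan is bounded. *)
Lemma no_stuck j (e t1 t2 : R) : e = Em j \/ e = Ep j -> t1 < t2 ->
  ~ (forall t, t1 <= t <= t2 -> dm j t = e).
Proof.
move=> he t12 st; have pi0 := pi_gt0 R.
have [g1 g2 g3] := gap_range mE gfE j.
pose N := (pi + 1) / (t2 - t1).
have N0 : 0 < N by rewrite divr_gt0 ?subr_gt0 // addr_gt0.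
have [C [C1 hC]] := toda_bound sol (`|t1| + `|t2|).
pose K0 := (C + (`|e0| + `|e1|)) ^+ 2.
have K00 : 0 <= K0 by exact: sqr_ge0.
have eta0 : 0 < (N ^+ 2 + K0)^-1 by rewrite invr_gt0 ltr_pwDl // exprn_gt0.
have [x hx' hsm] := green_small he eta0.
have nE := gap_nE hx'; have /andP[x1 x2] := hx'.
pose v (s : R) : R := - hx x s / gx x s.
pose dv (t : R) : R := v t ^+ 2 + (gx x t ^+ 2)^-1 + kf a t - (b t 0 - x) ^+ 2.
have vd t : t1 <= t <= t2 -> is_derive t 1 v (dv t).
  by move=> ht; have [gn _] := hsm t (st t ht); have := riccati nE gn; exact.
have vl t : t1 <= t <= t2 -> v t ^+ 2 + N ^+ 2 <= dv t.
  move=> ht; have [gn gs] := hsm t (st t ht).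
  have g2' : 0 < gx x t ^+ 2 by rewrite exprn_even_gt0.
  have i1 : N ^+ 2 + K0 <= (gx x t ^+ 2)^-1.
    by rewrite -[N ^+ 2 + K0]invrK lef_pV2 ?posrE // ltr_pwDl // exprn_gt0.
  have kp : 0 <= kf a t by rewrite /kf mulr_ge0 // addr_ge0 // sqr_ge0.
  have tb : `|t| <= `|t1| + `|t2|.
    have n1 := ler_norm (- t1); have n2 := ler_norm t2; rewrite normrN in n1.
    have n3 := normr_ge0 t1; have n4 := normr_ge0 t2.
    by case/andP: ht => ? ?; rewrite ler_norml; apply/andP; split; lra.
  have [_ bb] := hC t 0 tb.
  have xb : `|x| <= `|e0| + `|e1|.
    have n1 := ler_norm (- e0); have n2 := ler_norm e1; rewrite normrN in n1.
    have n3 := normr_ge0 e0; have n4 := normr_ge0 e1.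
    by rewrite ler_norml; apply/andP; split; lra.
  have cb : (b t 0 - x) ^+ 2 <= K0.
    rewrite -(real_normK (x := b t 0 - x)) ?num_real // /K0 ler_sqr ?nnegrE //.
      by apply: le_trans (ler_normB _ _) _; exact: lerD.
    by rewrite addr_ge0 ?addr_ge0 // (le_trans _ C1).
  by rewrite /dv; lra.
pose psi (s : R) := atan (v s * N^-1).
have pd t : t1 <= t <= t2 -> is_derive t 1 psi ((1 + (v t * N^-1) ^+ 2)^-1 * (dv t * N^-1)).
  move=> ht.
  have h1 : is_derive t 1 (fun s => v s * N^-1) (dv t * N^-1).
    have h := is_deriveM (vd t ht) (is_derive_cst N^-1 t 1); rewrite scaler0 add0r in h.
    have -> : dv t * N^-1 = cst N^-1 t *: dv t by rewrite /GRing.scale /= mulrC.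
    exact: h.
  exact: (is_derive1_comp (f := atan) (g := fun s => v s * N^-1) (is_derive1_atan _) h1).
have cc : {within `[t1, t2], continuous psi}.
  by apply: derivable_within_continuous => s; rewrite in_itv /= => hs; case: (pd s hs).
have pd' s : s \in `]t1, t2[%R -> is_derive s 1 psi ((1 + (v s * N^-1) ^+ 2)^-1 * (dv s * N^-1)).
  by rewrite in_itv /= => /andP[s1 s2]; apply: pd; rewrite !ltW.
have [c] := MVT t12 pd' cc; rewrite in_itv /= => /andP[c1 c2] pE.
have hc : t1 <= c <= t2 by rewrite !ltW.
have lo : N <= (1 + (v c * N^-1) ^+ 2)^-1 * (dv c * N^-1).
  have q0 : 0 < 1 + (v c * N^-1) ^+ 2 by rewrite ltr_pwDl // sqr_ge0.
  rewrite ler_pdivlMl // ler_pdivlMr //.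
  rewrite (_ : (1 + (v c * N^-1) ^+ 2) * N * N = v c ^+ 2 + N ^+ 2); first exact: vl.
  by field; rewrite gt_eqF.
have : N * (t2 - t1) <= psi t2 - psi t1 by rewrite pE ler_pM2r // subr_gt0.
rewrite /N divfK; last by rewrite gt_eqF // subr_gt0.
have := atan_ltpi2 (v t2 * N^-1); have := atan_gtNpi2 (v t1 * N^-1).
by rewrite -/(psi t1) -/(psi t2); lra.
Qed.

(** Between two visits to the same edge, mu_j would be constant or have an interior
    extremum, where its derivative cannot vanish. *)
Lemma no_two_visits j (e t1 t2 : R) : e = Em j \/ e = Ep j -> t1 < t2 ->
  dm j t1 = e -> dm j t2 = e ->
  (forall s, t1 <= s <= t2 -> `|dm j s - e| < Ep j - Em j) -> False.
Proof.
move=> he t12 m1 m2 near; have [_ lt _] := gap_range mE gfE j.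
have cont : {within `[t1, t2], continuous (dm j)}.
  by apply: continuous_subspaceT => s; exact: dm_cvg.
have inside c : dm j c != e -> t1 <= c <= t2 -> t1 < c < t2.
  move=> ce /andP[c1 c2]; rewrite !lt_neqAle c1 c2 !andbT; apply/andP; split.
    by apply: contraNneq ce => <-; rewrite m1.
  by apply: contraNneq ce => ->; rewrite m2.
have rad c : t1 < c < t2 -> exists2 r : R, 0 < r & forall s, `|s - c| < r -> t1 <= s <= t2.
  move=> /andP[c1 c2]; exists (Num.min (c - t1) (t2 - c)); first by rewrite lt_min !subr_gt0 c1.
  by move=> s; rewrite lt_min !ltr_norml => /andP[/andP[? ?] /andP[? ?]]; apply/andP; split; lra.
case: (he) => eE.
  have [c] := EVT_max (ltW t12) cont; rewrite in_itv /= => hc mx.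
  have [ce|ce] := eqVneq (dm j c) e.
    apply: (no_stuck he t12) => s hs; apply/eqP; rewrite eq_le -{1}ce mx ?in_itv //=.
    by rewrite eE; case/andP: (dm_in s j).
  have hi : in_gap j c.
    have /andP[d1 d2] := dm_in c j; have := near c hc; rewrite ltr_norml eE => /andP[_ n2].
    rewrite eE in ce; apply/andP; split; last by lra.
    by rewrite lt_neqAle eq_sym ce d1.
  have [r r0 hr] := rad c (inside c ce hc).
  by have [_] := no_extremum hi r0; apply=> s /hr hs; apply: mx; rewrite in_itv.
have [c] := EVT_min (ltW t12) cont; rewrite in_itv /= => hc mn.
have [ce|ce] := eqVneq (dm j c) e.
  apply: (no_stuck he t12) => s hs; apply/eqP; rewrite eq_le -{2}ce mn ?in_itv //= andbT.
  by rewrite eE; case/andP: (dm_in s j).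
have hi : in_gap j c.
  have /andP[d1 d2] := dm_in c j; have := near c hc; rewrite ltr_norml eE => /andP[n1 _].
  rewrite eE in ce; apply/andP; split; first by lra.
  by rewrite lt_neqAle ce d2.
have [r r0 hr] := rad c (inside c ce hc).
by have [+ _] := no_extremum hi r0; apply=> s /hr hs; apply: mn; rewrite in_itv.
Qed.

(** A second visit close to t0 is excluded by no_two_visits, and by continuity mu_j is too close
    to the edge e to be at the other one. *)
Lemma edge_isolated j (e t0 : R) : e = Em j \/ e = Ep j -> dm j t0 = e ->
  \forall t \near (t0 : R)^', in_gap j t.
Proof.
move=> he m0; have [_ lt _] := gap_range mE gfE j.
have g0 : 0 < Ep j - Em j by rewrite subr_gt0.
have [r /= r0 hr] := (cvgrPdist_lt _ _).1 (@dm_cvg j t0) _ g0.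
have near s : `|s - t0| < r -> `|dm j s - e| < Ep j - Em j.
  by move=> hs; rewrite -m0 distrC; apply: hr; rewrite /ball /= distrC.
exists r => // t; rewrite /ball /= distrC => ht tn.
have ne : dm j t != e.
  apply/eqP => me; have [h|h|h] := ltgtP t t0; last by rewrite h eqxx in tn.
    apply: (no_two_visits he h me m0) => s /andP[s1 s2]; apply: near.
    by move: ht; rewrite !ltr_norml => /andP[? ?]; apply/andP; split; lra.
  apply: (no_two_visits he h m0 me) => s /andP[s1 s2]; apply: near.
  by move: ht; rewrite !ltr_norml => /andP[? ?]; apply/andP; split; lra.
have /andP[d1 d2] := dm_in t j; have := near t ht; rewrite ltr_norml => /andP[n1 n2].
rewrite /in_gap; case: he => eE; rewrite eE in ne n1 n2.
  by rewrite lt_neqAle d1 eq_sym ne /=; lra.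
by rewrite [X in _ && X]lt_neqAle d2 ne /= andbT; lra.
Qed.

(** ** The angles *)
Definition cosv j (t : R) : R := (dm j t - Em j) * 2 / (Ep j - Em j) - 1.
(** Away from the edges this is +1 or -1 and agrees with the sign of the Dirichlet datum; at an edge
    the value 1 is a convention. *)
Definition sgn j (t : R) : R := if in_gap j t then hx (dm j t) t else 1.
Definition ang j (t : R) : R := sgn j t * acos (cosv j t).

Lemma gap_len j : 0 < Ep j - Em j.
Proof. by have [_ lt _] := gap_range mE gfE j; rewrite subr_gt0. Qed.

Lemma dm_cosv j t : dm j t = Em j + (Ep j - Em j) * ((1 + cosv j t) / 2).
Proof. by have := gap_len j => l0; rewrite /cosv; field; rewrite gt_eqF. Qed.

Lemma cosv_gap j t (y : R) : dm j t = Em j + (Ep j - Em j) * cos (y / 2) ^+ 2 -> cos y = cosv j t.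
Proof.
have l0 := gap_len j; rewrite cos_half_sq => h.
by rewrite /cosv h; field; rewrite gt_eqF.
Qed.

Lemma cosv_in j t : -1 <= cosv j t <= 1.
Proof.
have l0 := gap_len j; have /andP[d1 d2] := dm_in t j.
have h : (dm j t - Em j) * 2 / (Ep j - Em j) = cosv j t + 1 by rewrite /cosv; ring.
have h1 : 0 <= cosv j t + 1 by rewrite -h divr_ge0 ?(ltW l0) // mulr_ge0 // subr_ge0.
have h2 : cosv j t + 1 <= 2 by rewrite -h ler_pdivrMr //; lra.
by apply/andP; split; lra.
Qed.

Lemma cosv_in_gap j t : in_gap j t -> -1 < cosv j t < 1.
Proof.
move=> /andP[d1 d2]; have l0 := gap_len j.
have h : (dm j t - Em j) * 2 / (Ep j - Em j) = cosv j t + 1 by rewrite /cosv; ring.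
have h1 : 0 < cosv j t + 1 by rewrite -h divr_gt0 // mulr_gt0 // subr_gt0.
have h2 : cosv j t + 1 < 2 by rewrite -h ltr_pdivrMr //; lra.
by apply/andP; split; lra.
Qed.

Lemma cosv_cvg j (t : R) : cosv j s @[s --> t] --> cosv j t.
Proof.
rewrite /cosv; apply: cvgB; last exact: cvg_cst.
apply: cvgM; last exact: cvg_cst.
apply: cvgM; last exact: cvg_cst.
by apply: cvgB; [exact: dm_cvg | exact: cvg_cst].
Qed.

Lemma sgn_in j t : in_gap j t -> sgn j t = hx (dm j t) t.
Proof. by move=> hi; rewrite /sgn ifT. Qed.

Lemma sgn_pm j t : sgn j t = 1 \/ sgn j t = -1.
Proof.
rewrite /sgn; case: ifP => hi; last by left.
have /eqP := hx_sq (gap_nE hi) (gx_dm hi).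
by rewrite sqrf_eq1 => /orP[] /eqP; [left|right].
Qed.

Lemma dirichlet_sign_hx j t : in_gap j t ->
  (hx (dm j t) t = 1 -> dirichlet_sign (a t) (b t) (dm j t) = 1) /\
  (hx (dm j t) t = -1 -> dirichlet_sign (a t) (b t) (dm j t) = -1).
Proof.
move=> hi; have nE := gap_nE hi; set x := dm j t in nE *.
have [C [aC bC]] := flow_bound t; have [M iM] := flow_res t nE.
have g0 : gf a b x%:C%C t = 0 by rewrite (gfE_real nE) (gx_dm hi).
apply: (dirichlet_signE aC bC (toda_a_neq0 sol jc t) iM); first exact: g0.
have s1 := sum_AB (res_all_real sol jc nE) t; rewrite g0 mulr0 subr0 in s1.
have s2 := hfE_real nE t.
have -> : ((1 + hx x t) / 2)%:C%C = (1 + (hx x t)%:C%C) / 2 :> R[i].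
  by rewrite rmorphM fmorphV rmorphD rmorph1 (rmorph_nat (real_complex R) 2).
by rewrite -s2 -{1}s1 /hf -/(gt a b x%:C%C t 1 0); field.
Qed.

(** The point at which h is evaluated moves with the time; the resolvent bound is uniform for
    nearby times, which gives a uniform Lipschitz bound in the spectral parameter. *)
Lemma hx_dm_cvg j t : in_gap j t -> hx (dm j s) s @[s --> t] --> hx (dm j t) t.
Proof.
move=> hi; have nE := gap_nE hi; set x := dm j t in nE *.
have rx := res_all_real sol jc nE.
have [M hM] := rx (`|t| + 1); have [C [C1 hC]] := toda_bound sol (`|t| + 1).
have C0 : 0 <= C by apply: le_trans C1.
have M0 : 0 <= M by have [] := hM t _ ; rewrite ?lerDl.
pose L := C * (2 * M ^+ 2) + C * (2 * M ^+ 2).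
have L0 : 0 <= L by rewrite addr_ge0 // !mulr_ge0 // sqr_ge0.
have nb : \forall s \near t, `|t - s| <= 1.
  by exists 1 => //= u; rewrite /ball /= => /ltW.
apply/cvgrPdist_le => e ep; near=> s.
have st : `|s| <= `|t| + 1.
  have : `|t - s| <= 1 by near: s; exact: nb.
  move=> h; have := ler_normB t (t - s); rewrite opprB addrC subrK => /le_trans; apply.
  by rewrite lerD2l.
have k1 : `|hx x t - hx x s| <= e / 2.
  near: s; apply: ((cvgrPdist_le _ _).1 (is_derive_cvg (hx_derive nE t))); exact: divr_gt0.
have k2 : `|x - dm j s| <= Num.min (2^-1 / (M + 1)) (e / 2 / (L + 1)).
  near: s; apply: ((cvgrPdist_le _ _).1 (@dm_cvg j t)).
  by rewrite lt_min !divr_gt0 ?invr_gt0 // ltr_wpDl.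
move: k2; rewrite le_min => /andP[k2 k3].
have iM := hM s st.
have nw : normc ((dm j s)%:C%C - x%:C%C) = `|x - dm j s| by rewrite -rmorphB normc_real distrC.
have hw : normc ((dm j s)%:C%C - x%:C%C) * M <= 2^-1.
  rewrite nw; apply: le_trans (ler_wpM2r M0 k2) _.
  by rewrite -mulrA ler_piMr // mulrC ler_pdivrMr ?mul1r ?lerDl // ltr_wpDl.
have aC n : `|a s n| <= C by have [] := hC s n st.
have bC n : `|b s n| <= C by have [] := hC s n st.
have l1 := gmat_lip aC bC 1 0 iM hw; have l2 := gmat_lip aC bC (-1) 0 iM hw.
have k4 : `|hx x s - hx (dm j s) s| <= L * `|x - dm j s|.
  rewrite distrC /hx -Re_opp -Re_add; apply: le_trans (Re_le_normc _) _.
  have -> : hf a b (dm j s)%:C%C s - hf a b x%:C%C s =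
    (a s 0)%:C%C * (gmat (a s) (b s) (dm j s)%:C%C 1 0 - gmat (a s) (b s) x%:C%C 1 0) -
    (a s (-1))%:C%C * (gmat (a s) (b s) (dm j s)%:C%C (-1) 0 - gmat (a s) (b s) x%:C%C (-1) 0).
    have alg (A B x1 x2 y1 y2 : R[i]) : (A * x1 - B * x2) - (A * y1 - B * y2) =
      A * (x1 - y1) - B * (x2 - y2) by ring.
    exact: alg.
  apply: le_trans (normcB _ _) _; rewrite [leRHS]mulrDl; apply: lerD.
    by rewrite normcM normc_real -mulrA -nw; apply: ler_pM => //; exact: normc_ge0.
  by rewrite normcM normc_real -mulrA -nw; apply: ler_pM => //; exact: normc_ge0.
have k5 : L * `|x - dm j s| <= e / 2.
  have : `|x - dm j s| * (L + 1) <= e / 2 by rewrite -ler_pdivlMr // ltr_wpDl.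
  by apply: le_trans; rewrite mulrC ler_wpM2l // lerDl.
have -> : hx x t - hx (dm j s) s = (hx x t - hx x s) + (hx x s - hx (dm j s) s) by rewrite addrA subrK.
by rewrite (splitr e); exact: le_trans (ler_normD _ _) (lerD k1 (le_trans k4 k5)).
Unshelve. all: by end_near. Qed.

Lemma pm_close (u v : R) : u = 1 \/ u = -1 -> v = 1 \/ v = -1 -> `|v - u| <= 1 -> u = v.
Proof. by rewrite ler_norml => -[->|->] [->|->] // /andP[? ?]; lra. Qed.

Lemma sgn_near j (t : R) : in_gap j t -> \forall s \near t, sgn j s = sgn j t.
Proof.
move=> hi; near=> s.
have hs : in_gap j s by near: s; exact: in_gap_near.
have hd : `|hx (dm j t) t - hx (dm j s) s| <= 1.
  by near: s; exact: ((cvgrPdist_le _ _).1 (hx_dm_cvg hi)).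
have e1' := sgn_in hs.
have e2 := sgn_in hi.
rewrite -e1' -e2 in hd; exact: pm_close (sgn_pm j s) (sgn_pm j t) hd.
Unshelve. all: by end_near. Qed.

Local Notation phi t := (dirichlet_map (a t) (b t) Em Ep).

Lemma phi_set j t : exists p : circle R, dm j t = gap_point (Em j) (Ep j) p /\
    (Em j < dm j t < Ep j -> exists2 x, p = circle_of x &
     (dirichlet_sign (a t) (b t) (dm j t) = 1 -> 0 < x < pi) /\
     (dirichlet_sign (a t) (b t) (dm j t) = -1 -> - pi < x < 0)).
Proof.
exists (circle_of (ang j t)); split.
  rewrite gap_pointE cos_half_sq {1}dm_cosv; congr (_ + _ * ((1 + _) / _)).
  have cK : cos (acos (cosv j t)) = cosv j t by rewrite acosK // in_itv /= cosv_in.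
  by rewrite /ang; have [->|->] := sgn_pm j t; rewrite ?mul1r ?mulN1r ?cosN cK.
move=> hi; exists (ang j t) => //.
have /andP[c1 c2] := cosv_in_gap hi.
have p1 : 0 < acos (cosv j t) by rewrite acos_gt0 // (ltW c1).
have p2 : acos (cosv j t) < pi by rewrite acos_ltpi // c1 ltW.
have [s1 s2] := dirichlet_sign_hx hi.
have se := sgn_in hi.
rewrite /ang; have [h|h] := sgn_pm j t; rewrite h; rewrite se in h.
  by rewrite (s1 h) mul1r p1 p2; split.
by rewrite (s2 h) mulN1r ltrN2 p2 oppr_lt0 p1; split.
Qed.

Lemma gap_point_phi j t : gap_point (Em j) (Ep j) (phi t j) = dm j t.
Proof. by have [h _] := xgetPex (circle_of 0) (phi_set j t); exact: esym h. Qed.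

(** At an edge the cosine is 1 or -1, and both signs give the same point of the circle. *)
Lemma phi_ang j t : phi t j = circle_of (ang j t).
Proof.
have [h1 h2] := xgetPex (circle_of 0) (phi_set j t).
rewrite -[xget _ _]/(phi t j) in h1 h2.
case: (boolP (in_gap j t)) => hi.
  have [x px [q1 q2]] := h2 hi.
  have cx : cos x = cosv j t by apply: cosv_gap; rewrite h1 px gap_pointE.
  have [s1 s2] := dirichlet_sign_hx hi.
  have se := sgn_in hi.
  rewrite px /ang -cx; have [h|h] := sgn_pm j t; rewrite h; rewrite se in h.
    have /andP[x0 xp] := q1 (s1 h).
    by rewrite mul1r cosK // in_itv /= !ltW.
  have /andP[x0 xp] := q2 (s2 h).
  by rewrite cosKN ?mulN1r ?opprK // !ltW.
have pE : phi t j = circle_of (repr (phi t j)) by rewrite /circle_of reprK.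
have cx : cos (repr (phi t j)) = cosv j t by apply: cosv_gap; exact: h1.
have [tau [ht te]] := cos_eq_circle (repr (phi t j)).
rewrite pE te cx /ang /sgn (negbTE hi) mul1r.
case: ht => ->; first by rewrite mul1r.
have l0 := gap_len j; have /andP[d1 d2] := dm_in t j.
have [de|de] := eqVneq (dm j t) (Ep j).
  have -> : cosv j t = 1 by rewrite /cosv de; field; rewrite gt_eqF.
  by rewrite acos1 mulr0.
have de' : dm j t = Em j.
  by apply/eqP; move: hi; rewrite /in_gap [dm j t < _]lt_neqAle de d2 /= andbT -leNgt eq_le d1 => ->.
have -> : cosv j t = -1 by rewrite /cosv de' subrr !mul0r sub0r.
by rewrite acosN1; apply/circle_ofP; exists (-1); ring.
Qed.

Definition psi j (t : R) : R :=
  2 * Num.sqrt ((dm j t - e0) * (e1 - dm j t) * wprod Em Ep j (dm j t) (dm ^~ t)).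

Lemma toda_fieldE j t : toda_field E Em Ep (phi t) j = psi j t.
Proof.
rewrite /toda_field /psi /= gap_point_phi /wprod /fac; congr (2 * Num.sqrt (_ * _)).
by congr infinite_prod; apply/funext => k; rewrite gap_point_phi.
Qed.

Lemma psi_cvg j (t : R) : psi j s @[s --> t] --> psi j t.
Proof.
rewrite /psi; apply: cvgM; first exact: cvg_cst.
apply: (@continuous_cvg _ _ _ _ _ _ (@Num.sqrt R)); first exact: sqrt_continuous.
apply: cvgM.
  by apply: cvgM; apply: cvgB; (exact: dm_cvg || exact: cvg_cst).
by apply: (wprod_cvg mE gfE craig); [move=> s; exact: dm_in|exact: dm_in|exact: dm_in|exact: dm_in|exact: dm_cvg|move=> k; exact: dm_cvg].
Qed.

(** Differentiating arccos brings in 1 / sqrt ((mu - E^-) (E^+ - mu)), which removes these two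
    factors from the speed of mu_j, and the sign h occurs twice. *)
Lemma ang_derive j (t : R) : in_gap j t -> is_derive t 1 (ang j) (psi j t).
Proof.
move=> hi; have l0 := gap_len j; have /andP[d1 d2] := hi.
have [g1 g2 g3] := gap_range mE gfE j.
have nr : \forall s \near t, ang j s = sgn j t * acos (cosv j s).
  near=> s; have h : sgn j s = sgn j t by near: s; exact: sgn_near.
  by rewrite /ang h.
apply: (is_derive_near nr).
have dc : is_derive t 1 (cosv j) (- (2 * hx (dm j t) t * speed j t) * (2 / (Ep j - Em j))).
  have := is_deriveM (dm_derive hi) (is_derive_cst (2 / (Ep j - Em j)) t 1).
  rewrite scaler0 add0r => h.
  have h3 := is_deriveB h (is_derive_cst (Em j * (2 / (Ep j - Em j)) + 1) t 1).
  have e3 : dm j * cst (2 / (Ep j - Em j)) - cst (Em j * (2 / (Ep j - Em j)) + 1) = cosv j.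
    by apply/funext => s; rewrite /cosv /= !fctE; ring.
  rewrite e3 subr0 in h3.
  suff e4 : - (2 * hx (dm j t) t * speed j t) * (2 / (Ep j - Em j)) =
    cst (2 / (Ep j - Em j)) t *: - (2 * hx (dm j t) t * speed j t) by rewrite e4; exact: h3.
  by rewrite /GRing.scale /= mulrC.
have da := is_derive1_comp (f := acos) (is_derive1_acos (cosv_in_gap hi)) dc.
have h := is_deriveM (is_derive_cst (sgn j t) t 1) da; rewrite scaler0 addr0 in h.
suff e : psi j t = cst (sgn j t) t *: (- (Num.sqrt (1 - cosv j t ^+ 2))^-1 *
   (- (2 * hx (dm j t) t * speed j t) * (2 / (Ep j - Em j)))) by rewrite e; exact: h.
apply: esym; rewrite /GRing.scale /=.
rewrite (sgn_in hi).
have h2 := hx_sq (gap_nE hi) (gx_dm hi).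
(* 1 - cos^2 = 4 (mu - E^-)(E^+ - mu) / gamma^2, which cancels against the edge polynomial *)
pose Q := (dm j t - Em j) * (Ep j - dm j t).
have Q0 : 0 < Q by rewrite mulr_gt0 // subr_gt0.
have sQ : 0 < Num.sqrt Q by rewrite sqrtr_gt0.
have e1c : 1 - cosv j t ^+ 2 = (2 / (Ep j - Em j)) ^+ 2 * Q.
  by rewrite /cosv /Q; move: (dm j t) => m; field; rewrite gt_eqF.
have l2 : 0 < 2 / (Ep j - Em j) by rewrite divr_gt0.
have -> : Num.sqrt (1 - cosv j t ^+ 2) = 2 / (Ep j - Em j) * Num.sqrt Q.
  by rewrite e1c sqrtrM ?sqr_ge0 // sqrtr_sqr gtr0_norm.
have -> : speed j t = psi j t / 2 * Num.sqrt Q.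
  rewrite /psi mulrC [2 * _]mulrC mulfK // /speed /spoly /edge_poly -/Q.
  rewrite -sqrtrM; last by rewrite ltW.
  by congr Num.sqrt; rewrite [RHS]mulrCA [RHS]mulrA.
clear h; move: (hx _ _) h2 (psi j t) => h h2 p.
have -> : h * (- (2 / (Ep j - Em j) * Num.sqrt Q)^-1 *
   (- (2 * h * (p / 2 * Num.sqrt Q)) * (2 / (Ep j - Em j)))) = h ^+ 2 * p.
  by move: (Num.sqrt Q) sQ => r r0; field; rewrite !gt_eqF.
by rewrite h2 mul1r.
Unshelve. all: by end_near. Qed.

Lemma acos_small (e : R) : 0 < e -> exists2 d : R, 0 < d &
  forall c : R, -1 <= c <= 1 -> 1 - d < c -> acos c < e.
Proof.
move=> ep; have pi0 := pi_gt0 R.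
pose k := Num.min e pi.
have k0 : 0 < k by rewrite lt_min ep.
have kp : k <= pi by rewrite ge_min lexx orbT.
have kin : k \in `[0, pi]%R by rewrite in_itv /= (ltW k0).
exists (1 - cos k).
  by rewrite subr_gt0 -[ltRHS](@cos0 R) ltr_cos // in_itv /= lexx ltW.
move=> c hc; rewrite opprB addrC subrK => ck.
apply: (@lt_le_trans _ _ k); last by rewrite ge_min lexx.
have [hr cE] := acos_def hc.
have ain : acos c \in `[0, pi]%R by rewrite in_itv.
by rewrite -(ltr_cos ain kin) cE.
Qed.

(** At an edge the angle is lifted continuously: near the lower edge, where the angle is close
    to pi, the values with negative sign are shifted by a full turn. *)
Definition ang_lift (kappa : R) j (t : R) : R := ang j t + kappa * ((1 - sgn j t) * pi).

Lemma ang_lift_circle (kappa : R) j t : kappa = 0 \/ kappa = 1 -> circle_of (ang_lift kappa j t) = phi t j.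
Proof.
move=> hk; rewrite phi_ang; apply/circle_ofP; rewrite /ang_lift addrC addKr.
case: hk => ->; first by exists 0; rewrite !mul0r.
have [->|->] := sgn_pm j t; first by exists 0; rewrite subrr !mul0r mulr0.
by exists 1; ring.
Qed.

Lemma ang_lift_derive (kappa : R) j (t : R) : in_gap j t -> is_derive t 1 (ang_lift kappa j) (psi j t).
Proof.
move=> hi; have nr : \forall s \near t, ang_lift kappa j s = (ang j + cst (kappa * ((1 - sgn j t) * pi))) s.
  near=> s; have h : sgn j s = sgn j t by near: s; exact: sgn_near.
  by rewrite /ang_lift h.
apply: (is_derive_near nr).
have := is_deriveD (ang_derive hi) (is_derive_cst (kappa * ((1 - sgn j t) * pi)) t 1).
by rewrite addr0.
Unshelve. all: by end_near. Qed.

(** The arccosine of the cosine tends to 0, respectively pi, whatever the sign does. *)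
Lemma ang_lift_edge_cvg j (t : R) (kappa : R) :
  (dm j t = Ep j /\ kappa = 0) \/ (dm j t = Em j /\ kappa = 1) ->
  ang_lift kappa j s @[s --> t] --> ang_lift kappa j t.
Proof.
move=> he; have [g1 g2 g3] := gap_range mE gfE j; have l0 := gap_len j.
have ni : in_gap j t = false.
  by rewrite /in_gap; case: he => -[-> _]; rewrite ltxx ?andbF.
have ct : ang_lift kappa j t = acos (cosv j t) by rewrite /ang_lift /ang /sgn ni mul1r subrr mul0r mulr0 addr0.
have sg s : `|sgn j s| = 1 by have [->|->] := sgn_pm j s; rewrite ?normrN normr1.
rewrite ct; apply/cvgrPdist_lt => e ep; have [d d0 hd] := acos_small ep.
have cv := (cvgrPdist_lt _ _).1 (@cosv_cvg j t) d d0.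
near=> s.
have : `|cosv j t - cosv j s| < d by near: s; exact: cv.
rewrite ltr_norml => /andP[n1 n2]; have /andP[b1 b2] := cosv_in j s.
case: he => -[de ->].
  have c1 : cosv j t = 1 by rewrite /cosv de; field; rewrite gt_eqF.
  rewrite c1 in n1 n2; rewrite c1 acos1 sub0r normrN /ang_lift mul0r addr0 /ang normrM sg mul1r.
  by rewrite ger0_norm ?acos_ge0 ?b1 //; apply: hd; [rewrite b1|lra].
have c1 : cosv j t = -1 by rewrite /cosv de subrr !mul0r sub0r.
rewrite c1 in n1 n2; rewrite c1 acosN1 /ang_lift /ang mul1r.
have -> : pi - (sgn j s * acos (cosv j s) + (1 - sgn j s) * pi) =
  sgn j s * (pi - acos (cosv j s)) by move: (sgn j s) (acos _) => u w; ring.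
rewrite normrM sg mul1r -acosN ?b1 //.
have hN : -1 <= - cosv j s <= 1 by apply/andP; split; lra.
by rewrite ger0_norm ?acos_ge0 //; apply: hd => //; lra.
Unshelve. all: by end_near. Qed.

(** Edge times are isolated, so the derivative of the lift is known off t and extends to t by
    continuity of the vector field along the flow. *)
Theorem phi_derive j (t : R) : circle_derive (fun s => phi s j) t (toda_field E Em Ep (phi t) j).
Proof.
rewrite toda_fieldE.
case: (boolP (in_gap j t)) => hi.
  exists (ang_lift 0 j); split; last exact: ang_lift_derive.
  by near=> s; apply: ang_lift_circle; left.
have /andP[d1 d2] := dm_in t j.
have [kappa [e [he hk me]]] : exists kappa e : R, [/\ e = Em j \/ e = Ep j,
    (dm j t = Ep j /\ kappa = 0) \/ (dm j t = Em j /\ kappa = 1) & dm j t = e].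
  have [de|de] := eqVneq (dm j t) (Ep j).
    by exists 0, (Ep j); split=> //; [right|left].
  exists 1, (Em j).
  have de' : dm j t = Em j.
    by apply/eqP; move: hi; rewrite /in_gap [dm j t < _]lt_neqAle de d2 /= andbT -leNgt eq_le d1 => ->.
  by split=> //; [left|right].
exists (ang_lift kappa j); split.
  near=> s; apply: ang_lift_circle; case: hk => -[_ ->]; [by left|by right].
apply: is_derive_removable; [exact: ang_lift_edge_cvg | exact: psi_cvg |].
near=> s; apply: ang_lift_derive; near: s; exact: (edge_isolated he me).
Unshelve. all: by end_near. Qed.

End DirichletFlow.

(** * The theorem *)
Local Unset Implicit Arguments.

Theorem proposition5p2 (R : realType) (E : set R)
    (I : countType) (Em Ep : I -> R)
    (a b : R -> int -> R) (a0 b0 : int -> R) :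
  compact E ->
  (0 < lebesgue_measure E)%E ->
  gap_family E Em Ep ->
  craig_condition E Em Ep ->
  jacobi_class E a0 b0 ->
  toda_solution a b ->
  a 0 = a0 -> b 0 = b0 ->
  let phi := fun t : R => dirichlet_map (a t) (b t) Em Ep in
  forall (j : I) (t : R),
    circle_derive (fun s => phi s j) t (toda_field E Em Ep (phi t) j).
Proof.
move=> _ mE gfE craig jc sol a00 b00 phi j t; rewrite -a00 -b00 in jc.
exact: (phi_derive mE gfE craig sol jc).
Qed.
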